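(* Let $s>\frac32$. The Cauchy problem $$i\partial_t u-\partial_x^2u-iuv\,\partial_xu=0,\qquad i\partial_t v+\partial_x^2v-iuv\,\partial_xv=0,\qquad (u,v)|_{t=0}=(u_0,v_0)\qquad(\ast)$$ on $\mathbb T$ is well-posed in $\mathcal H^s_0(\mathbb T):=\{(f,g)\in\mathcal H^s(\mathbb T)\mid \operatorname{Im}\int_{\mathbb T}f(x)g(x)\,dx=0\}$. More precisely, for any $(u_0,v_0)\in\mathcal H^s_0(\mathbb T)$ there exists $T>0$ such that: (i) there exists a unique solution $(u,v)\in C([-T,T];\mathcal H^s_0(\mathbb T))$ to $(\ast)$ with initial data $(u_0,v_0)$; (ii) if $\{(u_{0,n},v_{0,n})\}_{n\in\mathbb N}\subset\mathcal H^s_0(\mathbb T)$ converges to $(u_0,v_0)$ in $\mathcal H^s_0(\mathbb T)$, then the corresponding solutions $(u_n,v_n)$ with initial data $(u_{0,n},v_{0,n})$ (which exist on $[-T,T]$ for all sufficiently large $n$) converge to $(u,v)$ in $C([-T,T];\mathcal H^s_0(\mathbb T))$.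
   Context: $\mathbb T=\mathbb R/2\pi\mathbb Z$; $u,v$ are $\mathbb C$-valued functions. $\int_{\mathbb T}f\,dx:=\frac1{2\pi}\int_{-\pi}^{\pi}f(x)\,dx$ and $\widehat f(k)=\int_{\mathbb T}f(x)e^{-ikx}dx$ for $k\in\mathbb Z$. $H^s(\mathbb T)$ is the $L^2$-based Sobolev space of $\mathbb C$-valued functions with norm $\|f\|_{H^s}=(\sum_{k\in\mathbb Z}(1+|k|^2)^{s}|\widehat f(k)|^2)^{1/2}$. $\mathcal H^s(\mathbb T):=H^s(\mathbb T)\times H^s(\mathbb T)$ with norm $\|(f,g)\|_{\mathcal H^s}=\|f\|_{H^s}+\|g\|_{H^s}$; the subset $\mathcal H^s_0(\mathbb T)$ carries the induced metric. Definition of solution. Let $s>\frac32$, $T>0$, $(u_0,v_0)\in\mathcal H^s(\mathbb T)$. $(u,v)$ is a solution to $(\ast)$ in $\mathcal H^s(\mathbb T)$ on $[0,T]$ with initial data $(u_0,v_0)$ if $(u,v)\in C([0,T];\mathcal H^s(\mathbb T))$ and for every $\chi\in C_c^\infty([0,T)\times\mathbb T)$ (smooth functions with compact support in $[0,T)\times\mathbb T$), $$-i\int_0^T\!\!\int_{\mathbb T}u\,\partial_t\chi\,dxdt-i\int_{\mathbb T}u_0(x)\chi(0,x)\,dx-\int_0^T\!\!\int_{\mathbb T}u\,\partial_x^2\chi\,dxdt=i\int_0^T\!\!\int_{\mathbb T}uv\,(\partial_xu)\,\chi\,dxdt,$$ $$-i\int_0^T\!\!\int_{\mathbb T}v\,\partial_t\chi\,dxdt-i\int_{\mathbb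 T}v_0(x)\chi(0,x)\,dx+\int_0^T\!\!\int_{\mathbb T}v\,\partial_x^2\chi\,dxdt=i\int_0^T\!\!\int_{\mathbb T}uv\,(\partial_xv)\,\chi\,dxdt.$$ A solution on $[-T,0]$ is defined in the same manner: $(u,v)\in C([-T,0];\mathcal H^s(\mathbb T))$ and the analogous identities hold for all $\chi\in C_c^\infty((-T,0]\times\mathbb T)$, with $\int_0^T$ replaced by $\int_{-T}^0$ and the terms at $t=0$ replaced by $+i\int_{\mathbb T}u_0\chi(0,x)dx$ and $+i\int_{\mathbb T}v_0\chi(0,x)dx$. A solution on $[-T,T]$ is one whose restrictions to $[0,T]$ and $[-T,0]$ are solutions. *)

(* Defs.v *)
From mathcomp Require Import all_boot all_order all_algebra.
From mathcomp Require Import all_classical all_reals all_analysis.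
From mathcomp Require Import complex.

Set Implicit Arguments.
Unset Strict Implicit.
Unset Printing Implicit Defensive.

Import Order.TTheory GRing.Theory Num.Theory.
Import numFieldNormedType.Exports.
Import ComplexField.

Local Open Scope classical_set_scope.
Local Open Scope ring_scope.
Local Open Scope complex_scope.

(* A function on the torus R / 2 pi Z is a function on R satisfying
   [periodic f (pi *+ 2)]; elements of L^p and Sobolev spaces are represented
   by measurable functions, equality being equality almost everywhere. *)

Section ComplexCalculus.
Context {R : realType}.

Definition cmeasurable (f : R -> R[i]) : Prop :=
  measurable_fun setT (fun x => complex.Re (f x)) /\
  measurable_fun setT (fun x => complex.Im (f x)).

Definition cintegral (a b : R) (f : R -> R[i]) : R[i] :=
  (\int[lebesgue_measure]_(x in `[a, b]) complex.Re (f x))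
  +i* (\int[lebesgue_measure]_(x in `[a, b]) complex.Im (f x)).

Definition tintegral (f : R -> R[i]) : R[i] :=
  ((pi *+ 2)^-1)%:C * cintegral (- pi) pi f.

Definition cderive (f : R -> R[i]) (x : R) : R[i] :=
  derive1 (fun y => complex.Re (f y)) x +i* derive1 (fun y => complex.Im (f y)) x.

Definition smooth1 (f : R -> R) : Prop :=
  forall (n : nat) (x : R), derivable (derive1n n f) x 1.

Definition csmooth1 (f : R -> R[i]) : Prop :=
  smooth1 (fun x => complex.Re (f x)) /\ smooth1 (fun x => complex.Im (f x)).

(* Class C^n in two variables, through partial derivatives. *)
Fixpoint Cn2 (n : nat) (f : R -> R -> R) : Prop :=
  continuous (fun p : R * R => f p.1 p.2) /\
  if n is m.+1 then
    [/\ forall t x, derivable (f ^~ x) t 1,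
        forall t x, derivable (f t) x 1,
        Cn2 m (fun t x => derive1 (f ^~ x) t) &
        Cn2 m (fun t x => derive1 (f t) x)]
  else True.

Definition csmooth2 (f : R -> R -> R[i]) : Prop :=
  forall n : nat, Cn2 n (fun t x => complex.Re (f t x)) /\
                  Cn2 n (fun t x => complex.Im (f t x)).

Definition dt (f : R -> R -> R[i]) : R -> R -> R[i] :=
  fun t x => cderive (f ^~ x) t.

Definition dx (f : R -> R -> R[i]) : R -> R -> R[i] :=
  fun t x => cderive (f t) x.

End ComplexCalculus.

Section Sobolev.
Context {R : realType}.

Definition Lp_torus (p : nat) : set (R -> R[i]) := [set f |
  [/\ periodic f (pi *+ 2),
      cmeasurable f &
      (@lebesgue_measure R).-integrable `[- pi, pi]
        (fun x => (Normc.normc (f x) ^+ p)%:E)]].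

Definition fourier (f : R -> R[i]) (k : int) : R[i] :=
  tintegral (fun x => f x * (cos (k%:~R * x) -i* sin (k%:~R * x))).

Definition Hs_norm (s : R) (f : R -> R[i]) : \bar R :=
  ((\esum_(k in [set: int])
     ((1 + k%:~R ^+ 2) `^ s * Normc.normc (fourier f k) ^+ 2)%:E) `^ 2^-1)%E.

(* H^s(T) for s >= 0 (for negative s it would contain distributions). *)
Definition Hs (s : R) : set (R -> R[i]) :=
  Lp_torus 2 `&` [set f | (Hs_norm s f < +oo)%E].

Definition Hs2_norm (s : R) (f g : R -> R[i]) : \bar R :=
  (Hs_norm s f + Hs_norm s g)%E.

Definition Hs2_0 (s : R) (f g : R -> R[i]) : Prop :=
  [/\ Hs s f, Hs s g & complex.Im (tintegral (fun x => f x * g x)) = 0].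

Definition is_weak_derivative (f g : R -> R[i]) : Prop :=
  Lp_torus 1 g /\
  forall phi : R -> R[i], periodic phi (pi *+ 2) -> csmooth1 phi ->
    tintegral (fun x => g x * phi x) =
    - tintegral (fun x => f x * cderive phi x).

(* Unique up to a null set when it exists, and 0 otherwise; it always exists
   on H^s(T) for s >= 1. *)
Definition weak_derivative (f : R -> R[i]) : R -> R[i] :=
  xget (fun=> 0) [set g | is_weak_derivative f g].

Definition C_Hs2 (s a b : R) (u v : R -> R -> R[i]) : Prop :=
  (forall t, t \in `[a, b] -> Hs s (u t) /\ Hs s (v t)) /\
  (forall t0, t0 \in `[a, b] ->
     Hs2_norm s (u t - u t0) (v t - v t0)
       @[t --> within `[a, b]%classic (nbhs t0)] --> 0%E).

Definition C_Hs2_0 (s a b : R) (u v : R -> R -> R[i]) : Prop :=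
  C_Hs2 s a b u v /\ (forall t, t \in `[a, b] -> Hs2_0 s (u t) (v t)).

Definition C_Hs2_dist (s a b : R) (u v u' v' : R -> R -> R[i]) : \bar R :=
  ereal_sup [set Hs2_norm s (u t - u' t) (v t - v' t) | t in `[a, b]].

End Sobolev.

Section Solutions.
Context {R : realType}.

(* Smooth functions with compact support in [0, T) x T are exactly the
   restrictions to [0, T) x T of the following functions, by extension to
   negative times (and by 0 after the support); likewise for (-T, 0] x T. *)
Definition test_forward (T : R) (chi : R -> R -> R[i]) : Prop :=
  [/\ csmooth2 chi, forall t, periodic (chi t) (pi *+ 2) &
      exists2 T', T' < T & forall t x, T' <= t -> chi t x = 0].

Definition test_backward (T : R) (chi : R -> R -> R[i]) : Prop :=
  [/\ csmooth2 chi, forall t, periodic (chi t) (pi *+ 2) &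
      exists2 T', - T < T' & forall t x, t <= T' -> chi t x = 0].

(* Weak formulation on [a, b], tested against chi, of
     i w_t + sigma w_xx = i F,  w(0) = w0;
   kappa is -1 for a forward interval [0, T] and 1 for a backward interval
   [-T, 0]. *)
Definition weak_identity (a b : R) (kappa sigma : R[i])
    (w0 : R -> R[i]) (w F chi : R -> R -> R[i]) : Prop :=
  - 'i * cintegral a b (fun t => tintegral (fun x => w t x * dt chi t x))
  + kappa * 'i * tintegral (fun x => w0 x * chi 0 x)
  + sigma * cintegral a b (fun t => tintegral (fun x => w t x * dx (dx chi) t x))
  = 'i * cintegral a b (fun t => tintegral (fun x => F t x * chi t x)).

(* u v (partial_x w) *)
Definition nonlinearity (u v w : R -> R -> R[i]) : R -> R -> R[i] :=
  fun t x => u t x * v t x * weak_derivative (w t) x.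

Definition solution_forward (s T : R) (u0 v0 : R -> R[i])
    (u v : R -> R -> R[i]) : Prop :=
  C_Hs2 s 0 T u v /\
  forall chi, test_forward T chi ->
    weak_identity 0 T (-1) (-1) u0 u (nonlinearity u v u) chi /\
    weak_identity 0 T (-1) 1 v0 v (nonlinearity u v v) chi.

Definition solution_backward (s T : R) (u0 v0 : R -> R[i])
    (u v : R -> R -> R[i]) : Prop :=
  C_Hs2 s (- T) 0 u v /\
  forall chi, test_backward T chi ->
    weak_identity (- T) 0 1 (-1) u0 u (nonlinearity u v u) chi /\
    weak_identity (- T) 0 1 1 v0 v (nonlinearity u v v) chi.

Definition solution (s T : R) (u0 v0 : R -> R[i])
    (u v : R -> R -> R[i]) : Prop :=
  solution_forward s T u0 v0 u v /\ solution_backward s T u0 v0 u v.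

Definition solution_0 (s T : R) (u0 v0 : R -> R[i])
    (u v : R -> R -> R[i]) : Prop :=
  C_Hs2_0 s (- T) T u v /\ solution s T u0 v0 u v.

End Solutions.

(* Main.v *)
(* On Fourier coefficients the system reads y_k' = +- i k^2 y_k + (uv u_x)_k, resp. (uv v_x)_k. Since the mean of
   uv is conserved and, by hypothesis, real, a Galilean change of frame x -> x + m t replaces uv by its mean-free
   part rho. Multiplying u and v by exp(+- (i/2) D^(-1) rho), D^(-1) being the mean-free primitive, then cancels
   rho u_x and rho v_x: what remains is - u^2 v_x, resp. - v^2 u_x, and terms without derivative. The phase of the
   trilinear term, 2 (l + n)(j + n) up to sign, is large when the differentiated frequency n dominates, so that an
   integration by parts in time (normal form) recovers the derivative there; elsewhere the derivative is absorbed by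
   the other factors. For data in H^s, s > 3/2, this gives a contraction on short time intervals, which is carried
   back through the gauge and the change of frame. Negative times are reached by the symmetry
   (u, v)(t, x) -> (v, u)(-t, -x), and testing the weak formulation against functions eta(t) exp(- i k x)
   identifies weak solutions with solutions of the equations for the coefficients. *)
Require Import Defs.
From mathcomp Require Import all_boot all_order all_algebra.
From mathcomp Require Import all_classical all_reals all_analysis.
From mathcomp Require Import complex measurable_realfun ring lra.
Import Order.TTheory GRing.Theory Num.Theory.
Import numFieldNormedType.Exports.
Local Open Scope classical_set_scope.
Local Open Scope ring_scope.
Local Open Scope complex_scope.
Set Implicit Arguments.
Unset Strict Implicit.
Unset Printing Implicit Defensive.

(** A direct iteration fails: [uv u_x] loses a derivative that the linear flow does not give back.
    The mean must be real for the change of frame to be a translation; a complex velocity would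
    amplify the k-th coefficient exponentially in k. After the gauge, dividing by the phase gains
    two powers of the high frequency against the one that is lost. The spare power serves twice: as
    a factor 1/M, which makes the boundary terms of the normal form contractive, something no short
    time could do, and as one derivative of smoothing, which admits the nonlinearity, only of class
    H^(s-1), in the terms where a factor was differentiated in time. Hence a Picard step involves an
    iterate, the nonlinearity driving it and the next iterate, and the contraction runs in H^s and
    H^(s-1) together. The translation depends on the datum through the mean and is not Lipschitz on
    H^s, so continuous dependence is obtained by compactness rather than as a Lipschitz bound. All
    estimates concern absolutely summable coefficient sequences; measure theory enters only where
    functions are identified with their coefficients. *)

Notation nC := Normc.normc.

(** * Infinite sums *)

Section Summation.
Context {R : realType}.
Implicit Types I J : choiceType.

(** A bound on all finite partial sums says at once that a non-negative family is summable and what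
    bounds its sum, without extended reals; [sumle_esum] is the link with them. *)
Definition sumle I (f : I -> R) (c : R) :=
  forall s : seq I, uniq s -> \sum_(i <- s) f i <= c.

Lemma sumle_ge0 I (f : I -> R) c : sumle f c -> 0 <= c.
Proof. by move/(_ [::] isT); rewrite big_nil. Qed.

Lemma sumle_mon I (f g : I -> R) c d :
  (forall i, f i <= g i) -> c <= d -> sumle g c -> sumle f d.
Proof.
move=> fg cd gc s us; apply: le_trans cd; apply: le_trans (gc s us).
exact: ler_sum.
Qed.

Lemma sumle1 I (f : I -> R) c i : sumle f c -> f i <= c.
Proof. by move/(_ [:: i] isT); rewrite big_seq1. Qed.

Lemma sumleD I (f g : I -> R) c d : sumle f c -> sumle g d ->
  sumle (fun i => f i + g i) (c + d).
Proof. by move=> fc gd s us; rewrite big_split; apply: lerD; [exact: fc|exact: gd]. Qed.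

Lemma sumleZ I (f : I -> R) c k : 0 <= k -> sumle f c ->
  sumle (fun i => k * f i) (k * c).
Proof. by move=> k0 fc s us; rewrite -mulr_sumr ler_wpM2l//; exact: fc. Qed.

Lemma sumle_inj I J (h : J -> I) (f : I -> R) c : injective h ->
  sumle f c -> sumle (f \o h) c.
Proof.
move=> hi fc s us; have := fc (map h s); rewrite big_map; apply.
by rewrite map_inj_uniq.
Qed.

Lemma sumle_esum I (f : I -> R) c : (forall i, 0 <= f i) ->
  sumle f c <-> (\esum_(i in [set: I]) (f i)%:E <= c%:E)%E.
Proof.
move=> f0; split=> [fc|fc s us].
  apply: ge_ereal_sup => _ [X [finX _]] <-.
  by rewrite fsbig_finite//= sumEFin lee_fin; apply: fc.
rewrite -lee_fin -sumEFin; apply: le_trans fc; apply: esum_ge.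
exists [set` s]; first by split.
by rewrite fsbig_seq.
Qed.

(** Tonelli, through [esum_esum]: non-negativity allows the double sum to be taken row by row. *)
Lemma sumle_pair I J (F : I -> J -> R) (c : I -> R) C :
  (forall i j, 0 <= F i j) ->
  (forall i, sumle (F i) (c i)) -> sumle c C ->
  sumle (fun p : I * J => F p.1 p.2) C.
Proof.
move=> F0 Fc cC; apply/sumle_esum => [[i j]//|].
have c0 i : 0 <= c i by exact: sumle_ge0 (Fc i).
have -> : [set: I * J] = [set: I] `*`` (fun=> [set: J]).
  by apply/seteqP; split=> // -[].
rewrite -(@esum_esum R I J setT (fun=> setT) (fun i j => (F i j)%:E)); last first.
  by move=> i j _ _; rewrite lee_fin.
apply: (@le_trans _ _ (\esum_(i in [set: I]) (c i)%:E)%E).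
  by apply: le_esum => i _; apply/sumle_esum.
by apply/sumle_esum.
Qed.

Definition psum I (f : I -> R) : R := fine (\esum_(i in [set: I]) (f i)%:E).

Section Psum.
Variables (I : choiceType).
Implicit Types f g : I -> R.

Lemma esum_psum f c : (forall i, 0 <= f i) -> sumle f c ->
  \esum_(i in [set: I]) (f i)%:E = (psum f)%:E.
Proof.
move=> f0 /(sumle_esum _ f0) fc; rewrite /psum fineK//.
apply/fin_numPlt; rewrite (le_lt_trans fc (ltry _)) andbT.
apply: lt_le_trans (esum_ge0 _); first exact: ltNy0.
by move=> i _; rewrite lee_fin.
Qed.

Lemma psum_le f c : (forall i, 0 <= f i) -> sumle f c -> psum f <= c.
Proof. by move=> f0 fc; rewrite -lee_fin -(esum_psum f0 fc); apply/sumle_esum. Qed.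

Lemma sumle_psum f c : (forall i, 0 <= f i) -> sumle f c -> sumle f (psum f).
Proof. by move=> f0 fc; apply/sumle_esum => //; rewrite (esum_psum f0 fc). Qed.

Lemma psum_ge0 f : (forall i, 0 <= f i) -> 0 <= psum f.
Proof. by move=> f0; apply: fine_ge0; apply: esum_ge0 => i _; rewrite lee_fin. Qed.

Lemma psumD f g c d : (forall i, 0 <= f i) -> (forall i, 0 <= g i) ->
  sumle f c -> sumle g d -> psum (fun i => f i + g i) = psum f + psum g.
Proof.
move=> f0 g0 fc gd; apply: EFin_inj.
rewrite -(esum_psum _ (sumleD fc gd)); last by move=> i; rewrite addr_ge0.
rewrite EFinD -(esum_psum f0 fc) -(esum_psum g0 gd) -esumD//.
all: by move=> i _; rewrite lee_fin.
Qed.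

Lemma psumZ f c k : 0 <= k -> (forall i, 0 <= f i) -> sumle f c ->
  psum (fun i => k * f i) = k * psum f.
Proof.
move=> k0 f0 fc; have kf0 i : 0 <= k * f i by rewrite mulr_ge0.
have s1 := sumleZ k0 (sumle_psum f0 fc).
apply/eqP; rewrite eq_le psum_le//=.
case: (eqVneq k 0) => [->|kn0].
  by rewrite mul0r; apply: psum_ge0 => i; rewrite mul0r.
have kp : 0 < k by rewrite lt_neqAle eq_sym kn0.
rewrite -ler_pdivlMl//; apply: psum_le => //.
have := sumleZ (ltW (_ : 0 < k^-1)) (sumle_psum kf0 s1); rewrite invr_gt0 => /(_ kp).
by apply: sumle_mon => // i; rewrite mulKf// gt_eqF.
Qed.

End Psum.

Lemma psum_pair I J (F : I -> J -> R) C :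
  (forall i j, 0 <= F i j) -> sumle (fun p : I * J => F p.1 p.2) C ->
  [/\ forall i, sumle (F i) C, sumle (fun i => psum (F i)) C &
   psum (fun p : I * J => F p.1 p.2) = psum (fun i => psum (F i))].
Proof.
move=> F0 FC.
have h1 i : sumle (F i) C.
  by apply: (@sumle_inj (I * J)%type J (pair i) _ _ _ FC) => x y [].
have P0 i : 0 <= psum (F i) by exact: psum_ge0.
have e1 : (\esum_(p in [set: I * J]) (F p.1 p.2)%:E =
           \esum_(i in [set: I]) (psum (F i))%:E)%E.
  have -> : [set: I * J] = [set: I] `*`` (fun=> [set: J]).
    by apply/seteqP; split=> // -[].
  rewrite -(@esum_esum R I J setT (fun=> setT) (fun i j => (F i j)%:E)); last first.
    by move=> i j _ _; rewrite lee_fin.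
  by apply: eq_esum => i _; exact: esum_psum (h1 i).
split=> //; first by apply/sumle_esum => //; rewrite -e1; apply/sumle_esum => // -[].
by rewrite /psum e1.
Qed.

Lemma psum_reindex I J (h : J -> I) (f : I -> R) : bijective h ->
  psum (f \o h) = psum f.
Proof.
move=> bh; rewrite /psum (@reindex_esum R _ _ setT setT h)//.
by rewrite setTT_bijective.
Qed.

Definition pos (x : R) := Num.max x 0.
Definition neg (x : R) := Num.max (- x) 0.

Lemma pos_ge0 x : 0 <= pos x. Proof. by rewrite /pos le_max lexx orbT. Qed.
Lemma neg_ge0 x : 0 <= neg x. Proof. by rewrite /neg le_max lexx orbT. Qed.
Lemma pos_neg x : x = pos x - neg x.
Proof. by rewrite /pos /neg; case: (leP x 0); case: (leP (- x) 0); lra. Qed.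
Lemma pos_le x : pos x <= `|x|.
Proof. by rewrite /pos ge_max normr_ge0 ler_norm. Qed.
Lemma neg_le x : neg x <= `|x|.
Proof. by rewrite /neg ge_max normr_ge0 -normrN ler_norm. Qed.
Hint Resolve pos_ge0 neg_ge0 : core.

Definition rsum I (f : I -> R) : R := psum (pos \o f) - psum (neg \o f).

Section Rsum.
Variable I : choiceType.
Implicit Types f g h : I -> R.

Lemma sumle_pos f c : sumle (Num.norm \o f) c -> sumle (pos \o f) c.
Proof. by apply: sumle_mon => // i; exact: pos_le. Qed.
Lemma sumle_neg f c : sumle (Num.norm \o f) c -> sumle (neg \o f) c.
Proof. by apply: sumle_mon => // i; exact: neg_le. Qed.

(** The signed sum does not depend on the decomposition: [pos f + h = neg f + g], and [psum] is
    additive on non-negative families. Additivity and homogeneity of [rsum] follow from this. *)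
Lemma rsumE f g h c d : (forall i, 0 <= g i) -> (forall i, 0 <= h i) ->
  sumle g c -> sumle h d -> (forall i, f i = g i - h i) ->
  rsum f = psum g - psum h.
Proof.
move=> g0 h0 gc hd fE.
have fc : sumle (Num.norm \o f) (c + d).
  apply: sumle_mon (sumleD gc hd) => // i /=.
  by rewrite fE (le_trans (ler_normB _ _))// !ger0_norm.
rewrite /rsum.
have e : psum (fun i => pos (f i) + h i) = psum (fun i => neg (f i) + g i).
  congr psum; apply/funext => i; have := pos_neg (f i); rewrite [in LHS]fE; lra.
move: e; rewrite (psumD _ h0 (sumle_pos fc) hd); last by move=> i; exact: pos_ge0.
rewrite (psumD _ g0 (sumle_neg fc) gc); last by move=> i; exact: neg_ge0.
rewrite /comp; lra.
Qed.

Lemma rsumD f g c d : sumle (Num.norm \o f) c -> sumle (Num.norm \o g) d ->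
  rsum (fun i => f i + g i) = rsum f + rsum g.
Proof.
move=> fc gd.
rewrite (rsumE _ _ (sumleD (sumle_pos fc) (sumle_pos gd))
  (sumleD (sumle_neg fc) (sumle_neg gd))); first last.
- by move=> i /=; rewrite {1}(pos_neg (f i)) {1}(pos_neg (g i)); lra.
- by move=> i /=; rewrite addr_ge0.
- by move=> i /=; rewrite addr_ge0.
rewrite (psumD _ _ (sumle_pos fc) (sumle_pos gd)) ?(psumD _ _ (sumle_neg fc) (sumle_neg gd)).
  by rewrite /rsum; lra.
all: by move=> i /=.
Qed.

Lemma rsumN f c : sumle (Num.norm \o f) c -> rsum (fun i => - f i) = - rsum f.
Proof.
move=> fc.
rewrite (rsumE _ _ (sumle_neg fc) (sumle_pos fc)); first by rewrite /rsum; lra.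
- by move=> i /=.
- by move=> i /=.
- by move=> i /=; rewrite {1}(pos_neg (f i)); lra.
Qed.

Lemma rsumZ f c k : sumle (Num.norm \o f) c -> rsum (fun i => k * f i) = k * rsum f.
Proof.
move=> fc.
wlog k0 : k / 0 <= k => [hw|].
  case: (leP 0 k) => k0; first exact: hw.
  have k0' : 0 <= - k by rewrite oppr_ge0 ltW.
  have e := hw _ k0'.
  have <- : rsum (fun i => - (- k * f i)) = rsum (fun i => k * f i).
    by congr rsum; apply/funext => i; rewrite mulNr opprK.
  rewrite (@rsumN _ (- k * c)); first by rewrite e mulNr opprK.
  apply: sumle_mon (sumleZ k0' fc) => // i /=.
  by rewrite normrM ger0_norm.
rewrite (rsumE _ _ (sumleZ k0 (sumle_pos fc)) (sumleZ k0 (sumle_neg fc))); first last.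
- by move=> i /=; rewrite {1}(pos_neg (f i)); lra.
- by move=> i /=; rewrite mulr_ge0.
- by move=> i /=; rewrite mulr_ge0.
rewrite (psumZ k0 _ (sumle_pos fc)); last by move=> i; exact: pos_ge0.
rewrite (psumZ k0 _ (sumle_neg fc)); last by move=> i; exact: neg_ge0.
by rewrite /rsum mulrBr.
Qed.

Lemma rsum_le f c : sumle (Num.norm \o f) c -> rsum f <= c.
Proof.
move=> fc; rewrite /rsum; apply: (@le_trans _ _ (psum (pos \o f))).
  by rewrite lerBlDr lerDl; apply: psum_ge0 => i; exact: neg_ge0.
by apply: psum_le (sumle_pos fc) => i; exact: pos_ge0.
Qed.

End Rsum.

Lemma rsum_pair I J (F : I -> J -> R) C :
  sumle (fun p : I * J => `|F p.1 p.2|) C ->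
  [/\ forall i, sumle (Num.norm \o F i) C,
      sumle (fun i => `|rsum (F i)|) C &
      rsum (fun p : I * J => F p.1 p.2) = rsum (fun i => rsum (F i))].
Proof.
move=> FC; have [h1 h2 _] := psum_pair (F := fun i j => `|F i j|) (fun _ _ => normr_ge0 _) FC.
have [p1 p2 p3] := psum_pair (F := fun i j => pos (F i j)) (fun _ _ => pos_ge0 _) (sumle_pos FC).
have [n1 n2 n3] := psum_pair (F := fun i j => neg (F i j)) (fun _ _ => neg_ge0 _) (sumle_neg FC).
split=> //.
- apply: sumle_mon h2 => // i; rewrite ler_norml; apply/andP; split.
    rewrite lerNl -(rsumN (h1 i)); apply: rsum_le.
    apply: sumle_mon (sumle_psum (fun _ => normr_ge0 _) (h1 i)) => // j /=.
    by rewrite normrN.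
  by apply: rsum_le; exact: sumle_psum (fun _ => normr_ge0 _) (h1 i).
rewrite (rsumE _ _ p2 n2) => [|i|i|i //]; first by rewrite -p3 -n3.
- by apply: psum_ge0 => j; exact: pos_ge0.
- by apply: psum_ge0 => j; exact: neg_ge0.
Qed.

End Summation.

(** * Modulus, real and imaginary parts *)

Section ComplexFacts.
Context {R : realType}.
Implicit Types x y z : R[i].

Lemma nC_ge0 x : 0 <= nC x.
Proof. by case: x => a b; rewrite /Normc.normc sqrtr_ge0. Qed.

Lemma nCD x y : nC (x + y) <= nC x + nC y.
Proof. exact: le_normcD. Qed.

Lemma nCN x : nC (- x) = nC x. Proof. exact: normcN. Qed.

Lemma nCB x y : nC (x - y) <= nC x + nC y.
Proof. by rewrite -[nC y]nCN nCD. Qed.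

Lemma nCC x y : nC (x - y) = nC (y - x).
Proof. by rewrite -nCN opprB. Qed.

Lemma nCM x y : nC (x * y) = nC x * nC y.
Proof. exact: Normc.normcM. Qed.

Lemma nC0 : nC (0 : R[i]) = 0. Proof. exact: Normc.normc0. Qed.
Lemma nC1 : nC (1 : R[i]) = 1. Proof. exact: Normc.normc1. Qed.

Lemma nC_eq0 x : nC x = 0 -> x = 0. Proof. exact: Normc.eq0_normc. Qed.

Lemma nC_real (a : R) : nC a%:C = `|a|.
Proof. by rewrite /Normc.normc /= expr0n addr0 sqrtr_sqr. Qed.

Lemma Re_le x : `|complex.Re x| <= nC x.
Proof.
case: x => a b /=; rewrite -sqrtr_sqr; apply: ler_wsqrtr.
by rewrite lerDl sqr_ge0.
Qed.

Lemma Im_le x : `|complex.Im x| <= nC x.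
Proof.
case: x => a b /=; rewrite -sqrtr_sqr; apply: ler_wsqrtr.
by rewrite lerDr sqr_ge0.
Qed.

Lemma nC_le x : nC x <= `|complex.Re x| + `|complex.Im x|.
Proof.
case: x => a b; have {1}-> : a +i* b = a%:C + 'i * b%:C :> R[i].
  by apply/eqP; rewrite eq_complex /= !mul0r !mul1r ?mulr0 ?subr0 !addr0 ?add0r !eqxx.
apply: le_trans (nCD _ _) _; rewrite nCM !nC_real.
by rewrite /Normc.normc /= expr0n expr1n add0r sqrtr1 mul1r.
Qed.

Lemma cReD x y : complex.Re (x + y) = complex.Re x + complex.Re y.
Proof. by case: x; case: y. Qed.
Lemma cImD x y : complex.Im (x + y) = complex.Im x + complex.Im y.
Proof. by case: x; case: y. Qed.
Lemma cReM x y : complex.Re (x * y) =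
  complex.Re x * complex.Re y - complex.Im x * complex.Im y.
Proof. by case: x; case: y. Qed.
Lemma cImM x y : complex.Im (x * y) =
  complex.Re x * complex.Im y + complex.Im x * complex.Re y.
Proof. by case: x; case: y. Qed.
Lemma cReN x : complex.Re (- x) = - complex.Re x.
Proof. by case: x. Qed.
Lemma cImN x : complex.Im (- x) = - complex.Im x.
Proof. by case: x. Qed.

Lemma complex_ext x y : complex.Re x = complex.Re y ->
  complex.Im x = complex.Im y -> x = y.
Proof. by case: x => a b; case: y => c d /= -> ->. Qed.

(** Rotating a complex number onto the positive axis turns a bound for its modulus into a bound for
    the real part of a linear expression; sums, integrals and increments are estimated in this
    way. *)
Lemma nC_unimod x : exists2 w : R[i], nC w = 1 & w * x = (nC x)%:C.
Proof.
case: (eqVneq x 0) => [->|x0]; first by exists 1; rewrite ?nC1 ?nC0 ?mulr0.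
have nx0 : nC x != 0 by apply: contra_neq x0 => /nC_eq0.
exists ((nC x)%:C * x^-1); first by rewrite nCM nC_real Normc.normcV ger0_norm ?nC_ge0// divff.
by rewrite mulfVK.
Qed.

Lemma nC_sum (I : Type) (s : seq I) (F : I -> R[i]) :
  nC (\sum_(i <- s) F i) <= \sum_(i <- s) nC (F i).
Proof.
elim: s => [|i s IH]; first by rewrite !big_nil nC0.
by rewrite !big_cons (le_trans (nCD _ _))// lerD2l.
Qed.

End ComplexFacts.

(** * Absolutely convergent complex sums *)

Section Csum.
Context {R : realType}.
Implicit Types I J : choiceType.

(* Meaningful only under [summ f]: otherwise [fine] truncates infinite sums to 0. *)
Definition csum I (f : I -> R[i]) : R[i] :=
  rsum (fun i => complex.Re (f i)) +i* rsum (fun i => complex.Im (f i)).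

Definition summ I (f : I -> R[i]) := exists c, sumle (fun i => nC (f i)) c.

Section Basic.
Variable I : choiceType.
Implicit Types f g : I -> R[i].

Lemma sumle_Re f c : sumle (fun i => nC (f i)) c ->
  sumle (Num.norm \o (fun i => complex.Re (f i))) c.
Proof. by apply: sumle_mon => // i; exact: Re_le. Qed.
Lemma sumle_Im f c : sumle (fun i => nC (f i)) c ->
  sumle (Num.norm \o (fun i => complex.Im (f i))) c.
Proof. by apply: sumle_mon => // i; exact: Im_le. Qed.

Lemma eq_csum f g : f =1 g -> csum f = csum g.
Proof. by move=> /funext ->. Qed.

Lemma summ0 : summ (fun _ : I => 0).
Proof. by exists 0 => s _; rewrite big1// => i _; rewrite nC0. Qed.

Lemma summ_le f (g : I -> R) c : (forall i, nC (f i) <= g i) -> sumle g c -> summ f.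
Proof. by move=> fg gc; exists c; apply: sumle_mon gc. Qed.

Lemma summD f g : summ f -> summ g -> summ (fun i => f i + g i).
Proof.
move=> [c fc] [d gd]; exists (c + d); apply: sumle_mon (sumleD fc gd) => // i.
exact: nCD.
Qed.

Lemma summZ f k : summ f -> summ (fun i => k * f i).
Proof.
move=> [c fc]; exists (nC k * c); apply: sumle_mon (sumleZ (nC_ge0 k) fc) => // i.
by rewrite nCM.
Qed.

Lemma summN f : summ f -> summ (fun i => - f i).
Proof. by move=> [c fc]; exists c; apply: sumle_mon fc => // i; rewrite nCN. Qed.

Lemma summB f g : summ f -> summ g -> summ (fun i => f i - g i).
Proof. by move=> sf sg; apply: summD => //; exact: summN. Qed.

Lemma csumD f g : summ f -> summ g -> csum (fun i => f i + g i) = csum f + csum g.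
Proof.
move=> [c fc] [d gd]; apply: complex_ext => /=.
  rewrite -(rsumD (sumle_Re fc) (sumle_Re gd)); congr rsum; apply/funext => i.
  by rewrite cReD.
rewrite -(rsumD (sumle_Im fc) (sumle_Im gd)); congr rsum; apply/funext => i.
by rewrite cImD.
Qed.

Lemma csumZ f k : summ f -> csum (fun i => k * f i) = k * csum f.
Proof.
move=> [c fc].
have zb (h : I -> R) a : sumle (Num.norm \o h) c ->
    sumle (Num.norm \o (fun i => a * h i)) (`|a| * c).
  move=> hc; apply: sumle_mon (sumleZ (normr_ge0 a) hc) => // i /=.
  by rewrite normrM.
have zbN (h : I -> R) d : sumle (Num.norm \o h) d ->
    sumle (Num.norm \o (fun i => - h i)) d.
  by apply: sumle_mon => // i /=; rewrite normrN.
apply: complex_ext => /=.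
  have -> : rsum (fun i => complex.Re (k * f i)) =
    rsum (fun i => complex.Re k * complex.Re (f i) + - (complex.Im k * complex.Im (f i))).
    by congr rsum; apply/funext => i; rewrite cReM.
  rewrite (rsumD (zb _ _ (sumle_Re fc)) (zbN _ _ (zb _ _ (sumle_Im fc)))).
  rewrite (rsumN (zb _ _ (sumle_Im fc))) (rsumZ _ (sumle_Re fc)) (rsumZ _ (sumle_Im fc)).
  by case: (k).
have -> : rsum (fun i => complex.Im (k * f i)) =
  rsum (fun i => complex.Re k * complex.Im (f i) + complex.Im k * complex.Re (f i)).
  by congr rsum; apply/funext => i; rewrite cImM.
rewrite (rsumD (zb _ _ (sumle_Im fc)) (zb _ _ (sumle_Re fc))).
rewrite (rsumZ _ (sumle_Re fc)) (rsumZ _ (sumle_Im fc)).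
by case: (k).
Qed.

Lemma csumN f : summ f -> csum (fun i => - f i) = - csum f.
Proof.
move=> sf; rewrite -mulN1r -csumZ//; apply: eq_csum => i; by rewrite mulN1r.
Qed.

Lemma csumB f g : summ f -> summ g -> csum (fun i => f i - g i) = csum f - csum g.
Proof. by move=> sf sg; rewrite csumD ?csumN//; exact: summN. Qed.

Lemma csum_le f c : sumle (fun i => nC (f i)) c -> nC (csum f) <= c.
Proof.
move=> fc; have [w w1 wE] := nC_unimod (csum f).
have -> : nC (csum f) = complex.Re (w * csum f) by rewrite wE.
rewrite -csumZ /=; last by exists c.
apply: rsum_le; apply: sumle_Re; apply: sumle_mon fc => // i.
by rewrite nCM w1 mul1r.
Qed.

Lemma csum0 : csum (fun _ : I => 0) = 0.
Proof.
apply: nC_eq0; apply/eqP; rewrite eq_le nC_ge0 andbT; apply: csum_le => s _.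
by rewrite big1// => i _; rewrite nC0.
Qed.

Lemma csum_sum (T : Type) (s : seq T) (F : T -> I -> R[i]) :
  (forall t, summ (F t)) ->
  summ (fun i => \sum_(t <- s) F t i) /\
  csum (fun i => \sum_(t <- s) F t i) = \sum_(t <- s) csum (F t).
Proof.
move=> sF; elim: s => [|t s [IH1 IH2]].
  rewrite big_nil; split.
    by have := summ0; congr summ; apply/funext => i; rewrite big_nil.
  by rewrite -[RHS]csum0; apply: eq_csum => i; rewrite big_nil.
rewrite big_cons -IH2 -csumD//; split.
  by have := summD (sF t) IH1; congr summ; apply/funext => i; rewrite big_cons.
by apply: eq_csum => i; rewrite big_cons.
Qed.

Lemma sumle_single (f : I -> R) i : 0 <= f i -> (forall j, j != i -> f j = 0) -> sumle f (f i).
Proof.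
move=> fi0 f0 s us; have [si|si] := boolP (i \in s); last first.
  rewrite big1_seq// => j /andP[_ js]; rewrite f0//.
  by apply: contraNneq si => <-.
rewrite (bigD1_seq i)//= big1 ?addr0// => j ji; exact: f0.
Qed.

Lemma psum_single (f : I -> R) i : 0 <= f i -> (forall j, j != i -> f j = 0) -> psum f = f i.
Proof.
move=> fi0 f0; have fp j : 0 <= f j by case: (eqVneq j i) => [->|/f0 ->].
have fs := sumle_single fi0 f0.
apply/eqP; rewrite eq_le psum_le//=.
exact: (sumle1 i (sumle_psum fp fs)).
Qed.

Lemma rsum_single (f : I -> R) i : (forall j, j != i -> f j = 0) -> rsum f = f i.
Proof.
move=> f0; rewrite /rsum (@psum_single _ i) ?(@psum_single (neg \o f) i) /= ?pos_ge0 ?neg_ge0//.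
- by rewrite -pos_neg.
- by move=> j ji; rewrite f0// /neg oppr0 maxxx.
- by move=> j ji; rewrite f0// /pos maxxx.
Qed.

Lemma csum_single f i : (forall j, j != i -> f j = 0) -> csum f = f i.
Proof.
move=> f0; rewrite /csum (@rsum_single _ i) ?(@rsum_single (fun i => complex.Im (f i)) i)//=.
- by case: (f i).
- by move=> j /f0 ->.
- by move=> j /f0 ->.
Qed.

(** Some finite set reaches [psum] up to e, so every finite set disjoint from it contributes at most
    e. Later approximations by finitely many frequencies rest on such tails. *)
Lemma csum_approx f c (e : R) : sumle (fun i => nC (f i)) c -> 0 < e ->
  exists2 s : seq I, uniq s &
    sumle (fun i => if i \in s then 0 else nC (f i)) e.
Proof.
move=> fc e0; have p0 i : 0 <= nC (f i) by exact: nC_ge0.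
have [s us se] : exists2 s : seq I, uniq s & psum (fun i => nC (f i)) - e <= \sum_(i <- s) nC (f i).
  apply: contrapT => H; have : psum (fun i => nC (f i)) <= psum (fun i => nC (f i)) - e.
    apply: psum_le => // s us; rewrite leNgt; apply/negP => h; apply: H; exists s => //.
    exact: ltW.
  lra.
exists s => // t ut.
rewrite (bigID (mem s))/= big1 ?add0r => [|i ->//].
have := sumle_psum p0 fc (s := s ++ [seq i <- t | i \notin s]).
rewrite cat_uniq us filter_uniq//= andbT big_cat/= big_filter => /(_ _) H.
have {}H := H (introT hasPn _).
have {H} : \sum_(i <- s) nC (f i) + \sum_(i <- t | i \notin s) nC (f i) <= psum (fun i => nC (f i)).
  by apply: H => x; rewrite mem_filter => /andP[].
rewrite [X in _ -> X <= _](eq_bigr (fun i => nC (f i))); first by lra.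
by move=> i /negbTE ->.
Qed.

End Basic.

Lemma csum_reindex I J (h : J -> I) (f : I -> R[i]) : bijective h ->
  csum (f \o h) = csum f.
Proof.
move=> bh; rewrite /csum /rsum -(psum_reindex (pos \o _) bh).
rewrite -(psum_reindex (neg \o fun i => complex.Re (f i)) bh).
by rewrite -(psum_reindex (pos \o fun i => complex.Im (f i)) bh)
           -(psum_reindex (neg \o fun i => complex.Im (f i)) bh).
Qed.

Lemma psum_image I J (h : J -> I) (f : I -> R) : injective h ->
  (forall i, (forall j, i <> h j) -> f i = 0) -> psum (f \o h) = psum f.
Proof.
move=> hi f0; rewrite /psum; congr fine.
rewrite -(@esum_image R J I setT h (fun i => (f i)%:E)); last by move=> x y _ _ /hi.
rewrite esum_mkcond; apply: eq_esum => i _; case: ifPn => // /negP hn.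
by rewrite f0// => j ij; apply: hn; rewrite inE; exists j.
Qed.

Lemma csum_image I J (h : J -> I) (f : I -> R[i]) : injective h ->
  (forall i, (forall j, i <> h j) -> f i = 0) -> csum (f \o h) = csum f.
Proof.
move=> hi f0; rewrite /csum /rsum.
rewrite -(psum_image (f := pos \o fun i => complex.Re (f i)) hi); last first.
  by move=> i /f0 e; rewrite /= e /pos maxxx.
rewrite -(psum_image (f := neg \o fun i => complex.Re (f i)) hi); last first.
  by move=> i /f0 e; rewrite /= e /neg oppr0 maxxx.
rewrite -(psum_image (f := pos \o fun i => complex.Im (f i)) hi); last first.
  by move=> i /f0 e; rewrite /= e /pos maxxx.
rewrite -(psum_image (f := neg \o fun i => complex.Im (f i)) hi)//.
by move=> i /f0 e; rewrite /= e /neg oppr0 maxxx.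
Qed.

Lemma csum_pair I J (F : I -> J -> R[i]) :
  summ (fun p : I * J => F p.1 p.2) ->
  [/\ forall i, summ (F i), summ (fun i => csum (F i)) &
      csum (fun p : I * J => F p.1 p.2) = csum (fun i => csum (F i))].
Proof.
move=> [C FC].
have [h1 h2 h3] := psum_pair (F := fun i j => nC (F i j)) (fun _ _ => nC_ge0 _) FC.
have [_ _ eR] := rsum_pair (F := fun i j => complex.Re (F i j)) (sumle_Re FC).
have [_ _ eI] := rsum_pair (F := fun i j => complex.Im (F i j)) (sumle_Im FC).
split.
- by move=> i; exists C.
- exists C; apply: sumle_mon h2 => // i; apply: csum_le.
  exact: sumle_psum (fun _ => nC_ge0 _) (h1 i).
- by rewrite /csum eR eI.
Qed.

Lemma csum_swap I J (F : I -> J -> R[i]) :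
  summ (fun p : I * J => F p.1 p.2) ->
  csum (fun i => csum (F i)) = csum (fun j => csum (F ^~ j)).
Proof.
move=> sF; have [_ _ <-] := csum_pair sF.
pose sw (p : J * I) : I * J := (p.2, p.1).
have bsw : bijective sw by exists (fun p : I * J => (p.2, p.1)) => -[].
have sF' : summ (fun p : J * I => F p.2 p.1).
  case: sF => C FC; exists C.
  by apply: (@sumle_inj _ _ _ sw _ _ _ FC); exact: bij_inj.
have [_ _ <-] := csum_pair (F := fun j i => F i j) sF'.
by rewrite -(csum_reindex (fun p : I * J => F p.1 p.2) bsw).
Qed.

(* Duality against a finitely supported weight, which turns bounds for a norm of an infinite sum
   into bounds for double sums of non-negative terms. *)
Lemma csum_dual I J (s : seq I) (th : I -> R) (F : I -> J -> R[i]) c :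
  (forall i, 0 <= th i) -> (forall i, summ (F i)) ->
  sumle (fun j => \sum_(i <- s) th i * nC (F i j)) c ->
  \sum_(i <- s) th i * nC (csum (F i)) <= c.
Proof.
move=> th0 sF Fc.
have /choice[w wP] : forall i, exists w : R[i], nC w = 1 /\ w * csum (F i) = (nC (csum (F i)))%:C.
  by move=> i; have [w ? ?] := nC_unimod (csum (F i)); exists w.
have [s1 s2] := csum_sum s (fun i => summZ ((th i)%:C * w i) (sF i)).
have e : (\sum_(i <- s) th i * nC (csum (F i)))%:C =
    csum (fun j => \sum_(i <- s) (th i)%:C * w i * F i j).
  rewrite s2 rmorph_sum/=; apply: eq_bigr => i _.
  by rewrite csumZ// -mulrA (wP i).2 rmorphM.
have : nC ((\sum_(i <- s) th i * nC (csum (F i)))%:C : R[i]) <= c.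
  rewrite e; apply: csum_le; apply: sumle_mon Fc => // j.
  apply: le_trans (nC_sum _ _) _; apply: ler_sum => i _.
  by rewrite !nCM (wP i).1 mulr1 nC_real ger0_norm.
by rewrite nC_real => /(le_trans (ler_norm _)).
Qed.

End Csum.

(** * Norms of sequences *)

Section Gnorm.
Context {R : realType}.
Implicit Types I J : choiceType.

(* A norm on sequences given by a family of non-negative finitely supported test weights: [nb N a c]
   means that the norm of [a] is at most [c].  Weighted l^1 and l^2 norms are the instances. *)
Record gnorm I := Gnorm {
  gn :> seq I -> (I -> R) -> Prop;
  gn_ge0 : forall s th, gn s th -> forall i, 0 <= th i;
  gn_nil : exists th, gn [::] th }.

Definition nb I (N : gnorm I) (a : I -> R[i]) (c : R) :=
  forall s th, N s th -> \sum_(i <- s) th i * nC (a i) <= c.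

Section NbTheory.
Variables (I : choiceType) (N : gnorm I).
Implicit Types a b : I -> R[i].

Lemma nb_ge0 a c : nb N a c -> 0 <= c.
Proof. by case: (gn_nil N) => th Nth /(_ _ _ Nth); rewrite big_nil. Qed.

Lemma nb_solid a b c d : (forall i, nC (a i) <= nC (b i)) -> c <= d ->
  nb N b c -> nb N a d.
Proof.
move=> ab cd bc s th Nth; apply: le_trans cd; apply: le_trans (bc _ _ Nth).
by apply: ler_sum => i _; rewrite ler_wpM2l// (gn_ge0 Nth).
Qed.

Lemma nb_mon a c d : c <= d -> nb N a c -> nb N a d.
Proof. exact: nb_solid. Qed.

Lemma nb_eq a b c : a =1 b -> nb N a c -> nb N b c.
Proof. by move=> /funext ->. Qed.

Lemma nbD a b c d : nb N a c -> nb N b d -> nb N (a + b) (c + d).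
Proof.
move=> ac bd s th Nth; apply: le_trans (lerD (ac _ _ Nth) (bd _ _ Nth)).
rewrite -big_split/=; apply: ler_sum => i _.
by rewrite -mulrDr ler_wpM2l ?(gn_ge0 Nth)// nCD.
Qed.

Lemma nbN a c : nb N a c -> nb N (- a) c.
Proof. by apply: nb_solid => // i; rewrite nCN. Qed.

Lemma nbB a b c d : nb N a c -> nb N b d -> nb N (a - b) (c + d).
Proof. by move=> ac bd; apply: nbD => //; exact: nbN. Qed.

Lemma nbBC a b c : nb N (a - b) c -> nb N (b - a) c.
Proof. by rewrite -opprB => /nbN; rewrite opprK. Qed.

Lemma nbZ a c k : nb N a c -> nb N (fun i => k * a i) (nC k * c).
Proof.
move=> ac s th Nth; have := ler_wpM2l (nC_ge0 k) (ac _ _ Nth).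
rewrite mulr_sumr; apply: le_trans; apply: ler_sum => i _.
by rewrite nCM mulrCA.
Qed.

Lemma nb0 : nb N 0 0.
Proof. by move=> s th _; rewrite big1// => i _; rewrite nC0 mulr0. Qed.

(** The triangle inequality for infinite sums: with norms given by test weights it is [csum_dual],
    applied test by test. *)
Lemma nb_csum J (F : J -> I -> R[i]) (c : J -> R) C :
  (forall i, summ (F ^~ i)) -> (forall j, nb N (F j) (c j)) -> sumle c C ->
  nb N (fun i => csum (F ^~ i)) C.
Proof.
move=> sF Fc cC s th Nth; apply: csum_dual => //; first exact: gn_ge0 Nth.
by apply: sumle_mon cC => // j; exact: Fc.
Qed.

End NbTheory.

(** Weighted l^1. The absolute value makes the test weights non-negative for any [wt], so that the
    definition carries no proof about [wt]; it disappears in [nb_W]. *)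
Definition Wn I (wt : I -> R) : gnorm I.
refine (@Gnorm I (fun s th => uniq s /\ th = fun i => `|wt i|) _ _).
- by move=> s th [_ ->] i.
- by exists (fun i => `|wt i|).
Defined.

Lemma nb_W I (wt : I -> R) a c : (forall i, 0 <= wt i) ->
  nb (Wn wt) a c <-> sumle (fun i => wt i * nC (a i)) c.
Proof.
move=> w0; split=> [h s us|h s th [us ->]].
  have := h s _ (conj us erefl); congr (_ <= _); apply: eq_bigr => i _.
  by rewrite ger0_norm.
have := h s us; congr (_ <= _); apply: eq_bigr => i _.
by rewrite ger0_norm.
Qed.

Lemma nb_W1 I (a : I -> R[i]) c : nb (Wn (fun=> 1)) a c <-> sumle (fun i => nC (a i)) c.
Proof.
rewrite nb_W// (_ : (fun i => 1 * nC (a i)) = fun i => nC (a i))//.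
by apply/funext => i; rewrite mul1r.
Qed.

(** Weighted l^2 by duality: the tests are [wt] times the l^2 unit ball. A bound [nb] thus has the
    same shape as for l^1, and one proof serves both norms. *)
Definition Hn I (wt : I -> R) : gnorm I.
refine (@Gnorm I (fun s th => uniq s /\ exists2 eta : I -> R,
   (forall i, 0 <= eta i) /\ \sum_(i <- s) eta i ^+ 2 <= 1 &
   th = fun i => `|wt i| * eta i) _ _).
- by move=> s th [_ [eta [e0 _] ->]] i; rewrite mulr_ge0.
- exists (fun i => `|wt i| * 0); split=> //; exists (fun=> 0) => //; split=> //.
  by rewrite big_nil.
Defined.

Lemma CS_seq (T : Type) (s : seq T) (f g : T -> R) :
  (\sum_(i <- s) f i * g i) ^+ 2 <= (\sum_(i <- s) f i ^+ 2) * (\sum_(i <- s) g i ^+ 2).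
Proof.
set A := \sum_(i <- s) f i ^+ 2; set B := \sum_(i <- s) g i ^+ 2.
set X := \sum_(i <- s) f i * g i.
have A0 : 0 <= A by apply: sumr_ge0 => i _; rewrite sqr_ge0.
have B0 : 0 <= B by apply: sumr_ge0 => i _; rewrite sqr_ge0.
have P t : 0 <= A - 2 * t * X + t ^+ 2 * B.
  have -> : A - 2 * t * X + t ^+ 2 * B = \sum_(i <- s) (f i - t * g i) ^+ 2.
    rewrite /A /B /X !mulr_sumr -sumrB -big_split/=; apply: eq_bigr => i _; ring.
  by apply: sumr_ge0 => i _; rewrite sqr_ge0.
case: (eqVneq B 0) => [B0'|Bn0].
  case: (eqVneq X 0) => [->|Xn0]; first by rewrite expr0n /= mulr_ge0.
  (* At this t the polynomial, affine because B = 0, takes the value -1. *)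
  have := P ((A + 1) / (2 * X)); rewrite B0' mulr0 addr0.
  have -> : 2 * ((A + 1) / (2 * X)) * X = A + 1 by field.
  lra.
have Bp : 0 < B by rewrite lt_neqAle eq_sym Bn0.
have := P (X / B).
have -> : A - 2 * (X / B) * X + (X / B) ^+ 2 * B = (A * B - X ^+ 2) / B by field.
by rewrite pmulr_lge0 ?invr_gt0// subr_ge0.
Qed.

Lemma nb_H I (wt : I -> R) a c : 0 <= c -> (forall i, 0 <= wt i) ->
  nb (Hn wt) a c <-> sumle (fun i => (wt i * nC (a i)) ^+ 2) (c ^+ 2).
Proof.
move=> c0 w0; split=> [h s us|h s th [us [eta [e0 e1] ->]]].
  set S := \sum_(i <- s) _.
  have S0 : 0 <= S by apply: sumr_ge0 => i _; rewrite sqr_ge0.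
  case: (eqVneq S 0) => [->|Sn0]; first by rewrite sqr_ge0.
  have Sp : 0 < S by rewrite lt_neqAle eq_sym Sn0.
  pose q := Num.sqrt S.
  have q0 : 0 < q by rewrite sqrtr_gt0.
  have q2 : q ^+ 2 = S by rewrite sqr_sqrtr.
  (* The optimal test, for which Cauchy-Schwarz is an equality. *)
  have /(_ _) := h s (fun i => `|wt i| * (wt i * nC (a i) / q)).
  have -> : \sum_(i <- s) `|wt i| * (wt i * nC (a i) / q) * nC (a i) = q.
    transitivity (S / q); last by rewrite -q2; field; exact: lt0r_neq0.
    rewrite /S mulr_suml; apply: eq_bigr => i _; rewrite ger0_norm//; field.
    exact: lt0r_neq0.
  rewrite -q2 ler_sqr ?nnegrE//; last by rewrite ltW.
  apply; split=> //; exists (fun i => wt i * nC (a i) / q) => //; split.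
    by move=> i; rewrite !mulr_ge0 ?nC_ge0// invr_ge0 ltW.
  rewrite (eq_bigr (fun i => (wt i * nC (a i)) ^+ 2 / S)) => [|i _].
    by rewrite -mulr_suml divff.
  by rewrite expr_div_n q2.
have E : \sum_(i <- s) `|wt i| * eta i * nC (a i) =
    \sum_(i <- s) eta i * (wt i * nC (a i)).
  by apply: eq_bigr => i _; rewrite ger0_norm//; ring.
rewrite E -(ler_sqr (x := \sum_(i <- s) _)) ?nnegrE//; last first.
  by apply: sumr_ge0 => i _; rewrite !mulr_ge0 ?nC_ge0.
apply: le_trans (CS_seq _ _ _) _.
apply: le_trans (h s us); rewrite -[leRHS]mul1r ler_wpM2r//.
by apply: sumr_ge0 => i _; rewrite sqr_ge0.
Qed.

Lemma nb_H_coef I (wt : I -> R) a c i : (forall i, 0 <= wt i) -> nb (Hn wt) a c ->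
  wt i * nC (a i) <= c.
Proof.
move=> w0 h; have c0 := nb_ge0 h; move/(nb_H _ c0 w0)/(sumle1 i): h.
by rewrite ler_sqr ?nnegrE// mulr_ge0 ?nC_ge0.
Qed.

Lemma nb_W_coef I (wt : I -> R) a c i : (forall i, 0 <= wt i) -> nb (Wn wt) a c ->
  wt i * nC (a i) <= c.
Proof. by move=> w0 /(nb_W _ _ w0)/(sumle1 i). Qed.

Lemma nb_W_mon I (w1 w2 : I -> R) C a b c : 0 <= C ->
  (forall i, 0 <= w1 i) -> (forall i, 0 <= w2 i) ->
  (forall i, w1 i * nC (a i) <= C * (w2 i * nC (b i))) ->
  nb (Wn w2) b c -> nb (Wn w1) a (C * c).
Proof.
move=> C0 w10 w20 h /(nb_W _ _ w20) hb; apply/nb_W => //.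
exact: sumle_mon (sumleZ C0 hb).
Qed.

Lemma nb_H_mon I (w1 w2 : I -> R) C a b c : 0 <= C ->
  (forall i, 0 <= w1 i) -> (forall i, 0 <= w2 i) ->
  (forall i, w1 i * nC (a i) <= C * (w2 i * nC (b i))) ->
  nb (Hn w2) b c -> nb (Hn w1) a (C * c).
Proof.
move=> C0 w10 w20 h hb; have c0 := nb_ge0 hb; move/(nb_H _ c0 w20): hb => hb.
apply/nb_H => //; first by rewrite mulr_ge0.
rewrite exprMn; apply: sumle_mon (sumleZ (sqr_ge0 C) hb) => // i.
rewrite -exprMn ler_sqr ?nnegrE ?h//; first by rewrite mulr_ge0 ?nC_ge0.
by rewrite !mulr_ge0 ?nC_ge0.
Qed.

End Gnorm.

(** * Curves of sequences *)

Section Curves.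
Context {R : realType}.
Implicit Types (a b t e d : R).

(* Derivatives and continuity are relative to [a, b], hence one-sided at its end points. *)
Definition rderat a b (f : R -> R) (x d : R) :=
  forall e : R, 0 < e -> exists2 del : R, 0 < del & forall t, a <= t <= b -> `|t - x| < del ->
    `|f t - f x - (t - x) * d| <= e * `|t - x|.

Lemma rderat_is_derive a b (f : R -> R) (x d : R) : a < x < b -> rderat a b f x d -> is_derive x 1 f d.
Proof.
move=> /andP[ax xb] H.
have cv : h^-1 *: (f (h *: (1 : R) + x) - f x) @[h --> 0^'] --> d.
  apply/cvgrPdist_le => e e0; have [del d0 Hd] := H e e0.
  near=> h.
  have hn0 : h != 0 by near: h; exact: nbhs_dnbhs_neq.
  have hs : `|h| < Num.min del (Num.min (x - a) (b - x)).
    near: h; apply: dnbhs0_lt; rewrite !lt_min d0/= !subr_gt0 ax//.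
  move: hs; rewrite !lt_min => /and3P[h1 h2 h3].
  have := Hd (h + x); rewrite addrK => /(_ _ h1) Hh.
  have hh : a <= h + x <= b by move: h2 h3; rewrite !ltr_norml => /andP[? ?] /andP[? ?]; lra.
  have {Hh} := Hh hh.
  rewrite /GRing.scale/= mulr1 => Hh.
  have -> : d - h^-1 * (f (h + x) - f x) = - (h^-1 * (f (h + x) - f x - h * d)).
    by field.
  rewrite normrN normrM normrV ?unitfE// mulrC ler_pdivrMr// normr_gt0//.
split; first by apply/cvg_ex; exists d.
exact/cvg_lim.
Unshelve. all: by end_near.
Qed.

Lemma is_derive_rderat a b (f : R -> R) (x d : R) : is_derive x 1 f d -> rderat a b f x d.
Proof.
move=> [df dv] e e0.
have : h^-1 *: (f (h *: (1 : R) + x) - f x) @[h --> 0^'] --> d.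
  by rewrite -dv; exact: df.
move/cvgrPdist_le => /(_ e e0) [del /= d0 H]; exists del => // t _ tx.
case: (eqVneq t x) => [->|tnx]; first by rewrite !subrr mul0r subrr normr0 mulr0.
have tx0 : t - x != 0 by rewrite subr_eq0.
have := H (t - x); rewrite /ball/= sub0r normrN => /(_ tx tx0).
rewrite /GRing.scale/= mulr1 subrK.
have -> : d - (t - x)^-1 * (f t - f x) = - ((t - x)^-1 * (f t - f x - (t - x) * d)) by field.
by rewrite normrN normrM normrV ?unitfE// mulrC ler_pdivrMr// normr_gt0.
Qed.

(** Relative derivatives are two-sided in the interior and give one-sided continuity at the end
    points, which is what the mean value theorem asks. *)
Lemma rder_mvt a b (f f' : R -> R) M : a <= b ->
  (forall x, a <= x <= b -> rderat a b f x (f' x)) ->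
  (forall x, a <= x <= b -> f' x <= M) -> f b - f a <= M * (b - a).
Proof.
rewrite le_eqVlt => /predU1P[->|ab] H HM; first by rewrite !subrr mulr0.
have df x : x \in `]a, b[ -> is_derive x 1 f (f' x).
  rewrite in_itv/= => /andP[ax xb]; apply: (@rderat_is_derive a b); rewrite ?ax//.
  by apply: H; rewrite !ltW.
have cf : {within `[a, b], continuous f}.
  apply/continuous_within_itvP => //.
  have cx x : a <= x <= b -> forall e : R, 0 < e -> exists2 del : R, 0 < del &
      forall t, a <= t <= b -> `|t - x| < del -> `|f x - f t| <= e.
    move=> xab e e0; have [del d0 Hd] := H x xab 1 ltr01.
    pose m := 1 + `|f' x|.
    have m0 : 0 < m by rewrite /m ltr_pwDl.
    exists (Num.min del (e / m)); first by rewrite lt_min d0 divr_gt0.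
    move=> t tab; rewrite lt_min => /andP[/(Hd t tab) h1 h2]; rewrite mul1r in h1.
    have h3 : `|f x - f t| <= m * `|t - x|.
      rewrite distrC -[f t - f x](subrK ((t - x) * f' x)).
      have -> : m * `|t - x| = `|t - x| + `|t - x| * `|f' x| by rewrite /m; ring.
      by apply: le_trans (ler_normD _ _) _; rewrite normrM lerD.
    by apply: le_trans h3 _; rewrite mulrC -ler_pdivlMr// ltW.
  split.
  - move=> x xab; have /derivable1_diffP/differentiable_continuous : derivable f x 1.
      by have [] := df x xab.
    by [].
  - apply/cvgrPdist_le => e e0; have [|del d0 Hd] := cx a _ e e0; first by rewrite lexx ltW.
    near=> t; apply: Hd.
      apply/andP; split; near: t; first exact: nbhs_right_ge.
      exact: nbhs_right_le.
    have at_ : a < t by near: t; exact: nbhs_right_gt.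
    have ta : t < a + del by near: t; apply: nbhs_right_lt; rewrite ltrDl.
    rewrite gtr0_norm ?subr_gt0//; lra.
  - apply/cvgrPdist_le => e e0; have [|del d0 Hd] := cx b _ e e0; first by rewrite lexx ltW.
    near=> t; apply: Hd.
      apply/andP; split; near: t; first exact: nbhs_left_ge.
      exact: nbhs_left_le.
    have at_ : t < b by near: t; exact: nbhs_left_lt.
    have ta : b - del < t by near: t; apply: nbhs_left_gt; rewrite gtrDl oppr_lt0.
    rewrite distrC gtr0_norm ?subr_gt0//; lra.
have [c cab ->] := MVT ab df cf.
apply: ler_wpM2r; first by rewrite subr_ge0 ltW.
by apply: HM; move: cab; rewrite in_itv/= => /andP[? ?]; rewrite !ltW.
Unshelve. all: by end_near.
Qed.

Definition cder a b (f f' : R -> R[i]) :=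
  forall x, a <= x <= b -> forall e : R, 0 < e -> exists2 del : R, 0 < del &
    forall t, a <= t <= b -> `|t - x| < del ->
    nC (f t - f x - (t - x)%:C * f' x) <= e * `|t - x|.

Definition ccont a b (f : R -> R[i]) :=
  forall x, a <= x <= b -> forall e : R, 0 < e -> exists2 del : R, 0 < del &
    forall t, a <= t <= b -> `|t - x| < del -> nC (f t - f x) <= e.

Definition ccurve (I : choiceType) (N : gnorm I) a b (f : R -> I -> R[i]) :=
  forall x, a <= x <= b -> forall e : R, 0 < e -> exists2 del : R, 0 < del &
    forall t, a <= t <= b -> `|t - x| < del -> nb N (f t - f x) e.

Lemma cder_sub a b a' b' f f' : a <= a' -> b' <= b -> cder a b f f' -> cder a' b' f f'.
Proof.
move=> aa bb H x /andP[x1 x2] e e0; have [|d d0 Hd] := H x _ e e0.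
  by rewrite (le_trans aa x1) (le_trans x2 bb).
exists d => // t /andP[t1 t2]; apply: Hd.
by rewrite (le_trans aa t1) (le_trans t2 bb).
Qed.

Lemma ccurve_sub I (N : gnorm I) a b a' b' f : a <= a' -> b' <= b ->
  ccurve N a b f -> ccurve N a' b' f.
Proof.
move=> aa bb H x /andP[x1 x2] e e0; have [|d d0 Hd] := H x _ e e0.
  by rewrite (le_trans aa x1) (le_trans x2 bb).
exists d => // t /andP[t1 t2]; apply: Hd.
by rewrite (le_trans aa t1) (le_trans t2 bb).
Qed.

Lemma cder_eq a b f g f' g' : (forall t, a <= t <= b -> f t = g t) ->
  (forall t, a <= t <= b -> f' t = g' t) -> cder a b f f' -> cder a b g g'.
Proof.
move=> fg fg' H x xab e e0; have [d d0 Hd] := H x xab e e0; exists d => // t tab.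
by rewrite -fg// -fg// -fg'//; exact: Hd.
Qed.

Lemma ccont_eq a b f g : (forall t, a <= t <= b -> f t = g t) ->
  ccont a b f -> ccont a b g.
Proof.
move=> fg H x xab e e0; have [d d0 Hd] := H x xab e e0; exists d => // t tab.
by rewrite -fg// -fg//; exact: Hd.
Qed.

Lemma ccurve_eq I (N : gnorm I) a b f g : (forall t, a <= t <= b -> f t = g t) ->
  ccurve N a b f -> ccurve N a b g.
Proof.
move=> fg H x xab e e0; have [d d0 Hd] := H x xab e e0; exists d => // t tab.
by rewrite -fg// -fg//; exact: Hd.
Qed.

Lemma ler_eps_div (e m : R) : 0 < e -> 0 <= m -> exists2 e', 0 < e' & e' * m <= e.
Proof.
move=> e0 m0; exists (e / (m + 1)); first by rewrite divr_gt0//; lra.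
rewrite mulrAC ler_pdivrMr; last by lra.
by rewrite ler_pM2l//; lra.
Qed.

Lemma cder_ccont a b f f' : cder a b f f' -> ccont a b f.
Proof.
move=> H x xab e e0; have [d d0 Hd] := H x xab 1 ltr01.
have m0 : 0 <= 1 + nC (f' x) by rewrite addr_ge0// nC_ge0.
have [e' e'0 he'] := ler_eps_div e0 m0.
exists (Num.min d e'); first by rewrite lt_min d0.
move=> t tab; rewrite lt_min => /andP[/(Hd t tab) h1 h2]; rewrite mul1r in h1.
rewrite -[f t - f x](subrK ((t - x)%:C * f' x)); apply: le_trans (nCD _ _) _.
rewrite nCM nC_real; apply: le_trans (lerD h1 (lexx _)) _.
rewrite -{1}[`|t - x|]mulr1 -mulrDr; apply: le_trans he'.
by rewrite ler_wpM2r// ltW.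
Qed.

Lemma cder_cst a b c : cder a b (fun=> c) (fun=> 0).
Proof. by move=> x _ e e0; exists 1 => // t _ _; rewrite mulr0 !subrr nC0 mulr_ge0// ltW. Qed.
Arguments cder_cst a b c : clear implicits.

Lemma cderD a b f f' g g' : cder a b f f' -> cder a b g g' ->
  cder a b (fun t => f t + g t) (fun t => f' t + g' t).
Proof.
move=> Hf Hg x xab e e0; have e20 : 0 < e / 2 by rewrite divr_gt0.
have [d d0 Hd] := Hf x xab _ e20; have [d' d'0 Hd'] := Hg x xab _ e20.
exists (Num.min d d'); first by rewrite lt_min d0.
move=> t tab; rewrite lt_min => /andP[/(Hd t tab) h1 /(Hd' t tab) h2].
have -> : f t + g t - (f x + g x) - (t - x)%:C * (f' x + g' x) =
  (f t - f x - (t - x)%:C * f' x) + (g t - g x - (t - x)%:C * g' x) by ring.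
by apply: le_trans (nCD _ _) _; lra.
Qed.

Lemma cderM a b f f' g g' : cder a b f f' -> cder a b g g' ->
  cder a b (fun t => f t * g t) (fun t => f' t * g t + f t * g' t).
Proof.
move=> Hf Hg x xab e e0; have cg := cder_ccont Hg.
pose m := nC (g x) + nC (f x) + (nC (f' x) + 1).
have m0 : 0 <= m by rewrite !addr_ge0 ?nC_ge0.
have [e' e'0 he'] := ler_eps_div e0 m0.
have e10 : 0 < Num.min e' 1 by rewrite lt_min e'0 ltr01.
have [d d0 Hd] := Hf x xab _ e10; have [d' d'0 Hd'] := Hg x xab _ e'0.
have [d'' d''0 Hd''] := cg x xab _ e'0.
exists (Num.min d (Num.min d' d'')); first by rewrite !lt_min d0 d'0.
move=> t tab; rewrite !lt_min => /and3P[/(Hd t tab) h1 /(Hd' t tab) h2 /(Hd'' t tab) h3].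
set u := f t - f x - _ in h1; set v := g t - g x - _ in h2.
have -> : f t * g t - f x * g x - (t - x)%:C * (f' x * g x + f x * g' x) =
  u * g x + f x * v + ((t - x)%:C * f' x + u) * (g t - g x).
  by rewrite /u /v; ring.
apply: le_trans (nCD _ _) _; apply: le_trans (lerD (nCD _ _) (lexx _)) _.
rewrite !nCM.
have h4 : nC ((t - x)%:C * f' x + u) <= `|t - x| * (nC (f' x) + 1).
  apply: le_trans (nCD _ _) _; rewrite nCM nC_real mulrDr mulr1 lerD2l.
  by apply: le_trans h1 _; rewrite ler_piMl// ge_min lexx orbT.
have h1' : nC u <= e' * `|t - x|.
  by apply: le_trans h1 _; rewrite ler_wpM2r// ge_min lexx.
apply: (@le_trans _ _ (e' * `|t - x| * nC (g x) + nC (f x) * (e' * `|t - x|) +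
    `|t - x| * (nC (f' x) + 1) * e')).
  apply: lerD; first apply: lerD.
  - by rewrite ler_wpM2r ?nC_ge0.
  - by rewrite ler_wpM2l ?nC_ge0.
  - by apply: ler_pM; rewrite ?nC_ge0.
have -> : e' * `|t - x| * nC (g x) + nC (f x) * (e' * `|t - x|) +
    `|t - x| * (nC (f' x) + 1) * e' = e' * m * `|t - x| by rewrite /m; ring.
by rewrite ler_wpM2r.
Qed.

Lemma cderZ a b k f f' : cder a b f f' -> cder a b (fun t => k * f t) (fun t => k * f' t).
Proof.
move=> H; have := cderM (cder_cst a b k) H; apply: cder_eq => // t _.
by rewrite mul0r add0r.
Qed.

Lemma cderN a b f f' : cder a b f f' -> cder a b (fun t => - f t) (fun t => - f' t).
Proof. by move=> H; have := cderZ (-1) H; apply: cder_eq => // t _; rewrite mulN1r. Qed.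

Lemma cderB a b f f' g g' : cder a b f f' -> cder a b g g' ->
  cder a b (fun t => f t - g t) (fun t => f' t - g' t).
Proof. by move=> Hf Hg; apply: cderD => //; exact: cderN. Qed.

Lemma cder_sum a b (T : Type) (s : seq T) (F F' : T -> R -> R[i]) :
  (forall i, cder a b (F i) (F' i)) ->
  cder a b (fun t => \sum_(i <- s) F i t) (fun t => \sum_(i <- s) F' i t).
Proof.
move=> H; elim: s => [|i s IH].
  by have := cder_cst a b 0; apply: cder_eq => t _; rewrite big_nil.
by have := cderD (H i) IH; apply: cder_eq => t _; rewrite big_cons.
Qed.

Lemma cder_Re a b f f' x : a <= x <= b -> cder a b f f' ->
  rderat a b (fun t => complex.Re (f t)) x (complex.Re (f' x)).
Proof.
move=> xab H e e0; have [d d0 Hd] := H x xab e e0; exists d => // t tab tx.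
apply: le_trans (Hd t tab tx); apply: le_trans (Re_le _).
by rewrite !cReD !cReN cReM /= mul0r subr0.
Qed.

Lemma cder_Im a b f f' x : a <= x <= b -> cder a b f f' ->
  rderat a b (fun t => complex.Im (f t)) x (complex.Im (f' x)).
Proof.
move=> xab H e e0; have [d d0 Hd] := H x xab e e0; exists d => // t tab tx.
apply: le_trans (Hd t tab tx); apply: le_trans (Im_le _).
by rewrite !cImD !cImN cImM /= mul0r addr0.
Qed.

Lemma rder_cder a b (f f' : R -> R[i]) :
  (forall x, a <= x <= b -> rderat a b (fun t => complex.Re (f t)) x (complex.Re (f' x))) ->
  (forall x, a <= x <= b -> rderat a b (fun t => complex.Im (f t)) x (complex.Im (f' x))) ->
  cder a b f f'.
Proof.
move=> H1 H2 x xab e e0; have e20 : 0 < e / 2 by rewrite divr_gt0.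
have [d d0 Hd] := H1 x xab _ e20; have [d' d'0 Hd'] := H2 x xab _ e20.
exists (Num.min d d'); first by rewrite lt_min d0.
move=> t tab; rewrite lt_min => /andP[/(Hd t tab) h1 /(Hd' t tab) h2].
apply: le_trans (nC_le _) _.
rewrite !cReD !cReN cReM !cImD !cImN cImM /= mul0r subr0 mul0r addr0.
lra.
Qed.

(** Each coefficient of [f b - f a] is rotated to its modulus by a constant of modulus 1; a test
    weight then yields a real function of time, to which the scalar mean value inequality applies.
    Only coefficientwise derivatives are used. *)
Lemma nb_mvt (I : choiceType) (N : gnorm I) a b (f f' : R -> I -> R[i]) M :
  a <= b -> (forall i, cder a b (f ^~ i) (f' ^~ i)) ->
  (forall t, a <= t <= b -> nb N (f' t) M) -> nb N (f b - f a) (M * (b - a)).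
Proof.
move=> ab Hf HM s th Nth.
have /choice[w wP] : forall i, exists w : R[i], nC w = 1 /\
    w * (f b i - f a i) = (nC (f b i - f a i))%:C.
  by move=> i; have [w ? ?] := nC_unimod (f b i - f a i); exists w.
pose phi t := \sum_(i <- s) (th i)%:C * w i * f t i.
pose phi' t := \sum_(i <- s) (th i)%:C * w i * f' t i.
have dphi : cder a b phi phi'.
  by apply: (cder_sum s (F := fun i t => (th i)%:C * w i * f t i)) => i; exact: cderZ.
have := @rder_mvt a b (fun t => complex.Re (phi t)) (fun t => complex.Re (phi' t)) M ab.
have E : phi b - phi a = (\sum_(i <- s) th i * nC ((f b - f a) i))%:C.
  rewrite /phi -sumrB rmorph_sum/=; apply: eq_bigr => i _.
  by rewrite -mulrBr -mulrA (wP i).2 -rmorphM.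
rewrite -cReN -cReD E /=; apply.
  by move=> x xab; exact: cder_Re.
move=> x xab; apply: le_trans (HM x xab _ _ Nth).
apply: le_trans (ler_norm _) _; apply: le_trans (Re_le _) _.
apply: le_trans (nC_sum _ _) _; apply: ler_sum => i _.
by rewrite !nCM (wP i).1 mulr1 nC_real ger0_norm ?(gn_ge0 Nth).
Qed.

Lemma nC_mvt a b (f f' : R -> R[i]) M :
  a <= b -> cder a b f f' -> (forall t, a <= t <= b -> nC (f' t) <= M) ->
  nC (f b - f a) <= M * (b - a).
Proof.
move=> ab Hf HM; have := @nb_mvt unit (Wn (fun=> 1)) a b (fun t _ => f t) (fun t _ => f' t) M ab.
move=> /(_ (fun=> Hf)) H.
suff /(nb_W1 _ _)/(sumle1 tt) : nb (Wn (fun=> 1)) ((fun=> f b) - (fun=> f a) : unit -> R[i]) (M * (b - a)) by [].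
apply: H => t tab; apply/nb_W1 => s us; case: s us => [_|[] [_|[]//]].
  by rewrite big_nil (le_trans (nC_ge0 _) (HM _ tab)).
by rewrite big_seq1 HM.
Qed.

(* The mean value inequality upgrades coefficientwise derivatives that are continuous in norm to a
   derivative in norm. *)
Lemma nb_der (I : choiceType) (N : gnorm I) a b (f f' : R -> I -> R[i]) :
  (forall i, cder a b (f ^~ i) (f' ^~ i)) -> ccurve N a b f' ->
  forall x, a <= x <= b -> forall e : R, 0 < e -> exists2 del : R, 0 < del &
    forall t, a <= t <= b -> `|t - x| < del ->
    nb N (fun i => f t i - f x i - (t - x)%:C * f' x i) (e * `|t - x|).
Proof.
move=> Hf cf x xab e e0.
have [d d0 Hd] := cf x xab e e0; exists d => // t tab tx.
(* Without its tangent at x, the curve has derivative [f' r - f' x], which is small in norm near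
   x. *)
pose g (r : R) i := f r i - r%:C * f' x i.
have gd lo hi : a <= lo -> hi <= b -> forall i, cder lo hi (g ^~ i) (fun r => f' r i - f' x i).
  move=> alo hib i; have c1 : cder lo hi (fun r => r%:C) (fun=> 1).
    move=> y _ e1 e10; exists 1 => // r _ _.
    by rewrite mulr1 rmorphB subrr nC0 mulr_ge0// ltW.
  have := cderB (cder_sub alo hib (Hf i)) (cderM c1 (@cder_cst lo hi (f' x i))).
  by apply: cder_eq => // r _; rewrite mulr0 addr0 mul1r.
have gE lo hi : (fun i => g hi i - g lo i) = (fun i => f hi i - f lo i - (hi - lo)%:C * f' x i).
  by apply/funext => i; rewrite /g rmorphB; ring.
case: (leP x t) => xt.
  have := @nb_mvt I N x t g (fun r => f' r - f' x) e xt.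
  rewrite (_ : g t - g x = (fun i => f t i - f x i - (t - x)%:C * f' x i)) -?gE//.
  rewrite ger0_norm ?subr_ge0//; apply.
    by apply: gd; [case/andP: xab|case/andP: tab].
  move=> r /andP[r1 r2]; apply: Hd.
    by case/andP: xab => x1 _; case/andP: tab => _ t2; rewrite (le_trans x1 r1) (le_trans r2 t2).
  rewrite ger0_norm ?subr_ge0//; apply: le_lt_trans tx; rewrite ger0_norm ?subr_ge0//; lra.
have := @nb_mvt I N t x g (fun r => f' r - f' x) e (ltW xt).
rewrite distrC ger0_norm; last by rewrite subr_ge0 ltW.
move=> H; have {}H : nb N (g x - g t) (e * (x - t)).
  apply: H; first by apply: gd; [case/andP: tab|case/andP: xab].
  move=> r /andP[r1 r2]; apply: Hd.
    by case/andP: xab => _ x2; case/andP: tab => t1 _; rewrite (le_trans t1 r1) (le_trans r2 x2).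
  rewrite distrC ger0_norm ?subr_ge0//; apply: le_lt_trans tx.
  rewrite distrC ger0_norm; [lra|by rewrite subr_ge0 ltW].
move: H => /nbBC; apply: nb_eq => i; rewrite -[LHS]/(g t i - g x i) /g rmorphB; ring.
Qed.

Lemma cder_csum (I : choiceType) a b (f f' : R -> I -> R[i]) :
  (forall i, cder a b (f ^~ i) (f' ^~ i)) ->
  (forall t, a <= t <= b -> summ (f t)) ->
  (forall t, a <= t <= b -> summ (f' t)) ->
  ccurve (Wn (fun=> 1)) a b f' ->
  cder a b (fun t => csum (f t)) (fun t => csum (f' t)).
Proof.
move=> Hf sf sf' cf x xab e e0.
have [d d0 Hd] := nb_der Hf cf xab e0; exists d => // t tab tx.
have E : csum (f t) - csum (f x) - (t - x)%:C * csum (f' x) =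
  csum (fun i => f t i - f x i - (t - x)%:C * f' x i).
  rewrite csumB ?csumB ?csumZ//; first exact: sf'.
  - by apply: sf.
  - exact: sf.
  - by apply: summB; exact: sf.
  - by apply: summZ; exact: sf'.
by rewrite E; apply: csum_le; apply/nb_W1; exact: Hd.
Qed.

End Curves.

(** * Weighted sequence spaces and multilinear multipliers *)

Section Weights.
Context {R : realType}.
Implicit Types (j k l : int) (s : R).

(** The Japanese bracket of k to the power s. *)
Definition wt s k : R := (1 + k%:~R ^+ 2) `^ (s / 2).

Lemma wt_base k : 1 <= 1 + (k%:~R : R) ^+ 2.
Proof. by rewrite lerDl sqr_ge0. Qed.

Lemma wt_base0 k : 0 < 1 + (k%:~R : R) ^+ 2.
Proof. exact: lt_le_trans ltr01 (wt_base k). Qed.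

Lemma wt_gt0 s k : 0 < wt s k. Proof. by rewrite powR_gt0// wt_base0. Qed.
Lemma wt_ge0 s k : 0 <= wt s k. Proof. exact: ltW (wt_gt0 _ _). Qed.
Lemma wt0 k : wt 0 k = 1. Proof. by rewrite /wt mul0r powRr0. Qed.

Lemma wt_mono s s' k : s <= s' -> wt s k <= wt s' k.
Proof. by move=> ss; apply: ler_powR; [exact: wt_base|rewrite ler_pM2r]. Qed.

Lemma wt_ge1 s k : 0 <= s -> 1 <= wt s k.
Proof. by move=> s0; rewrite -(wt0 k); exact: wt_mono. Qed.

Lemma wtD s s' k : wt (s + s') k = wt s k * wt s' k.
Proof. by rewrite /wt mulrDl powRD// (gt_eqF (wt_base0 k)) implybT. Qed.

Lemma wtN s k : wt (- s) k = (wt s k)^-1.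
Proof. by rewrite /wt mulNr powRN. Qed.

Lemma wt_sqr s k : wt s k ^+ 2 = (1 + k%:~R ^+ 2) `^ s.
Proof. by rewrite expr2 -wtD /wt; congr (_ `^ _); lra. Qed.

Lemma wt1_sqr k : wt 1 k ^+ 2 = 1 + k%:~R ^+ 2.
Proof. by rewrite wt_sqr powRr1// ltW// wt_base0. Qed.

Lemma wt_pow s k : wt s k = wt 1 k `^ s.
Proof. by rewrite /wt -powRrM; congr (_ `^ _); lra. Qed.

Lemma wt_opp s k : wt s (- k) = wt s k.
Proof. by rewrite /wt rmorphN sqrrN. Qed.

Lemma le_wt1 k : `|k%:~R : R| <= wt 1 k.
Proof.
rewrite -(@ler_pXn2r _ 2)//= ?nnegrE ?wt_ge0// wt1_sqr real_normK ?num_real//.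
by rewrite lerDr.
Qed.

Lemma wt1_add j k : wt 1 (j + k) <= wt 1 j + wt 1 k.
Proof.
rewrite -(@ler_pXn2r _ 2)//= ?nnegrE ?addr_ge0 ?wt_ge0//.
rewrite sqrrD !wt1_sqr rmorphD/= sqrrD.
have h : (j%:~R : R) * k%:~R <= wt 1 j * wt 1 k.
  apply: le_trans (ler_norm _) _; rewrite normrM.
  by apply: ler_pM; rewrite ?le_wt1.
rewrite -mulr_natr -[X in _ <= _ + X + _]mulr_natr; lra.
Qed.

Lemma wt_le_pow s j k C : 0 <= s -> 0 <= C -> wt 1 j <= C * wt 1 k ->
  wt s j <= C `^ s * wt s k.
Proof.
move=> s0 C0 h; rewrite !(wt_pow s) -powRM ?wt_ge0//.
by apply: ge0_ler_powR; rewrite ?nnegrE ?mulr_ge0 ?wt_ge0.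
Qed.

Lemma sumle_nat (f : nat -> R) C : (forall n, 0 <= f n) ->
  (forall n, \sum_(i < n) f i <= C) -> sumle f C.
Proof.
move=> f0 fC; apply/sumle_esum => //.
rewrite -nneseries_esumT => [|n]; last by rewrite lee_fin.
apply: lime_le; first by apply: is_cvg_nneseries => n _ _; rewrite lee_fin.
by apply: nearW => n; rewrite sumEFin lee_fin big_mkord.
Qed.

(** Comparison with a telescoping sum: for d = p - 1, d (n+2)^(-p) <= (n+1)^(-d) - (n+2)^(-d),
    because exp x >= 1 + x and ln((n+2)/(n+1)) >= 1/(n+2). *)
Lemma p_series_nat (p : R) : 1 < p -> exists C, sumle (fun n : nat => (n.+1%:R : R) `^ (- p)) C.
Proof.
move=> p1; pose d := p - 1; have d0 : 0 < d by rewrite subr_gt0.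
pose u n : R := (n.+1%:R) `^ (- d).
have key n : d * n.+2%:R `^ (- p) <= u n - u n.+1.
  rewrite /u; have n1 : 0 < (n.+1%:R : R) by []; have n2 : 0 < (n.+2%:R : R) by [].
  have -> : (n.+1%:R : R) `^ (- d) = n.+2%:R `^ (- d) * expR (d * (ln n.+2%:R - ln n.+1%:R)).
    rewrite /powR !gt_eqF// -expRD; congr expR; ring.
  have -> : (n.+2%:R : R) `^ (- p) = n.+2%:R `^ (- d) * n.+2%:R^-1.
    rewrite -powR_inv1// -powRD ?(gt_eqF n2) ?implybT//; congr (_ `^ _).
    by rewrite /d; ring.
  have h1 : n.+2%:R^-1 <= ln (n.+2%:R : R) - ln n.+1%:R.
    have := le_ln1Dx (x := - (n.+2%:R^-1 : R)).
    have -> : 1 + - (n.+2%:R^-1 : R) = n.+1%:R / n.+2%:R.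
      have e2 : (n.+2%:R : R) = n.+1%:R + 1 by rewrite -natr1.
      have n2' : (n.+2%:R : R) != 0 by rewrite gt_eqF.
      by apply: (mulIf n2'); rewrite mulrBl mulVf// divfK// mul1r e2 addrK.
    rewrite ln_div ?posrE// ltrN2 invf_lt1// ltr1n => /(_ isT).
    by rewrite -opprB lerN2 => ?.
  have h2 := expR_ge1Dx (d * (ln (n.+2%:R : R) - ln n.+1%:R)).
  have h3 : 0 <= (n.+2%:R : R) `^ (- d) by exact: powR_ge0.
  rewrite mulrCA -{3}[n.+2%:R `^ (- d)]mulr1 -mulrBr ler_wpM2l//.
  apply: le_trans (_ : d * (ln n.+2%:R - ln n.+1%:R) <= _); last by lra.
  by rewrite ler_pM2l.
exists (1 + d^-1); apply: sumle_nat => [n|n]; first exact: powR_ge0.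
case: n => [|n]; first by rewrite big_ord0 addr_ge0// invr_ge0 ltW.
rewrite big_ord_recl powR1 lerD2l.
rewrite -(ler_pM2l d0) divff ?gt_eqF// mulr_sumr.
apply: (@le_trans _ _ (\sum_(i < n) (u i - u i.+1))).
  by apply: ler_sum => i _; exact: key.
rewrite -(big_mkord xpredT (fun i => u i - u i.+1)).
rewrite (eq_bigr (fun i => - (u i.+1 - u i))) => [|i _]; last by rewrite opprB.
rewrite sumrN telescope_sumr// opprB /u powR1 lerBlDr lerDl; exact: powR_ge0.
Qed.

Lemma sumle_wt (p : R) : 1 < p -> exists C, sumle (wt (- p)) C.
Proof.
move=> p1; have [C hC] := p_series_nat p1.
(* Integers are coded by a sign and an absolute value; the factor 2^p comes from (|k| + 1)/2 <=
   [wt 1 k]. *)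
pose g (b : bool) (n : nat) : R := 2 `^ p * n.+1%:R `^ (- p).
pose h (k : int) := ((k < 0), `|k|%N).
have hi : injective h.
  move=> x y [e1 e2]; have := e1; case: x e1 e2 => x; case: y => y //= _ e2 _.
    by rewrite e2.
  by congr Negz; move: e2 => /= [].
exists (\sum_(b : bool) 2 `^ p * C).
have g0 b n : 0 <= g b n by rewrite mulr_ge0 ?powR_ge0.
have hg : sumle (fun q : bool * nat => g q.1 q.2) (\sum_(b : bool) 2 `^ p * C).
  apply: (@sumle_pair _ _ _ _ (fun=> 2 `^ p * C)) => //.
    by move=> b; apply: sumleZ hC; exact: powR_ge0.
  move=> s us; have C0 : 0 <= 2 `^ p * C by rewrite mulr_ge0 ?powR_ge0 ?(sumle_ge0 hC).
  rewrite big_bool /= -(big_map (fun _ : bool => tt) xpredT (fun _ => 2 `^ p * C)).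
  rewrite big_const_seq count_predT size_map.
  have : (size s <= 2)%N by rewrite (leq_trans (uniq_leq_size us (s2 := [:: true; false]) _))// => -[].
  by case: (size s) => [|[|[|]]]//= _; lra.
apply: (@sumle_mon _ _ _ ((fun q : bool * nat => g q.1 q.2) \o h)); last exact: sumle_inj hg.
  2: exact: lexx.
move=> k; rewrite /g /= wtN powRN.
have -> : (2 : R) `^ p * (`|k|.+1%:R `^ p)^-1 = ((`|k|%N.+1%:R / 2) `^ p)^-1.
  rewrite powRM ?invr_ge0// invfM mulrC; congr (_ * _).
  by rewrite -powR_inv1// -powRrM mulN1r powRN invrK.
rewrite lef_pV2 ?posrE ?wt_gt0 ?powR_gt0 ?divr_gt0// wt_pow.
apply: ge0_ler_powR; rewrite ?nnegrE ?wt_ge0 ?divr_ge0//; first lra.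
rewrite ler_pdivrMr// -natr1 natr_absz.
have := le_wt1 k; rewrite intr_norm; have := wt_ge1 k (ler01 : 0 <= 1 :> R); lra.
Qed.

End Weights.

(** * Young's inequality for bilinear and trilinear Fourier multipliers *)

Section Convolution.
Context {R : realType}.
Implicit Types (a b c : int -> R[i]) (s : R).

Definition Hw s : gnorm (R := R) int := Hn (wt s).
Definition Ww s : gnorm (R := R) int := Wn (wt s).

Lemma nb_Ww s a A : nb (Ww s) a A <-> sumle (fun i => wt s i * nC (a i)) A.
Proof. by apply: nb_W => i; exact: wt_ge0. Qed.

Lemma nb_Hw s a A : 0 <= A -> nb (Hw s) a A <-> sumle (fun i => (wt s i * nC (a i)) ^+ 2) (A ^+ 2).
Proof. by move=> A0; apply: nb_H => // i; exact: wt_ge0. Qed.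

Lemma nb_Ww_coef s a A k : nb (Ww s) a A -> wt s k * nC (a k) <= A.
Proof. by apply: nb_W_coef => i; exact: wt_ge0. Qed.
Lemma nb_Hw_coef s a A k : nb (Hw s) a A -> wt s k * nC (a k) <= A.
Proof. by apply: nb_H_coef => i; exact: wt_ge0. Qed.

Lemma nb_Ww0 a A : nb (Ww 0) a A <-> sumle (fun i => nC (a i)) A.
Proof.
rewrite nb_Ww (_ : (fun i => wt 0 i * nC (a i)) = fun i => nC (a i))//.
by apply/funext => i; rewrite wt0 mul1r.
Qed.

Lemma Ww_mono s s' a A : s <= s' -> nb (Ww s') a A -> nb (Ww s) a A.
Proof.
move=> ss; rewrite !nb_Ww; apply: sumle_mon => // i.
by rewrite ler_wpM2r ?nC_ge0// wt_mono.
Qed.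

Lemma Hw_mono s s' a A : s <= s' -> nb (Hw s') a A -> nb (Hw s) a A.
Proof.
move=> ss h; rewrite -[A]mul1r; apply: nb_H_mon h => // i; rewrite ?wt_ge0//.
by rewrite mul1r ler_wpM2r ?nC_ge0// wt_mono.
Qed.

(** Sobolev embedding: Cauchy-Schwarz against the weight of exponent s' - s, which is square
    summable because 2 (s - s') > 1. *)
Lemma Hw_Ww s s' : s' + 2^-1 < s -> exists2 K, 0 <= K & forall a A, nb (Hw s) a A -> nb (Ww s') a (K * A).
Proof.
move=> ss; have [|C hC] := @sumle_wt R ((s - s') * 2); first by lra.
have C0 := sumle_ge0 hC.
exists (Num.sqrt C) => // a A h; have A0 := nb_ge0 h.
move/(nb_Hw _ _ A0): h => h; apply/nb_Ww => t ut.
have S0 : 0 <= \sum_(i <- t) wt s' i * nC (a i).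
  by apply: sumr_ge0 => i _; rewrite mulr_ge0 ?wt_ge0 ?nC_ge0.
rewrite -ler_sqr ?nnegrE ?mulr_ge0 ?sqrtr_ge0// exprMn sqr_sqrtr//.
have -> : \sum_(i <- t) wt s' i * nC (a i) = \sum_(i <- t) wt (s' - s) i * (wt s i * nC (a i)).
  by apply: eq_bigr => i _; rewrite mulrA -wtD subrK.
apply: le_trans (CS_seq _ _ _) _; apply: ler_pM => //.
- by apply: sumr_ge0 => i _; rewrite sqr_ge0.
- by apply: sumr_ge0 => i _; rewrite sqr_ge0.
- apply: le_trans (hC _ ut); apply: ler_sum => i _.
  by rewrite expr2 -wtD; apply: wt_mono; lra.
- exact: h.
Qed.

(** A superposition, with coefficients [a j], of the sequences [G j] translated by j. Bilinear and
    trilinear sums both have this form, the latter with a bilinear sum as [G j]. *)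
Definition gc a (G : int -> int -> R[i]) k := csum (fun j => a j * G j (k - j)).

(** Minkowski's inequality; the norms of the translates may grow with j like w, since [a] is
    measured with this weight. *)
Lemma gc_nb (N : gnorm (R := R) int) a G A B (w : int -> R) :
  (forall i, 0 <= w i) -> 0 <= B ->
  (forall k, summ (fun j => a j * G j (k - j))) ->
  (forall j, nb N (fun k => G j (k - j)) (w j * B)) ->
  nb (Wn w) a A -> nb N (gc a G) (A * B).
Proof.
move=> w0 B0 sm hG /(nb_W _ _ w0) ha s th Nth; apply: csum_dual => //; first exact: gn_ge0 Nth.
have H j : \sum_(k <- s) th k * nC (a j * G j (k - j)) <= B * (w j * nC (a j)).
  have -> : \sum_(k <- s) th k * nC (a j * G j (k - j)) =
      nC (a j) * \sum_(k <- s) th k * nC (G j (k - j)).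
    by rewrite mulr_sumr; apply: eq_bigr => k _; rewrite nCM mulrCA.
  rewrite (_ : B * _ = nC (a j) * (w j * B)); last by ring.
  by apply: ler_wpM2l; [exact: nC_ge0|exact: hG].
by apply: (sumle_mon H (lexx _)); rewrite mulrC; exact: sumleZ.
Qed.

Lemma nb_Wn_shift (w : int -> R) a A j : (forall i, 0 <= w i) ->
  nb (Wn (fun l => w (j + l))) a A -> nb (Wn w) (fun k => a (k - j)) A.
Proof.
move=> w0 /(nb_W _ _ (fun l => w0 _)) ha; apply/nb_W => //.
have hi : injective (fun k : int => k - j) by move=> x y /addIr.
have := sumle_inj hi ha; apply: sumle_mon => // k /=.
by have -> : j + (k - j) = k by ring.
Qed.

Lemma nb_Hn_shift (w : int -> R) a A j : (forall i, 0 <= w i) ->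
  nb (Hn (fun l => w (j + l))) a A -> nb (Hn w) (fun k => a (k - j)) A.
Proof.
move=> w0 h; have A0 := nb_ge0 h; move/(nb_H _ A0 (fun l => w0 _)): h => ha; apply/nb_H => //.
have hi : injective (fun k : int => k - j) by move=> x y /addIr.
have := sumle_inj hi ha; apply: sumle_mon => // k /=.
by have -> : j + (k - j) = k by ring.
Qed.

(** The bilinear Fourier multiplier of symbol [m j l], where j + l = k is the output frequency. *)
Definition mc (m : int -> int -> R[i]) a b k := csum (fun j => m j (k - j) * a j * b (k - j)).

Lemma mcE m a b k : mc m a b k = gc a (fun j l => m j l * b l) k.
Proof. by apply: eq_csum => j; rewrite [m _ _ * _]mulrC mulrA. Qed.

Definition mc_summ m a b := forall k, summ (fun j => m j (k - j) * a j * b (k - j)).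

Lemma mc_comm m a b k : mc m a b k = mc (fun i j => m j i) b a k.
Proof.
have bh : bijective (fun j : int => k - j).
  by exists (fun j : int => k - j) => j; rewrite opprB addrC subrK.
rewrite /mc -(csum_reindex _ bh); apply: eq_csum => j /=.
by rewrite subKr mulrAC.
Qed.

Section McBounds.
Variables (m : int -> int -> R[i]) (w1 w2 w3 : int -> R) (C : R).
Hypotheses (C0 : 0 <= C) (w10 : forall i, 0 <= w1 i) (w20 : forall i, 0 <= w2 i)
  (w30 : forall i, 0 <= w3 i).
Hypothesis mw : forall j l, nC (m j l) * w3 (j + l) <= C * w1 j * w2 l.

(** The symbol inequality [mw] moves the output weight onto the inputs; what remains is Young's
    inequality, here l^1 with l^1 and in [mc_H] l^1 with l^2. *)
Lemma mc_W a b A B : mc_summ m a b ->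
  nb (Wn w1) a A -> nb (Wn w2) b B -> nb (Wn w3) (mc m a b) (C * A * B).
Proof.
move=> sm ha hb; rewrite (_ : C * A * B = A * (C * B)); last by ring.
apply: (nb_eq (fun k => esym (mcE m a b k))).
have B0 := nb_ge0 hb.
apply: (gc_nb w10) ha; first by rewrite mulr_ge0.
  move=> k; have := sm k; congr summ; apply/funext => j; ring.
move=> j; apply: (@nb_Wn_shift w3 (fun l => m j l * b l)) => //; rewrite mulrA.
apply: nb_W_mon hb => //; first by rewrite mulr_ge0.
move=> l; rewrite nCM mulrA; have := ler_wpM2r (nC_ge0 (b l)) (mw j l); lra.
Qed.

Lemma mc_H a b A B : mc_summ m a b ->
  nb (Wn w1) a A -> nb (Hn w2) b B -> nb (Hn w3) (mc m a b) (C * A * B).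
Proof.
move=> sm ha hb; rewrite (_ : C * A * B = A * (C * B)); last by ring.
apply: (nb_eq (fun k => esym (mcE m a b k))).
have B0 := nb_ge0 hb.
apply: (gc_nb w10) ha; first by rewrite mulr_ge0.
  move=> k; have := sm k; congr summ; apply/funext => j; ring.
move=> j; apply: (@nb_Hn_shift w3 (fun l => m j l * b l)) => //; rewrite mulrA.
apply: nb_H_mon hb => //; first by rewrite mulr_ge0.
move=> l; rewrite nCM mulrA; have := ler_wpM2r (nC_ge0 (b l)) (mw j l); lra.
Qed.

End McBounds.

Lemma mc_summ_bd m a b A B : nb (Ww 0) a A ->
  (forall j l, nC (m j l * b l) <= B) -> mc_summ m a b.
Proof.
move=> /nb_Ww0 ha hB k; apply: (@summ_le _ _ _ (fun j => B * nC (a j)) (B * A)).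
  move=> j; rewrite mulrAC nCM ler_wpM2r ?nC_ge0//.
apply: sumleZ ha; exact: le_trans (nC_ge0 _) (hB 0 0).
Qed.

Lemma mc_H2 m w1 w2 w3 C a b A B : 0 <= C -> (forall i, 0 <= w1 i) ->
  (forall i, 0 <= w2 i) -> (forall i, 0 <= w3 i) ->
  (forall j l, nC (m j l) * w3 (j + l) <= C * w1 j * w2 l) ->
  mc_summ (fun i j => m j i) b a ->
  nb (Hn w1) a A -> nb (Wn w2) b B -> nb (Hn w3) (mc m a b) (C * A * B).
Proof.
move=> C0 w10 w20 w30 mw sm ha hb; rewrite (mulrAC C).
apply: (nb_eq (fun k => esym (mc_comm m a b k))).
apply: (mc_H (m := fun i j => m j i) C0 w20 w10 w30 _ sm hb ha) => j l.
by rewrite addrC mulrAC.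
Qed.

Definition mc3 (m : int -> int -> int -> R[i]) a b c k :=
  csum (fun j => a j * mc (m j) b c (k - j)).

Lemma mc3E m a b c : mc3 m a b c = gc a (fun j => mc (m j) b c).
Proof. by []. Qed.

(** Two absolutely summable factors make the double sum converge; the third contributes a weighted
    supremum bound that pays for the growth of the symbol in its frequency. *)
Lemma mc3_summ m (w : int -> R) C a b c A B D :
  0 <= C -> (forall i, 0 <= w i) ->
  (forall j l n, nC (m j l n) <= C * w n) ->
  nb (Ww 0) a A -> nb (Ww 0) b B -> (forall n, w n * nC (c n) <= D) ->
  forall k, [/\ summ (fun p : int * int => a p.1 * (m p.1 p.2 (k - p.1 - p.2) * b p.2 * c (k - p.1 - p.2))),
    forall j, mc_summ (m j) b c & summ (fun j => a j * mc (m j) b c (k - j))].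
Proof.
move=> C0 w0 mC ha hb hc k.
have D0 : 0 <= D by apply: le_trans (hc 0); rewrite mulr_ge0 ?nC_ge0.
have bd j l n : nC (m j l n * c n) <= C * D.
  rewrite nCM; apply: le_trans (ler_wpM2r (nC_ge0 _) (mC j l n)) _.
  by rewrite -mulrA ler_wpM2l.
have sm j : mc_summ (m j) b c by exact: mc_summ_bd hb _.
have sp : summ (fun p : int * int => a p.1 * (m p.1 p.2 (k - p.1 - p.2) * b p.2 * c (k - p.1 - p.2))).
  exists (C * D * B * A).
  apply: (@sumle_mon _ _ _ (fun p => C * D * nC (b p.2) * nC (a p.1)) _ _ _ (lexx _)).
    move=> p; rewrite !nCM mulrC ler_wpM2r ?nC_ge0//.
    by rewrite mulrAC -nCM ler_wpM2r ?nC_ge0.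
  have := @sumle_pair R int int (fun i j => C * D * nC (b j) * nC (a i)) (fun i => nC (a i) * (C * D * B)).
  apply.
  - by move=> i j; rewrite !mulr_ge0 ?nC_ge0.
  - move=> i; have /nb_Ww0 hb' := hb; have := sumleZ (mulr_ge0 C0 D0) hb'.
    move/(sumleZ (nC_ge0 (a i))); apply: sumle_mon => // j; by rewrite mulrC.
  - have /nb_Ww0 ha' := ha; have B0 := nb_ge0 hb.
    have := sumleZ (mulr_ge0 (mulr_ge0 C0 D0) B0) ha'; apply: sumle_mon => // i.
    by rewrite mulrC.
split=> //.
have [_ h _] := csum_pair (F := fun j l => a j * (m j l (k - j - l) * b l * c (k - j - l))) sp.
by have := h; congr summ; apply/funext => j; rewrite -csumZ//; exact: sm.
Qed.

Lemma mc3_swap m (w : int -> R) C a b c A B D :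
  0 <= C -> (forall i, 0 <= w i) ->
  (forall j l n, nC (m j l n) <= C * w n) ->
  nb (Ww 0) a A -> nb (Ww 0) b B -> (forall n, w n * nC (c n) <= D) ->
  mc3 m a b c =1 mc3 (fun j l n => m l j n) b a c.
Proof.
move=> C0 w0 mC ha hb hc k.
have [sp sm sm'] := mc3_summ C0 w0 mC ha hb hc k.
have mC' j l n : nC (m l j n) <= C * w n by exact: mC.
have [_ smb _] := mc3_summ (m := fun j l n => m l j n) C0 w0 mC' hb ha hc k.
rewrite /mc3.
transitivity (csum (fun j => csum (fun l => a j * (m j l (k - j - l) * b l * c (k - j - l))))).
  by apply: eq_csum => j; rewrite csumZ//; exact: sm.
rewrite (csum_swap (F := fun j l => a j * (m j l (k - j - l) * b l * c (k - j - l))) sp).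
apply: eq_csum => l; rewrite -csumZ; last exact: smb.
apply: eq_csum => j; rewrite (addrAC k); ring.
Qed.

Section Mc3Bounds.
Variables (m : int -> int -> int -> R[i]) (w1 w2 w3 w4 : int -> R) (C : R).
Hypotheses (C0 : 0 <= C) (w10 : forall i, 0 <= w1 i) (w20 : forall i, 0 <= w2 i)
  (w30 : forall i, 0 <= w3 i) (w40 : forall i, 0 <= w4 i).
Hypothesis mw : forall j l n, nC (m j l n) * w4 (j + l + n) <= C * w1 j * w2 l * w3 n.
Variables (w : int -> R) (C' : R) (a b c : int -> R[i]) (A' B' D' A B D : R).
Hypotheses (C'0 : 0 <= C') (w0 : forall i, 0 <= w i)
  (mC : forall j l n, nC (m j l n) <= C' * w n)
  (ha' : nb (Ww 0) a A') (hb' : nb (Ww 0) b B') (hc' : forall n, w n * nC (c n) <= D').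

Let mwj j l n : nC (m j l n) * w4 (j + (l + n)) <= C * w1 j * w2 l * w3 n.
Proof. by rewrite addrA. Qed.

(** The primed bounds ensure that the sums converge; the estimate itself rests on the unprimed ones
    and on [mw]. The variants [mc3_Hc], [mc3_Hb] and [mc3_Ha] differ in the factor that takes the
    l^2 norm. *)
Lemma mc3_Hc : nb (Wn w1) a A -> nb (Wn w2) b B -> nb (Hn w3) c D ->
  nb (Hn w4) (mc3 m a b c) (C * A * B * D).
Proof.
move=> ha hb hc; rewrite mc3E (_ : _ * D = A * (C * B * D)); last by ring.
have B0 := nb_ge0 hb; have D0 := nb_ge0 hc.
apply: (gc_nb w10) ha; first by rewrite !mulr_ge0.
  by move=> k; have [] := mc3_summ C'0 w0 mC ha' hb' hc' k.
move=> j; apply: nb_Hn_shift => //.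
rewrite (_ : w1 j * _ = C * w1 j * B * D); last by ring.
apply: (mc_H (m := m j) _ w20 w30 _ (mwj j)) hb hc; rewrite ?mulr_ge0//.
by have [_ + _] := mc3_summ C'0 w0 mC ha' hb' hc' 0; apply.
Qed.

Lemma mc3_Hb : nb (Wn w1) a A -> nb (Hn w2) b B -> nb (Wn w3) c D ->
  nb (Hn w4) (mc3 m a b c) (C * A * B * D).
Proof.
move=> ha hb hc; rewrite mc3E (_ : _ * D = A * (C * B * D)); last by ring.
have B0 := nb_ge0 hb; have D0 := nb_ge0 hc.
apply: (gc_nb w10) ha; first by rewrite !mulr_ge0.
  by move=> k; have [] := mc3_summ C'0 w0 mC ha' hb' hc' k.
move=> j; apply: nb_Hn_shift => //.
rewrite (_ : w1 j * _ = C * w1 j * B * D); last by ring.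
apply: (mc_H2 (m := m j) _ w20 w30 _ (mwj j)) hb hc; rewrite ?mulr_ge0//.
have [_ + _] := mc3_summ C'0 w0 mC ha' hb' hc' 0 => /(_ j) sm k.
have bh : bijective (fun j : int => k - j).
  by exists (fun j : int => k - j) => i; rewrite opprB addrC subrK.
have [K hK] := sm k; exists K.
have := sumle_inj (bij_inj bh) hK; apply: sumle_mon => // i /=.
by rewrite subKr mulrAC.
Qed.

End Mc3Bounds.

Lemma mc3_Ha m w1 w2 w3 w4 C w C' a b c A' B' D' A B D : 0 <= C ->
  (forall i, 0 <= w1 i) -> (forall i, 0 <= w2 i) -> (forall i, 0 <= w3 i) -> (forall i, 0 <= w4 i) ->
  (forall j l n, nC (m j l n) * w4 (j + l + n) <= C * w1 j * w2 l * w3 n) ->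
  0 <= C' -> (forall i, 0 <= w i) -> (forall j l n, nC (m j l n) <= C' * w n) ->
  nb (Ww 0) a A' -> nb (Ww 0) b B' -> (forall n, w n * nC (c n) <= D') ->
  nb (Hn w1) a A -> nb (Wn w2) b B -> nb (Wn w3) c D ->
  nb (Hn w4) (mc3 m a b c) (C * A * B * D).
Proof.
move=> C0 w10 w20 w30 w40 mw C'0 w0 mC ha' hb' hc' ha hb hc.
apply: (nb_eq (fun k => esym (mc3_swap C'0 w0 mC ha' hb' hc' k))).
rewrite (mulrAC C).
apply: (mc3_Hb (m := fun j l n => m l j n) C0 w20 w10 w30 w40 _ C'0 w0 _ hb' ha' hc' hb ha hc).
  by move=> j l n; rewrite (addrC j) (mulrAC C).
by move=> j l n; exact: mC.
Qed.

End Convolution.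

(** * Complex integrals *)

Section ComplexIntegral.
Context {R : realType}.
Implicit Types (a b t : R) (f g : R -> R[i]).
Notation mu := (@lebesgue_measure R).

Definition cable a b f :=
  mu.-integrable `[a, b] (EFin \o (fun x => complex.Re (f x))) /\
  mu.-integrable `[a, b] (EFin \o (fun x => complex.Im (f x))).

Lemma cint_eq a b f g : (forall x, a <= x <= b -> f x = g x) ->
  cintegral a b f = cintegral a b g.
Proof.
move=> fg; rewrite /cintegral; congr (_ +i* _); apply: eq_Rintegral => x;
  by rewrite inE/= in_itv/= => /fg ->.
Qed.

Lemma cable_eq a b f g : (forall x, a <= x <= b -> f x = g x) ->
  cable a b f -> cable a b g.
Proof.
move=> fg [h1 h2]; split; [move: h1|move: h2]; apply: eq_integrable => // x;
  by rewrite inE/= in_itv/= => /fg ->.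
Qed.

Lemma cableD a b f g : cable a b f -> cable a b g -> cable a b (fun x => f x + g x).
Proof.
move=> [f1 f2] [g1 g2]; split.
  have := integrableD _ f1 g1 => /(_ (measurable_itv _)); apply: eq_integrable => // x _ /=.
  by rewrite cReD EFinD.
have := integrableD _ f2 g2 => /(_ (measurable_itv _)); apply: eq_integrable => // x _ /=.
by rewrite cImD EFinD.
Qed.

Lemma cintD a b f g : cable a b f -> cable a b g ->
  cintegral a b (fun x => f x + g x) = cintegral a b f + cintegral a b g.
Proof.
move=> [f1 f2] [g1 g2]; apply: complex_ext; rewrite ?cReD ?cImD /=.
  rewrite -RintegralD//; apply: eq_Rintegral => x _; exact: cReD.
rewrite -RintegralD//; apply: eq_Rintegral => x _; exact: cImD.
Qed.

Lemma RableZ a b (h : R -> R) r : mu.-integrable `[a, b] (EFin \o h) ->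
  mu.-integrable `[a, b] (EFin \o (fun x => r * h x)).
Proof.
move=> ih; have := integrableZl _ r ih => /(_ (measurable_itv _)); by apply: eq_integrable.
Qed.

Lemma cableZ a b f k : cable a b f -> cable a b (fun x => k * f x).
Proof.
move=> [f1 f2]; split.
  have := integrableB _ (RableZ (complex.Re k) f1) (RableZ (complex.Im k) f2) => /(_ (measurable_itv _)).
  by apply: eq_integrable => // x _ /=; rewrite cReM EFinB.
have := integrableD _ (RableZ (complex.Re k) f2) (RableZ (complex.Im k) f1) => /(_ (measurable_itv _)).
by apply: eq_integrable => // x _ /=; rewrite cImM EFinD.
Qed.

Lemma cintZ a b f k : cable a b f ->
  cintegral a b (fun x => k * f x) = k * cintegral a b f.
Proof.
move=> [f1 f2]; apply: complex_ext; rewrite ?cReM ?cImM /= -!RintegralZl//.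
  rewrite -RintegralB//; try exact: RableZ.
  by apply: eq_Rintegral => x _; rewrite cReM.
rewrite -RintegralD//; try exact: RableZ.
by apply: eq_Rintegral => x _; rewrite cImM.
Qed.

Lemma cableN a b f : cable a b f -> cable a b (fun x => - f x).
Proof. by move/(cableZ (-1)); apply: cable_eq => // x _; rewrite mulN1r. Qed.

Lemma cintN a b f : cable a b f -> cintegral a b (fun x => - f x) = - cintegral a b f.
Proof.
by move=> cf; rewrite -mulN1r -cintZ//; apply: cint_eq => x _; rewrite mulN1r.
Qed.

Lemma cableB a b f g : cable a b f -> cable a b g -> cable a b (fun x => f x - g x).
Proof. by move=> cf cg; apply: cableD => //; exact: cableN. Qed.

Lemma cintB a b f g : cable a b f -> cable a b g ->
  cintegral a b (fun x => f x - g x) = cintegral a b f - cintegral a b g.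
Proof. by move=> cf cg; rewrite cintD ?cintN//; exact: cableN. Qed.

Lemma cable_sum a b (T : Type) (s : seq T) (F : T -> R -> R[i]) :
  (forall i, cable a b (F i)) ->
  cable a b (fun x => \sum_(i <- s) F i x) /\
  cintegral a b (fun x => \sum_(i <- s) F i x) = \sum_(i <- s) cintegral a b (F i).
Proof.
move=> cF; have c0 : cable a b (fun=> 0) by split; exact: integrable0.
elim: s => [|i s [IH1 IH2]].
  split; first by move: c0; apply: cable_eq => // x _; rewrite big_nil.
  rewrite big_nil -[RHS](mul0r (cintegral a b (fun=> 0))) -cintZ//.
  by apply: cint_eq => x _; rewrite big_nil mul0r.
split.
  by have := cableD (cF i) IH1; apply: cable_eq => // x _; rewrite big_cons.
by rewrite big_cons -IH2 -cintD//; apply: cint_eq => x _; rewrite big_cons.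
Qed.

Lemma lebesgue_itv_cc a b : a <= b -> fine (mu `[a, b]%classic) = b - a.
Proof.
rewrite le_eqVlt => /predU1P[->|ab]; first by rewrite set_itv1 lebesgue_measure_set1 subrr.
by rewrite lebesgue_measure_itv/= lte_fin ab.
Qed.

Lemma cable_cst a b k : cable a b (fun=> k).
Proof.
by split; apply: continuous_compact_integrable; try exact: segment_compact;
  move=> ?; exact: cvg_cst.
Qed.

Lemma cint_cst a b k : a <= b -> cintegral a b (fun=> k) = (b - a)%:C * k.
Proof.
move=> ab; apply: complex_ext; rewrite /= Rintegral_cst// lebesgue_itv_cc//.
  by rewrite cReM /= mul0r subr0 mulrC.
by rewrite cImM /= mul0r addr0 mulrC.
Qed.

Lemma cint_le a b f M : a <= b -> cable a b f ->
  (forall x, a <= x <= b -> nC (f x) <= M) -> nC (cintegral a b f) <= M * (b - a).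
Proof.
move=> ab cf fM; have [w w1 wE] := nC_unimod (cintegral a b f).
have -> : nC (cintegral a b f) = complex.Re (w * cintegral a b f) by rewrite wE.
rewrite -cintZ//= -lebesgue_itv_cc// -Rintegral_cst//.
apply: le_Rintegral => //; first by have [] := cableZ w cf.
  by have [] := cable_cst a b M%:C.
move=> x; rewrite /= in_itv/= => /fM; apply: le_trans.
by apply: le_trans (ler_norm _) _; apply: le_trans (Re_le _) _; rewrite nCM w1 mul1r.
Qed.

Lemma ccont_within a b f : ccont a b f ->
  {within `[a, b], continuous (fun x => complex.Re (f x))} /\
  {within `[a, b], continuous (fun x => complex.Im (f x))}.
Proof.
move=> cf; split; apply/subspace_continuousP => x; rewrite /= in_itv/= => xab;
  apply/cvgrPdist_le => e e0; have [d d0 Hd] := cf x xab e e0;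
  near=> t; rewrite distrC.
- rewrite -cReN -cReD; apply: le_trans (Re_le _) _; apply: Hd.
    near: t; rewrite near_withinE; apply: nearW => t; by rewrite /= in_itv.
  near: t; apply: cvg_within; exists d => //= t; by rewrite /ball_ /= distrC.
- rewrite -cImN -cImD; apply: le_trans (Im_le _) _; apply: Hd.
    near: t; rewrite near_withinE; apply: nearW => t; by rewrite /= in_itv.
  near: t; apply: cvg_within; exists d => //= t; by rewrite /ball_ /= distrC.
Unshelve. all: by end_near.
Qed.

Lemma ccont_cable a b f : ccont a b f -> cable a b f.
Proof.
move=> /ccont_within[h1 h2]; split; apply: continuous_compact_integrable => //;
  exact: segment_compact.
Qed.

Lemma cable_sub a b c d f : a <= c -> d <= b -> cable a b f -> cable c d f.
Proof.
move=> ac db [f1 f2]; have S : `[c, d]%classic `<=` `[a, b]%classic.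
  move=> x; rewrite /= !in_itv/= => /andP[cx xd].
  by rewrite (le_trans ac cx) (le_trans xd db).
by split; [apply: integrableS f1|apply: integrableS f2].
Qed.

Lemma cint_split a b c f : a <= c <= b -> cable a b f ->
  cintegral a b f = cintegral a c f + cintegral c b f.
Proof.
move=> /andP[ac cb] [f1 f2].
have key (h : R -> R) : mu.-integrable `[a, b] (EFin \o h) ->
    \int[mu]_(x in `[a, b]) h x = \int[mu]_(x in `[a, c]) h x + \int[mu]_(x in `[c, b]) h x.
  move=> ih.
  have := @Rintegral_itvB R h (BLeft a) (BRight b) c ih.
  rewrite !bnd_simp => /(_ ac cb) e.
  rewrite -(@Rintegral_itv_obnd_cbnd R c (BRight b)) -?e; first by rewrite addrC subrK.
  apply: integrableS ih => //.
  by apply: subset_itvr; rewrite bnd_simp.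
by apply: complex_ext; rewrite ?cReD ?cImD /= -key.
Qed.

Lemma cint_primitive a b f : ccont a b f ->
  cder a b (fun t => cintegral a t f) f.
Proof.
move=> cf x xab e e0; have [d d0 Hd] := cf x xab e e0; exists d => // t tab tx.
have cab := ccont_cable cf.
have key lo hi : a <= lo -> lo <= hi -> hi <= b ->
    cintegral a hi f - cintegral a lo f = cintegral lo hi f.
  move=> h1 h2 h3; rewrite (@cint_split a hi lo) ?h1 ?h2//; first by rewrite addrC addKr.
  exact: cable_sub cab.
case/andP: xab => ax xb; case/andP: tab => at_ tb.
case: (leP x t) => xt.
  rewrite key// -cint_cst// -cintB; [|exact: cable_sub cab|exact: cable_cst].
  rewrite ger0_norm ?subr_ge0//; apply: cint_le => //.
    by apply: cableB; [exact: cable_sub cab|exact: cable_cst].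
  move=> r /andP[r1 r2]; apply: Hd; first by rewrite (le_trans ax r1) (le_trans r2 tb).
  rewrite ger0_norm ?subr_ge0//; apply: le_lt_trans tx; rewrite ger0_norm ?subr_ge0//; lra.
have -> : cintegral a t f - cintegral a x f - (t - x)%:C * f x =
    - (cintegral a x f - cintegral a t f - (x - t)%:C * f x).
  by rewrite !rmorphB; ring.
rewrite nCN key ?(ltW xt)//.
rewrite -cint_cst ?(ltW xt)// -cintB; [|by apply: cable_sub cab|exact: cable_cst].
rewrite distrC ger0_norm ?subr_ge0 ?(ltW xt)//; apply: cint_le => //; first exact: ltW.
  by apply: cableB; [exact: cable_sub cab|exact: cable_cst].
move=> r /andP[r1 r2]; apply: Hd; first by rewrite (le_trans at_ r1) (le_trans r2 xb).
rewrite distrC ger0_norm ?subr_ge0//; apply: le_lt_trans tx.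
rewrite distrC ger0_norm ?subr_ge0 ?(ltW xt)//; lra.
Qed.

Lemma cder0_cst a b f : a <= b -> cder a b f (fun=> 0) -> f b = f a.
Proof.
move=> ab df; apply/eqP; rewrite -subr_eq0; apply/eqP/nC_eq0/eqP.
rewrite eq_le nC_ge0 andbT -[leRHS](mul0r (b - a)).
by apply: (nC_mvt ab df) => t _; rewrite nC0.
Qed.

Lemma cint_FTC a b f f' : a <= b -> cder a b f f' -> ccont a b f' ->
  cintegral a b f' = f b - f a.
Proof.
move=> ab df cf.
have := cderB (cint_primitive cf) df.
move/(cder_eq (f' := fun t => f' t - f' t) (g' := fun=> 0) (fun _ _ => erefl)).
move=> /(_ (fun t _ => subrr (f' t)))/(cder0_cst ab).
have -> : cintegral a a f' = 0.
  have : nC (cintegral a a f') <= nC (f' a) * (a - a).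
    apply: cint_le => //; first by apply: cable_sub (ccont_cable cf).
    by move=> x /le_anti <-.
  rewrite subrr mulr0 => h; apply: nC_eq0; apply/eqP; by rewrite eq_le h nC_ge0.
rewrite sub0r => /eqP; rewrite subr_eq => /eqP ->; by rewrite addrC.
Qed.

Lemma ccontD a b f g : ccont a b f -> ccont a b g -> ccont a b (fun x => f x + g x).
Proof.
move=> Hf Hg x xab e e0; have e20 : 0 < e / 2 by rewrite divr_gt0.
have [d d0 Hd] := Hf x xab _ e20; have [d' d'0 Hd'] := Hg x xab _ e20.
exists (Num.min d d'); first by rewrite lt_min d0.
move=> t tab; rewrite lt_min => /andP[/(Hd t tab) h1 /(Hd' t tab) h2].
rewrite (_ : f t + g t - (f x + g x) = (f t - f x) + (g t - g x)); last by ring.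
by apply: le_trans (nCD _ _) _; lra.
Qed.

Lemma ccontM a b f g : ccont a b f -> ccont a b g -> ccont a b (fun x => f x * g x).
Proof.
move=> Hf Hg x xab e e0.
have m0 : 0 <= nC (g x) + nC (f x) + 1 by rewrite !addr_ge0 ?nC_ge0.
have [e1 e10 he] := ler_eps_div e0 m0.
have e20 : 0 < Num.min e1 1 by rewrite lt_min e10 ltr01.
have [d d0 Hd] := Hf x xab _ e20; have [d' d'0 Hd'] := Hg x xab _ e10.
exists (Num.min d d'); first by rewrite lt_min d0.
move=> t tab; rewrite lt_min => /andP[/(Hd t tab) h1 /(Hd' t tab) h2].
have {}h1 : nC (f t - f x) <= e1 /\ nC (f t - f x) <= 1.
  by move: h1; rewrite le_min => /andP[].
case: h1 => h1 h1'.
rewrite (_ : f t * g t - f x * g x =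
  (f t - f x) * g x + f x * (g t - g x) + (f t - f x) * (g t - g x)); last by ring.
apply: le_trans (nCD _ _) _; apply: le_trans (lerD (nCD _ _) (lexx _)) _.
rewrite !nCM; apply: le_trans he; rewrite !mulrDr; apply: lerD; first apply: lerD.
- by rewrite ler_wpM2r ?nC_ge0.
- by rewrite mulrC ler_wpM2r ?nC_ge0.
- by rewrite mulrC; apply: ler_pM; rewrite ?nC_ge0.
Qed.

Lemma ccont_cst a b k : ccont a b (fun=> k).
Proof. exact: cder_ccont (@cder_cst R a b k). Qed.

Lemma ccont_sum a b (T : Type) (s : seq T) (F : T -> R -> R[i]) :
  (forall i, ccont a b (F i)) -> ccont a b (fun x => \sum_(i <- s) F i x).
Proof.
move=> cF; elim: s => [|i s IH].
  by have := @ccont_cst a b 0; apply: ccont_eq => t _; rewrite big_nil.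
by have := ccontD (cF i) IH; apply: ccont_eq => t _; rewrite big_cons.
Qed.

Section SeriesIntegral.
Variables (I : choiceType) (a b : R) (F : I -> R -> R[i]) (c : I -> R) (C : R).
Hypotheses (ab : a <= b) (cF : forall i, ccont a b (F i))
  (Fc : forall i x, a <= x <= b -> nC (F i x) <= c i) (cC : sumle c C).

Let c0 i : 0 <= c i.
Proof. by apply: le_trans (nC_ge0 _) (Fc i (x := a) _); rewrite lexx. Qed.

Let sF x : a <= x <= b -> summ (F ^~ x).
Proof. by move=> xab; exists C; apply: sumle_mon cC => // i; exact: Fc. Qed.

Let approx e : 0 < e -> exists2 s : seq I, uniq s &
  sumle (fun i => if i \in s then 0 else c i) e.
Proof.
move=> e0; have cC' : sumle (fun i => nC ((c i)%:C : R[i])) C.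
  by apply: sumle_mon cC => // i; rewrite nC_real ger0_norm.
have [s us hs] := csum_approx cC' e0; exists s => //.
apply: sumle_mon hs => // i; case: ifP => // _; by rewrite nC_real ger0_norm.
Qed.

Lemma csum_split (f : I -> R[i]) (s : seq I) : uniq s -> summ f ->
  csum f = \sum_(i <- s) f i + csum (fun i => if i \in s then 0 else f i).
Proof.
move=> us sf.
have s1 i : summ (fun j => if j == i then f j else 0).
  case: sf => K hK; exists K; apply: sumle_mon hK => // j; case: ifP => //.
  by rewrite nC0 nC_ge0.
have [h1 h2] := csum_sum s s1.
have s2 : summ (fun i => if i \in s then 0 else f i).
  case: sf => K hK; exists K; apply: sumle_mon hK => // j; case: ifP => //.
  by rewrite nC0 nC_ge0.
have -> : \sum_(i <- s) f i = csum (fun j => \sum_(i <- s) if j == i then f j else 0).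
  rewrite h2; apply: eq_bigr => i _; rewrite (csum_single (i := i)) ?eqxx//.
  by move=> j /negbTE ->.
rewrite -csumD//; apply: eq_csum => j; case: ifPn => js.
  rewrite (bigD1_seq j)//= eqxx big1 ?addr0// => i; rewrite eq_sym => /negbTE ->//.
rewrite big1_seq ?add0r// => i /andP[_ is_]; case: eqP => // ji.
by rewrite ji is_ in js.
Qed.

Let tail s e x : a <= x <= b -> uniq s -> sumle (fun i => if i \in s then 0 else c i) e ->
  nC (csum (F ^~ x) - \sum_(i <- s) F i x) <= e.
Proof.
move=> xab us hs; rewrite (csum_split us (sF xab)) addrC addKr.
apply: csum_le; apply: sumle_mon hs => // i; case: ifP => // _; [by rewrite nC0|exact: Fc].
Qed.

(** Weierstrass test: a finite partial sum is within e/3 uniformly in x. *)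
Lemma ccont_csum : ccont a b (fun x => csum (F ^~ x)).
Proof.
move=> x xab e e0; have e3 : 0 < e / 3 by rewrite divr_gt0.
have [s us hs] := approx e3.
have [d d0 Hd] := ccont_sum s cF xab e3; exists d => // t tab tx.
have h1 := tail xab us hs; have h2 := tail tab us hs; have h3 := Hd t tab tx.
set A := csum _ in h2 *; set B := csum _ in h1 *.
rewrite nCC in h1.
rewrite (_ : A - B = (A - \sum_(i <- s) F i t) + (\sum_(i <- s) F i t - \sum_(i <- s) F i x)
  + (\sum_(i <- s) F i x - B)); last by ring.
apply: le_trans (nCD _ _) _; apply: le_trans (lerD (nCD _ _) (lexx _)) _; lra.
Qed.

(** Both sides are approximated by the same finite sum of integrals, with errors proportional to b -
    a. *)
Lemma cint_csum : cintegral a b (fun x => csum (F ^~ x)) = csum (fun i => cintegral a b (F i)) /\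
  summ (fun i => cintegral a b (F i)).
Proof.
have bi i : nC (cintegral a b (F i)) <= c i * (b - a).
  by apply: cint_le => //; [exact: ccont_cable|exact: Fc].
have ba : 0 <= b - a by rewrite subr_ge0.
have sm : summ (fun i => cintegral a b (F i)).
  exists ((b - a) * C); apply: sumle_mon (sumleZ ba cC) => // i; rewrite mulrC; exact: bi.
split=> //.
apply/eqP; rewrite -subr_eq0; apply/eqP/nC_eq0/eqP; rewrite eq_le nC_ge0 andbT.
apply/ler_addgt0Pr => e e0; rewrite add0r.
have m0 : 0 <= 2 * (b - a) by rewrite mulr_ge0.
have [e' e'0 he] := ler_eps_div e0 m0.
have [s us hs] := approx e'0.
have h1 : nC (cintegral a b (fun x => csum (F ^~ x)) - \sum_(i <- s) cintegral a b (F i)) <= e' * (b - a).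
  have [k1 k2] := cable_sum s (fun i => ccont_cable (cF i)).
  rewrite -k2 -cintB//; last exact: ccont_cable ccont_csum.
  apply: cint_le => //; first by apply: cableB => //; exact: ccont_cable ccont_csum.
  by move=> x xab; exact: tail.
have h2 : nC (csum (fun i => cintegral a b (F i)) - \sum_(i <- s) cintegral a b (F i)) <= e' * (b - a).
  rewrite (csum_split us sm) addrC addKr; apply: csum_le.
  rewrite mulrC; apply: sumle_mon (sumleZ ba hs) => // i; case: ifP => _.
    by rewrite nC0 mulr0.
  by rewrite mulrC; exact: bi.
rewrite nCC in h2.
set A := cintegral _ _ _ in h1 *; set B := csum _ in h2 *.
rewrite (_ : A - B = (A - \sum_(i <- s) cintegral a b (F i)) + (\sum_(i <- s) cintegral a b (F i) - B)); last by ring.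
apply: le_trans (nCD _ _) _; apply: le_trans he; lra.
Qed.

End SeriesIntegral.

End ComplexIntegral.

(** * Fourier series *)

Section Synthesis.
Context {R : realType}.
Implicit Types (a b : int -> R[i]) (j k : int) (x y : R).

Definition ek k x : R[i] := cos (k%:~R * x) +i* sin (k%:~R * x).

Lemma ekD j k x : ek (j + k) x = ek j x * ek k x.
Proof.
rewrite /ek rmorphD/= mulrDl cosD sinD; apply: complex_ext; rewrite ?cReM ?cImM /=; ring.
Qed.

Lemma ek_addx k x y : ek k (x + y) = ek k x * ek k y.
Proof.
rewrite /ek mulrDr cosD sinD; apply: complex_ext; rewrite ?cReM ?cImM /=; ring.
Qed.

Lemma ek0 x : ek 0 x = 1.
Proof. by rewrite /ek mul0r cos0 sin0. Qed.

Lemma ek_x0 k : ek k 0 = 1.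
Proof. by rewrite /ek mulr0 cos0 sin0. Qed.

Lemma nC_cis (t : R) : nC (cos t +i* sin t : R[i]) = 1.
Proof. by rewrite /Normc.normc cos2Dsin2 sqrtr1. Qed.

Lemma nC_ek k x : nC (ek k x) = 1.
Proof. exact: nC_cis. Qed.

Lemma ekNc k x : ek (- k) x = cos (k%:~R * x) -i* sin (k%:~R * x).
Proof. by rewrite /ek rmorphN/= mulNr cosN sinN. Qed.

Lemma cder_cis (th lo hi : R) : cder lo hi (fun t => cos (th * t) +i* sin (th * t) : R[i])
  (fun t => (0 +i* th) * (cos (th * t) +i* sin (th * t))).
Proof.
have dl (x : R) : is_derive x 1 (fun t : R => th * t) th.
  have := @is_deriveZ R R R id th x 1 1 (is_derive_id x 1).
  by rewrite /GRing.scale/= mulr1.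
apply: rder_cder => x _ /=; apply: is_derive_rderat.
  have h := is_derive1_comp (f := cos) (g := fun t => th * t) (is_derive_cos _) (dl x).
  apply: is_derive_eq h _; rewrite mul0r sub0r; rewrite /GRing.scale/=; ring.
have h := is_derive1_comp (f := sin) (g := fun t => th * t) (is_derive_sin _) (dl x).
apply: is_derive_eq h _; rewrite mul0r add0r; rewrite /GRing.scale/=; ring.
Qed.

Lemma cder_ek k (lo hi : R) : cder lo hi (ek k) (fun x => (0 +i* k%:~R) * ek k x).
Proof. exact: cder_cis. Qed.

Lemma ccont_ek k (lo hi : R) : ccont lo hi (ek k).
Proof. exact: cder_ccont (@cder_ek k lo hi). Qed.

Lemma sin_intpi k : sin (k%:~R * pi) = 0 :> R.
Proof.
have h (n : nat) : sin (n%:R * pi) = 0 :> R.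
  elim: n => [|n IH]; first by rewrite mul0r sin0.
  by rewrite -natr1 mulrDl mul1r sinDpi IH oppr0.
case: k => n; first by rewrite -[_%:~R]/(n%:R) h.
by rewrite NegzE mulrNz mulNr sinN h oppr0.
Qed.

Lemma cos_int2pi k : cos (k%:~R * (pi *+ 2)) = 1 :> R.
Proof.
have -> : k%:~R * (pi *+ 2) = (k%:~R * pi) *+ 2 :> R by rewrite mulrnAr.
by rewrite cos_mulr2n cos2sin2 sin_intpi expr0n /= subr0; lra.
Qed.

Lemma ek_period k : ek k (pi *+ 2) = 1.
Proof.
rewrite /ek cos_int2pi (_ : k%:~R * (pi *+ 2) = (k *+ 2)%:~R * pi :> R) ?sin_intpi//.
by rewrite rmorphMn mulrnAr mulrnAl.
Qed.

Lemma ek_periodic k : periodic (ek k) (pi *+ 2).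
Proof. by move=> x; rewrite /= ek_addx ek_period mulr1. Qed.

Lemma ek_pi k : ek k pi = ek k (- pi).
Proof. by rewrite -(ek_periodic k (- pi)); congr ek; rewrite mulr2n addKr. Qed.

Lemma pi2_gt0 : 0 < (pi *+ 2 : R).
Proof. by rewrite pmulrn_lgt0// pi_gt0. Qed.

Lemma Npi_le_pi : - pi <= pi :> R.
Proof. by have := pi_gt0 R; lra. Qed.

Lemma pi_len : pi - - pi = pi *+ 2 :> R.
Proof. by rewrite opprK mulr2n. Qed.

Definition table (f : R -> R[i]) := cable (- pi) pi f.

Lemma tint_eq f g : (forall x : R, - pi <= x <= pi -> f x = g x) -> tintegral f = tintegral g.
Proof. by move=> fg; rewrite /tintegral (cint_eq fg). Qed.

Lemma tintB f g : table f -> table g ->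
  tintegral (fun x : R => f x - g x) = tintegral f - tintegral g.
Proof. by move=> cf cg; rewrite /tintegral cintB// mulrBr. Qed.

Lemma tintZ f (k : R[i]) : table f -> tintegral (fun x : R => k * f x) = k * tintegral f.
Proof. by move=> cf; rewrite /tintegral cintZ// mulrCA. Qed.

Lemma tint_cst (k : R[i]) : tintegral (fun _ : R => k) = k.
Proof.
rewrite /tintegral cint_cst ?Npi_le_pi// pi_len mulrA -rmorphM mulVf ?mul1r//.
by rewrite gt_eqF// pi2_gt0.
Qed.

Lemma tint_le f M : table f -> (forall x : R, - pi <= x <= pi -> nC (f x) <= M) ->
  nC (tintegral f) <= M.
Proof.
move=> cf fM; rewrite /tintegral nCM nC_real ger0_norm; last by rewrite invr_ge0 ltW// pi2_gt0.
rewrite ler_pdivrMl ?pi2_gt0// mulrC -pi_len; apply: cint_le => //.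
exact: Npi_le_pi.
Qed.

Lemma tint_ek k : tintegral (ek k) = if k == 0 then 1 else 0 :> R[i].
Proof.
case: eqP => [->|/eqP k0].
  by rewrite -[RHS](tint_cst 1); apply: tint_eq => x _; rewrite ek0.
have h : cintegral (- pi) pi (fun x : R => (0 +i* k%:~R) * ek k x) = 0.
  rewrite (cint_FTC Npi_le_pi (@cder_ek k _ _)).
    by rewrite ek_pi subrr.
  by apply: ccontM; [exact: ccont_cst|exact: ccont_ek].
move: h; rewrite cintZ; last exact: ccont_cable (@ccont_ek _ _ _).
move/eqP; rewrite mulf_eq0 => /orP[|/eqP h]; last by rewrite /tintegral h mulr0.
by rewrite eq_complex /= eqxx/= intr_eq0 (negbTE k0).
Qed.

Definition Ss a x : R[i] := csum (fun k => a k * ek k x).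

Lemma Ss_summ a x : summ a -> summ (fun k => a k * ek k x).
Proof. by move=> [c h]; exists c; apply: sumle_mon h => // i; rewrite nCM nC_ek mulr1. Qed.

Lemma SsD a b x : summ a -> summ b -> Ss (a + b) x = Ss a x + Ss b x.
Proof.
move=> sa sb; rewrite /Ss -csumD; [|exact: Ss_summ..].
by apply: eq_csum => k; rewrite -mulrDl.
Qed.

Lemma SsB a b x : summ a -> summ b -> Ss (a - b) x = Ss a x - Ss b x.
Proof.
move=> sa sb; rewrite /Ss -csumB; [|exact: Ss_summ..].
by apply: eq_csum => k; rewrite -mulrBl.
Qed.

Lemma SsZ a c x : summ a -> Ss (fun k => c * a k) x = c * Ss a x.
Proof.
move=> sa; rewrite /Ss -csumZ; last exact: Ss_summ.
by apply: eq_csum => k; rewrite mulrA.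
Qed.

Lemma SsN a x : summ a -> Ss (- a) x = - Ss a x.
Proof.
move=> sa; rewrite /Ss -csumN; last exact: Ss_summ.
by apply: eq_csum => k; rewrite -mulNr.
Qed.

Lemma Ss_ccont a lo hi : lo <= hi -> summ a -> ccont lo hi (Ss a).
Proof.
move=> lh [c hc]; apply: (ccont_csum lh (c := fun k => nC (a k)) _ _ hc).
  by move=> k; apply: ccontM; [exact: ccont_cst|exact: ccont_ek].
by move=> k x _; rewrite nCM nC_ek mulr1.
Qed.

Lemma ccont_bounded lo hi (g : R -> R[i]) : lo <= hi -> ccont lo hi g ->
  exists2 B, 0 <= B & forall x : R, lo <= x <= hi -> nC (g x) <= B.
Proof.
move=> lh cg; have [h1 h2] := ccont_within cg.
have b (f : R -> R) : {within `[lo, hi], continuous f} ->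
    exists B, forall x, lo <= x <= hi -> `|f x| <= B.
  move=> cf; have [c1 _ H1] := EVT_max lh cf; have [c2 _ H2] := EVT_min lh cf.
  exists (`|f c1| + `|f c2|) => x xab.
  have xi : x \in `[lo, hi] by rewrite in_itv.
  have := H1 _ xi; have := H2 _ xi; rewrite ler_norml => k2 k1.
  have := ler_norm (f c1); have := ler_norm (- f c2); rewrite normrN => n2 n1.
  by apply/andP; split; have := normr_ge0 (f c1); have := normr_ge0 (f c2); lra.
have [B1 k1] := b _ h1; have [B2 k2] := b _ h2.
exists (B1 + B2) => [|x xab].
  have l : lo <= lo <= hi by rewrite lexx.
  by rewrite addr_ge0// (le_trans (normr_ge0 _) (k1 _ l), le_trans (normr_ge0 _) (k2 _ l)).
by apply: le_trans (nC_le _) _; rewrite lerD ?k1 ?k2.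
Qed.

Lemma Ss_tint_mul a g : summ a -> ccont (- pi) pi g ->
  tintegral (fun x : R => Ss a x * g x) = csum (fun k => a k * tintegral (fun x => ek k x * g x)) /\
  summ (fun k => a k * tintegral (fun x => ek k x * g x)).
Proof.
move=> sa cg; have [c hc] := sa.
have [B B0 hB] := ccont_bounded Npi_le_pi cg.
have cf k : ccont (- pi) pi (fun x => a k * ek k x * g x).
  by apply: ccontM => //; apply: ccontM; [exact: ccont_cst|exact: ccont_ek].
have [|h1 h2] := cint_csum Npi_le_pi cf _ (sumleZ B0 hc).
  move=> k x xab; rewrite !nCM nC_ek mulr1 mulrC ler_wpM2r ?nC_ge0//; exact: hB.
have e k : ((pi *+ 2)^-1)%:C * cintegral (- pi) pi (fun x => a k * ek k x * g x) =
    a k * tintegral (fun x => ek k x * g x).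
  rewrite /tintegral mulrCA; congr (_ * _); rewrite -cintZ; last first.
    by apply: ccont_cable; apply: ccontM => //; exact: ccont_ek.
  by apply: cint_eq => x _; rewrite mulrA.
split.
  rewrite /tintegral.
  rewrite (_ : csum _ = csum (fun k => ((pi *+ 2)^-1)%:C * cintegral (- pi) pi (fun x => a k * ek k x * g x))).
    rewrite csumZ// -h1; congr (_ * _); apply: cint_eq => x _.
    rewrite mulrC -csumZ; last exact: Ss_summ.
    by apply: eq_csum => k; rewrite mulrC.
  by apply: eq_csum => k; rewrite e.
have := summZ ((pi *+ 2)^-1)%:C h2; congr summ; apply/funext => k; exact: e.
Qed.

Lemma fourier_Ss a k : summ a -> fourier (Ss a) k = a k.
Proof.
move=> sa; rewrite /fourier.
have -> : tintegral (fun x : R => Ss a x * (cos (k%:~R * x) -i* sin (k%:~R * x))) =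
    tintegral (fun x => Ss a x * ek (- k) x).
  by apply: tint_eq => x _; rewrite ekNc.
have [-> _] := Ss_tint_mul sa (@ccont_ek (- k) _ _).
rewrite (csum_single (i := k)) => [|j jk].
  rewrite -[RHS]mulr1 -[X in _ = _ * X](tint_cst 1); congr (_ * _); apply: tint_eq => x _.
  by rewrite -ekD subrr ek0.
rewrite (_ : tintegral _ = tintegral (ek (j - k))); last by apply: tint_eq => x _; rewrite ekD.
by rewrite tint_ek subr_eq0 (negbTE jk) mulr0.
Qed.

(** Convolution identities, associativity included, are proved by comparing the synthesised
    functions, where they become identities between numbers. *)
Lemma Ss_inj a b : summ a -> summ b -> (forall x, Ss a x = Ss b x) -> a = b.
Proof.
move=> sa sb h; apply/funext => k; rewrite -(fourier_Ss k sa) -(fourier_Ss k sb).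
by have -> : Ss a = Ss b by apply/funext.
Qed.

End Synthesis.

(** * Convolution algebras *)

Section ConvolutionAlgebra.
Context {R : realType}.
Implicit Types (a b c : int -> R[i]) (j k : int) (s : R).

Definition conv a b k := csum (fun j => a j * b (k - j)).

Lemma summ_W0 a : summ a <-> exists A, nb (Ww 0) a A.
Proof. by split=> -[A h]; exists A; apply/nb_Ww0. Qed.

Lemma W0_summ a A : nb (Ww 0) a A -> summ a.
Proof. by move=> h; apply/summ_W0; exists A. Qed.

Lemma summ_bd a : summ a -> exists2 A, 0 <= A & forall k, nC (a k) <= A.
Proof. by move=> [A h]; exists A; [exact: sumle_ge0 h|move=> k; exact: (sumle1 k h)]. Qed.

Lemma conv_mc a b : conv a b = mc (fun _ _ => 1) a b.
Proof. by apply/funext => k; apply: eq_csum => j; rewrite mul1r. Qed.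

Lemma conv_summ_bd a b B k : summ a -> (forall j, nC (b j) <= B) ->
  summ (fun j => a j * b (k - j)).
Proof.
move=> [A hA] hB; exists (B * A); have B0 : 0 <= B by apply: le_trans (hB 0); exact: nC_ge0.
apply: sumle_mon (sumleZ B0 hA) => // j; rewrite nCM mulrC.
by rewrite ler_wpM2r ?nC_ge0.
Qed.

Lemma conv_summ a b k : summ a -> summ b -> summ (fun j => a j * b (k - j)).
Proof. by move=> sa /summ_bd[B _ hB]; exact: conv_summ_bd hB. Qed.

Lemma mc1_summ a b : summ a -> summ b -> mc_summ (fun _ _ => 1) a b.
Proof.
move=> sa sb k; have := conv_summ k sa sb; congr summ; apply/funext => j.
by rewrite mul1r.
Qed.

Lemma convC a b : conv a b = conv b a.
Proof. by rewrite !conv_mc; apply/funext => k; rewrite mc_comm. Qed.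

Lemma conv_W0 a b A B : nb (Ww 0) a A -> nb (Ww 0) b B -> nb (Ww 0) (conv a b) (A * B).
Proof.
move=> ha hb; rewrite conv_mc -[A]mul1r.
apply: (mc_W (w1 := wt 0) (w2 := wt 0)) => //; try by move=> i; exact: wt_ge0.
  by move=> j l; rewrite !wt0 nC1 !mulr1.
by apply: mc1_summ; [exact: W0_summ ha|exact: W0_summ hb].
Qed.

Lemma summ_conv a b : summ a -> summ b -> summ (conv a b).
Proof.
move=> /summ_W0[A ha] /summ_W0[B hb]; exact: W0_summ (conv_W0 ha hb).
Qed.

Lemma Ss_conv a b x : summ a -> summ b -> Ss (conv a b) x = Ss a x * Ss b x.
Proof.
move=> sa sb; rewrite /Ss /conv.
transitivity (csum (fun k => csum (fun j => (a j * ek j x) * (b (k - j) * ek (k - j) x)))).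
  apply: eq_csum => k; rewrite mulrC -csumZ; last exact: conv_summ.
  apply: eq_csum => j; have -> : ek k x = ek (k - j) x * ek j x by rewrite -ekD subrK.
  ring.
rewrite csum_swap.
  rewrite mulrC -csumZ; last exact: Ss_summ.
  apply: eq_csum => j; rewrite csumZ; last first.
    have [B hB] := Ss_summ x sb; exists B.
    have hi : injective (fun k : int => k - j) by move=> y z /addIr.
    exact: (sumle_inj hi hB).
  rewrite mulrC; congr (_ * _).
  have bh : bijective (fun k : int => k - j).
    by exists (fun k : int => k + j) => k; rewrite ?subrK ?addrK.
  by rewrite -(csum_reindex (fun k => b k * ek k x) bh).
have [A hA] := sa; have [B hB] := sb.
exists (B * A).
pose sw (p : int * int) := (p.2, p.1).
have hsw : injective sw by move=> [? ?] [? ?] [-> ->].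
suff H : sumle (fun p : int * int => nC (a p.1) * nC (b (p.2 - p.1))) (B * A).
  have := sumle_inj hsw H; apply: sumle_mon => // -[k j] /=.
  by rewrite !nCM !nC_ek !mulr1.
apply: (@sumle_pair _ _ _ (fun j k => nC (a j) * nC (b (k - j))) (fun j => B * nC (a j))).
- by move=> j k; rewrite mulr_ge0 ?nC_ge0.
- move=> j; rewrite mulrC; apply: sumleZ; first exact: nC_ge0.
  have hi : injective (fun k : int => k - j) by move=> y z /addIr.
  exact: (sumle_inj hi hB).
- by apply: sumleZ => //; exact: sumle_ge0 hB.
Qed.

Lemma summD' a b : summ a -> summ b -> summ (a + b).
Proof. exact: summD. Qed.
Lemma summB' a b : summ a -> summ b -> summ (a - b).
Proof. exact: summB. Qed.
Lemma summN' a : summ a -> summ (- a).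
Proof. exact: summN. Qed.

Lemma convDl a b c : summ a -> summ b -> summ c -> conv (a + b) c = conv a c + conv b c.
Proof.
move=> sa sb sc; apply/funext => k; rewrite /conv -[RHS]/(_ + _) -csumD; [|exact: conv_summ..].
by apply: eq_csum => j; rewrite -mulrDl.
Qed.

Lemma convBl a b c : summ a -> summ b -> summ c -> conv (a - b) c = conv a c - conv b c.
Proof.
move=> sa sb sc; apply/funext => k; rewrite /conv -[RHS]/(_ - _) -csumB; [|exact: conv_summ..].
by apply: eq_csum => j; rewrite -mulrBl.
Qed.

Lemma convBr a b c : summ a -> summ b -> summ c -> conv c (a - b) = conv c a - conv c b.
Proof. by move=> sa sb sc; rewrite convC convBl// ![conv _ c]convC. Qed.

Lemma convDr a b c : summ a -> summ b -> summ c -> conv c (a + b) = conv c a + conv c b.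
Proof. by move=> sa sb sc; rewrite convC convDl// ![conv _ c]convC. Qed.

(** The unit for convolution: the coefficients of the constant function 1. *)
Definition dl : int -> R[i] := fun k => if k == 0 then 1 else 0.

Lemma nb_dl (w : int -> R) : (forall i, 0 <= w i) -> w 0 = 1 ->
  nb (Wn w) dl 1 /\ nb (Hn w) dl 1.
Proof.
move=> w0 w1; have z j : j != 0 -> dl j = 0 by rewrite /dl => /negbTE ->.
split.
  apply/nb_W => //; have := @sumle_single R int (fun i => w i * nC (dl i)) 0.
  rewrite /dl eqxx w1 nC1 mulr1; apply => // j /negbTE ->; by rewrite nC0 mulr0.
apply/nb_H => //; have := @sumle_single R int (fun i => (w i * nC (dl i)) ^+ 2) 0.
rewrite /dl eqxx w1 nC1 mulr1; apply; first by rewrite sqr_ge0.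
by move=> j /negbTE ->; rewrite nC0 mulr0 expr0n.
Qed.

Lemma wt_00 s : wt s 0 = 1 :> R.
Proof. by rewrite /wt expr0n addr0 powR1. Qed.

Lemma nb_dl_W s : nb (Ww s) dl 1.
Proof. by have [] := nb_dl (@wt_ge0 R s) (wt_00 s). Qed.
Lemma nb_dl_H s : nb (Hw s) dl 1.
Proof. by have [] := nb_dl (@wt_ge0 R s) (wt_00 s). Qed.

Lemma summ_dl : summ dl. Proof. by apply: (@W0_summ _ 1); exact: nb_dl_W. Qed.

Lemma Ss_dl x : Ss dl x = 1.
Proof.
rewrite /Ss (csum_single (i := 0)) ?ek0 ?mulr1// /dl => j /negbTE ->.
by rewrite mul0r.
Qed.

Lemma conv_dl a : conv dl a = a.
Proof.
apply/funext => k; rewrite /conv (csum_single (i := 0)) /dl ?eqxx ?mul1r ?subr0//.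
by move=> j /negbTE ->; rewrite mul0r.
Qed.

Definition Dq a k := (0 +i* k%:~R) * a k.

Lemma nC_ik k : nC (0 +i* k%:~R : R[i]) = `|k%:~R|.
Proof. by rewrite /Normc.normc expr0n add0r sqrtr_sqr. Qed.

Lemma Dq_W s a A : nb (Ww (s + 1)) a A -> nb (Ww s) (Dq a) A.
Proof.
move=> h; rewrite -[A]mul1r; apply: nb_W_mon h => //; try by move=> i; exact: wt_ge0.
move=> i; rewrite mul1r nCM nC_ik wtD mulrA ler_wpM2r ?nC_ge0// ler_wpM2l ?wt_ge0//.
exact: le_wt1.
Qed.

Lemma Dq_H s a A : nb (Hw s) a A -> nb (Hw (s - 1)) (Dq a) A.
Proof.
move=> h; rewrite -[A]mul1r; apply: nb_H_mon h => //; try by move=> i; exact: wt_ge0.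
move=> i; have -> : wt s i = wt (s - 1) i * wt 1 i :> R by rewrite -wtD subrK.
by rewrite mul1r nCM nC_ik mulrA ler_wpM2r ?nC_ge0// ler_wpM2l ?wt_ge0// le_wt1.
Qed.

Lemma DqB a b : Dq (a - b) = Dq a - Dq b.
Proof. by apply/funext => k; rewrite /Dq mulrBr. Qed.

Lemma Dq_conv a b : summ a -> summ b -> summ (Dq a) -> summ (Dq b) ->
  Dq (conv a b) = conv (Dq a) b + conv a (Dq b).
Proof.
move=> sa sb sDa sDb; apply/funext => k.
rewrite /Dq -[RHS]/(conv (Dq a) b k + conv a (Dq b) k) /conv -csumD; [|exact: conv_summ..].
rewrite -csumZ; last exact: conv_summ.
apply: eq_csum => j; rewrite /Dq; rewrite -{1}(subrK j k) rmorphD/=.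
by apply: complex_ext; rewrite !(cReM, cImM, cReD, cImD)/=; ring.
Qed.

(* [C] bounds both the embedding into absolutely summable sequences and the submultiplicativity. *)
Record algn (N : gnorm (R := R) int) (C : R) : Prop := Algn {
  algn_ge0 : 1 <= C;
  algn_W0 : forall a A, nb N a A -> nb (Ww 0) a (C * A);
  algn_conv : forall a b A B, nb N a A -> nb N b B -> nb N (conv a b) (C * A * B);
  algn_dl : nb N dl 1 }.

Lemma algn_summ N C a A : algn N C -> nb N a A -> summ a.
Proof. by move=> h /(algn_W0 h)/W0_summ. Qed.

Lemma algn_Ww0 : algn (Ww 0) 1.
Proof.
split=> //; first by move=> a A; rewrite mul1r.
  by move=> a b A B; rewrite mul1r; exact: conv_W0.
exact: nb_dl_W.
Qed.

(** The output weight is carried, up to 2^s, by the input of larger frequency; the other input is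
    absolutely summable because s > 1/2. The symbols [m1] and [m2] separate the two cases. *)
Lemma algn_Hw s : 2^-1 < s -> exists C, algn (Hw s) C.
Proof.
move=> s2; have [|K K0 hK] := @Hw_Ww R s 0; first by lra.
have s0 : 0 <= s by lra.
pose P := (2 : R) `^ s; have P0 : 0 <= P by exact: powR_ge0.
(* One K for the embedding into l^1 and one [P * K] for each of the two frequency regions. *)
exists (1 + K + P * K + P * K).
have PK : 0 <= P * K by rewrite mulr_ge0.
split; last exact: nb_dl_H; first by lra.
  move=> a A h; apply: nb_mon (hK _ _ h); apply: ler_wpM2r; [exact: nb_ge0 h|lra].
move=> a b A B ha hb; have A0 := nb_ge0 ha; have B0 := nb_ge0 hb.
have sa := W0_summ (hK _ _ ha); have sb := W0_summ (hK _ _ hb).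
pose m1 (j l : int) : R[i] := if (wt 1 j : R) <= wt 1 l then 1 else 0 : R[i].
pose m2 (j l : int) : R[i] := if (wt 1 j : R) <= wt 1 l then 0 else 1 : R[i].
have sm (m : int -> int -> R[i]) a' b' : (forall j l, nC (m j l) <= 1) -> summ a' -> summ b' -> mc_summ m a' b'.
  move=> m1' [A' hA'] [B' hB'].
  apply: (@mc_summ_bd _ _ _ _ A' B'); first by apply/nb_Ww0.
  move=> j l; rewrite nCM -[B']mul1r; apply: ler_pM; rewrite ?nC_ge0//.
  exact: (sumle1 l hB').
have b1 j l : nC (m1 j l) <= 1 by rewrite /m1; case: ifP; rewrite ?nC1 ?nC0.
have b2 j l : nC (m2 j l) <= 1 by rewrite /m2; case: ifP; rewrite ?nC1 ?nC0.
have E : conv a b = mc m1 a b + mc m2 a b.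
  apply/funext => k; rewrite -[RHS]/(mc m1 a b k + mc m2 a b k) /mc -csumD; last 2 first.
  - exact: sm.
  - exact: sm.
  by apply: eq_csum => j; rewrite /m1 /m2; case: ifP => _; ring.
rewrite E; apply: nb_mon (nbD (_ : nb _ _ (P * (K * A) * B)) (_ : nb _ _ (P * A * (K * B)))).
- have AB : 0 <= A * B by rewrite mulr_ge0.
  rewrite (_ : _ + _ = (P * K + P * K) * A * B); last by ring.
  by rewrite ler_wpM2r// ler_wpM2r//; lra.
- apply: (mc_H (w1 := wt 0) (w2 := wt s)) => //; try by move=> i; exact: wt_ge0.
  + move=> j l; rewrite wt0 mulr1 /m1; case: ifP => h; last by rewrite nC0 mul0r mulr_ge0 ?wt_ge0.
    rewrite nC1 mul1r; apply: wt_le_pow => //.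
    by apply: le_trans (wt1_add _ _) _; lra.
  + exact: sm.
  + exact: hK.
- apply: (mc_H2 (w1 := wt s) (w2 := wt 0)) => //; try by move=> i; exact: wt_ge0.
  + move=> j l; rewrite wt0 mulr1 /m2; case: ifPn => h; first by rewrite nC0 mul0r mulr_ge0 ?wt_ge0.
    rewrite nC1 mul1r; apply: wt_le_pow => //.
    by move: h; rewrite -ltNge => /ltW h; apply: le_trans (wt1_add _ _) _; lra.
  + exact: sm.
  + exact: hK.
Qed.

End ConvolutionAlgebra.

(** * The exponential in the convolution algebra *)

Section Exponential.
Context {R : realType}.
Implicit Types (a b c : int -> R[i]) (z w : R[i]).

Fixpoint cpow a n := if n is m.+1 then conv a (cpow a m) else dl.

Lemma summ_cpow a n : summ a -> summ (cpow a n).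
Proof. by move=> sa; elim: n => [|n IH] /=; [exact: summ_dl|exact: summ_conv]. Qed.

Lemma Ss_cpow a n x : summ a -> Ss (cpow a n) x = Ss a x ^+ n.
Proof.
move=> sa; elim: n => [|n IH] /=; first exact: Ss_dl.
by rewrite Ss_conv ?IH ?exprS//; exact: summ_cpow.
Qed.

Lemma nb_cpow N C a A n : algn N C -> nb N a A -> nb N (cpow a n) ((C * A) ^+ n).
Proof.
move=> hN ha; elim: n => [|n IH] /=; first exact: algn_dl hN.
by rewrite exprS; exact: algn_conv hN _ _ _ _ ha IH.
Qed.

Lemma sumle_finsupp (I : choiceType) (f : I -> R) t : uniq t ->
  (forall i, 0 <= f i) -> (forall i, i \notin t -> f i = 0) -> sumle f (\sum_(i <- t) f i).
Proof.
move=> ut f0 ft s us; rewrite (bigID (mem t))/= [X in _ + X]big1 ?addr0// -big_filter.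
rewrite (perm_big [seq i <- t | i \in s]) /=.
  by rewrite big_filter [leRHS](bigID (mem s))/= lerDl sumr_ge0.
by apply: uniq_perm; rewrite ?filter_uniq// => i; rewrite !mem_filter andbC.
Qed.

Definition ec (x : R) n : R := x ^+ n / n`!%:R.

Lemma ec_ge0 x n : 0 <= x -> 0 <= ec x n.
Proof. by move=> x0; rewrite divr_ge0// exprn_ge0. Qed.

Lemma sumle_ec x : 0 <= x -> sumle (ec x) (expR x).
Proof.
move=> x0; apply: sumle_nat => [n|n]; first exact: ec_ge0.
have -> : \sum_(i < n) ec x i = series (exp_coeff x) n.
  by rewrite /series/= big_mkord.
apply: nondecreasing_cvgn_le; last exact: is_cvg_series_exp_coeff.
apply: nondecreasing_series => i _ _; exact: ec_ge0.
Qed.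

(** For n >= m, x^n / n! is at most x^m times x^(n-m) / (n-m)!. *)
Lemma sumle_ec_tail x m : 0 <= x ->
  sumle (fun n => if (n < m)%N then 0 else ec x n) (x ^+ m * expR x).
Proof.
move=> x0 s us; have := sumleZ (exprn_ge0 m x0) (sumle_ec x0).
move=> /(_ [seq (n - m)%N | n <- s & (m <= n)%N]) H.
rewrite (bigID (fun n => n < m)%N)/= big1 ?add0r => [|n -> //].
apply: le_trans (H _); last first.
  rewrite map_inj_in_uniq ?filter_uniq// => i j; rewrite !mem_filter => /andP[mi _] /andP[mj _] e.
  by rewrite -(subnK mi) e subnK.
rewrite big_map big_filter (eq_bigl (fun n => (m <= n)%N)) => [|n]; last by rewrite -leqNgt.
apply: ler_sum => n mn; rewrite ltnNge mn /= /ec mulrA -exprD subnKC//.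
rewrite ler_wpM2l ?exprn_ge0// lef_pV2 ?posrE ?ltr0n ?fact_gt0// ler_nat.
by apply: leq_fact; exact: leq_subr.
Qed.

Definition expq a k := csum (fun n => (n`!%:R^-1)%:C * cpow a n k).

Lemma nC_fact n : nC ((n`!%:R^-1)%:C : R[i]) = n`!%:R^-1.
Proof. by rewrite nC_real ger0_norm// invr_ge0. Qed.

Lemma expq_summ a k : summ a -> summ (fun n => (n`!%:R^-1)%:C * cpow a n k).
Proof.
move=> /summ_W0[A ha]; have A0 := nb_ge0 ha.
exists (expR A); apply: sumle_mon (sumle_ec A0) => // n.
rewrite nCM nC_fact mulrC ler_wpM2r ?invr_ge0//.
have := nb_Ww_coef k (nb_cpow n algn_Ww0 ha); by rewrite wt0 !mul1r.
Qed.

(** The orders m = 0, 1, 2 give the size, the Lipschitz bound and the differentiability of the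
    exponential. *)
Lemma nb_expq_tail N C a A m : algn N C -> nb N a A ->
  nb N (fun k => expq a k - \sum_(n < m) (n`!%:R^-1)%:C * cpow a n k) ((C * A) ^+ m * expR (C * A)).
Proof.
move=> hN ha; have A0 := nb_ge0 ha; have C0 := algn_ge0 hN.
have CA : 0 <= C * A by rewrite mulr_ge0//; lra.
have sa := algn_summ hN ha.
pose F n k := if (n < m)%N then 0 else (n`!%:R^-1)%:C * cpow a n k.
apply: (@nb_eq _ _ _ (fun k => csum (F ^~ k))).
  move=> k; rewrite /expq (csum_split (iota_uniq 0 m) (expq_summ k sa)).
  rewrite -(big_mkord xpredT (fun n => (n`!%:R^-1)%:C * cpow a n k)) /index_iota subn0.
  by rewrite addrAC subrr add0r; apply: eq_csum => n; rewrite /F mem_iota add0n.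
apply: nb_csum (sumle_ec_tail m CA).
  move=> k; have [B hB] := expq_summ k sa; exists B; apply: sumle_mon hB => // n.
  by rewrite /F; case: ifP; rewrite ?nC0 ?nC_ge0.
move=> n; rewrite /F; case: ifP => _; first exact: nb0.
have -> : ec (C * A) n = nC ((n`!%:R^-1)%:C : R[i]) * (C * A) ^+ n by rewrite nC_fact [RHS]mulrC.
by apply: nbZ; exact: nb_cpow.
Qed.

Lemma nb_expq0 N C a A : algn N C -> nb N a A -> nb N (expq a) (expR (C * A)).
Proof.
move=> hN ha; have := nb_expq_tail 0 hN ha; rewrite expr0 mul1r; apply: nb_eq => k.
by rewrite big_ord0 subr0.
Qed.

Lemma nb_expq1 N C a A : algn N C -> nb N a A ->
  nb N (expq a - dl) (C * A * expR (C * A)).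
Proof.
move=> hN ha; have := nb_expq_tail 1 hN ha; rewrite expr1; apply: nb_eq => k.
by rewrite big_ord_recl big_ord0 fact0 invr1 addr0 mul1r.
Qed.

Lemma nb_expq2 N C a A : algn N C -> nb N a A ->
  nb N (expq a - dl - a) ((C * A) ^+ 2 * expR (C * A)).
Proof.
move=> hN ha; have := nb_expq_tail 2 hN ha; apply: nb_eq => k.
rewrite big_ord_recl big_ord_recl big_ord0 fact0 invr1 addr0 mul1r opprD addrA.
by rewrite /= [conv a dl]convC conv_dl mul1r.
Qed.

Lemma summ_expq a : summ a -> summ (expq a).
Proof. by move=> /summ_W0[A ha]; exact: W0_summ (nb_expq0 algn_Ww0 ha). Qed.

Definition cexp z := csum (fun n => (n`!%:R^-1)%:C * z ^+ n).

Lemma nCX z n : nC (z ^+ n) = nC z ^+ n.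
Proof. by elim: n => [|n IH]; rewrite ?expr0 ?nC1// !exprS nCM IH. Qed.

Lemma cexp_summ z : summ (fun n => (n`!%:R^-1)%:C * z ^+ n).
Proof.
exists (expR (nC z)); apply: sumle_mon (sumle_ec (nC_ge0 z)) => // n.
by rewrite nCM nC_fact nCX mulrC.
Qed.

(** Cauchy product: the binomial theorem writes each term for z + w as a sum over i <= n, and the
    triangle of such pairs is the image of all pairs under (m, i) -> (m + i, i). *)
Lemma cexpD z w : cexp (z + w) = cexp z * cexp w.
Proof.
pose g (n i : nat) : R[i] := if (i <= n)%N then
  ((n - i)`!%:R^-1)%:C * z ^+ (n - i) * ((i`!%:R^-1)%:C * w ^+ i) else 0.
have e1 n : (n`!%:R^-1)%:C * (z + w) ^+ n = csum (g n).
  rewrite (csum_split (iota_uniq 0 n.+1)); last first.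
    exists (\sum_(i <- iota 0 n.+1) nC (g n i)); apply: sumle_finsupp; first exact: iota_uniq.
      by move=> i; exact: nC_ge0.
    by move=> i; rewrite mem_iota leq0n add0n ltnS /g /= => /negbTE ->; rewrite nC0.
  rewrite [csum _](_ : _ = 0) ?addr0; last first.
    transitivity (csum (fun _ : nat => 0 : R[i])); last exact: csum0.
    apply: eq_csum => i; rewrite mem_iota leq0n add0n ltnS /g /=.
    by case: (i <= n)%N.
  rewrite exprDn mulr_sumr -[iota 0 n.+1]/(index_iota 0 n.+1) big_mkord.
  apply: eq_bigr => i _; rewrite /g -ltnS ltn_ord -[X in _ * X = _]mulr_natl.
  have -> : ('C(n, i)%:R : R[i]) = (n`!%:R * (i`!%:R^-1 * (n - i)`!%:R^-1))%:C.
    have hin : (i <= n)%N by rewrite -ltnS.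
    have E : n`!%:R * (i`!%:R^-1 * (n - i)`!%:R^-1) = 'C(n, i)%:R :> R.
      rewrite -(bin_fact hin) !natrM; field.
      by rewrite !pnatr_eq0 -!lt0n !fact_gt0.
    by rewrite E rmorph_nat.
  have fn0 : (n`!%:R : R[i]) != 0 by rewrite pnatr_eq0 -lt0n fact_gt0.
  rewrite !rmorphM/= !fmorphV/= !rmorph_nat; field.
  by rewrite !pnatr_eq0 -!lt0n !fact_gt0.
rewrite /cexp (eq_csum e1).
pose h (p : nat * nat) := ((p.1 + p.2)%N, p.2).
have hi : injective h.
  by move=> [x y] [x' y'] [/= e ?]; subst y'; move/addIn: e => ->.
pose G (p : nat * nat) := g p.1 p.2.
have Gh (p : nat * nat) : G (h p) = ((p.1)`!%:R^-1)%:C * z ^+ p.1 * (((p.2)`!%:R^-1)%:C * w ^+ p.2).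
  by rewrite /G /h /g /= leq_addl addnK.
have G0 p : (forall q, p <> h q) -> G p = 0.
  case: p => n i H; rewrite /G /g /=; case: ifP => // hin.
  by case: (H ((n - i)%N, i)); rewrite /h /= subnK.
have [Z hZ] := cexp_summ z; have [W hW] := cexp_summ w.
have sGh : summ (G \o h).
  exists (W * Z).
  have -> : (fun p => nC ((G \o h) p)) = (fun p : nat * nat =>
     nC (((p.1)`!%:R^-1)%:C * z ^+ p.1) * nC (((p.2)`!%:R^-1)%:C * w ^+ p.2)).
    by apply/funext => p; rewrite /= Gh nCM.
  apply: (@sumle_pair _ _ _ (fun n i => nC ((n`!%:R^-1)%:C * z ^+ n) * nC ((i`!%:R^-1)%:C * w ^+ i))
     (fun n => W * nC ((n`!%:R^-1)%:C * z ^+ n))).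
  - by move=> n i; rewrite mulr_ge0 ?nC_ge0.
  - by move=> n; rewrite [W * _]mulrC; apply: sumleZ => //; exact: nC_ge0.
  - by apply: sumleZ => //; exact: sumle_ge0 hW.
have sG : summ G.
  case: sGh => B hB; exists B => s us.
  rewrite (bigID (fun p => p.2 <= p.1)%N)/= [X in _ + X]big1 ?addr0; last first.
    by move=> p; rewrite /G /g => /negbTE ->; rewrite nC0.
  rewrite -big_filter.
  have := hB [seq ((p.1 - p.2)%N, p.2) | p <- s & (p.2 <= p.1)%N].
  rewrite big_map => H; apply: le_trans (H _).
    rewrite !big_filter; apply: ler_sum => p hp.
    by rewrite /= /h /= subnK//; case: p hp.
  rewrite map_inj_in_uniq ?filter_uniq// => -[n i] [n' i']; rewrite !mem_filter /= => /andP[h1 _] /andP[h2 _] [e ?].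
  by subst i'; rewrite -(subnK h1) e subnK.
have [_ _ <-] := csum_pair (F := g) sG.
rewrite -/G -(csum_image hi G0).
pose F n i := ((n`!%:R^-1)%:C * z ^+ n) * ((i`!%:R^-1)%:C * w ^+ i).
have sF : summ (fun p : nat * nat => F p.1 p.2).
  by have := sGh; congr summ; apply/funext => p; exact: Gh.
have [_ _ E] := csum_pair sF.
have -> : csum (G \o h) = csum (fun p : nat * nat => F p.1 p.2).
  by apply: eq_csum => p; exact: Gh.
rewrite E mulrC -csumZ; last exact: cexp_summ.
apply: eq_csum => n; transitivity (((n`!%:R^-1)%:C * z ^+ n) * csum (fun i => (i`!%:R^-1)%:C * w ^+ i)).
  exact: csumZ (cexp_summ w).
exact: mulrC.
Qed.

Lemma Ss_expq a x : summ a -> Ss (expq a) x = cexp (Ss a x).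
Proof.
move=> sa; have /summ_W0[A ha] := sa; have A0 := nb_ge0 ha.
rewrite /Ss /expq /cexp.
transitivity (csum (fun k => csum (fun n => (n`!%:R^-1)%:C * (cpow a n k * ek k x)))).
  apply: eq_csum => k; rewrite mulrC -csumZ; last exact: expq_summ.
  by apply: eq_csum => n; ring.
rewrite csum_swap.
  apply: eq_csum => n; rewrite csumZ; last by apply: Ss_summ; exact: summ_cpow.
  by rewrite -(Ss_cpow _ _ sa).
exists (expR A).
pose sw (p : int * nat) := (p.2, p.1).
have hsw : injective sw by move=> [? ?] [? ?] [-> ->].
suff H : sumle (fun p : nat * int => ((p.1)`!%:R^-1) * nC (cpow a p.1 p.2)) (expR A).
  have := sumle_inj hsw H; apply: sumle_mon => // -[k n] /=.
  by rewrite !nCM nC_ek mulr1 nC_fact.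
apply: (@sumle_pair _ _ _ (fun n k => (n`!%:R^-1) * nC (cpow a n k)) (ec A)).
- by move=> n k; rewrite mulr_ge0 ?nC_ge0.
- move=> n; rewrite /ec mulrC; apply: sumleZ => //.
  by have /nb_Ww0 := nb_cpow n algn_Ww0 ha; rewrite mul1r.
- exact: sumle_ec.
Qed.

Lemma expqD a b : summ a -> summ b -> expq (a + b) = conv (expq a) (expq b).
Proof.
move=> sa sb; have sab := summD' sa sb; apply: Ss_inj.
- exact: summ_expq.
- by apply: summ_conv; exact: summ_expq.
- by move=> x; rewrite Ss_conv ?Ss_expq ?SsD ?cexpD//; exact: summ_expq.
Qed.

Lemma expq0 : expq 0 = dl.
Proof.
apply/funext => k; rewrite /expq (csum_single (i := 0%N)).
  by rewrite fact0 invr1 mul1r.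
move=> [//|n] _ /=; rewrite (_ : conv 0 _ k = 0) ?mulr0// /conv -[RHS](@csum0 R int).
by apply: eq_csum => j; rewrite mul0r.
Qed.

Lemma expqN a : summ a -> conv (expq a) (expq (- a)) = dl.
Proof. by move=> sa; rewrite -expqD ?subrr ?expq0//; exact: summN'. Qed.

(** The difference is [expq a] convolved with [expq (b - a) - dl], so the remainder of order 1
    suffices. *)
Lemma expqB N C a b A B D : algn N C -> nb N a A -> nb N b B -> nb N (b - a) D ->
  nb N (expq b - expq a) (C * expR (C * A) * (C * D * expR (C * D))).
Proof.
move=> hN ha hb hd; have sa := algn_summ hN ha; have sd := algn_summ hN hd.
have -> : expq b - expq a = conv (expq a) (expq (b - a) - dl).
  have s1 := summ_expq sa; have s2 := summ_expq sd.
  rewrite convBr//; last exact: summ_dl.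
  have eb : a + (b - a) = b by rewrite addrC subrK.
  by rewrite -expqD// [conv _ dl]convC conv_dl eb.
exact: algn_conv hN _ _ _ _ (nb_expq0 hN ha) (nb_expq1 hN hd).
Qed.

(** With c = g t - g x, [expq (g t)] is the convolution of [expq (g x)] and [expq c], whose
    remainder of order 2 is quadratic in t - x. The linear remainder of [g] is controlled in l^1 by
    [nb_der]. *)
Lemma expq_der (lo hi : R) (g gm : R -> int -> R[i]) :
  (forall i, cder lo hi (g ^~ i) (gm ^~ i)) -> ccurve (Ww 0) lo hi gm ->
  (forall t : R, lo <= t <= hi -> summ (g t)) -> (forall t : R, lo <= t <= hi -> summ (gm t)) ->
  forall k, cder lo hi (fun t => expq (g t) k) (fun t => conv (gm t) (expq (g t)) k).
Proof.
move=> dg cg sg sgm k x xab e e0.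
have /summ_W0[G hG] := sg x xab; have /summ_W0[M hM] := sgm x xab.
have G0 := nb_ge0 hG; have M0 := nb_ge0 hM.
pose E0 := expR G; have E00 : 0 <= E0 by rewrite expR_ge0.
(* Half of e is for the linear remainder of [g], which is multiplied by E0; the bound by 1 makes c
   at most M + 1 times |t - x|. *)
pose e1 := Num.min 1 (e / (2 * (E0 + 1))).
have e10 : 0 < e1 by rewrite lt_min ltr01 divr_gt0// mulr_gt0//; lra.
have [d d0 Hd] := nb_der dg cg xab e10.
pose K := (M + 1) ^+ 2 * expR (M + 1) * E0.
have K0 : 0 <= K.
  by apply: mulr_ge0 => //; apply: mulr_ge0; [exact: sqr_ge0|exact: expR_ge0].
have e20 : 0 < e / 2 by rewrite divr_gt0.
have [e2 e20' he2] := ler_eps_div e20 K0.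
exists (Num.min d (Num.min 1 e2)); first by rewrite !lt_min d0 ltr01.
move=> t tab; rewrite !lt_min => /and3P[/(Hd t tab) h1 h2 h3].
set h := `|t - x| in h1 h2 h3 *; have h0 : 0 <= h by exact: normr_ge0.
pose c := g t - g x.
have hc : nb (Ww 0) c ((M + 1) * h).
  have -> : c = (fun i => g t i - g x i - (t - x)%:C * gm x i) + (fun i => (t - x)%:C * gm x i).
    by apply/funext => i; rewrite /c; apply/esym; exact: subrK.
  rewrite mulrDl mul1r [M * h + h]addrC; apply: nbD.
    by apply: nb_mon h1; rewrite -[leRHS]mul1r ler_wpM2r// ge_min lexx.
  by rewrite mulrC; have := nbZ ((t - x)%:C : R[i]) hM; rewrite nC_real.
have hc1 : nb (Ww 0) c (M + 1) by apply: nb_mon hc; rewrite ler_piMr//; [lra|exact: ltW].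
have cE : g t = g x + c by rewrite /c addrC subrK.
clearbody c.
have sc := W0_summ hc; have sx := sg x xab.
have sEx := summ_expq sx; have sEc := summ_expq sc.
have sr : summ (fun i => g t i - g x i - (t - x)%:C * gm x i) by exact: W0_summ h1.
have Eq : expq (g t) k - expq (g x) k - (t - x)%:C * conv (gm x) (expq (g x)) k =
   conv (expq (g x)) (expq c - dl - c) k +
   conv (expq (g x)) (fun i => g t i - g x i - (t - x)%:C * gm x i) k.
  rewrite cE.
  have sd0 : summ (dl : int -> R[i]) by exact: summ_dl.
  have sEcd := summB' sEc sd0.
  rewrite expqD// (convBr sEcd sc sEx) (convBr sEc sd0 sEx).
  rewrite [conv _ dl]convC conv_dl.
  have -> : conv (expq (g x)) (fun i => (g x + c) i - g x i - (t - x)%:C * gm x i) k =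
      conv (expq (g x)) c k - (t - x)%:C * conv (gm x) (expq (g x)) k.
    rewrite [conv (gm x) _]convC /conv -csumZ; last by apply: conv_summ => //; exact: sgm.
    rewrite -csumB; first last.
    - by apply: summZ; apply: conv_summ => //; exact: sgm.
    - exact: conv_summ.
    apply: eq_csum => j; rewrite -[(g x + c) _]/(g x (k - j) + c (k - j)); ring.
  rewrite -[((conv (expq (g x)) (expq c) - expq (g x)) - conv (expq (g x)) c) k]/(conv (expq (g x)) (expq c) k - expq (g x) k - conv (expq (g x)) c k).
  ring.
rewrite Eq; apply: le_trans (nCD _ _) _.
have hE := nb_expq0 algn_Ww0 hG; rewrite mul1r in hE.
have q1 := conv_W0 hE (nb_expq2 algn_Ww0 hc).
have q2 := conv_W0 hE h1.
move: (nb_Ww_coef k q1) (nb_Ww_coef k q2); rewrite !wt0 !mul1r -/E0 => {}q1 {}q2.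
have l1 : E0 * (((M + 1) * h) ^+ 2 * expR ((M + 1) * h)) <= e / 2 * h.
  have : expR ((M + 1) * h) <= expR (M + 1).
    by rewrite ler_expR ler_piMr//; [lra|exact: ltW].
  move=> l2; apply: (@le_trans _ _ (h * K * h)).
    rewrite (_ : h * K * h = E0 * (((M + 1) * h) ^+ 2 * expR (M + 1))); last by rewrite /K; ring.
    by rewrite ler_wpM2l// ler_wpM2l ?sqr_ge0.
  rewrite ler_wpM2r//; apply: le_trans he2; rewrite ler_wpM2r//; exact: ltW.
have l2 : E0 * (e1 * h) <= e / 2 * h.
  rewrite mulrA ler_wpM2r//; apply: (@le_trans _ _ (E0 * (e / (2 * (E0 + 1))))).
    by rewrite ler_wpM2l// ge_min lexx orbT.
  rewrite (_ : E0 * (e / (2 * (E0 + 1))) = e / 2 * (E0 / (E0 + 1))); last first.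
    by field; rewrite gt_eqF//; lra.
  rewrite ler_piMr//; first exact: ltW.
  by rewrite ler_pdivrMr ?mul1r ?lerDl//; lra.
lra.
Qed.

End Exponential.

(** * Lipschitz estimates *)

Section TrilinearTheory.
Context {R : realType}.
Implicit Types (a b c : int -> R[i]) (j l n k : int).

(** The growth of the symbol is charged to the third frequency alone, as convergence in [mc3_summ]
    requires. *)
Definition mgood (m : int -> int -> int -> R[i]) (w : int -> R) :=
  (forall i, 0 <= w i) /\ exists2 C, 0 <= C & forall j l n, nC (m j l n) <= C * w n.

Definition wbd (w : int -> R) c := exists D, forall n, w n * nC (c n) <= D.

Lemma wbdB w c c' : (forall i, 0 <= w i) -> wbd w c -> wbd w c' -> wbd w (c - c').
Proof.
move=> w0 [D h] [D' h']; exists (D + D') => n; apply: le_trans (lerD (h n) (h' n)).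
by rewrite -mulrDr ler_wpM2l// nCB.
Qed.

(** A trilinear sum as one sum over pairs of frequencies, so that linearity and time derivatives are
    handled term by term. *)
Definition fam (m : int -> int -> int -> R[i]) a b c k (p : int * int) :=
  a p.1 * (m p.1 p.2 (k - p.1 - p.2) * b p.2 * c (k - p.1 - p.2)).

Lemma mc3_pair m w a b c k : mgood m w -> summ a -> summ b -> wbd w c ->
  summ (fam m a b c k) /\ mc3 m a b c k = csum (fam m a b c k).
Proof.
move=> [w0 [C C0 mC]] /summ_W0[A ha] /summ_W0[B hb] [D hc].
have [sp sm sm'] := mc3_summ C0 w0 mC ha hb hc k.
split=> //; have [_ _ e] := csum_pair (F := fun j l => a j * (m j l (k - j - l) * b l * c (k - j - l))) sp.
rewrite /fam e; apply: eq_csum => j; rewrite -csumZ//; exact: sm.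
Qed.

Lemma nb_fam m w C a b c k A B D : 0 <= C -> (forall i, 0 <= w i) ->
  (forall j l n, nC (m j l n) <= C * w n) ->
  nb (Ww 0) a A -> nb (Ww 0) b B -> (forall n, w n * nC (c n) <= D) ->
  nb (Wn (fun=> 1)) (fam m a b c k) (C * A * B * D).
Proof.
move=> C0 w0 mC ha hb hc; apply/nb_W1.
have A0 := nb_ge0 ha; have B0 := nb_ge0 hb.
have D0 : 0 <= D by apply: le_trans (hc 0); rewrite mulr_ge0 ?nC_ge0.
apply: (@sumle_mon _ _ _ (fun p => C * D * nC (b p.2) * nC (a p.1)) _ _ _ (lexx _)).
  move=> p; rewrite /fam !nCM mulrC ler_wpM2r ?nC_ge0// mulrAC ler_wpM2r ?nC_ge0//.
  by apply: le_trans (ler_wpM2r (nC_ge0 _) (mC _ _ _)) _; rewrite -mulrA ler_wpM2l.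
have e : C * A * B * D = C * D * B * A by ring.
rewrite e; apply: (@sumle_pair R int int (fun i j => C * D * nC (b j) * nC (a i)) (fun i => nC (a i) * (C * D * B))).
- by move=> i j; rewrite !mulr_ge0 ?nC_ge0.
- move=> i; have /nb_Ww0 hb' := hb; have := sumleZ (mulr_ge0 C0 D0) hb'.
  move/(sumleZ (nC_ge0 (a i))); apply: sumle_mon => // j; by rewrite mulrC.
- have /nb_Ww0 ha' := ha.
  have := sumleZ (mulr_ge0 (mulr_ge0 C0 D0) B0) ha'; apply: sumle_mon => // i.
  by rewrite mulrC.
Qed.

Lemma mc3_ext m m' a b c : (forall j l n, m j l n = m' j l n) -> mc3 m a b c = mc3 m' a b c.
Proof.
by move=> h; apply/funext => k; apply: eq_csum => j; congr (_ * _); apply: eq_csum => l; rewrite h.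
Qed.

Lemma mc3_addm m m' w a b c : mgood m w -> mgood m' w -> summ a -> summ b -> wbd w c ->
  mc3 (fun j l n => m j l n + m' j l n) a b c = mc3 m a b c + mc3 m' a b c.
Proof.
move=> g g' sa sb hc; apply/funext => k.
have g'' : mgood (fun j l n => m j l n + m' j l n) w.
  case: g => w0 [C C0 h]; case: g' => _ [C' C'0 h']; split=> //; exists (C + C'); first by rewrite addr_ge0.
  by move=> j l n; rewrite mulrDl; apply: le_trans (nCD _ _) (lerD (h _ _ _) (h' _ _ _)).
rewrite -[RHS]/(mc3 m a b c k + mc3 m' a b c k).
have [_ ->] := mc3_pair k g'' sa sb hc.
have [s1 ->] := mc3_pair k g sa sb hc; have [s2 ->] := mc3_pair k g' sa sb hc.
by rewrite -csumD//; apply: eq_csum => p; rewrite /fam; ring.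
Qed.

Lemma mc3_telescope m w a b c a' b' c' : mgood m w ->
  summ a -> summ b -> wbd w c -> summ a' -> summ b' -> wbd w c' ->
  mc3 m a b c - mc3 m a' b' c' =
  mc3 m (a - a') b c + mc3 m a' (b - b') c + mc3 m a' b' (c - c').
Proof.
move=> g sa sb hc sa' sb' hc'; have w0 := g.1; apply/funext => k.
rewrite -[LHS]/(mc3 m a b c k - mc3 m a' b' c' k).
rewrite -[RHS]/(mc3 m (a - a') b c k + mc3 m a' (b - b') c k + mc3 m a' b' (c - c') k).
have [s1 ->] := mc3_pair k g sa sb hc; have [s2 ->] := mc3_pair k g sa' sb' hc'.
have [s3 ->] := mc3_pair k g (summB' sa sa') sb hc.
have [s4 ->] := mc3_pair k g sa' (summB' sb sb') hc.
have [s5 ->] := mc3_pair k g sa' sb' (wbdB w0 hc hc').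
rewrite -csumB// -csumD// -csumD//; last exact: summD.
apply: eq_csum => p; rewrite /fam -[(a - a') _]/(_ - _) -[(b - b') _]/(_ - _) -[(c - c') _]/(_ - _).
ring.
Qed.

Lemma fam_ccurve m w (lo hi : R) (a b c : R -> int -> R[i]) k : mgood m w ->
  ccurve (Ww 0) lo hi a -> ccurve (Ww 0) lo hi b -> ccurve (Wn w) lo hi c ->
  (forall t, lo <= t <= hi -> summ (a t)) -> (forall t, lo <= t <= hi -> summ (b t)) ->
  (forall t, lo <= t <= hi -> wbd w (c t)) ->
  ccurve (Wn (fun=> 1)) lo hi (fun t => fam m (a t) (b t) (c t) k).
Proof.
move=> g ca cb cc sa sb sc x xab e e0; have [w0 [C C0 mC]] := g.
have /summ_W0[A hA] := sa x xab; have /summ_W0[B hB] := sb x xab; have [D hD] := sc x xab.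
have A0 := nb_ge0 hA; have B0 := nb_ge0 hB.
have D0 : 0 <= D by apply: le_trans (hD 0); rewrite mulr_ge0 ?nC_ge0.
pose P := C * (B + 1) * (D + 1) + C * A * (D + 1) + C * A * B.
have P0 : 0 <= P by rewrite /P !addr_ge0 ?mulr_ge0 ?addr_ge0.
have [e1 e10 he1] := ler_eps_div e0 P0.
have e20 : 0 < Num.min e1 1 by rewrite lt_min e10 ltr01.
have [d1 d10 H1] := ca x xab _ e20; have [d2 d20 H2] := cb x xab _ e20.
have [d3 d30 H3] := cc x xab _ e20.
exists (Num.min d1 (Num.min d2 d3)); first by rewrite !lt_min d10 d20.
move=> t tab; rewrite !lt_min => /and3P[/(H1 t tab) h1 /(H2 t tab) h2 /(H3 t tab) h3].
have m1 : Num.min e1 1 <= e1 by rewrite ge_min lexx.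
have m2 : Num.min e1 1 <= 1 by rewrite ge_min lexx orbT.
have hBt : nb (Ww 0) (b t) (B + 1).
  rewrite -(subrK (b x) (b t)) addrC; apply: nbD => //; exact: nb_mon h2.
have hDd n : w n * nC ((c t - c x) n) <= e1.
  by apply: le_trans m1; exact: nb_W_coef h3.
have hDt n : w n * nC (c t n) <= D + 1.
  have -> : c t n = c x n + (c t - c x) n by rewrite -[(c t - c x) n]/(c t n - c x n) addrC subrK.
  apply: le_trans (ler_wpM2l (w0 n) (nCD _ _)) _; rewrite mulrDr lerD//.
  by apply: le_trans m2; exact: nb_W_coef h3.
have -> : fam m (a t) (b t) (c t) k - fam m (a x) (b x) (c x) k =
   fam m (a t - a x) (b t) (c t) k + fam m (a x) (b t - b x) (c t) k
   + fam m (a x) (b x) (c t - c x) k.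
  apply/funext => p; rewrite -[LHS]/(fam m (a t) (b t) (c t) k p - fam m (a x) (b x) (c x) k p).
  rewrite -[RHS]/(fam m (a t - a x) (b t) (c t) k p + fam m (a x) (b t - b x) (c t) k p
   + fam m (a x) (b x) (c t - c x) k p) /fam.
  by rewrite -[(a t - a x) _]/(_ - _) -[(b t - b x) _]/(_ - _) -[(c t - c x) _]/(_ - _); ring.
have q1 := nb_fam k C0 w0 mC (nb_mon m1 h1) hBt hDt.
have q2 := nb_fam k C0 w0 mC hA (nb_mon m1 h2) hDt.
have q3 := nb_fam k C0 w0 mC hA hB hDd.
apply: nb_mon (nbD (nbD q1 q2) q3); apply: le_trans he1; rewrite /P.
rewrite le_eqVlt; apply/orP; left; apply/eqP; ring.
Qed.

End TrilinearTheory.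

(** * Locally Lipschitz maps on pairs of sequences *)

Section Lipschitz.
Context {R : realType}.
Notation seqs := (bool -> int -> R[i]).

Definition bdd (N : gnorm int) (r : R) (x : seqs) := forall b, nb N (x b) r.

(** Boundedness and Lipschitz continuity on every ball, with a constant depending on the radius, are
    what survives products and exponentials. *)
Definition lipb (N N' : gnorm (R := R) int) (F : seqs -> int -> R[i]) :=
  forall r : R, exists C : R, [/\ 0 <= C, forall x, bdd N r x -> nb N' (F x) C &
    forall x y D, bdd N r x -> bdd N r y -> (forall b, nb N (x b - y b) D) ->
      nb N' (F x - F y) (C * D)].

Lemma lip_proj N b : lipb N N (fun x => x b).
Proof.
move=> r; exists (Num.max r 1); split.
- by rewrite le_max ler01 orbT.
- by move=> x /(_ b); apply: nb_mon; rewrite le_max lexx.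
- move=> x y D hx hy /(_ b) h; have D0 := nb_ge0 h; apply: nb_mon h.
  by rewrite ler_peMl// le_max lexx orbT.
Qed.

Lemma lip_conv N N' C F G : algn N' C -> lipb N N' F -> lipb N N' G ->
  lipb N N' (fun x => conv (F x) (G x)).
Proof.
move=> hN hF hG r; have [A [A0 A1 A2]] := hF r; have [B [B0 B1 B2]] := hG r.
have C1 := algn_ge0 hN; have C0 : 0 <= C by lra.
exists (C * A * B + C * A * B); split; first by rewrite addr_ge0// !mulr_ge0.
  move=> x hx; apply: nb_mon (algn_conv hN (A1 x hx) (B1 x hx)).
  by rewrite lerDl !mulr_ge0.
move=> x y D hx hy hd.
have -> : conv (F x) (G x) - conv (F y) (G y) = conv (F x - F y) (G x) + conv (F y) (G x - G y).
  have sFx := algn_summ hN (A1 x hx); have sFy := algn_summ hN (A1 y hy).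
  have sGx := algn_summ hN (B1 x hx); have sGy := algn_summ hN (B1 y hy).
  by rewrite convBl// convBr// addrA subrK.
rewrite mulrDl; apply: nbD.
  by rewrite (_ : C * A * B * D = C * (A * D) * B); [exact: (algn_conv hN)(A2 _ _ _ hx hy hd)(B1 _ hx)|ring].
by rewrite (_ : C * A * B * D = C * A * (B * D)); [exact: (algn_conv hN)(A1 _ hy)(B2 _ _ _ hx hy hd)|ring].
Qed.

Lemma lipD N N' F G : lipb N N' F -> lipb N N' G -> lipb N N' (fun x => F x + G x).
Proof.
move=> hF hG r; have [A [A0 A1 A2]] := hF r; have [B [B0 B1 B2]] := hG r.
exists (A + B); split; first by rewrite addr_ge0.
  by move=> x hx; apply: nbD; [exact: A1|exact: B1].
move=> x y D hx hy hd; rewrite opprD addrACA mulrDl; apply: nbD; [exact: A2|exact: B2].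
Qed.

Lemma lipZ N N' F (k : R[i]) : lipb N N' F -> lipb N N' (fun x i => k * F x i).
Proof.
move=> hF r; have [A [A0 A1 A2]] := hF r.
exists (nC k * A); split; first by rewrite mulr_ge0 ?nC_ge0.
  by move=> x hx; apply: nbZ; exact: A1.
move=> x y D hx hy hd; have := nbZ k (A2 _ _ _ hx hy hd); rewrite mulrA; apply: nb_eq => i.
by rewrite -[(F x - F y) i]/(_ - _) mulrBr.
Qed.

Lemma lipN N N' F : lipb N N' F -> lipb N N' (fun x => - F x).
Proof.
move=> /(lipZ (-1)) h r; have [A [A0 A1 A2]] := h r; exists A; split=> //.
  by move=> x /A1; apply: nb_eq => i; rewrite mulN1r.
move=> x y D hx hy hd; apply: nb_eq (A2 _ _ _ hx hy hd) => i.
by rewrite -[LHS]/(-1 * F x i - -1 * F y i) !mulN1r.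
Qed.

Lemma lipB N N' F G : lipb N N' F -> lipb N N' G -> lipb N N' (fun x => F x - G x).
Proof. by move=> hF hG; apply: lipD => //; exact: lipN. Qed.

Lemma lip_weak N N' N'' F (C : R) : 0 <= C -> (forall a A, nb N' a A -> nb N'' a (C * A)) ->
  lipb N N' F -> lipb N N'' F.
Proof.
move=> C0 h hF r; have [A [A0 A1 A2]] := hF r.
exists (C * A); split; first by rewrite mulr_ge0.
  by move=> x hx; apply: h; exact: A1.
by move=> x y D hx hy hd; rewrite -mulrA; apply: h; exact: A2.
Qed.

Definition md (a : int -> R[i]) k : R[i] := a 0 * dl k.

(** Only frequency 0 is left, where all weights equal 1, so the exponent can change freely. A mean
    is therefore harmless even when a derivative stands under it. *)
Lemma nb_md s s' (a : int -> R[i]) A : nb (Hw s) a A -> nb (Hw s') (md a) A.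
Proof.
move=> h; have A0 := nb_ge0 h; have := nb_Hw_coef 0 h; rewrite wt_00 mul1r => h0.
have q := nbZ (a 0) (@nb_dl_H R s').
by rewrite mulr1 in q; exact: nb_mon h0 q.
Qed.

Lemma lip_md s s' N F : lipb N (Hw s) F -> lipb N (Hw s') (fun x => md (F x)).
Proof.
move=> hF r; have [A [A0 A1 A2]] := hF r; exists A; split=> //.
  by move=> x hx; exact: nb_md (A1 _ hx).
move=> x y D hx hy hd; have := @nb_md s s' _ _ (A2 _ _ _ hx hy hd); apply: nb_eq => i.
by rewrite /md -[(F x - F y) 0]/(_ - _) mulrBl.
Qed.

Lemma lip_Dq s N F : lipb N (Hw s) F -> lipb N (Hw (s - 1)) (fun x => Dq (F x)).
Proof.
move=> hF r; have [A [A0 A1 A2]] := hF r; exists A; split=> //.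
  by move=> x hx; exact: Dq_H (A1 _ hx).
by move=> x y D hx hy hd; rewrite -DqB; exact: Dq_H (A2 _ _ _ hx hy hd).
Qed.

Lemma lip_ccurve N N' F (lo hi r : R) (x : R -> seqs) : lipb N N' F ->
  (forall b, ccurve N lo hi (fun t => x t b)) ->
  (forall t, lo <= t <= hi -> bdd N r (x t)) -> ccurve N' lo hi (fun t => F (x t)).
Proof.
move=> hF cx bx t0 t0ab e e0; have [C [C0 _ hC]] := hF r.
have [e1 e10 he1] := ler_eps_div e0 C0.
have [d1 d10 H1] := cx true t0 t0ab e1 e10; have [d2 d20 H2] := cx false t0 t0ab e1 e10.
exists (Num.min d1 d2); first by rewrite lt_min d10.
move=> t tab; rewrite lt_min => /andP[/(H1 t tab) h1 /(H2 t tab) h2].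
apply: nb_mon (hC _ _ e1 (bx t tab) (bx t0 t0ab) _); first by rewrite mulrC.
by case.
Qed.

End Lipschitz.

(** * The gauged system and its normal form *)

Section System.
Context {R : realType}.
Notation seqs := (bool -> int -> R[i]).
Implicit Types (a w z : int -> R[i]) (j l n k : int) (b : bool) (x y : seqs) (M : R).

(* A state is the pair of coefficient sequences of u (index [true]) and v (index [false]); the linear part of
   the system multiplies the k-th coefficient by [Lk b k]. *)
Definition ep b : R[i] := if b then 'i else - 'i.
Definition kc k : R[i] := k%:~R.

Lemma epN b : ep (~~ b) = - ep b. Proof. by case: b; rewrite /= ?opprK. Qed.

Lemma ii : 'i * 'i = -1 :> R[i]. Proof. by rewrite -expr2 sqr_i. Qed.

Lemma ep2 b : ep b * ep b = -1. Proof. by case: b; rewrite /ep ?mulrNN ii. Qed.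

Lemma nC_ep b : nC (ep b) = 1.
Proof. by case: b; rewrite /= ?oppr0 ?sqrrN expr0n expr1n add0r sqrtr1. Qed.

Lemma kcE k : kc k = (k%:~R)%:C. Proof. by rewrite /kc rmorph_int. Qed.

Lemma ikE k : 0 +i* k%:~R = 'i * kc k.
Proof. by rewrite kcE; apply: complex_ext; rewrite ?cReM ?cImM /=; ring. Qed.

Lemma nC_kc k : nC (kc k) = `|k%:~R|. Proof. by rewrite kcE nC_real. Qed.

Lemma kcD j k : kc (j + k) = kc j + kc k. Proof. exact: rmorphD. Qed.
Definition Lk b k : R[i] := ep b * kc k ^+ 2.
Definition th b k : R := if b then k%:~R ^+ 2 else - (k%:~R ^+ 2).
(** The propagator exp(t [Lk b k]). That of the other component is its inverse, so multiplication by
    [ph (~~ b)] removes the linear part of component b. *)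
Definition ph b k (t : R) : R[i] := cos (th b k * t) +i* sin (th b k * t).

Lemma LkE b k : 0 +i* th b k = Lk b k.
Proof.
rewrite /Lk kcE; case: b; rewrite /th /ep; apply: complex_ext;
  by rewrite ?expr2 ?mulNr ?cReN ?cImN ?cReM ?cImM /= ?cReM ?cImM /=; ring.
Qed.

Lemma cder_ph b k lo hi : cder lo hi (ph b k) (fun t => Lk b k * ph b k t).
Proof. by rewrite -LkE; exact: cder_cis. Qed.

Lemma nC_ph b k t : nC (ph b k t) = 1. Proof. exact: nC_cis. Qed.

Lemma ph0 b k : ph b k 0 = 1. Proof. by rewrite /ph mulr0 cos0 sin0. Qed.

Lemma ph_opp b k t : ph b k (- t) * ph b k t = 1.
Proof.
rewrite /ph mulrN cosN sinN; apply: complex_ext; rewrite ?cReM ?cImM /=; last by ring.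
have := cos2Dsin2 (th b k * t); rewrite !expr2 mulNr opprK => ->; by [].
Qed.

Lemma phN b k t : ph (~~ b) k t = ph b k (- t).
Proof. by rewrite /ph mulrN; case: b; rewrite /th /= ?mulNr ?opprK. Qed.

Lemma ph_conj b k t : ph (~~ b) k t * ph b k t = 1.
Proof. by rewrite phN ph_opp. Qed.

Definition rho x := conv (x true) (x false) - md (conv (x true) (x false)).

(** The terms without loss of derivative: in the second one the derivative stands under a mean.
    Their coefficients are those that [Nq_forward] produces. *)
Definition Qn b x : int -> R[i] :=
  (fun k => - (ep b / 2) * conv (conv (rho x) (conv (x b) (x b))) (x (~~ b)) k)
  + conv (md (conv (x b) (Dq (x (~~ b))))) (x b)
  + (fun k => ep b / 4 * conv (md (conv (rho x) (rho x))) (x b) k).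

(* The nonlinearity after the gauge transformation: the derivative falls on the other component only. *)
Definition Nn b x : int -> R[i] := - conv (x b) (conv (x b) (Dq (x (~~ b)))) + Qn b x.

(* The frequency region in which the derivative falls on a dominating high frequency and is not
   absorbed by the other two factors. *)
Definition hi M j l n := (M <= `|n%:~R|) && (2 * (`|j%:~R| + `|l%:~R|) <= `|n%:~R| :> R).

Definition Psi b j l n := - Lk b (j + l + n) + Lk b j + Lk b l + Lk (~~ b) n.

(** The quadratic form factors because two of the inputs have the dispersion sign of the output and
    the third, of frequency n, has the opposite one. *)
Lemma PsiE b j l n : Psi b j l n = - (2 * ep b) * ((kc l + kc n) * (kc j + kc n)).
Proof. by rewrite /Psi /Lk epN !kcD; ring. Qed.

Definition mH M j l n : R[i] := if hi M j l n then - (0 +i* n%:~R) else 0.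
Definition mL M j l n : R[i] := if hi M j l n then 0 else - (0 +i* n%:~R).
Definition mB b M j l n : R[i] := if hi M j l n then - (0 +i* n%:~R) / Psi b j l n else 0.

Lemma hi_n M j l n : 1 <= M -> hi M j l n -> 1 <= `|n%:~R| :> R.
Proof. by move=> M1 /andP[h _]; lra. Qed.

Lemma hi_sum M j l n : hi M j l n -> `|n%:~R| <= 2 * `|j%:~R + n%:~R| :> R /\
   `|n%:~R| <= 2 * `|l%:~R + n%:~R| :> R.
Proof.
move=> /andP[_ h].
have hj : `|n%:~R| <= `|j%:~R + n%:~R| + `|j%:~R| :> R.
  by have := ler_normB (j%:~R + n%:~R : R) j%:~R; rewrite addrAC subrr add0r.
have hl : `|n%:~R| <= `|l%:~R + n%:~R| + `|l%:~R| :> R.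
  by have := ler_normB (l%:~R + n%:~R : R) l%:~R; rewrite addrAC subrr add0r.
by have := normr_ge0 (j%:~R : R); have := normr_ge0 (l%:~R : R); split; lra.
Qed.

Lemma nC_Psi b j l n : nC (Psi b j l n) = 2 * (`|l%:~R + n%:~R| * `|j%:~R + n%:~R|).
Proof.
rewrite PsiE nCM nCN !nCM nC_ep -!kcD !nC_kc !rmorphD mulr1.
by congr (_ * _); rewrite -[2]/(2%:R) -(rmorph_nat (real_complex R)) nC_real ger0_norm.
Qed.

Lemma Psi_ge M b j l n : hi M j l n -> `|n%:~R| ^+ 2 <= 2 * nC (Psi b j l n).
Proof.
move=> /hi_sum[h1 h2]; rewrite nC_Psi expr2.
have := ler_pM (normr_ge0 _) (normr_ge0 _) h1 h2; lra.
Qed.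

(** The phase is at least n^2 / 2 and the derivative costs n, so one power of n is left. [mB_wt]
    spends it on smoothing, [mB_small] on a factor 1/M. *)
Lemma mB_le M b j l n : 1 <= M -> nC (mB b M j l n) * `|n%:~R| <= 2.
Proof.
move=> M1; rewrite /mB; case: ifP => h; last by rewrite nC0 mul0r.
have n1 := hi_n M1 h; have hP := Psi_ge b h.
have P0 : 0 < nC (Psi b j l n).
  have : 1 <= `|n%:~R| ^+ 2 :> R by rewrite exprn_ege1.
  lra.
by rewrite nCM nCN nC_ik Normc.normcV mulrAC ler_pdivrMr.
Qed.

Lemma mB_Psi M b j l n : 1 <= M -> Psi b j l n * mB b M j l n = mH M j l n.
Proof.
move=> M1; rewrite /mB /mH; case: ifP => h; last by rewrite mulr0.
have n1 := hi_n M1 h; have hP := Psi_ge b h.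
rewrite mulrC divfK//; apply/eqP => P0; move: hP; rewrite P0 nC0 mulr0 => hP.
by have : 1 <= `|n%:~R| ^+ 2 :> R by [rewrite exprn_ege1]; lra.
Qed.

Lemma wt1_le2 n : 1 <= `|n%:~R| :> R -> wt 1 n <= 2 * `|n%:~R| :> R.
Proof.
move=> n1; rewrite -(@ler_pXn2r _ 2)//= ?nnegrE ?wt_ge0 ?mulr_ge0//.
rewrite wt1_sqr exprMn real_normK ?num_real//.
have : 1 <= (n%:~R : R) ^+ 2 by rewrite -real_normK ?num_real// exprn_ege1.
lra.
Qed.

Lemma mB_wt M b j l n : 1 <= M -> nC (mB b M j l n) <= 4 * wt (-1) n.
Proof.
move=> M1; rewrite wtN ler_pdivlMr ?wt_gt0//.
case h : (hi M j l n); last by rewrite /mB h nC0 mul0r.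
have n1 := hi_n M1 h; have := mB_le b j l n M1.
have := ler_wpM2l (nC_ge0 (mB b M j l n)) (wt1_le2 n1); lra.
Qed.

Lemma mB_small M b j l n : 1 <= M -> nC (mB b M j l n) <= 2 / M.
Proof.
move=> M1; rewrite ler_pdivlMr; last by lra.
case h : (hi M j l n); last by rewrite /mB h nC0 mul0r.
apply: le_trans (mB_le b j l n M1); rewrite ler_wpM2l ?nC_ge0//.
by case/andP: h.
Qed.

Lemma hi_wt M j l n : hi M j l n -> wt 1 (j + l + n) <= 2 * wt 1 n :> R.
Proof.
move=> /andP[_ h]; rewrite -(@ler_pXn2r _ 2)//= ?nnegrE ?wt_ge0 ?mulr_ge0 ?wt_ge0//.
rewrite exprMn !wt1_sqr !rmorphD/=.
have h2 : `|j%:~R + l%:~R + n%:~R| <= 2 * `|n%:~R| :> R.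
  apply: le_trans (ler_normD _ _) _; apply: le_trans (lerD (ler_normD _ _) (lexx _)) _.
  have := normr_ge0 (n%:~R : R); lra.
have : `|j%:~R + l%:~R + n%:~R| ^+ 2 <= (2 * `|n%:~R|) ^+ 2 :> R.
  by rewrite ler_sqr ?nnegrE ?mulr_ge0.
rewrite exprMn !real_normK ?num_real//; lra.
Qed.

Lemma mB_good M b : 1 <= M -> mgood (mB b M) (wt (-1)).
Proof.
move=> M1; split; first by move=> i; exact: wt_ge0.
by exists 4 => // j l n; exact: mB_wt.
Qed.

Lemma mH_good M : mgood (mH M) (wt 1).
Proof.
split; first by move=> i; exact: wt_ge0.
exists 1 => // j l n; rewrite /mH mul1r; case: ifP => _; last by rewrite nC0 wt_ge0.
by rewrite nCN nC_ik le_wt1.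
Qed.

Lemma mL_good M : mgood (mL M) (wt 1).
Proof.
split; first by move=> i; exact: wt_ge0.
exists 1 => // j l n; rewrite /mL mul1r; case: ifP => _; first by rewrite nC0 wt_ge0.
by rewrite nCN nC_ik le_wt1.
Qed.

Lemma Nn_split M b x : summ (x b) -> summ (x (~~ b)) -> wbd (wt 1) (x (~~ b)) -> summ (Dq (x (~~ b))) ->
  Nn b x = mc3 (mH M) (x b) (x b) (x (~~ b)) + mc3 (mL M) (x b) (x b) (x (~~ b)) + Qn b x.
Proof.
move=> s1 s2 w1 sD; rewrite -(mc3_addm (mH_good M) (mL_good M))//; congr (_ + _).
apply/funext => k; rewrite -[LHS]/(- conv (x b) (conv (x b) (Dq (x (~~ b)))) k).
have sc := summ_conv s1 sD.
rewrite {1}/conv -csumN; last exact: conv_summ.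
apply: eq_csum => j; rewrite -mulrN; congr (_ * _).
rewrite /conv -csumN; last exact: conv_summ.
apply: eq_csum => l; rewrite /mH /mL /Dq; case: ifP => _; rewrite ?addr0 ?add0r; ring.
Qed.

Section Estimates.
Variables (s : R).
Hypothesis hs : 3 / 2 < s.
Let s0 : 0 <= s. Proof. by have := hs; lra. Qed.

(** The threshold 3/2 enters here: one derivative of a sequence in H^s is absolutely summable when s
    - 1 > 1/2. *)
Lemma X_W1 : exists2 K, 1 <= K & forall a A, nb (Hw s) a A -> nb (Ww 1) a (K * A).
Proof.
have [|K K0 hK] := @Hw_Ww R s 1; first by have := hs; lra.
exists (1 + K) => [|a A h]; first by lra.
by apply: nb_mon (hK _ _ h); apply: ler_wpM2r; [exact: nb_ge0 h|lra].
Qed.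

Lemma X1_W0 : exists2 K, 1 <= K & forall a A, nb (Hw (s - 1)) a A -> nb (Ww 0) a (K * A).
Proof.
have [|K K0 hK] := @Hw_Ww R (s - 1) 0; first by have := hs; lra.
exists (1 + K) => [|a A h]; first by lra.
by apply: nb_mon (hK _ _ h); apply: ler_wpM2r; [exact: nb_ge0 h|lra].
Qed.

Lemma X_facts a A : nb (Hw s) a A -> [/\ summ a, summ (Dq a), wbd (wt 1) a, wbd (wt (-1)) a & wbd (wt 0) a].
Proof.
move=> h; have [K _ hK] := X_W1; have h1 := hK _ _ h.
have sm (r : R) : r <= 1 -> wbd (wt r) a.
  move=> r1; exists (K * A) => n; apply: nb_Ww_coef; exact: Ww_mono h1.
split.
- exact: W0_summ (Ww_mono ler01 h1).
- by apply: (@W0_summ _ _ (K * A)); apply: Dq_W; rewrite add0r.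
- exact: sm.
- by apply: sm; lra.
- exact: sm.
Qed.

(** The spare power of n becomes the factor 2/M; the output weight goes to the dominating frequency
    n by [hi_wt]. *)
Lemma B_bound M b a1 a2 a3 A1 A2 A3 : 1 <= M ->
  nb (Ww 0) a1 A1 -> nb (Ww 0) a2 A2 -> nb (Hw s) a3 A3 ->
  nb (Hw s) (mc3 (mB b M) a1 a2 a3) (2 `^ s * (2 / M) * A1 * A2 * A3).
Proof.
move=> M1 h1 h2 h3; have [_ _ _ w3 _] := X_facts h3; case: w3 => D3 hD3.
have M0 : 0 < M by lra.
apply: (mc3_Hc (w1 := wt 0) (w2 := wt 0) (w3 := wt s) _ _ _ _ _ _ _ _ (fun j l n => mB_wt b j l n M1) h1 h2 hD3 h1 h2 h3) => //;
  try by move=> i; exact: wt_ge0.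
- by rewrite mulr_ge0 ?powR_ge0// divr_ge0// ltW.
- move=> j l n; rewrite !wt0 !mulr1.
  case h : (hi M j l n); last by rewrite /mB h nC0 mul0r !mulr_ge0 ?powR_ge0 ?wt_ge0// invr_ge0 ltW.
  rewrite (_ : 2 `^ s * (2 / M) * wt s n = (2 / M) * (2 `^ s * wt s n)); last by ring.
  apply: ler_pM; rewrite ?nC_ge0 ?wt_ge0//; first exact: mB_small.
  by apply: wt_le_pow => //; exact: (hi_wt h).
Qed.

(** The spare power of n becomes a derivative, so the third factor may be a nonlinearity, which lies
    in H^(s-1) only. *)
Lemma B_bound1 M b a1 a2 a3 A1 A2 A3 : 1 <= M ->
  nb (Ww 0) a1 A1 -> nb (Ww 0) a2 A2 -> nb (Hw (s - 1)) a3 A3 ->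
  nb (Hw s) (mc3 (mB b M) a1 a2 a3) (2 `^ s * 4 * A1 * A2 * A3).
Proof.
move=> M1 h1 h2 h3; have [K _ hK] := X1_W0; have h3' := hK _ _ h3.
have hD n : wt (-1) n * nC (a3 n) <= K * A3.
  by apply: nb_Ww_coef; apply: Ww_mono h3'; rewrite lerNl oppr0.
apply: (mc3_Hc (w1 := wt 0) (w2 := wt 0) (w3 := wt (s - 1)) _ _ _ _ _ _ _ _ (fun j l n => mB_wt b j l n M1) h1 h2 hD h1 h2 h3) => //;
  try by move=> i; exact: wt_ge0.
- move=> j l n; rewrite !wt0 !mulr1.
  case h : (hi M j l n); last by rewrite /mB h nC0 mul0r !mulr_ge0 ?powR_ge0 ?wt_ge0.
  rewrite (_ : 2 `^ s * 4 * wt (s - 1) n = (4 * wt (-1) n) * (2 `^ s * wt s n)); last first.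
    by rewrite wtD; ring.
  apply: ler_pM; rewrite ?nC_ge0 ?wt_ge0//; first exact: mB_wt.
  by apply: wt_le_pow => //; exact: (hi_wt h).
Qed.

(** The factor of largest frequency takes the H^s norm. If that frequency is j or l, the derivative
    falls on a smaller one and is absorbed by the weighted l^1 norm of the third factor; if it is n,
    the complement of [hi] lets the other two factors absorb the derivative. *)
Lemma L_bound M : 1 <= M -> exists2 K, 0 <= K & forall a1 a2 a3 A1 A2 A3,
  nb (Hw s) a1 A1 -> nb (Hw s) a2 A2 -> nb (Hw s) a3 A3 ->
  nb (Hw s) (mc3 (mL M) a1 a2 a3) (K * A1 * A2 * A3).
Proof.
move=> M1; have [K0 K01 hK] := X_W1.
pose P := (3 : R) `^ s; have P0 : 0 <= P by exact: powR_ge0.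
have K00 : 0 <= K0 by lra.
have M40 : 0 <= M + 4 by lra.
exists (P * K0 * K0 + P * K0 * K0 + (M + 4) * P * K0 * K0).
  by rewrite !addr_ge0// !mulr_ge0.
move=> a1 a2 a3 A1 A2 A3 h1 h2 h3.
pose c1 j l n := (wt 1 l <= wt 1 j :> R) && (wt 1 n <= wt 1 j :> R).
pose c2 j l n := ~~ c1 j l n && ((wt 1 j <= wt 1 l :> R) && (wt 1 n <= wt 1 l :> R)).
pose c3 j l n := ~~ c1 j l n && ~~ c2 j l n.
pose m (c : int -> int -> int -> bool) j l n := if c j l n then mL M j l n else 0 : R[i].
have mw c j l n : nC (m c j l n) <= 1 * wt 1 n.
  by rewrite /m; case: ifP => _; [have [_ [C _ h]] := mL_good M; rewrite mul1r; apply: le_trans (_ : nC (mL M j l n) <= _) => //; rewrite /mL; case: ifP => _; rewrite ?nC0 ?wt_ge0// nCN nC_ik le_wt1|rewrite nC0 mul1r wt_ge0].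
have mg c : mgood (m c) (wt 1) by split; [move=> i; exact: wt_ge0|exists 1].
have mn c j l n : nC (m c j l n) <= `|n%:~R|.
  by rewrite /m /mL; case: ifP => _; [case: ifP => _|]; rewrite ?nC0// nCN nC_ik.
have [s1 _ _ _ _] := X_facts h1; have [s2 _ _ _ _] := X_facts h2.
have [s3 _ w3 _ _] := X_facts h3.
have E : mc3 (mL M) a1 a2 a3 = mc3 (m c1) a1 a2 a3 + mc3 (m c2) a1 a2 a3 + mc3 (m c3) a1 a2 a3.
  rewrite -(mc3_addm (mg c1) (mg c2))//.
  have mg12 : mgood (fun j l n => m c1 j l n + m c2 j l n) (wt 1).
    split; first by move=> i; exact: wt_ge0.
    exists 2 => // j l n; apply: le_trans (nCD _ _) _; have := mw c1 j l n; have := mw c2 j l n; lra.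
  rewrite -(mc3_addm mg12 (mg c3))//; apply: mc3_ext => j l n.
  rewrite /m /c3 /c2; case: (c1 j l n) => /=; first by rewrite !addr0.
  by case: ifP => /= _; rewrite ?addr0 ?add0r.
have W1 := hK _ _ h1; have W2 := hK _ _ h2; have W3 := hK _ _ h3.
have W01 := Ww_mono ler01 W1; have W02 := Ww_mono ler01 W2.
have [D3 hD3] := w3.
have tri j l n : wt 1 (j + l + n) <= wt 1 j + wt 1 l + wt 1 n :> R.
  by apply: le_trans (wt1_add _ _) _; rewrite lerD2r; exact: wt1_add.
have b3 j l n k : wt 1 j <= wt 1 k :> R -> wt 1 l <= wt 1 k :> R -> wt 1 n <= wt 1 k :> R ->
    wt s (j + l + n) <= P * wt s k.
  move=> q1 q2 q3; apply: wt_le_pow => //; have := tri j l n.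
  set u := wt 1 _; lra.
have q1 : nb (Hw s) (mc3 (m c1) a1 a2 a3) (P * A1 * (K0 * A2) * (K0 * A3)).
  apply: (mc3_Ha (w1 := wt s) (w2 := wt 0) (w3 := wt 1) (w := wt 1) (C' := 1) _ _ _ _ _ _ _ _ (mw c1) W01 W02 hD3 h1 W02 W3) => //;
    try by move=> i; exact: wt_ge0.
  move=> j l n; rewrite wt0 mulr1; case h : (c1 j l n); last by rewrite /m h nC0 mul0r !mulr_ge0 ?wt_ge0.
  case/andP: (h) => g1 g2; rewrite mulrC; apply: ler_pM; rewrite ?nC_ge0 ?wt_ge0//; first exact: b3.
  by apply: le_trans (mn _ _ _ _) (le_wt1 _).
have q2 : nb (Hw s) (mc3 (m c2) a1 a2 a3) (P * (K0 * A1) * A2 * (K0 * A3)).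
  apply: (mc3_Hb (w1 := wt 0) (w2 := wt s) (w3 := wt 1) _ _ _ _ _ _ _ _ (mw c2) W01 W02 hD3 W01 h2 W3) => //;
    try by move=> i; exact: wt_ge0.
  move=> j l n; rewrite wt0 mulr1; case h : (c2 j l n); last by rewrite /m h nC0 mul0r !mulr_ge0 ?wt_ge0.
  case/andP: (h) => _ /andP[g1 g2]; rewrite mulrC; apply: ler_pM; rewrite ?nC_ge0 ?wt_ge0//; first exact: b3.
  by apply: le_trans (mn _ _ _ _) (le_wt1 _).
have q3 : nb (Hw s) (mc3 (m c3) a1 a2 a3) ((M + 4) * P * (K0 * A1) * (K0 * A2) * A3).
  apply: (mc3_Hc (w1 := wt 1) (w2 := wt 1) (w3 := wt s) _ _ _ _ _ _ _ _ (mw c3) W01 W02 hD3 W1 W2 h3) => //;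
    try by move=> i; exact: wt_ge0.
    by rewrite mulr_ge0.
  move=> j l n; have wj := wt_ge1 j (ler01 : 0 <= 1 :> R); have wl := wt_ge1 l (ler01 : 0 <= 1 :> R).
  have pos : 0 <= (M + 4) * P * wt 1 j * wt 1 l * wt s n.
    by rewrite !mulr_ge0 ?wt_ge0.
  case h : (c3 j l n); last by rewrite /m h nC0 mul0r.
  have /andP[nc1 nc2] := h; rewrite /c2 nc1 /= in nc2.
  have g : wt 1 j <= wt 1 n :> R /\ wt 1 l <= wt 1 n :> R.
    clear -nc1 nc2; move: nc1 nc2; rewrite /c1 !negb_and -!ltNge.
    by move=> /orP[u1|u1] /orP[u2|u2]; split; lra.
  rewrite /m h /mL; case hh : (hi M j l n); first by rewrite nC0 mul0r.
  rewrite nCN nC_ik.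
  (* Outside [hi] either |n| < M, or |n| < 2 (|j| + |l|), which is at most 4 times the product of
     the brackets of j and l. *)
  have nb1 : `|n%:~R| <= (M + 4) * (wt 1 j * wt 1 l) :> R.
    have jl1 : 1 <= wt 1 j * wt 1 l :> R by rewrite -[leLHS]mulr1 ler_pM.
    have jl2 : wt 1 j <= wt 1 j * wt 1 l :> R by rewrite ler_peMr ?wt_ge0.
    have jl3 : wt 1 l <= wt 1 j * wt 1 l :> R by rewrite ler_peMl ?wt_ge0.
    have := ler_wpM2l (_ : 0 <= M) jl1; rewrite mulr1 => /(_ _) jl4.
    have {}jl4 : M <= M * (wt 1 j * wt 1 l) by apply: jl4; lra.
    move: hh => /negbT; rewrite /hi negb_and -!ltNge => /orP[u|u]; first by lra.
    have := le_wt1 (R := R) j; have := le_wt1 (R := R) l; lra.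
  rewrite (_ : _ * wt s n = ((M + 4) * (wt 1 j * wt 1 l)) * (P * wt s n)); last by ring.
  by apply: ler_pM; rewrite ?wt_ge0//; apply: b3; case: g.
rewrite E; apply: nb_mon (nbD (nbD q1 q2) q3).
rewrite le_eqVlt; apply/orP; left; apply/eqP; ring.
Qed.

Lemma algX : exists C, algn (Hw (R := R) s) C. Proof. by apply: algn_Hw; have := hs; lra. Qed.
Lemma algX1 : exists C, algn (Hw (R := R) (s - 1)) C. Proof. by apply: algn_Hw; have := hs; lra. Qed.

Notation X := (Hw (R := R) s).
Notation X1 := (Hw (R := R) (s - 1)).

Lemma lip_rho : lipb X X rho.
Proof.
have [C hC] := algX; apply: lipB; last apply: (@lip_md _ s s).
  by apply: (lip_conv hC); exact: lip_proj.
by apply: (lip_conv hC); exact: lip_proj.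
Qed.

Lemma lip_incl b : lipb X X1 (fun x => x b).
Proof.
apply: (@lip_weak _ _ X _ _ 1) => //; last exact: lip_proj.
by move=> a A h; rewrite mul1r; apply: Hw_mono h; rewrite gerDl lerN10.
Qed.

Lemma lip_wDz b : lipb X X1 (fun x => conv (x b) (Dq (x (~~ b)))).
Proof.
have [C1 hC1] := algX1; apply: (lip_conv hC1); first exact: lip_incl.
by apply: (@lip_Dq _ s); exact: lip_proj.
Qed.

Lemma lip_Qn b : lipb X X (Qn b).
Proof.
have [C hC] := algX.
apply: lipD; first apply: lipD.
- apply: (@lipZ _ X X (fun x => conv (conv (rho x) (conv (x b) (x b))) (x (~~ b)))).
  apply: (lip_conv hC); last exact: lip_proj.
  apply: (lip_conv hC); first exact: lip_rho.
  by apply: (lip_conv hC); exact: lip_proj.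
- by apply: (lip_conv hC); [apply: (@lip_md _ (s - 1)); exact: lip_wDz|exact: lip_proj].
- apply: (@lipZ _ X X (fun x => conv (md (conv (rho x) (rho x))) (x b))).
  apply: (lip_conv hC); last exact: lip_proj.
  by apply: (@lip_md _ s); apply: (lip_conv hC); exact: lip_rho.
Qed.

Lemma lip_Nn b : lipb X X1 (Nn b).
Proof.
have [C1 hC1] := algX1; apply: lipD.
  by apply: lipN; apply: (lip_conv hC1); [exact: lip_incl|exact: lip_wDz].
apply: (@lip_weak _ _ X _ _ 1) => //; last exact: lip_Qn.
by move=> a A h; rewrite mul1r; apply: Hw_mono h; rewrite gerDl lerN10.
Qed.

End Estimates.
End System.

(** * Integration by parts in time and one Picard step *)

Section NormalForm.
Context {R : realType}.
Notation seqs := (bool -> int -> R[i]).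
Implicit Types (j l n k : int) (b : bool) (M : R).
Variables (s : R).
Hypothesis hs : 3 / 2 < s.
Notation X := (Hw (R := R) s).
Notation X1 := (Hw (R := R) (s - 1)).

Lemma ccurve_weak (N N' : gnorm (R := R) int) C lo hi f : 0 <= C ->
  (forall a A, nb N a A -> nb N' a (C * A)) -> ccurve N lo hi f -> ccurve N' lo hi f.
Proof.
move=> C0 h cf x xab e e0; have [e1 e10 he] := ler_eps_div e0 C0.
have [d d0 H] := cf x xab _ e10; exists d => // t tab tx.
by apply: nb_mon (h _ _ (H t tab tx)); rewrite mulrC.
Qed.

Lemma ccurve_X_W r lo hi f : r <= 1 -> ccurve X lo hi f -> ccurve (Ww r) lo hi f.
Proof.
move=> r1; have [K K1 hK] := X_W1 hs; apply: (@ccurve_weak _ _ K); first by lra.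
by move=> a A /hK; exact: Ww_mono.
Qed.

Lemma ccurve_W_mono r r' lo hi (f : R -> int -> R[i]) : r <= r' -> ccurve (Ww r') lo hi f -> ccurve (Ww r) lo hi f.
Proof.
by move=> rr; apply: (@ccurve_weak _ _ 1) => // a A h; rewrite mul1r; exact: Ww_mono h.
Qed.

Lemma ccurve_X1_W0 lo hi f : ccurve X1 lo hi f -> ccurve (Ww 0) lo hi f.
Proof.
have [K K1 hK] := X1_W0 hs; apply: (@ccurve_weak _ _ K) => //; lra.
Qed.

Lemma ccurveD (I : choiceType) (N : gnorm (R := R) I) lo hi f g : ccurve N lo hi f -> ccurve N lo hi g ->
  ccurve N lo hi (fun t => f t + g t).
Proof.
move=> cf cg x xab e e0; have e2 : 0 < e / 2 by rewrite divr_gt0.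
have [d d0 H] := cf x xab _ e2; have [d' d'0 H'] := cg x xab _ e2.
exists (Num.min d d'); first by rewrite lt_min d0.
move=> t tab; rewrite lt_min => /andP[/(H t tab) h /(H' t tab) h'].
by rewrite opprD addrACA (splitr e); exact: nbD.
Qed.

Lemma ccurveZ (I : choiceType) (N : gnorm (R := R) I) lo hi f (k : R[i]) : ccurve N lo hi f ->
  ccurve N lo hi (fun t i => k * f t i).
Proof.
move=> cf x xab e e0; have [e1 e10 he] := ler_eps_div e0 (nC_ge0 k).
have [d d0 H] := cf x xab _ e10; exists d => // t tab tx.
have q := nbZ k (H t tab tx); rewrite mulrC in q; apply: nb_mon he _.
by apply: nb_eq q => i; rewrite -[(f t - f x) i]/(_ - _) mulrBr.
Qed.

Definition Bn b M (x : seqs) := mc3 (mB b M) (x b) (x b) (x (~~ b)).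

(* The derivative of [Bn] in the direction [nu], and what the normal form leaves of the nonlinearity. *)
Definition B3 b M (x nu : seqs) := mc3 (mB b M) (nu b) (x b) (x (~~ b))
  + mc3 (mB b M) (x b) (nu b) (x (~~ b)) + mc3 (mB b M) (x b) (x b) (nu (~~ b)).

Definition Gn b M (x nu : seqs) :=
  mc3 (mL M) (x b) (x b) (x (~~ b)) + Qn b x - B3 b M x nu.

Lemma summ_wbd r (c : int -> R[i]) : r <= 0 -> summ c -> wbd (wt r) c.
Proof.
move=> r0 /summ_W0[A hA]; exists A => n; apply: nb_Ww_coef; exact: Ww_mono hA.
Qed.

(* Normal form: integrating by parts the high-frequency part of the nonlinearity, whose phase is
   [Psi], trades its derivative for the trilinear terms [B3] involving [nu]. *)
Lemma step_der (lo hi r : R) (x nu : R -> seqs) (y : R -> int -> R[i]) b M : 1 <= M ->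
  (forall b, ccurve X lo hi (x ^~ b)) -> (forall t, lo <= t <= hi -> bdd X r (x t)) ->
  (forall b, ccurve (Ww 0) lo hi (nu ^~ b)) ->
  (forall t b, lo <= t <= hi -> summ (nu t b)) ->
  (forall b k, cder lo hi (fun t => x t b k) (fun t => Lk b k * x t b k + nu t b k)) ->
  (forall k, cder lo hi (y ^~ k) (fun t => Lk b k * y t k + Nn b (x t) k)) ->
  forall k, cder lo hi (fun t => ph (~~ b) k t * (y t k - Bn b M (x t) k))
    (fun t => ph (~~ b) k t * Gn b M (x t) (nu t) k).
Proof.
move=> M1 cx bx cnu snu dx dy k.
have gB := mB_good b M1; have gH := mH_good (R := R) M.
have sx t b' : lo <= t <= hi -> summ (x t b') by move=> /bx /(_ b') /(X_facts hs)[].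
have wx t b' : lo <= t <= hi -> wbd (wt (-1)) (x t b') by move=> /bx /(_ b') /(X_facts hs)[].
have w1x t b' : lo <= t <= hi -> wbd (wt 1) (x t b') by move=> /bx /(_ b') /(X_facts hs)[].
have wnu t b' : lo <= t <= hi -> wbd (wt (-1)) (nu t b').
  by move=> tab; apply: summ_wbd; [rewrite lerNl oppr0|exact: snu].
have c0x b' : ccurve (Ww 0) lo hi (x ^~ b') by apply: ccurve_X_W => //; exact: cx.
have c1x b' : ccurve (Ww 1) lo hi (x ^~ b') by apply: ccurve_X_W => //; exact: cx.
have cmx b' : ccurve (Ww (-1)) lo hi (x ^~ b') by apply: ccurve_X_W; [lra|exact: cx].
have cmnu b' : ccurve (Ww (-1)) lo hi (nu ^~ b') by apply: ccurve_W_mono (cnu b'); rewrite lerNl oppr0.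
pose F t := fam (mB b M) (x t b) (x t b) (x t (~~ b)) k.
pose f0 t := fam (mH M) (x t b) (x t b) (x t (~~ b)) k.
pose f1 t := fam (mB b M) (nu t b) (x t b) (x t (~~ b)) k.
pose f2 t := fam (mB b M) (x t b) (nu t b) (x t (~~ b)) k.
pose f3 t := fam (mB b M) (x t b) (x t b) (nu t (~~ b)) k.
(* The linear parts of the three factors contribute their symbols, whose sum is [Psi] plus [Lk b k];
   by [mB_Psi] the first gives the high part [f0], the second the linear term. *)
pose F' t := f0 t + (fun p => Lk b k * F t p) + f1 t + f2 t + f3 t.
have dF p : cder lo hi (F ^~ p) (F' ^~ p).
  case: p => j l; pose n := k - j - l.
  have := cderM (dx b j) (cderM (cderM (@cder_cst R lo hi (mB b M j l n)) (dx b l)) (dx (~~ b) n)).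
  apply: cder_eq => // t _.
  rewrite -[F' t (j, l)]/(f0 t (j, l) + Lk b k * F t (j, l) + f1 t (j, l) + f2 t (j, l) + f3 t (j, l)).
  rewrite /f0 /F /f1 /f2 /f3 /fam /= -/n -(mB_Psi b j l n M1) /Psi.
  have -> : j + l + n = k by rewrite /n; ring.
  ring.
have [P1 P2 P3 P4 P5] : [/\ forall t, lo <= t <= hi -> summ (F t) /\ Bn b M (x t) k = csum (F t),
    forall t, lo <= t <= hi -> summ (f0 t) /\ mc3 (mH M) (x t b) (x t b) (x t (~~ b)) k = csum (f0 t),
    forall t, lo <= t <= hi -> summ (f1 t) /\ mc3 (mB b M) (nu t b) (x t b) (x t (~~ b)) k = csum (f1 t),
    forall t, lo <= t <= hi -> summ (f2 t) /\ mc3 (mB b M) (x t b) (nu t b) (x t (~~ b)) k = csum (f2 t) &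
    forall t, lo <= t <= hi -> summ (f3 t) /\ mc3 (mB b M) (x t b) (x t b) (nu t (~~ b)) k = csum (f3 t)].
  split=> t tab; [apply: (mc3_pair k gB)|apply: (mc3_pair k gH)|apply: (mc3_pair k gB)|
    apply: (mc3_pair k gB)|apply: (mc3_pair k gB)]; auto.
have sF' t : lo <= t <= hi -> summ (F' t) /\ csum (F' t) =
    mc3 (mH M) (x t b) (x t b) (x t (~~ b)) k + Lk b k * Bn b M (x t) k + B3 b M (x t) (nu t) k.
  move=> tab; have [a1 a2] := P1 t tab; have [b1 b2] := P2 t tab; have [c1 c2] := P3 t tab.
  have [d1 d2] := P4 t tab; have [e1 e2] := P5 t tab.
  have z1 := summZ (Lk b k) a1.
  have z2 : summ (f0 t + (fun p => Lk b k * F t p)) := summD b1 z1.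
  have z3 : summ (f0 t + (fun p => Lk b k * F t p) + f1 t) := summD z2 c1.
  have z4 : summ (f0 t + (fun p => Lk b k * F t p) + f1 t + f2 t) := summD z3 d1.
  split; first exact: (summD z4 e1).
  rewrite (csumD z4 e1) (csumD z3 d1) (csumD z2 c1) (csumD b1 z1) csumZ// a2 b2.
  rewrite -[B3 b M _ _ k]/(mc3 (mB b M) (nu t b) (x t b) (x t (~~ b)) k
  + mc3 (mB b M) (x t b) (nu t b) (x t (~~ b)) k + mc3 (mB b M) (x t b) (x t b) (nu t (~~ b)) k) c2 d2 e2.
  by rewrite !addrA.
have cF' : ccurve (Wn (fun=> 1)) lo hi F'.
  apply: ccurveD; first apply: ccurveD; first apply: ccurveD; first apply: ccurveD.
  - by apply: (fam_ccurve k gH) => //; auto.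
  - by apply: ccurveZ; apply: (fam_ccurve k gB) => //; auto.
  - by apply: (fam_ccurve k gB) => //; auto.
  - by apply: (fam_ccurve k gB) => //; auto.
  - by apply: (fam_ccurve k gB) => //; auto.
have dB := cder_csum dF (fun t tab => (P1 t tab).1) (fun t tab => (sF' t tab).1) cF'.
have := cderM (@cder_ph R (~~ b) k lo hi) (cderB (dy k) dB).
apply: cder_eq => t tab; first by rewrite (P1 t tab).2.
rewrite -(P1 t tab).2 (sF' t tab).2 /Lk epN.
have [s1 sD w1 _ _] := X_facts hs (bx t tab (~~ b)).
rewrite (Nn_split M (sx t b tab) s1 w1 sD).
rewrite -[Gn b M _ _ k]/(mc3 (mL M) (x t b) (x t b) (x t (~~ b)) k + Qn b (x t) k - B3 b M (x t) (nu t) k).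
rewrite -[(mc3 (mH M) _ _ _ + _ + _) k]/(mc3 (mH M) (x t b) (x t b) (x t (~~ b)) k + mc3 (mL M) (x t b) (x t b) (x t (~~ b)) k + Qn b (x t) k).
move: (mc3 (mH M) _ _ _ k) (mc3 (mL M) _ _ _ k) (Qn b _ k) (B3 _ _ _ _ k) (Bn b M _ k) (y t k) (ph _ _ _) (ep b) (kc k).
by move=> *; ring.
Qed.

Lemma Bn_lip : exists2 C, 1 <= C & forall b M r, 1 <= M ->
  (forall x, bdd X r x -> nb X (Bn b M x) (C / M * r ^+ 3)) /\
  (forall x y D, bdd X r x -> bdd X r y -> (forall b, nb X (x b - y b) D) ->
     nb X (Bn b M x - Bn b M y) (C / M * r ^+ 2 * D)).
Proof.
have [K K1 hK] := X_W1 hs.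
pose C0 : R := 2 `^ s * 2 * K * K.
have C00 : 0 <= C0 by rewrite !mulr_ge0 ?powR_ge0//; lra.
exists (1 + 3 * C0); first by lra.
move=> b M r M1; have M0 : 0 < M by lra.
have Mi : 0 <= M^-1 by rewrite invr_ge0 ltW.
have hW a A : nb X a A -> nb (Ww 0) a (K * A) by move=> /hK; apply: Ww_mono.
have tri a1 a2 a3 A1 A2 A3 : nb X a1 A1 -> nb X a2 A2 -> nb X a3 A3 ->
    nb X (mc3 (mB b M) a1 a2 a3) (C0 / M * A1 * A2 * A3).
  move=> h1 h2 h3; have := B_bound hs b M1 (hW _ _ h1) (hW _ _ h2) h3.
  rewrite (_ : _ * A3 = C0 / M * A1 * A2 * A3)//; rewrite /C0; ring.
split.
  move=> x hx; have r0 := nb_ge0 (hx b); apply: nb_mon (tri _ _ _ _ _ _ (hx b) (hx b) (hx (~~ b))).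
  rewrite (_ : _ * r = C0 / M * r ^+ 3); last by ring.
  by rewrite ler_wpM2r ?exprn_ge0// ler_wpM2r//; lra.
move=> x y D hx hy hd; have r0 := nb_ge0 (hx b); have D0 := nb_ge0 (hd b).
have [sx1 _ _ wx1 _] := X_facts hs (hx b); have [sx2 _ _ wx2 _] := X_facts hs (hx (~~ b)).
have [sy1 _ _ wy1 _] := X_facts hs (hy b); have [sy2 _ _ wy2 _] := X_facts hs (hy (~~ b)).
rewrite /Bn (mc3_telescope (mB_good b M1))//.
apply: nb_mon (nbD (nbD (tri _ _ _ _ _ _ (hd b) (hx b) (hx (~~ b))) (tri _ _ _ _ _ _ (hy b) (hd b) (hx (~~ b)))) (tri _ _ _ _ _ _ (hy b) (hy b) (hd (~~ b)))).
rewrite [leLHS](_ : _ = 3 * C0 / M * r ^+ 2 * D); last by ring.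
by rewrite ler_wpM2r// ler_wpM2r ?sqr_ge0// ler_wpM2r//; lra.
Qed.

(** [x] is measured in [X] and [nu] only in [X1]. In the first two places of [mB] a sequence of
    class [X1] is used through its l^1 norm, in the third through [B_bound1]. *)
Lemma Gn_lip b M r r1 : 1 <= M -> exists2 C, 0 <= C &
  (forall x nu, bdd X r x -> bdd X1 r1 nu -> nb X (Gn b M x nu) C) /\
  (forall x y nu mu D E, bdd X r x -> bdd X r y -> bdd X1 r1 nu -> bdd X1 r1 mu ->
     (forall b, nb X (x b - y b) D) -> (forall b, nb X1 (nu b - mu b) E) ->
     nb X (Gn b M x nu - Gn b M y mu) (C * (D + E))).
Proof.
move=> M1; have [K K1 hK] := X_W1 hs; have [K' K'1 hK'] := X1_W0 hs.
have [L L0 hL] := L_bound hs M1; have [Q [Q0 hQ hQl]] := lip_Qn hs b r.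
case: (leP 0 r) => r0; last first.
  exists 0 => //; split=> x; first by move=> nu /(_ b) /nb_ge0; rewrite leNgt r0.
  by move=> y nu mu D E /(_ b) /nb_ge0; rewrite leNgt r0.
case: (leP 0 r1) => r10; last first.
  exists 0 => //; split=> x; first by move=> nu _ /(_ b) /nb_ge0; rewrite leNgt r10.
  by move=> y nu mu D E _ _ /(_ b) /nb_ge0; rewrite leNgt r10.
pose k := K + K'.
have hW a A : nb X a A -> nb (Ww 0) a (k * A).
  move=> h; apply: nb_mon (Ww_mono ler01 (hK _ _ h)); apply: ler_wpM2r; [exact: nb_ge0 h|rewrite /k; lra].
have hW' a A : nb X1 a A -> nb (Ww 0) a (k * A).
  move=> h; apply: nb_mon (hK' _ _ h); apply: ler_wpM2r; [exact: nb_ge0 h|rewrite /k; lra].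
have hX1 a A : nb X a A -> nb X1 a A by apply: Hw_mono; rewrite gerDl lerN10.
pose P : R := 2 `^ s * 4 * k * k.
have k0 : 0 <= k by rewrite /k; lra.
have P0 : 0 <= P by rewrite !mulr_ge0 ?powR_ge0.
have tri a1 a2 a3 A1 A2 A3 : nb (Ww 0) a1 (k * A1) -> nb (Ww 0) a2 (k * A2) -> nb X1 a3 A3 ->
    nb X (mc3 (mB b M) a1 a2 a3) (P * A1 * A2 * A3).
  move=> h1 h2 h3; have := B_bound1 hs b M1 h1 h2 h3.
  rewrite (_ : _ * A3 = P * A1 * A2 * A3)//; rewrite /P; ring.
pose C := L * r * r * r + L * r * r * 3 + Q + P * r * r * r1 * 3 + P * r * r * 3 + P * r * r1 * 6.
have c1 : 0 <= L * r * r * r by rewrite !mulr_ge0.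
have c2 : 0 <= L * r * r * 3 by rewrite !mulr_ge0.
have c3 : 0 <= P * r * r * r1 * 3 by rewrite !mulr_ge0.
have c4 : 0 <= P * r * r * 3 by rewrite !mulr_ge0.
have c5 : 0 <= P * r * r1 * 6 by rewrite !mulr_ge0.
exists C; first by rewrite /C; lra.
split=> [x nu hx hnu|x y nu mu D E hx hy hnu hmu hd he].
  have q1 := hL _ _ _ _ _ _ (hx b) (hx b) (hx (~~ b)).
  have q2 := tri _ _ _ _ _ _ (hW' _ _ (hnu b)) (hW _ _ (hx b)) (hX1 _ _ (hx (~~ b))).
  have q3 := tri _ _ _ _ _ _ (hW _ _ (hx b)) (hW' _ _ (hnu b)) (hX1 _ _ (hx (~~ b))).
  have q4 := tri _ _ _ _ _ _ (hW _ _ (hx b)) (hW _ _ (hx b)) (hnu (~~ b)).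
  apply: nb_mon (nbB (nbD q1 (hQ _ hx)) (nbD (nbD q2 q3) q4)).
  rewrite (_ : _ + _ = L * r * r * r + Q + P * r * r * r1 * 3); last by ring.
  rewrite /C; lra.
have D0 := nb_ge0 (hd b); have E0 := nb_ge0 (he b).
have [sx1 _ ux1 wx1 _] := X_facts hs (hx b); have [sx2 _ ux2 wx2 _] := X_facts hs (hx (~~ b)).
have [sy1 _ uy1 wy1 _] := X_facts hs (hy b); have [sy2 _ uy2 wy2 _] := X_facts hs (hy (~~ b)).
have sn b' : summ (nu b') by exact: W0_summ (hW' _ _ (hnu b')).
have sm b' : summ (mu b') by exact: W0_summ (hW' _ _ (hmu b')).
have wn b' : wbd (wt (-1)) (nu b') by apply: summ_wbd => //; rewrite lerNl oppr0.
have wm b' : wbd (wt (-1)) (mu b') by apply: summ_wbd => //; rewrite lerNl oppr0.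
have gB := mB_good b M1.
have -> : Gn b M x nu - Gn b M y mu =
  (mc3 (mL M) (x b) (x b) (x (~~ b)) - mc3 (mL M) (y b) (y b) (y (~~ b))) + (Qn b x - Qn b y)
  - ((mc3 (mB b M) (nu b) (x b) (x (~~ b)) - mc3 (mB b M) (mu b) (y b) (y (~~ b)))
   + (mc3 (mB b M) (x b) (nu b) (x (~~ b)) - mc3 (mB b M) (y b) (mu b) (y (~~ b)))
   + (mc3 (mB b M) (x b) (x b) (nu (~~ b)) - mc3 (mB b M) (y b) (y b) (mu (~~ b)))).
  have aux (V : zmodType) (u1 u2 u3 u4 u5 v1 v2 v3 v4 v5 : V) : u1 + u2 - (u3 + u4 + u5) - (v1 + v2 - (v3 + v4 + v5)) =
      (u1 - v1) + (u2 - v2) - ((u3 - v3) + (u4 - v4) + (u5 - v5)).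
    rewrite [u3 - v3 + _]addrACA -opprD [_ + (u5 - v5)]addrACA -opprD [u1 - v1 + _]addrACA -opprD.
    by rewrite !opprD !opprK [LHS]addrACA.
  exact: aux.
have tele m w a c d a' c' d' A1 A2 A3 : mgood m w -> summ a -> summ c -> wbd w d -> summ a' -> summ c' -> wbd w d' ->
    nb X (mc3 m (a - a') c d) A1 -> nb X (mc3 m a' (c - c') d) A2 -> nb X (mc3 m a' c' (d - d')) A3 ->
    nb X (mc3 m a c d - mc3 m a' c' d') (A1 + A2 + A3).
  move=> g p1 p2 p3 p4 p5 p6 q1 q2 q3; rewrite (mc3_telescope g p1 p2 p3 p4 p5 p6).
  exact: nbD (nbD q1 q2) q3.
have q0 := tele _ _ _ _ _ _ _ _ _ _ _ (mL_good M) sx1 sx1 ux2 sy1 sy1 uy2 (hL _ _ _ _ _ _ (hd b) (hx b) (hx (~~ b))) (hL _ _ _ _ _ _ (hy b) (hd b) (hx (~~ b))) (hL _ _ _ _ _ _ (hy b) (hy b) (hd (~~ b))).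
have q1 := hQl _ _ _ hx hy hd.
have xW := hW _ _ (hx b); have yW := hW _ _ (hy b); have dW := hW _ _ (hd b).
have nW := hW' _ _ (hnu b); have mW := hW' _ _ (hmu b); have eW := hW' _ _ (he b).
have x1 := hX1 _ _ (hx (~~ b)); have y1 := hX1 _ _ (hy (~~ b)); have d1 := hX1 _ _ (hd (~~ b)).
have q2 := tele _ _ _ _ _ _ _ _ _ _ _ gB (sn b) sx1 wx2 (sm b) sy1 wy2 (tri _ _ _ _ _ _ eW xW x1) (tri _ _ _ _ _ _ mW dW x1) (tri _ _ _ _ _ _ mW yW d1).
have q3 := tele _ _ _ _ _ _ _ _ _ _ _ gB sx1 (sn b) wx2 sy1 (sm b) wy2 (tri _ _ _ _ _ _ dW nW x1) (tri _ _ _ _ _ _ yW eW x1) (tri _ _ _ _ _ _ yW mW d1).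
have q4 := tele _ _ _ _ _ _ _ _ _ _ _ gB sx1 sx1 (wn (~~ b)) sy1 sy1 (wm (~~ b)) (tri _ _ _ _ _ _ dW xW (hnu (~~ b))) (tri _ _ _ _ _ _ yW dW (hnu (~~ b))) (tri _ _ _ _ _ _ yW yW (he (~~ b))).
apply: nb_mon (nbB (nbD q0 q1) (nbD (nbD q2 q3) q4)).
rewrite [leLHS](_ : _ = (L * r * r * 3 + Q + P * r * r1 * 6) * D + (P * r * r * 3) * E); last by ring.
rewrite [C * _]mulrDr; apply: lerD; apply: ler_wpM2r => //; rewrite /C; lra.
Qed.

Lemma nb_ph (N : gnorm (R := R) int) b t (a : int -> R[i]) A : nb N a A -> nb N (fun k => ph b k t * a k) A.
Proof. by apply: nb_solid => // k; rewrite nCM nC_ph mul1r. Qed.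

Lemma nb_ph_inv (N : gnorm (R := R) int) b t (a : int -> R[i]) A : nb N (fun k => ph b k t * a k) A -> nb N a A.
Proof.
move=> h; have := nb_ph (~~ b) t h; apply: nb_eq => k.
by rewrite mulrA ph_conj mul1r.
Qed.

(* One Picard step: [y] is the iterate after [x], and [nu] the nonlinearity at the iterate before [x]. *)
Record step_data (lo hi r r1 : R) (x nu y : R -> seqs) : Prop := StepData {
  sd_cx : forall b, ccurve X lo hi (x ^~ b);
  sd_bx : forall t, lo <= t <= hi -> bdd X r (x t);
  sd_cnu : forall b, ccurve (Ww 0) lo hi (nu ^~ b);
  sd_bnu : forall t, lo <= t <= hi -> bdd X1 r1 (nu t);
  sd_dx : forall b k, cder lo hi (fun t => x t b k) (fun t => Lk b k * x t b k + nu t b k);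
  sd_dy : forall b k, cder lo hi (fun t => y t b k) (fun t => Lk b k * y t b k + Nn b (x t) k) }.

Lemma sd_der lo hi r r1 x nu y : step_data lo hi r r1 x nu y -> forall b M k, 1 <= M ->
  cder lo hi (fun t => ph (~~ b) k t * (y t b k - Bn b M (x t) k))
    (fun t => ph (~~ b) k t * Gn b M (x t) (nu t) k).
Proof.
move=> h b M k M1; have [K' _ hK'] := X1_W0 hs.
apply: (step_der (r := r) M1 (sd_cx h) (sd_bx h) (sd_cnu h) _ (sd_dx h) (sd_dy h b)) => t b' tab.
exact: W0_summ (hK' _ _ (sd_bnu h tab b')).
Qed.

(* Short intervals and a high frequency cut-off [M] make the Duhamel map contract. *)
Lemma step_estimate r r1 : 0 <= r -> 0 <= r1 -> exists2 C, 0 <= C &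
  forall lo hi x nu y, step_data lo hi r r1 x nu y ->
  forall t, lo <= t <= hi ->
    (forall b A, nb X (y lo b) A -> nb X (y t b) (A + 1 / 4 + C * (t - lo))) /\
    (forall x' nu' y', step_data lo hi r r1 x' nu' y' -> forall D E A,
      (forall t b, lo <= t <= hi -> nb X (x t b - x' t b) D) ->
      (forall t b, lo <= t <= hi -> nb X1 (nu t b - nu' t b) E) ->
      forall b, nb X (y lo b - y' lo b) A ->
      nb X (y t b - y' t b) (A + D / 4 + C * (t - lo) * (D + E))).
Proof.
move=> r0 r10; have [CB CB1 hB] := Bn_lip.
pose q := r ^+ 3 + r ^+ 2 + 1.
have r3 : 0 <= r ^+ 3 by rewrite exprn_ge0.
have r2 : 0 <= r ^+ 2 by rewrite exprn_ge0.
have q1 : 1 <= q by rewrite /q; lra.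
(* The boundary terms at the two ends of the interval then have size at most 1/8 each, and Lipschitz
   constant at most 1/8. *)
pose M := 8 * CB * q.
have M1 : 1 <= M.
  have : 1 <= CB * q by rewrite -[leLHS]mulr1 ler_pM.
  rewrite /M; lra.
have hM z : 0 <= z -> z <= q -> CB / M * z <= 1 / 8.
  move=> z0 zq; have -> : CB / M * z = z / q / 8.
    rewrite /M; field; apply/andP; split; [lra|].
    rewrite gt_eqF//; lra.
  by rewrite ler_pM2r// ler_pdivrMr; lra.
have [C1 C10 [h1 h1']] := Gn_lip true r r1 M1; have [C2 C20 [h2 h2']] := Gn_lip false r r1 M1.
exists (C1 + C2); first by rewrite addr_ge0.
have hG b x nu : bdd X r x -> bdd X1 r1 nu -> nb X (Gn b M x nu) (C1 + C2).
  move=> hx hnu; case: b; [apply: nb_mon (h1 _ _ hx hnu)|apply: nb_mon (h2 _ _ hx hnu)]; lra.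
have hG' b x y nu mu D E : bdd X r x -> bdd X r y -> bdd X1 r1 nu -> bdd X1 r1 mu ->
     (forall b, nb X (x b - y b) D) -> (forall b, nb X1 (nu b - mu b) E) ->
     nb X (Gn b M x nu - Gn b M y mu) ((C1 + C2) * (D + E)).
  move=> hx hy hnu hmu hd he; have DE : 0 <= D + E by rewrite addr_ge0 ?(nb_ge0 (hd b)) ?(nb_ge0 (he b)).
  case: b; [apply: nb_mon (h1' _ _ _ _ _ _ hx hy hnu hmu hd he)|apply: nb_mon (h2' _ _ _ _ _ _ hx hy hnu hmu hd he)];
    rewrite ler_wpM2r//; lra.
move=> lo hi x nu y H t /andP[lt th]; have ll : lo <= lo <= hi by rewrite lexx (le_trans lt th).
have tt : lo <= t <= hi by rewrite lt.
have sub u : lo <= u <= t -> lo <= u <= hi by move=> /andP[u1 u2]; rewrite u1 (le_trans u2 th).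
split=> [b A hA|x' nu' y' H' D E A hD hE b hA].
  pose f u k := ph (~~ b) k u * (y u b k - Bn b M (x u) k).
  have df k : cder lo t (f ^~ k) (fun u => ph (~~ b) k u * Gn b M (x u) (nu u) k).
    exact: cder_sub (lexx _) th (sd_der H b k M1).
  have bf u : lo <= u <= t -> nb X (fun k => ph (~~ b) k u * Gn b M (x u) (nu u) k) (C1 + C2).
    by move=> /sub uh; apply: nb_ph; apply: hG; [exact: sd_bx H _ uh|exact: sd_bnu H _ uh].
  have {bf} hf := nb_mvt lt df bf.
  have e8 u : lo <= u <= hi -> nb X (Bn b M (x u)) (1 / 8).
    by move=> uh; apply: nb_mon ((hB b M r M1).1 _ (sd_bx H uh)); apply: hM => //; rewrite /q; lra.
  have h3 : nb X (fun k => ph (~~ b) k t * (y t b k - Bn b M (x t) k)) (A + 1 / 8 + (C1 + C2) * (t - lo)).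
    have -> : (fun k => ph (~~ b) k t * (y t b k - Bn b M (x t) k)) = f lo + (f t - f lo).
      by apply/funext => k; rewrite !fctE addrC subrK.
    apply: nbD hf; apply: nb_ph; exact: nbB hA (e8 lo ll).
  have := nbD (nb_ph_inv h3) (e8 t tt).
  rewrite (_ : (fun k => _) + _ = y t b); last by apply/funext => k; rewrite !fctE subrK.
  by apply: nb_mon; lra.
pose f u k := ph (~~ b) k u * (y u b k - Bn b M (x u) k) - ph (~~ b) k u * (y' u b k - Bn b M (x' u) k).
have df k : cder lo t (f ^~ k) (fun u => ph (~~ b) k u * Gn b M (x u) (nu u) k - ph (~~ b) k u * Gn b M (x' u) (nu' u) k).
  by apply: cder_sub (lexx _) th _; apply: cderB; [exact: (sd_der H b k M1)|exact: (sd_der H' b k M1)].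
have bf u : lo <= u <= t -> nb X (fun k => ph (~~ b) k u * Gn b M (x u) (nu u) k - ph (~~ b) k u * Gn b M (x' u) (nu' u) k) ((C1 + C2) * (D + E)).
  move=> /sub uh.
  have := nb_ph (~~ b) u (hG' b _ _ _ _ _ _ (sd_bx H uh) (sd_bx H' uh) (sd_bnu H uh) (sd_bnu H' uh) (hD u ^~ uh) (hE u ^~ uh)).
  by apply: nb_eq => k; rewrite !fctE mulrBr.
have {bf} hf := nb_mvt lt df bf.
have D0 := nb_ge0 (hD lo b ll).
have e8 u : lo <= u <= hi -> nb X (Bn b M (x u) - Bn b M (x' u)) (D / 8).
  move=> uh; apply: nb_mon ((hB b M r M1).2 _ _ _ (sd_bx H uh) (sd_bx H' uh) (hD u ^~ uh)).
  have hh : CB / M * r ^+ 2 <= 1 / 8 by apply: hM => //; rewrite /q; lra.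
  by have := ler_wpM2r D0 hh; lra.
have h3 : nb X (f t) (A + D / 8 + (C1 + C2) * (D + E) * (t - lo)).
  have -> : f t = f lo + (f t - f lo) by rewrite addrC subrK.
  apply: nbD hf; have := nb_ph (~~ b) lo (nbB hA (e8 lo ll)); apply: nb_eq => k.
  rewrite /f !fctE; ring.
have h4 : nb X (fun k => ph (~~ b) k t * ((y t b k - Bn b M (x t) k) - (y' t b k - Bn b M (x' t) k))) (A + D / 8 + (C1 + C2) * (D + E) * (t - lo)).
  by apply: nb_eq h3 => k; rewrite /f -mulrBr.
have := nbD (nb_ph_inv h4) (e8 t tt).
rewrite (_ : (fun k => _) + _ = y t b - y' t b); last by apply/funext => k; rewrite !fctE; ring.
apply: nb_mon; lra.
Qed.

Lemma tail_H w (a : int -> R[i]) A (e : R) : (forall i, 0 <= w i) -> nb (Hn w) a A -> 0 < e ->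
  exists2 t : seq int, uniq t & nb (Hn w) (fun i => if i \in t then 0 else a i) e.
Proof.
move=> w0 h e0; have A0 := nb_ge0 h; move/(nb_H _ A0 w0): h => h.
have h' : sumle (fun i => nC (((w i * nC (a i)) ^+ 2)%:C : R[i])) (A ^+ 2).
  by apply: sumle_mon h => // i; rewrite nC_real ger0_norm// sqr_ge0.
have [t ut ht] := csum_approx h' (exprn_gt0 2 e0); exists t => //.
apply/nb_H => //; first exact: ltW.
apply: sumle_mon ht => // i; case: ifP => _; first by rewrite nC0 mulr0 expr0n.
by rewrite nC_real ger0_norm// sqr_ge0.
Qed.

(** The phases may oscillate faster as k grows, so their continuity is not uniform in k; a small
    tail of [f x] is split off and only finitely many phases remain. *)
Lemma phase_ccurve w (p : int -> R -> R[i]) (lo hi : R) (f : R -> int -> R[i]) : (forall i, 0 <= w i) ->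
  (forall k t, nC (p k t) = 1) -> (forall k, ccont lo hi (p k)) ->
  (forall t, lo <= t <= hi -> exists A, nb (Hn w) (f t) A) ->
  ccurve (Hn w) lo hi f -> ccurve (Hn w) lo hi (fun t k => p k t * f t k).
Proof.
move=> w0 p1 cp bf cf x xab e e0; have e4 : 0 < e / 4 by rewrite divr_gt0.
have [A hA] := bf x xab; have A0 := nb_ge0 hA.
have [t ut ht] := tail_H w0 hA e4.
have [e1 e10 he1] := ler_eps_div e4 A0.
have [d d0 Hd] := cf x xab _ e4.
have [d' d'0 Hd'] : exists2 d' : R, 0 < d' & forall u, lo <= u <= hi -> `|u - x| < d' -> forall k, k \in t -> nC (p k u - p k x) <= e1.
  elim: t {ut ht} => [|k t [d1 d10 IH]]; first by exists 1.
  have [d2 d20 H2] := cp k x xab _ e10.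
  exists (Num.min d1 d2); first by rewrite lt_min d10.
  move=> u uab; rewrite lt_min => /andP[u1 u2] k'; rewrite inE => /orP[/eqP ->|kt].
    exact: H2.
  exact: IH.
exists (Num.min d d'); first by rewrite lt_min d0.
move=> u uab; rewrite lt_min => /andP[/(Hd u uab) h1 /(Hd' u uab) h2].
have g1 : nb (Hn w) (fun k => p k u * (f u k - f x k)) (e / 4).
  by apply: nb_solid h1 => // k; rewrite nCM p1 mul1r.
have g2 : nb (Hn w) (fun k => (p k u - p k x) * (if k \in t then 0 else f x k)) (2 * (e / 4)).
  have := nbZ (2 : R[i]) ht; rewrite (_ : nC (2 : R[i]) = 2); last first.
    by rewrite -(rmorph_nat (real_complex R)) nC_real ger0_norm.
  apply: nb_solid => // k; rewrite !nCM ler_wpM2r ?nC_ge0//.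
  apply: le_trans (nCB _ _) _; rewrite !p1.
  by rewrite -(rmorph_nat (real_complex R)) nC_real ger0_norm.
have g3 : nb (Hn w) (fun k => (p k u - p k x) * (if k \in t then f x k else 0)) (e / 4).
  have := nbZ (e1%:C : R[i]) hA; rewrite nC_real ger0_norm; last exact: ltW.
  move=> q; apply: nb_mon he1 _; apply: nb_solid q => // k; rewrite !nCM nC_real ger0_norm; last exact: ltW.
  case: ifP => kt; first by rewrite ler_wpM2r ?nC_ge0// h2.
  by rewrite nC0 mulr0 mulr_ge0 ?nC_ge0// ltW.
have := nbD (nbD g1 g2) g3; rewrite (_ : e / 4 + 2 * (e / 4) + e / 4 = e); last by field.
apply: nb_eq => k; rewrite !fctE; case: ifP => _; ring.
Qed.

End NormalForm.

(** * Local theory of the gauged system *)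

Section GeometricLimits.
Context {R : realType}.
Notation h := (2^-1 : R).

Lemma half_small (c e : R) : 0 < e -> exists n, c * h ^+ n <= e.
Proof.
move=> e0; pose n := Num.truncn (`|c| / e); exists n.
have p0 : 0 < (2 : R) ^+ n by rewrite exprn_gt0.
rewrite exprVn ler_pdivrMr//; apply: le_trans (ler_norm c) _.
have := truncnS_gt (`|c| / e); rewrite -/n ltr_pdivrMr// => q; apply: le_trans (ltW q) _.
by rewrite mulrC ler_wpM2l ?(ltW e0)// -natrX ler_nat ltn_expl.
Qed.

Lemma geo_sum (c : R) n : \sum_(m < n) c * h ^+ m = 2 * c * (1 - h ^+ n).
Proof.
elim: n => [|n IH]; first by rewrite big_ord0 expr0 subrr mulr0.
by rewrite big_ord_recr /= IH exprS; field.
Qed.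

Lemma geo_sumle (c : R) : 0 <= c -> sumle (fun m => c * h ^+ m) (2 * c).
Proof.
move=> c0; apply: sumle_nat => n; first by rewrite mulr_ge0// exprn_ge0// invr_ge0.
rewrite geo_sum -[leRHS]mulr1; apply: ler_wpM2l; first by rewrite mulr_ge0.
by rewrite gerBl exprn_ge0// invr_ge0.
Qed.

Lemma nb_lim (I : choiceType) (N : gnorm (R := R) I) a A c :
  (forall n, nb N a (A + c * h ^+ n)) -> nb N a A.
Proof.
move=> H s th Nth; apply/ler_addgt0Pr => e e0.
by have [n hn] := half_small c e0; apply: le_trans (H n s th Nth) _; rewrite lerD2l.
Qed.

Lemma nC_lim (z : R[i]) (c : R) : (forall n, nC z <= c * h ^+ n) -> z = 0.
Proof.
move=> H; apply: nC_eq0; apply/eqP; rewrite eq_le nC_ge0 andbT.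
by apply/ler_addgt0Pr => e /(half_small c)[n hn]; rewrite add0r; exact: le_trans (H n) hn.
Qed.

Lemma csum_recl (f : nat -> R[i]) : summ f -> csum f = f 0%N + csum (fun n => f n.+1).
Proof.
move=> sf; rewrite (@csum_split _ _ f [:: 0%N])// big_seq1; congr (_ + _).
have <- := @csum_image R _ _ S (fun i => if i \in [:: 0%N] then 0 else f i); first by apply: eq_csum.
  by move=> m n [].
by case=> [|n] H; [rewrite inE|case: (H n)].
Qed.

(** Completeness along geometrically convergent sequences: the limit is a telescoping series, and
    the first hypothesis makes each of its coefficients summable. *)
Lemma nb_lim_geo (I : choiceType) (N : gnorm (R := R) I) (a : nat -> I -> R[i]) (c : R) :
  (forall i, exists K, forall b A, nb N b A -> nC (b i) <= K * A) ->
  (forall n, nb N (a n.+1 - a n) (c * h ^+ n)) ->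
  exists l, forall n, nb N (l - a n) (2 * c * h ^+ n).
Proof.
move=> hK ha; have c0 : 0 <= c by have := nb_ge0 (ha 0%N); rewrite expr0 mulr1.
pose d n i := a n.+1 i - a n i.
have sd n i : summ (fun m => d (n + m)%N i).
  have [K hKi] := hK i; exists (`|K| * (2 * c)).
  have := sumleZ (normr_ge0 K) (geo_sumle c0); apply: sumle_mon => // m.
  have hm : nb N (a (n + m).+1 - a (n + m)%N) (c * h ^+ m).
    apply: nb_mon (ha _); apply: ler_wpM2l => //; rewrite exprD ler_piMl ?exprn_ge0 ?invr_ge0//.
    by rewrite exprn_ile1 ?invr_ge0// invf_le1// ler1n.
  apply: le_trans (hKi _ _ hm) _; apply: ler_wpM2r; last exact: ler_norm.
  exact: nb_ge0 hm.
exists (fun i => a 0%N i + csum (d ^~ i)) => n.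
have E i : a 0%N i + csum (d ^~ i) - a n i = csum (fun m => d (n + m)%N i).
  elim: n => [|n IH]; first by rewrite addrC addKr.
  have := csum_recl (sd n i); rewrite addn0 => q.
  rewrite (_ : csum (fun m => d (n.+1 + m)%N i) = csum (fun m => d (n + m)%N i) - d n i).
    by rewrite -IH /d; ring.
  by rewrite q addrC addKr; apply: eq_csum => m; rewrite addnS.
apply: (@nb_eq _ _ _ (fun i => csum (fun m => d (n + m)%N i))); first by move=> i; rewrite -E.
have c1 : 0 <= c * h ^+ n by rewrite mulr_ge0// exprn_ge0// invr_ge0.
rewrite -mulrA; apply: (nb_csum (F := fun m i => d (n + m)%N i) _ _ (geo_sumle c1)); first exact: sd.
by move=> m; rewrite -mulrA -exprD; exact: ha.
Qed.

Lemma ccurve_unif (I : choiceType) (N : gnorm (R := R) I) lo hi (f : R -> I -> R[i]) (F : nat -> R -> I -> R[i]) (c : R) :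
  (forall n, ccurve N lo hi (F n)) ->
  (forall n t, lo <= t <= hi -> nb N (f t - F n t) (c * h ^+ n)) -> ccurve N lo hi f.
Proof.
move=> cF H x xab e e0; have e4 : 0 < e / 3 by rewrite divr_gt0.
have [n hn] := half_small c e4; have [d d0 Hd] := cF n x xab _ e4; exists d => // t tab tx.
have q1 := nb_mon hn (H n t tab); have q2 := nb_mon hn (H n x xab).
rewrite (_ : e = e / 3 + e / 3 + e / 3); last by field.
have := nbD (nbB q1 q2) (Hd t tab tx); apply: nb_eq => i; rewrite !fctE; ring.
Qed.

Lemma ccurve_lip (I : choiceType) (N : gnorm (R := R) I) lo hi (f : R -> I -> R[i]) (C : R) :
  (forall t t', lo <= t -> t <= t' -> t' <= hi -> nb N (f t' - f t) (C * (t' - t))) -> ccurve N lo hi f.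
Proof.
move=> H x /andP[x1 x2] e e0; have [e1 e10 he] := ler_eps_div e0 (normr_ge0 C).
exists e1 => // t /andP[t1 t2] tx; apply: nb_mon (_ : `|C| * `|t - x| <= e) _.
  by apply: le_trans he; rewrite mulrC; apply: ler_wpM2r => //; exact: ltW.
have cc (y : R) : 0 <= y -> C * y <= `|C| * `|y|.
  by move=> y0; rewrite -normrM; exact: ler_norm.
case: (leP x t) => xt; first by apply: nb_mon (H _ _ x1 xt t2); apply: cc; rewrite subr_ge0.
apply: nbBC; rewrite distrC; apply: nb_mon (H _ _ t1 (ltW xt) x2); apply: cc; rewrite subr_ge0; exact: ltW.
Qed.

Lemma ccurve_cst (I : choiceType) (N : gnorm (R := R) I) lo hi (a : I -> R[i]) : ccurve N lo hi (fun=> a).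
Proof.
move=> x _ e e0; exists 1 => // t _ _.
by rewrite subrr; exact: (nb_mon (ltW e0) (@nb0 R I N)).
Qed.

Lemma ccurve_bounded (I : choiceType) (N : gnorm (R := R) I) lo hi (f : R -> I -> R[i]) :
  ccurve N lo hi f -> (forall t, lo <= t <= hi -> exists A, nb N (f t) A) ->
  exists r, forall t, lo <= t <= hi -> nb N (f t) r.
Proof.
move=> cf bf; have cK := @segment_compact R lo hi.
move/compact_near_coveringP : cK => /(_ R (pinfty_nbhs R) (fun r t => lo <= t <= hi -> nb N (f t) r)).
case.
  move=> t; rewrite /= in_itv /= => tab; have [A hA] := bf t tab; have [d d0 Hd] := cf t tab 1 ltr01.
  exists (ball t d, [set r | A + 1 < r]); first split; first exact: nbhsx_ballx.
    by exists (A + 1); split; [exact: num_real|].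
  move=> [u r] /= [tu rA] uab; apply: nb_mon (ltW rA) _.
  have -> : f u = f t + (f u - f t) by rewrite addrC subrK.
  by apply: nbD hA _; apply: Hd => //; move: tu; rewrite /ball /= distrC.
move=> M [Mr HM]; exists (M + 1) => t tab; by apply: (HM (M + 1)) => //; rewrite ltrDl.
Qed.

End GeometricLimits.

(** * Picard iteration and uniqueness for the gauged system *)

Section Wellposed.
Context {R : realType}.
Notation seqs := (bool -> int -> R[i]).
Notation h := (2^-1 : R).
Implicit Types (k : int) (b : bool) (r A : R) (x y : R -> seqs).
Variables (s : R).
Hypothesis hs : 3 / 2 < s.
Notation X := (Hw (R := R) s).
Notation X1 := (Hw (R := R) (s - 1)).

Definition solw lo hi x := (forall b, ccurve X lo hi (x ^~ b)) /\
  forall b k, cder lo hi (fun t => x t b k) (fun t => Lk b k * x t b k + Nn b (x t) k).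

Lemma Hw_coefC (p : R) k : exists K, forall a (A : R), nb (Hw p) a A -> nC (a k) <= K * A.
Proof.
exists ((wt p k)^-1) => a A /(nb_Hw_coef k); have w0 := wt_gt0 p k => q.
by rewrite mulrC ler_pdivlMr// mulrC.
Qed.

Lemma ccurve_coef (p : R) lo hi f k : ccurve (Hw p) lo hi f -> ccont lo hi (f ^~ k).
Proof.
move=> cf t tab e e0; have [K hK] := Hw_coefC p k; have [e1 e10 he] := ler_eps_div e0 (normr_ge0 K).
have [d d0 Hd] := cf t tab _ e10; exists d => // u uab ut.
apply: le_trans (hK _ _ (Hd u uab ut)) _; apply: le_trans he; rewrite mulrC.
by rewrite ler_wpM2l ?(ltW e10)// ler_norm.
Qed.

Lemma Nn_facts r : exists r1, [/\ 0 <= r1, forall (x : seqs) b, bdd X r x -> nb X1 (Nn b x) r1 &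
  forall (x y : seqs) D b, bdd X r x -> bdd X r y -> (forall b, nb X (x b - y b) D) ->
    nb X1 (Nn b x - Nn b y) (r1 * D)].
Proof.
have [C1 [c1 p1 q1]] := lip_Nn hs true r; have [C2 [c2 p2 q2]] := lip_Nn hs false r.
exists (C1 + C2); split; first by rewrite addr_ge0.
  by move=> x [] /= hx; [apply: nb_mon (p1 x hx)|apply: nb_mon (p2 x hx)]; lra.
move=> x y D b hx hy hd; have D0 := nb_ge0 (hd b).
by case: b; [apply: nb_mon (q1 x y D hx hy hd)|apply: nb_mon (q2 x y D hx hy hd)]; rewrite ler_wpM2r//; lra.
Qed.

Lemma Nn_ccurve lo hi r x b : (forall b, ccurve X lo hi (x ^~ b)) ->
  (forall t, lo <= t <= hi -> bdd X r (x t)) -> ccurve X1 lo hi (fun t => Nn b (x t)).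
Proof. move=> cx bx; exact: lip_ccurve (lip_Nn hs b) cx bx. Qed.

(** Duhamel's formula. Its integrand is of class [X1] only, so it serves to produce an iterate; the
    bounds in [X] come from the normal form. *)
Definition duh lo (w0 : seqs) x (t : R) b k : R[i] :=
  ph b k t * (ph (~~ b) k lo * w0 b k + cintegral lo t (fun u => ph (~~ b) k u * Nn b (x u) k)).

Lemma cint_pt (a : R) f : cintegral a a f = 0.
Proof.
rewrite (@cint_eq R a a f (fun=> f a)) ?cint_cst ?subrr ?mul0r// => t tab.
by congr (f _); apply/eqP; rewrite eq_le andbC.
Qed.

Lemma duh_lo lo w0 x b : duh lo w0 x lo b = w0 b.
Proof.
by apply/funext => k; rewrite /duh cint_pt addr0 mulrA [ph b k lo * _]mulrC ph_conj mul1r.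
Qed.

Lemma duh_der lo hi w0 x r : (forall b, ccurve X lo hi (x ^~ b)) ->
  (forall t, lo <= t <= hi -> bdd X r (x t)) -> forall b k,
  cder lo hi (fun t => duh lo w0 x t b k) (fun t => Lk b k * duh lo w0 x t b k + Nn b (x t) k).
Proof.
move=> cx bx b k.
have cf : ccont lo hi (fun u => ph (~~ b) k u * Nn b (x u) k).
  apply: ccontM; first exact: (cder_ccont (@cder_ph R (~~ b) k lo hi)).
  exact: ccurve_coef k (Nn_ccurve b cx bx).
have := cderM (@cder_ph R b k lo hi) (cderD (@cder_cst R lo hi (ph (~~ b) k lo * w0 b k)) (cint_primitive cf)).
apply: cder_eq => t _ //; rewrite add0r [ph b k t * (_ * Nn _ _ _)]mulrA [ph b k t * ph _ _ _]mulrC ph_conj mul1r.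
by congr (_ + _); rewrite /duh; ring.
Qed.

Lemma lip_Bn b : lipb X X (Bn b 1).
Proof.
have [C C1 H] := Bn_lip hs => r; have [H1 H2] := H b 1 r (lexx _).
have C0 : 0 <= C by lra.
exists (C * (`|r| ^+ 3 + r ^+ 2)); split.
- by rewrite mulr_ge0// addr_ge0 ?sqr_ge0// exprn_ge0.
- move=> x /H1; apply: nb_mon; rewrite divr1 ler_wpM2l//.
  rewrite -[leLHS]addr0; apply: lerD; last exact: sqr_ge0.
  apply: le_trans (ler_norm _) _; by rewrite normrX.
- move=> x y D hx hy hd; apply: nb_mon (H2 x y D hx hy hd).
  apply: ler_wpM2r; first exact: nb_ge0 (hd b).
  by rewrite divr1 ler_wpM2l// lerDr exprn_ge0.
Qed.

(** The equation by itself gives continuity in a weaker norm. After the normal form with M = 1 the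
    profile is Lipschitz in time with values in [X]; the propagator and the boundary term are then
    restored. *)
Lemma step_ccurve lo hi r r1 x nu y A : step_data s lo hi r r1 x nu y -> bdd X A (y lo) ->
  forall b, ccurve X lo hi (y ^~ b).
Proof.
move=> H hA b.
have cB : ccurve X lo hi (fun t => Bn b 1 (x t)).
  exact: lip_ccurve (lip_Bn b) (sd_cx H) (sd_bx H).
pose f t k := ph (~~ b) k t * (y t b k - Bn b 1 (x t) k).
have [C C0 [hG _]] := Gn_lip hs b r r1 (lexx 1).
have lf t t' : lo <= t -> t <= t' -> t' <= hi -> nb X (f t' - f t) (C * (t' - t)).
  move=> t1 t2 t3; apply: (nb_mvt (f' := fun u k => ph (~~ b) k u * Gn b 1 (x u) (nu u) k) t2).
    move=> k; exact: cder_sub t1 t3 (sd_der hs H b k (lexx 1)).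
  move=> u /andP[u1 u2]; apply: nb_ph.
  have uab : lo <= u <= hi by rewrite (le_trans t1 u1) (le_trans u2 t3).
  by apply: hG; [exact: sd_bx H _ uab|exact: sd_bnu H _ uab].
have cf := ccurve_lip lf.
have bf t : lo <= t <= hi -> exists B, nb X (f t) B.
  move=> /andP[t1 t2]; have ll : lo <= lo <= hi by rewrite lexx (le_trans t1 t2).
  have [CB [_ hB _]] := lip_Bn b r.
  exists (A + CB + C * (t - lo)); have -> : f t = f lo + (f t - f lo) by rewrite addrC subrK.
  apply: nbD; last exact: lf.
  by apply: nb_ph; exact: nbB (hA b) (hB _ (sd_bx H ll)).
have cpf := phase_ccurve (w := wt s) (@wt_ge0 R s) (fun k t => nC_ph b k t) (fun k => cder_ccont (@cder_ph R b k lo hi)) bf cf.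
have := ccurveD cpf cB; apply: ccurve_eq => t _; apply/funext => k; rewrite !fctE /f mulrA.
by rewrite [ph b k t * _]mulrC ph_conj mul1r subrK.
Qed.

Lemma nb_X_eq (a c : int -> R[i]) : nb X (a - c) 0 -> a = c.
Proof.
move=> H; apply/funext => k; apply/eqP; rewrite -subr_eq0; apply/eqP.
apply: nC_eq0; apply/eqP; rewrite eq_le nC_ge0 andbT.
by have [K hK] := Hw_coefC s k; have := hK _ _ H; rewrite mulr0.
Qed.

Lemma exist_w A : 0 <= A -> exists T r : R, [/\ 0 < T, 0 <= r & forall w0, bdd X A w0 ->
  exists x, [/\ solw 0 T x, x 0 = w0 & forall t, 0 <= t <= T -> bdd X r (x t)]].
Proof.
move=> A0; pose r := A + 1; have r0 : 0 <= r by rewrite /r; lra.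
have [r1 [r10 hN hN']] := Nn_facts r; have [C C0 hC] := step_estimate hs r0 r10.
(* Successive iterates will differ by a / 2^n in [X] and their driving terms by e / 2^n in [X1]: a
   covers the first difference, r1 the first nonlinearity, and 2 r1 a the factor 2 lost between n
   and n + 1. *)
pose a := 2 * r; have a0 : 0 < a by rewrite /a /r; lra.
pose e := r1 + 2 * r1 * a; have e0 : 0 <= e by rewrite addr_ge0// !mulr_ge0// ltW.
(* The first bound keeps the iterates in the ball of radius A + 1; the second, together with the 1/4
   of the boundary terms, gives the contraction factor 1/2. *)
pose T := Num.min (1 / 4 / (C + 1)) (a / 4 / (C * (a + e) + 1)).
have Cae : 0 <= C * (a + e) by rewrite mulr_ge0// addr_ge0// ltW.
have T0 : 0 < T by rewrite lt_min; apply/andP; split; rewrite divr_gt0//; lra.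
have T1 : C * T <= 1 / 4.
  have : T <= 1 / 4 / (C + 1) by rewrite ge_min lexx.
  rewrite ler_pdivlMr; lra.
have T2 : C * T * (a + e) <= a / 4.
  have : T <= a / 4 / (C * (a + e) + 1) by rewrite ge_min lexx orbT.
  rewrite ler_pdivlMr; lra.
have h0 n : 0 <= h ^+ n by rewrite exprn_ge0// invr_ge0.
exists T, r; split=> // w0 hw0.
pose Y := fix Y n : R -> seqs := if n is m.+1 then duh 0 w0 (Y m) else fun t b k => ph b k t * w0 b k.
(* [nu n] drives [Y n]; the free evolution [Y 0] has no forcing. *)
pose nu n : R -> seqs := if n is m.+1 then fun t b => Nn b (Y m t) else fun _ _ _ => 0.
have Y0 n b : Y n 0 b = w0 b.
  by case: n => [|n]; [apply/funext => k; rewrite /= ph0 mul1r|exact: duh_lo].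
have P n : step_data s 0 T r r1 (Y n) (nu n) (Y n.+1).
  elim: n => [|n IH].
    have b0 t : 0 <= t <= T -> bdd X r (Y 0%N t).
      move=> _ b; apply: nb_ph; apply: nb_mon (hw0 b); rewrite /r; lra.
    have c0 b : ccurve X 0 T (Y 0%N ^~ b).
      apply: (phase_ccurve (w := wt s) (p := fun k t => ph b k t) (f := fun=> w0 b)).
      - by move=> i; exact: wt_ge0.
      - by move=> k t; exact: nC_ph.
      - by move=> k; exact: cder_ccont (@cder_ph R b k 0 T).
      - by move=> t _; exists A; exact: hw0.
      - exact: ccurve_cst.
    split=> //.
    - by move=> b; exact: ccurve_cst.
    - by move=> t _ b; exact: (nb_mon r10 (@nb0 R int X1)).
    - move=> b k; have := cderZ (w0 b k) (@cder_ph R b k 0 T).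
      by apply: cder_eq => t _ /=; rewrite ?addr0; ring.
    - exact: (duh_der w0 c0 b0).
  have bn t : 0 <= t <= T -> bdd X r (Y n.+1 t).
    move=> tab b; have [e1 _] := hC _ _ _ _ _ IH t tab.
    have hh : nb X (Y n.+1 0 b) A by rewrite Y0.
    apply: nb_mon (e1 b A hh); rewrite subr0.
    have : C * t <= C * T by rewrite ler_wpM2l//; case/andP: tab.
    rewrite /r; lra.
  have hA0 : bdd X A (Y n.+1 0) by move=> b; rewrite Y0.
  have cn := step_ccurve IH hA0.
  split=> //.
  - by move=> b; apply: (ccurve_X1_W0 hs); apply: (@Nn_ccurve _ _ r); [exact: sd_cx IH|exact: sd_bx IH].
  - by move=> t tab b; apply: hN; exact: sd_bx IH _ tab.
  - exact: sd_dy IH.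
  - exact: (duh_der w0 cn bn).
have Q n t b : 0 <= t <= T -> nb X (Y n.+1 t b - Y n t b) (a * h ^+ n) /\
    nb X1 (nu n.+1 t b - nu n t b) (e * h ^+ n).
  elim: n t b => [|n IH] t b tab; rewrite ?expr0 ?mulr1.
    split.
      have := nbB (sd_bx (P 1%N) tab b) (sd_bx (P 0%N) tab b); apply: nb_mon; rewrite /a; lra.
    rewrite (_ : _ - _ = nu 1%N t b); last by apply/funext => k; rewrite fctE subr0.
    apply: nb_mon (sd_bnu (P 1%N) tab b); rewrite /e lerDl !mulr_ge0//; exact: ltW.
  have hh := h0 n; split.
    have [_ est] := hC _ _ _ _ _ (P n.+1) t tab.
    have z : nb X (Y n.+2 0 b - Y n.+1 0 b) 0 by rewrite !Y0 subrr; exact: nb0.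
    have {est} := est _ _ _ (P n) _ _ _ (fun t b tab => (IH t b tab).1) (fun t b tab => (IH t b tab).2) b z.
    apply: nb_mon; rewrite add0r subr0.
    have q1 : C * t <= C * T by rewrite ler_wpM2l//; case/andP: tab.
    have ae : 0 <= (a + e) * h ^+ n by rewrite mulr_ge0// addr_ge0// ltW.
    have q2 := ler_wpM2r ae q1; have q3 := ler_wpM2r hh T2.
    rewrite exprS; lra.
  have := hN' (Y n.+1 t) (Y n t) _ b (sd_bx (P n.+1) tab) (sd_bx (P n) tab) (fun b => (IH t b tab).1).
  apply: nb_mon; rewrite exprS /e.
  have : 0 <= r1 * h ^+ n by rewrite mulr_ge0.
  lra.
have /choice[x hx] : forall p : R * bool, exists l, 0 <= p.1 <= T -> forall n, nb X (l - Y n p.1 p.2) (2 * a * h ^+ n).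
  case=> t b /=; case tab : (0 <= t <= T); last by exists 0.
  have [l hl] := nb_lim_geo (fun i => Hw_coefC s i) (fun n => (Q n t b tab).1).
  by exists l.
have hx' t b n : 0 <= t <= T -> nb X (x (t, b) - Y n t b) (2 * a * h ^+ n) by move=> tab; exact: (hx (t, b)).
pose x' t b := x (t, b).
have cx b : ccurve X 0 T (x' ^~ b).
  apply: (@ccurve_unif _ _ _ _ _ _ (fun n t => Y n t b) (2 * a)).
    by move=> n; exact: sd_cx (P n) b.
  by move=> n t tab; exact: hx'.
have bx t : 0 <= t <= T -> bdd X r (x' t).
  move=> tab b; apply: (@nb_lim _ _ _ _ _ (2 * a)) => n.
  have -> : x' t b = Y n t b + (x (t, b) - Y n t b) by rewrite addrC subrK.
  by apply: nbD (hx' t b n tab); exact: (sd_bx (P n) tab).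
have x0 b : x' 0 b = w0 b.
  apply: nb_X_eq; apply: (@nb_lim _ _ _ _ _ (2 * a)) => n; rewrite add0r -(Y0 n b).
  by apply: hx'; rewrite lexx ltW.
have dz := duh_der w0 cx bx.
(* The limit satisfies Duhamel's equation. This is checked coefficient by coefficient, where the
   weaker norm of the nonlinearity is enough. *)
have E t b k : 0 <= t <= T -> x' t b k = duh 0 w0 x' t b k.
  move=> tab; have /andP[t0 tT] := tab; apply/eqP; rewrite -subr_eq0; apply/eqP.
  have [K hK] := Hw_coefC s k; have [K1 hK1] := Hw_coefC (s - 1) k.
  apply: (@nC_lim _ _ (`|K| * (2 * a) + `|K1| * (r1 * (2 * a)) * t)) => n.
  have p1 : nC (x' t b k - Y n.+1 t b k) <= `|K| * (2 * a) * h ^+ n.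
    have q := hK _ _ (hx' t b n.+1 tab); apply: le_trans q _.
    have a2 : 0 <= 2 * a * h ^+ n.+1 by rewrite mulr_ge0// mulr_ge0// ltW.
    apply: le_trans (ler_wpM2r a2 (ler_norm K)) _.
    rewrite -[leRHS]mulrA ler_wpM2l// ler_wpM2l ?mulr_ge0 ?(ltW a0)//.
    by rewrite exprS ler_piMl// invf_le1// ler1n.
  pose f u := ph (~~ b) k u * (duh 0 w0 x' u b k - Y n.+1 u b k).
  have df : cder 0 t f (fun u => ph (~~ b) k u * (Nn b (x' u) k - Nn b (Y n u) k)).
    apply: cder_sub (lexx _) tT _.
    have := cderM (@cder_ph R (~~ b) k 0 T) (cderB (dz b k) (sd_dy (P n) b k)).
    apply: cder_eq => u _ //; rewrite /Lk epN; move: (duh 0 w0 x' u b k) (Y n.+1 u b k) (Nn b _ k) (Nn b _ k) (ph _ _ _) (ep b) (kc k).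
    by move=> *; ring.
  have p2 : nC (f t - f 0) <= `|K1| * (r1 * (2 * a * h ^+ n)) * (t - 0).
    apply: (nC_mvt t0 df) => u /andP[u0 ut]; have uab : 0 <= u <= T by rewrite u0 (le_trans ut).
    rewrite nCM nC_ph mul1r.
    have q := hN' (x' u) (Y n u) _ b (bx u uab) (sd_bx (P n) uab) (fun b => hx' u b n uab).
    apply: le_trans (hK1 _ _ q) _; apply: ler_wpM2r (ler_norm K1).
    exact: nb_ge0 q.
  have f0 : f 0 = 0 by rewrite /f duh_lo Y0 subrr mulr0.
  move: p2; rewrite f0 !subr0 /f nCM nC_ph mul1r => p2.
  have -> : x' t b k - duh 0 w0 x' t b k = (x' t b k - Y n.+1 t b k) - (duh 0 w0 x' t b k - Y n.+1 t b k).
    by rewrite opprB addrA subrK.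
  apply: le_trans (nCB _ _) _; apply: le_trans (lerD p1 p2) _.
  rewrite le_eqVlt; apply/orP; left; apply/eqP; ring.
exists x'; split=> //; last by apply/funext => b; exact: x0.
split=> // b k; apply: cder_eq (dz b k) => t tab; rewrite ?E//.
Qed.

Lemma solw_step lo hi r r1 x : (forall (x : seqs) b, bdd X r x -> nb X1 (Nn b x) r1) -> solw lo hi x ->
  (forall t, lo <= t <= hi -> bdd X r (x t)) -> step_data s lo hi r r1 x (fun t b => Nn b (x t)) x.
Proof.
move=> hN [cx dx] bx; split=> //.
  by move=> b; apply: (ccurve_X1_W0 hs); exact: Nn_ccurve cx bx.
by move=> t tab b; apply: hN; exact: bx.
Qed.

Lemma lip_w r : 0 <= r -> exists2 tau : R, 0 < tau & forall lo hi x y (d : R), lo <= hi -> hi <= lo + tau ->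
  solw lo hi x -> solw lo hi y -> (forall t, lo <= t <= hi -> bdd X r (x t)) ->
  (forall t, lo <= t <= hi -> bdd X r (y t)) -> (forall b, nb X (x lo b - y lo b) d) ->
  forall t b, lo <= t <= hi -> nb X (x t b - y t b) (2 * d).
Proof.
move=> r0; have [r1 [r10 hN hN']] := Nn_facts r; have [C C0 hC] := step_estimate hs r0 r10.
pose tau := 1 / 4 / (C * (1 + r1) + 1).
have p0 : 0 <= C * (1 + r1) by rewrite mulr_ge0// addr_ge0.
have tau0 : 0 < tau by rewrite divr_gt0//; lra.
have htau : C * tau * (1 + r1) <= 1 / 4.
  have : tau <= 1 / 4 / (C * (1 + r1) + 1) by [].
  rewrite ler_pdivlMr; lra.
exists tau => // lo hi x y d lh hl sx sy bx by' hd.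
have dx := solw_step hN sx bx; have dy := solw_step hN sy by'.
have d0 : 0 <= d := nb_ge0 (hd true).
have H n : forall t b, lo <= t <= hi -> nb X (x t b - y t b) (2 * d + 2 * r * h ^+ n).
  elim: n => [|n IH] t b tab.
    apply: nb_mon (nbB (bx t tab b) (by' t tab b)); rewrite expr0; lra.
  pose D := 2 * d + 2 * r * h ^+ n.
  have D0 : 0 <= D := nb_ge0 (IH t b tab).
  have hE u b' : lo <= u <= hi -> nb X1 (Nn b' (x u) - Nn b' (y u)) (r1 * D).
    by move=> uab; apply: hN'; [exact: bx|exact: by'|move=> b''; exact: IH].
  have [_ est] := hC _ _ _ _ _ dx t tab.
  have := est _ _ _ dy D (r1 * D) d IH hE b (hd b); apply: nb_mon.
  have tt : t - lo <= tau by case/andP: tab => _; lra.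
  have q1 := ler_wpM2l C0 tt.
  have D1 : 0 <= (1 + r1) * D by rewrite mulr_ge0// addr_ge0.
  have q2 := ler_wpM2r D1 q1; have q3 := ler_wpM2r D0 htau.
  rewrite exprS; have : D = 2 * d + 2 * r * h ^+ n by [].
  lra.
move=> t b tab; apply: (@nb_lim _ _ _ _ _ (2 * r)) => n; exact: H.
Qed.

Lemma solw_sub lo hi lo' hi' x : lo <= lo' -> hi' <= hi -> solw lo hi x -> solw lo' hi' x.
Proof.
move=> l1 l2 [c d]; split=> [b|b k]; first exact: ccurve_sub l1 l2 (c b).
exact: cder_sub l1 l2 (d b k).
Qed.

(** The length tau of [lip_w] depends only on the radius, so finitely many steps cover the
    interval. *)
Lemma uniq_w lo hi r x y : 0 <= r -> solw lo hi x -> solw lo hi y ->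
  (forall t, lo <= t <= hi -> bdd X r (x t)) -> (forall t, lo <= t <= hi -> bdd X r (y t)) ->
  x lo = y lo -> forall t, lo <= t <= hi -> x t = y t.
Proof.
move=> r0 sx sy bx by' xy; have [tau tau0 H] := lip_w r0.
have K n : forall t, lo <= t <= hi -> t <= lo + n%:R * tau -> x t = y t.
  elim: n => [|n IH] t /andP[t1 t2] tn.
    by rewrite (_ : t = lo)//; apply/eqP; rewrite eq_le t1 andbT -[leRHS]addr0 -[X in _ + X](mul0r tau).
  case: (leP t (lo + n%:R * tau)) => tn'; first by apply: IH => //; rewrite t1.
  pose l := lo + n%:R * tau.
  have l1 : lo <= l by rewrite lerDl mulr_ge0// ltW.
  have l2 : l <= hi by apply: le_trans (ltW tn') t2.
  have e : x l = y l by apply: IH => //; rewrite l1.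
  apply/funext => b; apply: nb_X_eq; rewrite -(mulr0 2).
  apply: (H l t x y 0 (ltW tn')); rewrite ?lexx ?(ltW tn')//.
  - by move: tn; rewrite /l -natr1 mulrDl mul1r addrA.
  - exact: solw_sub sx.
  - exact: solw_sub sy.
  - by move=> u /andP[u1 u2]; apply: bx; rewrite (le_trans l1 u1) (le_trans u2 t2).
  - by move=> u /andP[u1 u2]; apply: by'; rewrite (le_trans l1 u1) (le_trans u2 t2).
  - by move=> b'; rewrite e subrr; exact: nb0.
move=> t tab; pose n := Num.truncn ((t - lo) / tau); apply: (K n.+1) => //.
have := truncnS_gt ((t - lo) / tau); rewrite -/n ltr_pdivrMr//; lra.
Qed.

End Wellposed.

(** * The gauge transformation *)

Section Gauge.
Context {R : realType}.
Notation seqs := (bool -> int -> R[i]).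
Implicit Types (a c f g : int -> R[i]) (j k l : int) (b : bool) (x y : seqs).

Lemma conv_at a c k : conv a c k = csum (fun j => a j * c (k - j)). Proof. by []. Qed.

Lemma Dq_at a k : Dq a k = 'i * kc k * a k. Proof. by rewrite /Dq ikE. Qed.

Lemma pair_ccurve (lo hi : R) (a c : R -> int -> R[i]) k :
  ccurve (Ww 0) lo hi a -> ccurve (Ww 0) lo hi c ->
  (forall t, lo <= t <= hi -> summ (a t)) -> (forall t, lo <= t <= hi -> summ (c t)) ->
  ccurve (Wn (fun=> 1)) lo hi (fun t j => a t j * c t (k - j)).
Proof.
move=> ca cc sa sc x xab e e0.
have /summ_W0[A hA] := sa x xab; have /summ_W0[C hC] := sc x xab.
have A0 := nb_ge0 hA; have C0 := nb_ge0 hC.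
have P0 : 0 <= A + (C + 1) by lra.
have [e1 e10 he1] := ler_eps_div e0 P0.
have e20 : 0 < Num.min e1 1 by rewrite lt_min e10 ltr01.
have [d1 d10 H1] := ca x xab _ e20; have [d2 d20 H2] := cc x xab _ e20.
have m1 : Num.min e1 1 <= e1 by rewrite ge_min lexx.
have m2 : Num.min e1 1 <= 1 by rewrite ge_min lexx orbT.
exists (Num.min d1 d2); first by rewrite !lt_min d10 d20.
move=> t tab; rewrite !lt_min => /andP[/(H1 t tab) h1 /(H2 t tab) h2].
have co n (z : int -> R[i]) Z : nb (Ww 0) z Z -> nC (z n) <= Z.
  by move=> /(nb_Ww_coef n); rewrite wt0 mul1r.
have q1 : sumle (fun j => nC (c t (k - j)) * nC ((a t - a x) j)) ((C + 1) * e1).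
  have c10 : 0 <= C + 1 by lra.
  have /nb_Ww0 h1' := nb_mon m1 h1; have := sumleZ c10 h1'; apply: sumle_mon => // j.
  rewrite ler_wpM2r ?nC_ge0//; have -> : c t (k - j) = c x (k - j) + (c t - c x) (k - j).
    by rewrite fctE [RHS]addrC subrK.
  apply: le_trans (nCD _ _) _; apply: lerD (co _ _ _ hC) _; apply: le_trans m2; exact: co.
have q2 : sumle (fun j => nC ((c t - c x) (k - j)) * nC (a x j)) (e1 * A).
  have /nb_Ww0 hA' := hA; have := sumleZ (ltW e10) hA'; apply: sumle_mon => // j.
  by rewrite ler_wpM2r ?nC_ge0//; apply: le_trans m1; exact: co.
apply: nb_mon he1 _; apply/nb_W1; have := sumleD q1 q2; apply: sumle_mon => [j|]; last by lra.
rewrite -!nCM; apply: le_trans _ (nCD _ _); rewrite le_eqVlt; apply/orP; left; apply/eqP; congr nC.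
rewrite !fctE; ring.
Qed.

(* The second derivatives of the factors of a product are not summable, but only the combination
   [conv (Dq a) (Dq c)] and a total derivative enter. *)
Lemma conv_der (lo hi : R) (al be : R[i]) (a c f g : R -> int -> R[i]) k :
  ccurve (Ww 1) lo hi a -> ccurve (Ww 1) lo hi c ->
  ccurve (Ww 0) lo hi f -> ccurve (Ww 0) lo hi g ->
  (forall t, lo <= t <= hi -> [/\ summ (a t), summ (c t), summ (Dq (a t)) & summ (Dq (c t))]) ->
  (forall t, lo <= t <= hi -> summ (f t) /\ summ (g t)) ->
  (forall j, cder lo hi (a ^~ j) (fun t => al * kc j ^+ 2 * a t j + f t j)) ->
  (forall j, cder lo hi (c ^~ j) (fun t => be * kc j ^+ 2 * c t j + g t j)) ->
  cder lo hi (fun t => conv (a t) (c t) k)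
   (fun t => - 'i * kc k * (al * conv (Dq (a t)) (c t) k + be * conv (a t) (Dq (c t)) k)
     + (al + be) * conv (Dq (a t)) (Dq (c t)) k + conv (f t) (c t) k + conv (a t) (g t) k).
Proof.
move=> ca cc cf cg sac sfg da dc.
have cDa : ccurve (Ww 0) lo hi (fun t => Dq (a t)).
  by move=> x xab e e0; have [d d0 H] := ca x xab e e0; exists d => // t tab tx; rewrite -DqB; apply: Dq_W; rewrite add0r; exact: H.
have cDc : ccurve (Ww 0) lo hi (fun t => Dq (c t)).
  by move=> x xab e e0; have [d d0 H] := cc x xab e e0; exists d => // t tab tx; rewrite -DqB; apply: Dq_W; rewrite add0r; exact: H.
have ca0 := ccurve_W_mono ler01 ca; have cc0 := ccurve_W_mono ler01 cc.
pose P (a c : int -> R[i]) := fun j => a j * c (k - j).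
pose F' t := (fun j => (- 'i * kc k * al) * P (Dq (a t)) (c t) j) + (fun j => (- 'i * kc k * be) * P (a t) (Dq (c t)) j)
  + (fun j => (al + be) * P (Dq (a t)) (Dq (c t)) j) + P (f t) (c t) + P (a t) (g t).
have dF j : cder lo hi (fun t => P (a t) (c t) j) (F' ^~ j).
  have := cderM (da j) (dc (k - j)); apply: cder_eq => // t _.
  rewrite -[F' t j]/(- 'i * kc k * al * (Dq (a t) j * c t (k - j)) + - 'i * kc k * be * (a t j * Dq (c t) (k - j))
    + (al + be) * (Dq (a t) j * Dq (c t) (k - j)) + f t j * c t (k - j) + a t j * g t (k - j)).
  rewrite !Dq_at; have -> : kc k = kc j + kc (k - j) :> R[i] by rewrite -kcD addrC subrK.
  move: (kc j) (kc (k - j)) (a t j) (c t (k - j)) (f t j) (g t (k - j)) => u v p q w z.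
  apply/eqP; rewrite -subr_eq0; apply/eqP.
  (* The identity holds because i^2 = -1: the difference is displayed as a multiple of
     ['i * 'i + 1]. The same device is used below with [ep b]. *)
  rewrite [LHS](_ : _ = ('i * 'i + 1) * ((al * u ^+ 2 + be * v ^+ 2) * (p * q))); last by ring.
  by rewrite ii addNr mul0r.
have sF t : lo <= t <= hi -> summ (P (a t) (c t)).
  by move=> tab; have [? ? _ _] := sac t tab; exact: conv_summ.
have EF t : lo <= t <= hi -> summ (F' t) /\ csum (F' t) =
   - 'i * kc k * (al * conv (Dq (a t)) (c t) k + be * conv (a t) (Dq (c t)) k)
     + (al + be) * conv (Dq (a t)) (Dq (c t)) k + conv (f t) (c t) k + conv (a t) (g t) k.
  move=> tab; have [s1 s2 s3 s4] := sac t tab; have [s5 s6] := sfg t tab.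
  have p1 : summ (P (Dq (a t)) (c t)) := conv_summ k s3 s2.
  have p2 : summ (P (a t) (Dq (c t))) := conv_summ k s1 s4.
  have p3 : summ (P (Dq (a t)) (Dq (c t))) := conv_summ k s3 s4.
  have p4 : summ (P (f t) (c t)) := conv_summ k s5 s2.
  have p5 : summ (P (a t) (g t)) := conv_summ k s1 s6.
  have z1 := summZ (- 'i * kc k * al) p1; have z2 := summZ (- 'i * kc k * be) p2.
  have z3 := summZ (al + be) p3.
  have y1 := summD' z1 z2; have y2 := summD' y1 z3; have y3 := summD' y2 p4.
  split; first exact: summD' y3 p5.
  rewrite /F' (csumD y3 p5) (csumD y2 p4) (csumD y1 z3) (csumD z1 z2) !csumZ// !conv_at.
  by rewrite mulrDr !mulrA.
have cF' : ccurve (Wn (fun=> 1)) lo hi F'.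
  have q t : lo <= t <= hi -> summ (a t) by move=> /sac[].
  have q2 t : lo <= t <= hi -> summ (c t) by move=> /sac[].
  have q3 t : lo <= t <= hi -> summ (Dq (a t)) by move=> /sac[].
  have q4 t : lo <= t <= hi -> summ (Dq (c t)) by move=> /sac[].
  have q5 t : lo <= t <= hi -> summ (f t) by move=> /sfg[].
  have q6 t : lo <= t <= hi -> summ (g t) by move=> /sfg[].
  apply: ccurveD; first apply: ccurveD; first apply: ccurveD; first apply: ccurveD.
  - exact: (ccurveZ _ (@pair_ccurve _ _ _ _ k cDa cc0 q3 q2)).
  - exact: (ccurveZ _ (@pair_ccurve _ _ _ _ k ca0 cDc q q4)).
  - exact: (ccurveZ _ (@pair_ccurve _ _ _ _ k cDa cDc q3 q4)).
  - exact: (@pair_ccurve _ _ _ _ k cf cc0 q5 q2).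
  - exact: (@pair_ccurve _ _ _ _ k ca0 cg q q6).
have := cder_csum dF sF (fun t tab => (EF t tab).1) cF'.
by apply: cder_eq => // t tab; rewrite (EF t tab).2.
Qed.

Lemma cpowS a n : cpow a n.+1 = conv a (cpow a n). Proof. by []. Qed.

Lemma conv_bilin_Z a c (z : R[i]) : summ a -> summ c -> conv a (fun k => z * c k) = (fun k => z * conv a c k).
Proof.
move=> sa sc; apply/funext => k; rewrite !conv_at -csumZ; last exact: conv_summ.
by apply: eq_csum => j; rewrite mulrCA.
Qed.

Lemma Dq_cpow a n : summ a -> summ (Dq a) -> summ (Dq (cpow a n.+1)) /\
  Dq (cpow a n.+1) = (fun k => n.+1%:R * conv (Dq a) (cpow a n) k).
Proof.
move=> sa sD; have sp m := summ_cpow m sa.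
elim: n => [|n [s1 IH]].
  have E : cpow a 1 = a by rewrite cpowS /= convC conv_dl.
  by rewrite E; split=> //; apply/funext => k; rewrite mul1r /= convC conv_dl.
have E : Dq (cpow a n.+2) = conv (Dq a) (cpow a n.+1) + conv a (Dq (cpow a n.+1)).
  by rewrite cpowS Dq_conv.
split; first by rewrite E; apply: summD'; apply: summ_conv => //; exact: sp.
rewrite E IH conv_bilin_Z//; last by apply: summ_conv.
have -> : conv a (conv (Dq a) (cpow a n)) = conv (Dq a) (cpow a n.+1).
  apply: Ss_inj; [by apply: summ_conv => //; apply: summ_conv|by apply: summ_conv|].
  move=> x; rewrite !Ss_conv//; [by rewrite mulrCA|exact: summ_conv].
apply/funext => k; rewrite fctE -[n.+2%:R]natr1 mulrDl mul1r addrC; congr (_ + _).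
Qed.

(** Term by term, the derivative of a^n / n! is (Da) a^(n-1) / (n-1)!; the term n = 0 is constant
    and drops out. *)
Lemma Dq_expq a : summ a -> summ (Dq a) -> Dq (expq a) = conv (Dq a) (expq a).
Proof.
move=> sa sD; apply/funext => k; have se := expq_summ k sa.
rewrite {1}/Dq /expq -csumZ//.
have se' : summ (fun n => (0 +i* k%:~R) * ((n`!%:R^-1)%:C * cpow a n k)) by exact: summZ.
rewrite csum_recl// (_ : (0 +i* k%:~R) * _ = 0); last first.
  rewrite -[cpow a 0]/dl /dl; case: eqP => [->|_]; last by rewrite !mulr0.
  by rewrite (_ : 0 +i* _ = 0 :> R[i]) ?mul0r// -complex0.
rewrite add0r.
have E n : (0 +i* k%:~R) * ((n.+1`!%:R^-1)%:C * cpow a n.+1 k) = csum (fun j => Dq a j * ((n`!%:R^-1)%:C * cpow a n (k - j))).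
  rewrite mulrCA -[_ * cpow a n.+1 k]/(Dq (cpow a n.+1) k) (Dq_cpow n sa sD).2 conv_at mulrA.
  have -> : (n.+1`!%:R^-1)%:C * n.+1%:R = ((n`!%:R : R)^-1)%:C :> R[i].
    by rewrite -(rmorph_nat (real_complex R)) -rmorphM/= factS natrM invfM mulrAC mulVf ?mul1r.
  rewrite -csumZ; last by apply: conv_summ => //; exact: summ_cpow.
  by apply: eq_csum => j; rewrite mulrCA.
rewrite (eq_csum E) conv_at csum_swap; last first.
  have [A hA] := sa; have /nb_Ww0 hA' := hA; have A0 := nb_ge0 hA'.
  have [D hD] := sD; exists (expR A * D).
  apply: (@sumle_pair R nat int (fun n j => nC (Dq a j * ((n`!%:R^-1)%:C * cpow a n (k - j)))) (fun n => ec A n * D)).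
  - by move=> *; exact: nC_ge0.
  - move=> n; have := sumleZ (ec_ge0 n A0) hD; apply: sumle_mon => // j.
    rewrite nCM mulrC ler_wpM2r ?nC_ge0// nCM nC_fact /ec mulrC.
    apply: ler_wpM2r; first by rewrite invr_ge0.
    have := nb_Ww_coef (k - j) (nb_cpow n (@algn_Ww0 R) hA'); by rewrite wt0 !mul1r.
  - have D0 : 0 <= D := sumle_ge0 hD.
    have := sumleZ D0 (sumle_ec A0); rewrite mulrC; apply: sumle_mon => // n; by rewrite mulrC.
apply: eq_csum => j; rewrite /expq csumZ//; exact: expq_summ.
Qed.

(** Translation by x of the function with these coefficients. *)
Definition tr (x : R) a k := ek k x * a k.

Lemma nb_tr (N : gnorm (R := R) int) (x : R) a A : nb N a A -> nb N (tr x a) A.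
Proof. by apply: nb_solid => // k; rewrite /tr nCM nC_ek mul1r. Qed.

Lemma tr_conv (x : R) a c : summ a -> summ c -> conv (tr x a) (tr x c) = tr x (conv a c).
Proof.
move=> sa sc; apply/funext => k; rewrite /tr !conv_at -csumZ; last exact: conv_summ.
apply: eq_csum => j; have -> : ek k x = ek j x * ek (k - j) x by rewrite -ekD addrC subrK.
by rewrite mulrACA.
Qed.

Lemma tr_Dq (x : R) a : Dq (tr x a) = tr x (Dq a).
Proof. by apply/funext => k; rewrite /Dq /tr mulrCA. Qed.

Lemma trN (x : R) a : tr (- x) (tr x a) = a.
Proof.
apply/funext => k; rewrite /tr mulrA -ek_addx addNr.
by rewrite ek_x0 mul1r.
Qed.

Lemma tr_md (x : R) a : md (tr x a) = md a.
Proof. by apply/funext => k; rewrite /md /tr ek0 mul1r. Qed.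

Lemma md_tr (x : R) a : tr x (md a) = md a.
Proof. by apply/funext => k; rewrite /md /tr /dl; case: eqP => [->|_]; rewrite ?ek0 ?mul1r// !mulr0. Qed.

Lemma Ss_md a (x : R) : Ss (md a) x = a 0.
Proof. by rewrite SsZ; [rewrite Ss_dl mulr1|exact: summ_dl]. Qed.

Lemma summ_md a : summ (md a).
Proof. apply: summZ; exact: summ_dl. Qed.

Lemma conv_md a c : conv (md a) c = (fun k => a 0 * c k).
Proof.
apply/funext => k; rewrite conv_at (@csum_single _ _ _ 0).
  by rewrite /md /dl eqxx mulr1 subr0.
by move=> j /negbTE j0; rewrite /md /dl j0 mulr0 mul0r.
Qed.

(** The mean-free primitive: at k = 0 the divisor is 0, hence so is the quotient. *)
Definition Iq a k : R[i] := a k / (0 +i* k%:~R).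

Lemma Iq_le a k : nC (Iq a k) <= nC (a k).
Proof.
rewrite /Iq nCM Normc.normcV nC_ik; have [->|k0] := eqVneq k 0.
  by rewrite normr0 invr0 mulr0 nC_ge0.
rewrite ler_piMr ?nC_ge0// invf_le1; last by rewrite normr_gt0 intr_eq0.
rewrite -[leLHS](_ : 1%:~R = 1)// -intr_norm ler_int; by rewrite -gtz0_ge1 normr_gt0.
Qed.

Lemma Dq_Iq a : a 0 = 0 -> Dq (Iq a) = a.
Proof.
move=> a0; apply/funext => k; rewrite /Dq /Iq mulrCA.
have [->|k0] := eqVneq k 0; first by rewrite a0 mul0r.
rewrite divff ?mulr1//; apply/eqP => /(congr1 (@Normc.normc R)); rewrite nC_ik nC0 => /eqP.
by rewrite normr_eq0 intr_eq0 (negbTE k0).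
Qed.

Lemma rho0 x : rho x 0 = 0.
Proof. rewrite -[LHS]/(conv (x true) (x false) 0 - conv (x true) (x false) 0 * dl 0).
by rewrite /dl eqxx mulr1 subrr. Qed.

Lemma convb b x : conv (x b) (x (~~ b)) = conv (x true) (x false).
Proof. by case: b => //=; rewrite convC. Qed.

Definition gam b x k : R[i] := - (ep b / 2) * Iq (rho x) k.

Lemma gamN b x k : gam (~~ b) x k = - gam b x k.
Proof. by rewrite /gam epN; move: (Iq _ _) => z; ring. Qed.

Lemma Dq_gam b x k : Dq (gam b x) k = - (ep b / 2) * rho x k.
Proof.
by rewrite -[in RHS](Dq_Iq (rho0 x)) /Dq /gam mulrCA.
Qed.

(* [c = -1] gives the gauge transformation and [c = 1] its inverse. *)
Definition gmq (c : R[i]) x b := conv (expq (fun k => c * gam b x k)) (x b).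

End Gauge.

Ltac summ_tac := repeat match goal with
  | |- is_true _ => fail 1
  | |- summ (conv _ _) => apply: summ_conv
  | |- summ (expq _) => apply: summ_expq
  | |- summ dl => exact: summ_dl
  | |- summ (md _) => exact: summ_md
  | |- summ (- _) => apply: summN'
  | |- summ (_ + _) => apply: summD'
  | |- summ (fun k => _ * _) => apply: summZ
  | |- summ _ => assumption
  end.

(** * Sobolev bounds and invertibility of the gauge *)

Section GaugeRegularity.
Context {R : realType}.
Notation seqs := (bool -> int -> R[i]).
Implicit Types (a c f g : int -> R[i]) (j k l : int) (b : bool) (x y : seqs).
Variables (s : R).
Hypothesis hs : 3 / 2 < s.
Notation X := (Hw (R := R) s).
Notation X1 := (Hw (R := R) (s - 1)).

Lemma lip_solid (N N' : gnorm (R := R) int) F (T : (int -> R[i]) -> int -> R[i]) : lipb N N' F ->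
  (forall a k, nC (T a k) <= nC (a k)) -> (forall a c k, T a k - T c k = T (a - c) k) -> lipb N N' (fun x => T (F x)).
Proof.
move=> hF T1 T2 r; have [A [A0 A1 A2]] := hF r; exists A; split=> //.
  by move=> x /A1; apply: nb_solid.
move=> x y D hx hy hd; have := A2 _ _ _ hx hy hd; apply: nb_solid => // k.
by rewrite fctE T2.
Qed.

Lemma lip_gam b : lipb X X (gam b).
Proof.
apply: (@lipZ _ X X (fun x => Iq (rho x))); apply: (@lip_solid X X rho Iq).
- exact: lip_rho.
- exact: Iq_le.
- by move=> a c k; rewrite /Iq -mulrBl.
Qed.

Lemma lip_expq N N' C F : algn N' C -> lipb N N' F -> lipb N N' (fun x => expq (F x)).
Proof.
move=> hN hF r; have [A [A0 A1 A2]] := hF r; have C1 := algn_ge0 hN; have C0 : 0 <= C by lra.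
pose E := C * expR (C * A) * (C * A * expR (C * (A * (2 * `|r|)))).
have E0 : 0 <= E by rewrite !mulr_ge0// expR_ge0.
exists (expR (C * A) + E); split; first by rewrite addr_ge0// expR_ge0.
  by move=> x /A1/(nb_expq0 hN); apply: nb_mon; rewrite lerDl.
move=> x y D hx hy hd; have D0 := nb_ge0 (hd true); have r0 := nb_ge0 (hx true).
(* D is arbitrary, but points of the ball are at most 2 |r| apart; with D' inside the exponential
   the bound stays linear in D. *)
pose D' := Num.min D (2 * `|r|).
have D'0 : 0 <= D' by rewrite le_min D0 mulr_ge0.
have hd' b : nb N (x b - y b) D'.
  rewrite /D'; case: (leP D (2 * `|r|)) => _; first exact: hd.
  by apply: nb_mon (nbB (hx b) (hy b)); rewrite ger0_norm//; lra.
have := expqB hN (A1 _ hy) (A1 _ hx) (A2 _ _ _ hx hy hd'); apply: nb_mon.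
have m1 : D' <= D by rewrite ge_min lexx.
have m2 : D' <= 2 * `|r| by rewrite ge_min lexx orbT.
apply: (@le_trans _ _ (E * D)); last first.
  by apply: ler_wpM2r => //; rewrite lerDr expR_ge0.
rewrite /E -![leRHS]mulrA -![leLHS]mulrA; apply: ler_wpM2l => //; apply: ler_wpM2l; first exact: expR_ge0.
rewrite (_ : C * (A * D') * _ = C * A * (D' * expR (C * (A * D')))); last by ring.
rewrite -[leRHS]mulrA; apply: ler_wpM2l; first exact: mulr_ge0.
rewrite [leRHS]mulrC; apply: ler_pM => //; rewrite ?expR_ge0//.
by rewrite ler_expR; apply: ler_wpM2l => //; exact: ler_wpM2l.
Qed.

Lemma lip_gmq (c : R[i]) b : lipb X X (fun x => gmq c x b).
Proof.
have [C hC] := algX hs; apply: (lip_conv hC); last exact: lip_proj.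
by apply: (lip_expq hC); apply: lipZ; exact: lip_gam.
Qed.

Lemma X_summ a A : nb X a A -> summ a /\ summ (Dq a).
Proof. by move=> /(X_facts hs)[]. Qed.

Lemma lip_summ (F : seqs -> int -> R[i]) (r : R) x : lipb X X F -> bdd X r x -> summ (F x) /\ summ (Dq (F x)).
Proof. by move=> /(_ r)[A [_ H _]] /H /X_summ. Qed.

Lemma lip_summ1 (F : seqs -> int -> R[i]) (r : R) x : lipb X X1 F -> bdd X r x -> summ (F x).
Proof. by move=> /(_ r)[A [_ H _]] /H h; have [K _ hK] := X1_W0 hs; exact: W0_summ (hK _ _ h). Qed.

(** The two components are multiplied by mutually inverse factors, so their product, and with it the
    exponent of the gauge, is unchanged. Hence changing the sign of c inverts the gauge. *)
Lemma rho_gmq (c : R[i]) x r : bdd X r x -> rho (gmq c x) = rho x.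
Proof.
move=> hx; rewrite /rho; suff -> : conv (gmq c x true) (gmq c x false) = conv (x true) (x false) by [].
have [st _] := X_summ (hx true); have [sf _] := X_summ (hx false).
have [sg _] := lip_summ (lip_gam true) hx.
have e : (fun k => c * gam false x k) = - (fun k => c * gam true x k).
  by apply/funext => k; rewrite -[false]/(~~ true) gamN mulrN.
rewrite /gmq e; set g := fun k => c * gam true x k.
have sgg : summ g by exact: summZ.
apply: Ss_inj; [by summ_tac|by summ_tac|] => z.
rewrite !Ss_conv; try by summ_tac.
have E : Ss (expq g) z * Ss (expq (- g)) z = 1.
  by rewrite -Ss_conv; [rewrite expqN// Ss_dl|summ_tac|summ_tac].
by rewrite mulrACA E mul1r.
Qed.

Lemma gmqK (c : R[i]) x r r' : bdd X r x -> bdd X r' (gmq c x) -> gmq (- c) (gmq c x) = x.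
Proof.
move=> hx hx'; apply/funext => b; rewrite {1}/gmq.
have -> : gam b (gmq c x) = gam b x by apply/funext => k; rewrite /gam (rho_gmq _ hx).
have [st _] := X_summ (hx b); have [sg _] := lip_summ (lip_gam b) hx.
rewrite /gmq; set g := fun k => c * gam b x k.
have -> : (fun k => - c * gam b x k) = - g by apply/funext => k; rewrite mulNr.
have sgg : summ g by exact: summZ.
apply: Ss_inj; [by summ_tac|by summ_tac|] => z.
rewrite !Ss_conv; try by summ_tac.
have E : Ss (expq g) z * Ss (expq (- g)) z = 1.
  by rewrite -Ss_conv; [rewrite expqN// Ss_dl|summ_tac|summ_tac].
by rewrite mulrA [_ * Ss (expq g) z]mulrC E mul1r.
Qed.

End GaugeRegularity.

(** * The equations after the gauge and after the change of frame *)

Section GaugeDynamics.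
Context {R : realType}.
Notation seqs := (bool -> int -> R[i]).
Implicit Types (a c f g : int -> R[i]) (j k l : int) (b : bool) (x y : seqs).
Variables (s : R).
Hypothesis hs : 3 / 2 < s.
Notation X := (Hw (R := R) s).
Notation X1 := (Hw (R := R) (s - 1)).

Definition fsol (Ff : bool -> seqs -> int -> R[i]) lo hi (x : R -> seqs) :=
  (forall b, ccurve X lo hi (x ^~ b)) /\
  forall b k, cder lo hi (fun t => x t b k) (fun t => Lk b k * x t b k + Ff b (x t) k).

Lemma Dq0 a : Dq a 0 = 0.
Proof. by rewrite Dq_at /kc mulr0 mul0r. Qed.

Lemma Dq_md a : Dq (md a) = 0.
Proof.
apply/funext => k; rewrite Dq_at /md /dl; case: eqP => [->|_]; last by rewrite !mulr0.
by rewrite /kc mulr0 mul0r.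
Qed.

Lemma DqZ (z : R[i]) a : Dq (fun k => z * a k) = (fun k => z * Dq a k).
Proof. by apply/funext => k; rewrite /Dq mulrCA. Qed.

Lemma X_sums x (r : R) : bdd X r x ->
  [/\ forall b, summ (x b), forall b, summ (Dq (x b)), summ (rho x) & summ (Dq (rho x))].
Proof.
move=> hx; have [s1 s2] := lip_summ hs (lip_rho hs) hx.
by split=> // b; have [] := X_summ hs (hx b).
Qed.

Lemma rhoE b x : rho x = conv (x b) (x (~~ b)) - md (conv (x b) (x (~~ b))).
Proof. by rewrite convb. Qed.

Lemma Ss_rho b x (r : R) z : bdd X r x ->
  Ss (rho x) z = Ss (x b) z * Ss (x (~~ b)) z - conv (x b) (x (~~ b)) 0.
Proof.
move=> hx; have [s1 s2 s3 s4] := X_sums hx; have := s1 b; have := s1 (~~ b) => p1 p2.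
by rewrite (rhoE b) SsB ?Ss_conv ?Ss_md//; summ_tac.
Qed.

Lemma Ss_Drho b x (r : R) z : bdd X r x ->
  Ss (Dq (rho x)) z = Ss (Dq (x b)) z * Ss (x (~~ b)) z + Ss (x b) z * Ss (Dq (x (~~ b))) z.
Proof.
move=> hx; have [s1 s2 s3 s4] := X_sums hx; have := s1 b; have := s1 (~~ b) => p1 p2.
have := s2 b; have := s2 (~~ b) => p3 p4.
by rewrite (rhoE b) DqB Dq_md subr0 Dq_conv// SsD ?Ss_conv//; summ_tac.
Qed.

Lemma conv_D0 a c : summ a -> summ c -> summ (Dq a) -> summ (Dq c) ->
  conv (Dq a) c 0 = - conv a (Dq c) 0.
Proof.
move=> sa sc sDa sDc; apply/eqP; rewrite -subr_eq0 opprK; apply/eqP.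
by rewrite -[LHS]/((conv (Dq a) c + conv a (Dq c)) 0) -Dq_conv// Dq0.
Qed.

Section Generic.
Variables (Ff Bf : bool -> seqs -> int -> R[i]).
Hypothesis hF : forall b, lipb X X1 (Ff b).
Hypothesis hB : forall b, lipb X X (Bf b).
Hypothesis hFB : forall x (r : R) b, bdd X r x ->
  conv (Ff b x) (x (~~ b)) + conv (x b) (Ff (~~ b) x) = Dq (Bf b x).

(** The current u v_x - u_x v which, up to the factor [ep b], transports the density uv under the
    linear flow. *)
Definition Wr b x := conv (x b) (Dq (x (~~ b))) - conv (Dq (x b)) (x (~~ b)).

Lemma X1_ccurve lo hi r F (x : R -> seqs) : lipb X X1 F -> (forall b, ccurve X lo hi (x ^~ b)) ->
  (forall t, lo <= t <= hi -> bdd X r (x t)) -> ccurve (Ww 0) lo hi (fun t => F (x t)).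
Proof. by move=> lF cx bx; apply: (ccurve_X1_W0 hs); exact: lip_ccurve lF cx bx. Qed.

(** The conservation law of uv: opposite dispersion signs leave a divergence from the linear part,
    and [hFB] makes the nonlinear part a divergence too. *)
Lemma pair_der lo hi r (x : R -> seqs) b k : fsol Ff lo hi x -> (forall t, lo <= t <= hi -> bdd X r (x t)) ->
  cder lo hi (fun t => conv (x t b) (x t (~~ b)) k)
    (fun t => ep b * Dq (Wr b (x t)) k + Dq (Bf b (x t)) k).
Proof.
move=> [cx dx] bx.
have c1 b' : ccurve (Ww 1) lo hi (x ^~ b') by apply: (ccurve_X_W hs) => //; exact: cx.
have cF b' : ccurve (Ww 0) lo hi (fun t => Ff b' (x t)) := X1_ccurve (hF b') cx bx.
have := @conv_der R lo hi (ep b) (ep (~~ b)) _ _ _ _ k (c1 b) (c1 (~~ b)) (cF b) (cF (~~ b)) _ _ (dx b) (dx (~~ b)).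
move=> H; apply: cder_eq (H _ _) => //; first last.
- by move=> t tab; split; apply: (lip_summ1 hs) (hF _) (bx t tab).
- by move=> t tab; have [s1 s2 _ _] := X_sums (bx t tab).
move=> t tab; rewrite -(hFB b (bx t tab)) epN addrN mul0r addr0.
rewrite -[(conv (Ff _ _) _ + conv _ _) k]/(conv (Ff b (x t)) (x t (~~ b)) k + conv (x t b) (Ff (~~ b) (x t)) k) addrA.
congr (_ + _ + _); rewrite Dq_at -[Wr b (x t) k]/(conv (x t b) (Dq (x t (~~ b))) k - conv (Dq (x t b)) (x t (~~ b)) k).
ring.
Qed.

Lemma mean_const lo hi r (x : R -> seqs) : fsol Ff lo hi x -> (forall t, lo <= t <= hi -> bdd X r (x t)) ->
  forall t, lo <= t <= hi -> conv (x t true) (x t false) 0 = conv (x lo true) (x lo false) 0.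
Proof.
move=> hx bx t /andP[t1 t2]; have := pair_der true 0 hx bx => /= d.
have d0 : cder lo t (fun t => conv (x t true) (x t false) 0) (fun=> 0).
  by apply: cder_eq (cder_sub (lexx lo) t2 d) => // u _; rewrite !Dq0 mulr0 addr0.
have := nC_mvt t1 d0 (M := 0); rewrite mul0r => H.
apply/eqP; rewrite -subr_eq0; apply/eqP/nC_eq0; apply/eqP; rewrite eq_le nC_ge0 andbT H// => u _.
by rewrite nC0.
Qed.

(** Applying - (ep b / 2) D^(-1) to the conservation law undoes its divergence, since the square of
    [ep b] is -1; without the mean, removed in [Gt], this is the time derivative of [gam]. *)
Definition Aq b x : int -> R[i] := (fun k => 2^-1 * Wr b x k) - (fun k => ep b / 2 * Bf b x k).
Definition Gt b x := Aq b x - md (Aq b x).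

Lemma lip_Aq b : lipb X X1 (Aq b).
Proof.
have [C1 hC1] := algX1 hs; apply: lipB.
  apply: (@lipZ _ X X1 (Wr b)); apply: lipB; apply: (lip_conv hC1); try exact: lip_incl;
    by apply: (@lip_Dq _ s); exact: lip_proj.
apply: (@lipZ _ X X1 (Bf b)); apply: (@lip_weak _ _ X _ _ 1) => //.
by move=> a A h; rewrite mul1r; apply: Hw_mono h; rewrite gerDl lerN10.
Qed.

Lemma lip_Gt b : lipb X X1 (Gt b).
Proof. by apply: lipB; [exact: lip_Aq|apply: (@lip_md _ (s - 1)); exact: lip_Aq]. Qed.

Lemma gam_der lo hi r (x : R -> seqs) b k : fsol Ff lo hi x -> (forall t, lo <= t <= hi -> bdd X r (x t)) ->
  cder lo hi (fun t => gam b (x t) k) (fun t => Gt b (x t) k).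
Proof.
move=> hx bx; have [->|k0] := eqVneq k 0.
  apply: cder_eq (@cder_cst R lo hi 0) => t _; first by rewrite /gam /Iq rho0 mul0r mulr0.
  by rewrite -[RHS]/(Aq b (x t) 0 - Aq b (x t) 0 * dl 0) /dl eqxx mulr1 subrr.
have dk : dl k = 0 :> R[i] by rewrite /dl (negbTE k0).
have i0 : (0 +i* k%:~R : R[i]) != 0.
  apply/eqP => /(congr1 (@Normc.normc R)); rewrite nC_ik nC0 => /eqP.
  by rewrite normr_eq0 intr_eq0 (negbTE k0).
have := cderZ (- (ep b / 2) / (0 +i* k%:~R)) (pair_der b k hx bx).
apply: cder_eq => t _.
  rewrite /gam /Iq (rhoE b) -[(conv _ _ - md _) k]/(conv (x t b) (x t (~~ b)) k - conv (x t b) (x t (~~ b)) 0 * dl k) dk mulr0 subr0.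
  by rewrite mulrA mulrAC.
rewrite -[Gt b (x t) k]/(2^-1 * Wr b (x t) k - ep b / 2 * Bf b (x t) k - Aq b (x t) 0 * dl k) dk mulr0 subr0.
rewrite /Dq; move: i0 (ep2 (R := R) b); move: (0 +i* k%:~R : R[i]) (Wr _ _ _) (Bf _ _ _) (ep b) => d u v e d0 e2.
rewrite [LHS](_ : _ = - (e * e) / 2 * u - e / 2 * v); last by field.
by rewrite e2 opprK mul1r.
Qed.

Definition hq (z : R[i]) b x k := z * (- (ep b / 2) * rho x k).
Definition Eq (z : R[i]) b x := expq (fun k => z * gam b x k).

(* The nonlinearity of the equation satisfied by [gmq z x]; [Bf] is the flux in the conservation law of the product uv. *)
Definition Nq (z : R[i]) b x : int -> R[i] :=
  (fun k => 2 * ep b * conv (conv (hq z b x) (Eq z b x)) (Dq (x b)) k)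
  + (fun k => ep b * conv (conv (Dq (hq z b x)) (Eq z b x) + conv (hq z b x) (conv (hq z b x) (Eq z b x))) (x b) k)
  + conv (conv (fun k => z * Gt b x k) (Eq z b x)) (x b) + conv (Eq z b x) (Ff b x).

Lemma E_sums z b x (r : R) : bdd X r x ->
  [/\ summ (Eq z b x), summ (hq z b x), summ (Dq (hq z b x)),
   Dq (Eq z b x) = conv (hq z b x) (Eq z b x) & summ (fun k => z * gam b x k)].
Proof using hs.
move=> hx; have [s1 s2 s3 s4] := X_sums hx; have [g1 g2] := lip_summ hs (lip_gam hs b) hx.
have sg : summ (fun k => z * gam b x k) by summ_tac.
have sh : summ (hq z b x) by apply: summZ; summ_tac.
have e : Dq (fun k => z * gam b x k) = hq z b x.
  by rewrite DqZ; apply/funext => k; rewrite Dq_gam.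
split=> //.
- exact: summ_expq.
- rewrite (_ : hq z b x = fun k => z * - (ep b / 2) * rho x k); last by apply/funext => k; rewrite /hq mulrA.
  by rewrite DqZ; summ_tac.
- by rewrite /Eq Dq_expq// e.
Qed.

(** The product rule for E x_b with E = [Eq]: here E_x = h E and E_xx = (h_x + h^2) E for h = [hq],
    and E_t = z [Gt] E. The term E (x_b)_xx combines with these into the second derivative of the
    product. *)
Lemma gmq_der z lo hi r (x : R -> seqs) b k : fsol Ff lo hi x -> (forall t, lo <= t <= hi -> bdd X r (x t)) ->
  cder lo hi (fun t => gmq z (x t) b k) (fun t => Lk b k * gmq z (x t) b k + Nq z b (x t) k).
Proof.
move=> hx bx; have [cx dx] := hx; have [C hC] := algX hs; have [C1 hC1] := algX1 hs.
have lE : lipb X X (Eq z b) by apply: (lip_expq hC); apply: lipZ; exact: lip_gam.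
have lzG : lipb X X1 (fun x k => z * Gt b x k) by apply: lipZ; exact: lip_Gt.
have lGE : lipb X X1 (fun x => conv (fun k => z * Gt b x k) (Eq z b x)).
  apply: (lip_conv hC1) => //; apply: (@lip_weak _ _ X _ _ 1) lE => //.
  by move=> a A h; rewrite mul1r; apply: Hw_mono h; rewrite gerDl lerN10.
have cE : ccurve (Ww 1) lo hi (fun t => Eq z b (x t)).
  by apply: (ccurve_X_W hs) => //; exact: lip_ccurve lE cx bx.
have c1 b' : ccurve (Ww 1) lo hi (x ^~ b') by apply: (ccurve_X_W hs) => //; exact: cx.
have dE k' : cder lo hi (fun t => Eq z b (x t) k')
    (fun t => 0 * kc k' ^+ 2 * Eq z b (x t) k' + conv (fun k => z * Gt b (x t) k) (Eq z b (x t)) k').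
  have := @expq_der R lo hi (fun t k => z * gam b (x t) k) (fun t k => z * Gt b (x t) k) _ (X1_ccurve lzG cx bx) _ _ k'.
  move=> H; apply: cder_eq (H _ _ _) => //.
  - by move=> t _; rewrite !mul0r add0r.
  - by move=> i; apply: cderZ; exact: gam_der hx bx.
  - by move=> t tab; have [] := E_sums z b (bx t tab).
  - by move=> t tab; exact: (lip_summ1 (F := fun x k => z * Gt b x k) hs lzG (bx t tab)).
have := @conv_der R lo hi 0 (ep b) _ _ _ _ k cE (c1 b) (X1_ccurve lGE cx bx) (X1_ccurve (hF b) cx bx) _ _ dE (dx b).
move=> H; apply: cder_eq (H _ _) => //; first last.
- by move=> t tab; split; [exact: (lip_summ1 (F := fun x => conv (fun k => z * Gt b x k) (Eq z b x)) hs lGE (bx t tab))|exact: (lip_summ1 hs (hF b) (bx t tab))].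
- move=> t tab; have [s1 s2 _ _] := X_sums (bx t tab).
  by have [e1 e2] := lip_summ hs lE (bx t tab).
move=> t tab; have [s1 s2 _ _] := X_sums (bx t tab).
have [e1 e2 e3 e4 e5] := E_sums z b (bx t tab).
have sU := s1 b; have sDU := s2 b.
have e6 : summ (Dq (Eq z b (x t))) by rewrite e4; summ_tac.
rewrite mul0r !add0r.
rewrite -[Nq z b (x t) k]/(2 * ep b * conv (conv (hq z b (x t)) (Eq z b (x t))) (Dq (x t b)) k
  + ep b * conv (conv (Dq (hq z b (x t))) (Eq z b (x t)) + conv (hq z b (x t)) (conv (hq z b (x t)) (Eq z b (x t)))) (x t b) k
  + conv (conv (fun k => z * Gt b (x t) k) (Eq z b (x t))) (x t b) k + conv (Eq z b (x t)) (Ff b (x t)) k).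
rewrite !addrA; congr (_ + _ + _).
have D1 : Dq (gmq z (x t) b) k = conv (conv (hq z b (x t)) (Eq z b (x t))) (x t b) k + conv (Eq z b (x t)) (Dq (x t b)) k.
  by rewrite /gmq -/(Eq z b (x t)) Dq_conv// e4.
have D2 : Dq (conv (conv (hq z b (x t)) (Eq z b (x t))) (x t b)) k =
   conv (conv (Dq (hq z b (x t))) (Eq z b (x t)) + conv (hq z b (x t)) (conv (hq z b (x t)) (Eq z b (x t)))) (x t b) k
   + conv (conv (hq z b (x t)) (Eq z b (x t))) (Dq (x t b)) k.
  have sDh : summ (Dq (conv (hq z b (x t)) (Eq z b (x t)))) by rewrite Dq_conv// e4; summ_tac.
  have q1 : summ (conv (hq z b (x t)) (Eq z b (x t))) by summ_tac.
  have key : Dq (conv (hq z b (x t)) (Eq z b (x t))) = conv (Dq (hq z b (x t))) (Eq z b (x t)) + conv (hq z b (x t)) (conv (hq z b (x t)) (Eq z b (x t))).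
    by rewrite (Dq_conv e2 e1 e3 e6) e4.
  by rewrite (Dq_conv q1 sU sDh sDU) key.
move: D1 D2; rewrite !Dq_at e4 /Lk.
move: (conv (Eq z b (x t)) (Dq (x t b)) k) (conv (conv (Dq _) _ + _) _ k) => a3 a4.
move: (gmq z (x t) b k) (conv (conv (hq z b (x t)) (Eq z b (x t))) (x t b) k) (conv (conv (hq z b (x t)) (Eq z b (x t))) (Dq (x t b)) k) (ep b) (kc k) => q a2 a1 e u D1 D2.
have -> : a3 = 'i * u * q - a2 by rewrite D1 addrC addKr.
have -> : a4 = 'i * u * a2 - a1 by rewrite D2 addrK.
apply/eqP; rewrite -subr_eq0; apply/eqP.
rewrite [LHS](_ : _ = ('i * 'i + 1) * (- e * u ^+ 2 * q)); last by ring.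
by rewrite ii addNr mul0r.
Qed.

(** In pointwise form everything has the factor E, so that the comparisons with [Nn] and [Fr] reduce
    to algebraic identities between numbers. *)
Lemma Ss_Nq z b x (r : R) p : bdd X r x -> summ (Ff b x) -> summ (Bf b x) ->
  let h := z * (- (ep b / 2) * Ss (rho x) p) in
  Ss (Nq z b x) p = Ss (Eq z b x) p *
   (2 * ep b * h * Ss (Dq (x b)) p + ep b * (z * (- (ep b / 2) * Ss (Dq (rho x)) p) + h * h) * Ss (x b) p
    + z * (2^-1 * (Ss (x b) p * Ss (Dq (x (~~ b))) p - Ss (Dq (x b)) p * Ss (x (~~ b)) p)
           - ep b / 2 * Ss (Bf b x) p - Aq b x 0) * Ss (x b) p + Ss (Ff b x) p).
Proof using hs.
move=> hx sF sB h; have [s1 s2 s3 s4] := X_sums hx; have [e1 e2 e3 e4 e5] := E_sums z b hx.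
have sU := s1 b; have sDU := s2 b; have sV := s1 (~~ b); have sDV := s2 (~~ b).
have sW : summ (Wr b x) by rewrite /Wr; summ_tac.
have sA : summ (Aq b x) by rewrite /Aq; summ_tac.
have sG : summ (Gt b x) by rewrite /Gt; summ_tac.
have hE : Ss (hq z b x) p = h.
  rewrite /h -SsZ// -SsZ; last by summ_tac.
  by [].
have h1E : Ss (Dq (hq z b x)) p = z * (- (ep b / 2) * Ss (Dq (rho x)) p).
  have -> : Dq (hq z b x) = (fun k => z * (- (ep b / 2) * Dq (rho x) k)).
    by apply/funext => k; rewrite /Dq /hq; ring.
  by rewrite !SsZ//; summ_tac.
have GE : Ss (fun k => z * Gt b x k) p = z * (2^-1 * (Ss (x b) p * Ss (Dq (x (~~ b))) p - Ss (Dq (x b)) p * Ss (x (~~ b)) p)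
           - ep b / 2 * Ss (Bf b x) p - Aq b x 0).
  rewrite SsZ// /Gt SsB ?Ss_md//; last by summ_tac.
  rewrite {1}/Aq SsB; try by summ_tac.
  rewrite !SsZ// /Wr SsB ?Ss_conv//; by summ_tac.
have q1 : summ (conv (hq z b x) (Eq z b x)) by summ_tac.
have q2 : summ (conv (Dq (hq z b x)) (Eq z b x) + conv (hq z b x) (conv (hq z b x) (Eq z b x))) by summ_tac.
have q3 : summ (fun k => z * Gt b x k) by summ_tac.
have q4 : summ (conv (fun k => z * Gt b x k) (Eq z b x)) by summ_tac.
rewrite /Nq !SsD; try by summ_tac.
rewrite !SsZ; try by summ_tac.
rewrite (Ss_conv p q1 sDU) (Ss_conv p q2 sU) (Ss_conv p q4 sU) (Ss_conv p e1 sF) (Ss_conv p q3 e1) GE.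
rewrite SsD; try by summ_tac.
rewrite (Ss_conv p e3 e1) (Ss_conv p e2 q1) (Ss_conv p e2 e1) hE h1E.
move: (Aq b x 0) (Ss (Bf b x) p) (Ss (Ff b x) p) (Ss (Eq z b x) p) (Ss (x b) p) (Ss (Dq (x b)) p) (Ss (Dq (rho x)) p) (Ss (x (~~ b)) p) (Ss (Dq (x (~~ b))) p) (2^-1 : R[i]) => *; ring.
Qed.

Lemma Nq_summ z b x (r : R) : bdd X r x -> summ (Ff b x) -> summ (Bf b x) -> summ (Nq z b x).
Proof using hs.
move=> hx sF sB; have [s1 s2 s3 s4] := X_sums hx; have [e1 e2 e3 e4 e5] := E_sums z b hx.
have sU := s1 b; have sDU := s2 b; have sV := s1 (~~ b); have sDV := s2 (~~ b).
have sW : summ (Wr b x) by rewrite /Wr; summ_tac.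
have sA : summ (Aq b x) by rewrite /Aq; summ_tac.
have sG : summ (Gt b x) by rewrite /Gt; summ_tac.
by rewrite /Nq; summ_tac.
Qed.

End Generic.

Lemma Ss_gmq z b x (r : R) p : bdd X r x ->
  [/\ Ss (gmq z x b) p = Ss (Eq z b x) p * Ss (x b) p,
   Ss (Dq (gmq z x b)) p = Ss (Eq z b x) p * (z * (- (ep b / 2) * Ss (rho x) p) * Ss (x b) p + Ss (Dq (x b)) p) &
   Ss (Eq z b x) p * Ss (Eq z (~~ b) x) p = 1].
Proof.
move=> hx; have [s1 s2 s3 s4] := X_sums hx; have [e1 e2 e3 e4 e5] := E_sums z b hx.
have sU := s1 b; have sDU := s2 b.
have sD : summ (Dq (Eq z b x)) by rewrite e4; summ_tac.
have hE : Ss (hq z b x) p = z * (- (ep b / 2) * Ss (rho x) p).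
  rewrite -SsZ// -SsZ; last by summ_tac.
  by [].
split.
- by rewrite /gmq -/(Eq z b x) Ss_conv.
- rewrite /gmq -/(Eq z b x) Dq_conv// e4 SsD ?Ss_conv//; try by summ_tac.
  by rewrite hE; ring.
rewrite -Ss_conv//; last by have [] := E_sums z (~~ b) hx.
rewrite /Eq; have -> : (fun k => z * gam (~~ b) x k) = - (fun k => z * gam b x k).
  by apply/funext => k; rewrite gamN mulrN.
by rewrite expqN// Ss_dl.
Qed.

(** uv differs from rho by a constant, and rho has mean zero. *)
Lemma conv_rho_pair b x (r : R) : bdd X r x ->
  conv (rho x) (conv (x b) (x (~~ b))) 0 = conv (rho x) (rho x) 0.
Proof.
move=> hx; have [s1 s2 s3 s4] := X_sums hx; have sU := s1 b; have sV := s1 (~~ b).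
have -> : conv (x b) (x (~~ b)) = rho x + md (conv (x b) (x (~~ b))) by rewrite (rhoE b) subrK.
rewrite convDr//; last exact: summ_md.
by rewrite [conv _ (md _)]convC conv_md fctE rho0 mulr0 addr0.
Qed.

Lemma mean_gmq z b x (r r' : R) : bdd X r x -> bdd X r' (gmq z x) ->
  conv (gmq z x b) (Dq (gmq z x (~~ b))) 0 =
  conv (x b) (Dq (x (~~ b))) 0 + z * (ep b / 2) * conv (rho x) (rho x) 0.
Proof.
move=> hx hq; have [s1 s2 s3 s4] := X_sums hx; have [t1 t2 _ _] := X_sums hq.
have sU := s1 b; have sDU := s2 b; have sV := s1 (~~ b); have sDV := s2 (~~ b).
have sp : summ (conv (rho x) (conv (x b) (x (~~ b)))) by summ_tac.
have tU := t1 b; have tV := t2 (~~ b).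
rewrite -(conv_rho_pair b hx).
suff -> : conv (gmq z x b) (Dq (gmq z x (~~ b))) =
  conv (x b) (Dq (x (~~ b))) + (fun k => z * (ep b / 2) * conv (rho x) (conv (x b) (x (~~ b))) k) by [].
apply: Ss_inj; [by summ_tac|by summ_tac|] => p.
have [a1 a2 a3] := Ss_gmq z b p hx; have [b1 b2 b3] := Ss_gmq z (~~ b) p hx.
rewrite SsD; try by summ_tac.
rewrite SsZ// (Ss_conv p tU tV) (Ss_conv p sU sDV) (Ss_conv p s3 (summ_conv sU sV)) (Ss_conv p sU sV).
rewrite a1 b2 epN [LHS]mulrACA a3 mul1r.
move: (Ss (rho x) p) (Ss (x b) p) (Ss (x (~~ b)) p) (Ss (Dq (x (~~ b))) p) (ep b) => *; ring.
Qed.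

Lemma Ss_Nn b x (r : R) p : bdd X r x ->
  Ss (Nn b x) p = - (Ss (x b) p * (Ss (x b) p * Ss (Dq (x (~~ b))) p))
    - ep b / 2 * (Ss (rho x) p * (Ss (x b) p * Ss (x b) p) * Ss (x (~~ b)) p)
    + conv (x b) (Dq (x (~~ b))) 0 * Ss (x b) p + ep b / 4 * (conv (rho x) (rho x) 0 * Ss (x b) p).
Proof.
move=> hx; have [s1 s2 s3 s4] := X_sums hx.
have sU := s1 b; have sDU := s2 b; have sV := s1 (~~ b); have sDV := s2 (~~ b).
rewrite /Nn /Qn; move: (rho x) s3 s4 => rr s3 s4.
rewrite SsD; try by summ_tac.
rewrite SsN; last by summ_tac.
rewrite !SsD; try by summ_tac.
rewrite !SsZ; try by summ_tac.
rewrite ?Ss_conv ?Ss_md; try by summ_tac.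
by rewrite !addrA mulNr.
Qed.

(** The nonlinearity in the moving frame. [Bfr] and [BN] are the fluxes that [Fr] and [Nn] add to
    the conservation law of uv. *)
Definition Fr b x := conv (rho x) (Dq (x b)).
Definition Bfr (b : bool) x k : R[i] := 2^-1 * conv (rho x) (rho x) k.
Definition BN (b : bool) x k : R[i] := - 2^-1 * conv (conv (x true) (x false)) (conv (x true) (x false)) k.

Lemma lip_Fr b : lipb X X1 (Fr b).
Proof.
have [C1 hC1] := algX1 hs; apply: (lip_conv hC1); last by apply: (@lip_Dq _ s); exact: lip_proj.
apply: (@lip_weak _ _ X _ _ 1) (lip_rho hs) => //.
by move=> a A h; rewrite mul1r; apply: Hw_mono h; rewrite gerDl lerN10.
Qed.

Lemma lip_Bfr b : lipb X X (Bfr b).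
Proof.
have [C hC] := algX hs; apply: (@lipZ _ X X (fun x => conv (rho x) (rho x))).
by apply: (lip_conv hC); exact: lip_rho.
Qed.

Lemma lip_BN b : lipb X X (BN b).
Proof.
have [C hC] := algX hs; apply: (@lipZ _ X X (fun x => conv (conv (x true) (x false)) (conv (x true) (x false)))).
by apply: (lip_conv hC); apply: (lip_conv hC); exact: lip_proj.
Qed.

Lemma Nn_summ b x (r : R) : bdd X r x -> summ (Nn b x).
Proof. exact: (lip_summ1 hs (lip_Nn hs b)). Qed.

Lemma Fr_pair x (r : R) b : bdd X r x ->
  conv (Fr b x) (x (~~ b)) + conv (x b) (Fr (~~ b) x) = Dq (Bfr b x).
Proof.
move=> hx; have [s1 s2 s3 s4] := X_sums hx.
have sU := s1 b; have sDU := s2 b; have sV := s1 (~~ b); have sDV := s2 (~~ b).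
have sFr b' : summ (Fr b' x) by exact: (lip_summ1 hs (lip_Fr b') hx).
have sF1 := sFr b; have sF2 := sFr (~~ b).
have sR : summ (Dq (conv (rho x) (rho x))) by rewrite Dq_conv//; summ_tac.
apply: Ss_inj; first by summ_tac.
  by rewrite /Bfr DqZ; summ_tac.
move=> p; rewrite /Bfr DqZ SsZ// Dq_conv// !SsD ?Ss_conv//; try by summ_tac.
rewrite (Ss_Drho b p hx).
move: (Ss (rho x) p) (Ss (x b) p) (Ss (x (~~ b)) p) (Ss (Dq (x b)) p) (Ss (Dq (x (~~ b))) p) => *; by field.
Qed.

(** In the pairing the quintic terms cancel by the sign of [ep b] and the remaining mean terms by an
    integration by parts; - u^2 v_x v - v^2 u_x u is the derivative of - (uv)^2 / 2. *)
Lemma Nn_pair x (r : R) b : bdd X r x ->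
  conv (Nn b x) (x (~~ b)) + conv (x b) (Nn (~~ b) x) = Dq (BN b x).
Proof.
move=> hx; have [s1 s2 s3 s4] := X_sums hx.
have sU := s1 b; have sDU := s2 b; have sV := s1 (~~ b); have sDV := s2 (~~ b).
have sF1 := Nn_summ b hx; have sF2 := Nn_summ (~~ b) hx.
have sP : summ (conv (x b) (x (~~ b))) by summ_tac.
have sDP : summ (Dq (conv (x b) (x (~~ b)))) by rewrite Dq_conv//; summ_tac.
have sR : summ (Dq (conv (conv (x b) (x (~~ b))) (conv (x b) (x (~~ b))))) by rewrite Dq_conv//; summ_tac.
have E : BN b x = fun k => - 2^-1 * conv (conv (x b) (x (~~ b))) (conv (x b) (x (~~ b))) k.
  by apply/funext => k; rewrite /BN convb.
rewrite E DqZ; apply: Ss_inj; [by summ_tac|by summ_tac|] => p.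
rewrite SsZ// (Dq_conv sP sP)// (SsD p (summ_conv sF1 sV) (summ_conv sU sF2)) (SsD p (summ_conv sDP sP) (summ_conv sP sDP)).
rewrite (Ss_conv p sF1 sV) (Ss_conv p sU sF2) (Ss_conv p sDP sP) (Ss_conv p sP sDP) (Dq_conv sU sV)// (Ss_conv p sU sV).
rewrite (SsD p (summ_conv sDU sV) (summ_conv sU sDV)).
rewrite !(Ss_Nn _ p hx) negbK epN (Ss_conv p sDU sV) (Ss_conv p sU sDV).
rewrite [conv (x (~~ b)) (Dq (x b))]convC (conv_D0 sU sV sDU sDV).
move: (Ss (rho x) p) (Ss (x b) p) (Ss (x (~~ b)) p) (Ss (Dq (x b)) p) (Ss (Dq (x (~~ b))) p) (conv _ _ 0) (conv _ _ 0) (ep b) => *; by field.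
Qed.

(** The gauge at work: for z = -1 one has h = (ep b / 2) rho, so 2 ep b h u_x cancels rho u_x. The
    terms u v u_x coming from h_x and from the current cancel each other, and their terms in u^2 v_x
    add up to - u^2 v_x. *)
Lemma Nq_forward b x (r r' : R) : bdd X r x -> bdd X r' (gmq (-1) x) -> Nq Fr Bfr (-1) b x = Nn b (gmq (-1) x).
Proof.
move=> hx hq; have [s1 s2 s3 s4] := X_sums hx.
have sU := s1 b; have sDU := s2 b; have sV := s1 (~~ b); have sDV := s2 (~~ b).
have sF := lip_summ1 hs (lip_Fr b) hx; have [sB _] := lip_summ hs (lip_Bfr b) hx.
apply: Ss_inj; [exact: (Nq_summ _ hx sF sB)|exact: (Nn_summ b hq)|] => p.
rewrite (Ss_Nq _ p hx sF sB) (Ss_Nn b p hq) (rho_gmq hs _ hx) (mean_gmq b hx hq).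
have [a1 a2 a3] := Ss_gmq (-1) b p hx; have [b1 b2 _] := Ss_gmq (-1) (~~ b) p hx.
rewrite a1 b1 b2 /Fr Ss_conv// (Ss_Drho b p hx) epN.
have -> : Ss (Bfr b x) p = 2^-1 * (Ss (rho x) p * Ss (rho x) p).
  by rewrite /Bfr SsZ ?Ss_conv//; summ_tac.
have -> : Aq Bfr b x 0 = conv (x b) (Dq (x (~~ b))) 0 - ep b / 4 * conv (rho x) (rho x) 0.
  rewrite -[LHS]/(2^-1 * (conv (x b) (Dq (x (~~ b))) 0 - conv (Dq (x b)) (x (~~ b)) 0) - ep b / 2 * (2^-1 * conv (rho x) (rho x) 0)).
  by rewrite (conv_D0 sU sV sDU sDV); field.
have e2 := ep2 (R := R) b.
move: a3 e2; move: (Ss (Eq (-1) b x) p) (Ss (Eq (-1) (~~ b) x) p) => E E' EE.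
move: (Ss (rho x) p) (Ss (x b) p) (Ss (x (~~ b)) p) (Ss (Dq (x b)) p) (Ss (Dq (x (~~ b))) p) (conv _ _ 0) (conv _ _ 0) (ep b) => rr U V U1 V1 m1 m3 e e2.
have E0 : E' = E^-1.
  have En : E != 0 by apply/eqP => E0; move: EE; rewrite E0 mul0r => /esym/eqP; rewrite oner_eq0.
  by rewrite -[LHS]mul1r -(mulVf En) -mulrA EE mulr1.
have En : E != 0 by apply/eqP => E1; move: EE; rewrite E1 mul0r => /esym/eqP; rewrite oner_eq0.
apply/eqP; rewrite -subr_eq0; apply/eqP; rewrite E0.
rewrite [LHS](_ : _ = (e * e + 1) * (E * (rr * U1 + 2^-1 * (U1 * V + U * V1) * U + e / 4 * rr ^+ 2 * U))); last by field.
by rewrite e2 addNr mul0r.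
Qed.

Lemma Nq_backward b x (r r' : R) : bdd X r x -> bdd X r' (gmq 1 x) -> Nq (@Nn R) BN 1 b x = Fr b (gmq 1 x).
Proof.
move=> hx hq; have [s1 s2 s3 s4] := X_sums hx; have [t1 t2 t3 t4] := X_sums hq.
have sU := s1 b; have sDU := s2 b; have sV := s1 (~~ b); have sDV := s2 (~~ b).
have tU := t1 b; have tDU := t2 b.
have sP : summ (conv (x b) (x (~~ b))) by summ_tac.
have sF := Nn_summ b hx; have [sB _] := lip_summ hs (lip_BN b) hx.
apply: Ss_inj; [exact: (Nq_summ _ hx sF sB)|by rewrite /Fr; summ_tac|] => p.
rewrite (Ss_Nq _ p hx sF sB) (Ss_Nn b p hx) /Fr Ss_conv// (rho_gmq hs _ hx).
have [_ a2 _] := Ss_gmq 1 b p hx; rewrite a2 (Ss_Drho b p hx).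
have E : BN b x = fun k => - 2^-1 * conv (conv (x b) (x (~~ b))) (conv (x b) (x (~~ b))) k.
  by apply/funext => k; rewrite /BN convb.
have -> : Ss (BN b x) p = - 2^-1 * ((Ss (x b) p * Ss (x (~~ b)) p) * (Ss (x b) p * Ss (x (~~ b)) p)).
  by rewrite E SsZ ?Ss_conv//; summ_tac.
set mu := conv (x b) (x (~~ b)) 0.
(* [BN] involves the full product uv = rho + mu, whose square has as mean that of rho^2 plus
   mu^2. *)
have PP : conv (conv (x b) (x (~~ b))) (conv (x b) (x (~~ b))) 0 = conv (rho x) (rho x) 0 + mu * mu.
  rewrite -(conv_rho_pair b hx) (rhoE b) convBl//; last exact: summ_md.
  by rewrite conv_md -[(conv _ _ - _) 0]/(conv (conv (x b) (x (~~ b))) (conv (x b) (x (~~ b))) 0 - mu * mu) subrK.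
have -> : Aq BN b x 0 = conv (x b) (Dq (x (~~ b))) 0 + ep b / 4 * (conv (rho x) (rho x) 0 + mu * mu).
  rewrite -[LHS]/(2^-1 * (conv (x b) (Dq (x (~~ b))) 0 - conv (Dq (x b)) (x (~~ b)) 0) - ep b / 2 * BN b x 0).
  by rewrite (conv_D0 sU sV sDU sDV) E PP; field.
have rE := Ss_rho b p hx; rewrite -/mu in rE; have e2 := ep2 (R := R) b.
rewrite rE; move: e2; rewrite /mu.
move: (Ss (Eq 1 b x) p) (Ss (x b) p) (Ss (x (~~ b)) p) (Ss (Dq (x b)) p) (Ss (Dq (x (~~ b))) p) (conv (x b) (Dq _) 0) (conv (rho x) _ 0) (conv _ _ 0) (ep b) => E1 U V U1 V1 m1 m3 m e e2.
apply/eqP; rewrite -subr_eq0; apply/eqP.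
rewrite [LHS](_ : _ = (e * e + 1) * (E1 * (- (U * V - m) * U1 - 2^-1 * (U1 * V + U * V1) * U + e / 4 * (U * V - m) ^+ 2 * U))); last by field.
by rewrite e2 addNr mul0r.
Qed.

Lemma gauge_forward lo hi r (x : R -> seqs) : fsol Fr lo hi x -> (forall t, lo <= t <= hi -> bdd X r (x t)) ->
  fsol (@Nn R) lo hi (fun t => gmq (-1) (x t)).
Proof.
move=> hx bx; have [cx _] := hx; split=> [b|b k]; first exact: lip_ccurve (lip_gmq hs (-1) b) cx bx.
have := gmq_der lip_Fr lip_Bfr Fr_pair (-1) b k hx bx; apply: cder_eq => // t tab.
have [A [_ hA _]] := lip_gmq hs (-1) true r; have [A' [_ hA' _]] := lip_gmq hs (-1) false r.
rewrite (Nq_forward (r' := Num.max A A') b (bx t tab))//.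
move=> [] /=; [apply: nb_mon (hA _ (bx t tab))|apply: nb_mon (hA' _ (bx t tab))]; by rewrite le_max lexx ?orbT.
Qed.

Lemma gauge_backward lo hi r (x : R -> seqs) : fsol (@Nn R) lo hi x -> (forall t, lo <= t <= hi -> bdd X r (x t)) ->
  fsol Fr lo hi (fun t => gmq 1 (x t)).
Proof.
move=> hx bx; have [cx _] := hx; split=> [b|b k]; first exact: lip_ccurve (lip_gmq hs 1 b) cx bx.
have := gmq_der (lip_Nn hs) lip_BN Nn_pair 1 b k hx bx; apply: cder_eq => // t tab.
have [A [_ hA _]] := lip_gmq hs 1 true r; have [A' [_ hA' _]] := lip_gmq hs 1 false r.
rewrite (Nq_backward (r' := Num.max A A') b (bx t tab))//.
move=> [] /=; [apply: nb_mon (hA _ (bx t tab))|apply: nb_mon (hA' _ (bx t tab))]; by rewrite le_max lexx ?orbT.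
Qed.

Definition Fu b x := conv (conv (x true) (x false)) (Dq (x b)).
Definition BP (b : bool) x k : R[i] := 2^-1 * conv (conv (x true) (x false)) (conv (x true) (x false)) k.

Lemma lip_Fu b : lipb X X1 (Fu b).
Proof.
have [C1 hC1] := algX1 hs; apply: (lip_conv hC1); last by apply: (@lip_Dq _ s); exact: lip_proj.
by apply: (lip_conv hC1); exact: lip_incl.
Qed.

Lemma Fu_pair x (r : R) b : bdd X r x ->
  conv (Fu b x) (x (~~ b)) + conv (x b) (Fu (~~ b) x) = Dq (BP b x).
Proof.
move=> hx; have [s1 s2 s3 s4] := X_sums hx.
have sU := s1 b; have sDU := s2 b; have sV := s1 (~~ b); have sDV := s2 (~~ b).
have sF1 := lip_summ1 hs (lip_Fu b) hx; have sF2 := lip_summ1 hs (lip_Fu (~~ b)) hx.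
have sP : summ (conv (x b) (x (~~ b))) by summ_tac.
have sDP : summ (Dq (conv (x b) (x (~~ b)))) by rewrite Dq_conv//; summ_tac.
have sR : summ (Dq (conv (conv (x b) (x (~~ b))) (conv (x b) (x (~~ b))))) by rewrite Dq_conv//; summ_tac.
have E : BP b x = fun k => 2^-1 * conv (conv (x b) (x (~~ b))) (conv (x b) (x (~~ b))) k.
  by apply/funext => k; rewrite /BP convb.
rewrite E DqZ; apply: Ss_inj; [by summ_tac|by summ_tac|] => p.
rewrite SsZ// (Dq_conv sP sP)// (SsD p (summ_conv sF1 sV) (summ_conv sU sF2)) (SsD p (summ_conv sDP sP) (summ_conv sP sDP)).
rewrite (Ss_conv p sF1 sV) (Ss_conv p sU sF2) (Ss_conv p sDP sP) (Ss_conv p sP sDP) (Dq_conv sU sV)// (Ss_conv p sU sV).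
rewrite (SsD p (summ_conv sDU sV) (summ_conv sU sDV)).
rewrite (Ss_conv p sDU sV) (Ss_conv p sU sDV) /Fu -(convb b) (Ss_conv p sP sDU) (Ss_conv p sP sDV) (Ss_conv p sU sV).
by move: (Ss (x b) p) (Ss (x (~~ b)) p) (Ss (Dq (x b)) p) (Ss (Dq (x (~~ b))) p) => *; field.
Qed.

Definition trs (y : R) x b := tr y (x b).

Lemma trs_bdd (y : R) x (r : R) : bdd X r x -> bdd X r (trs y x).
Proof. by move=> hx b; apply: nb_tr; exact: hx. Qed.

Lemma pair_trs (y : R) x (r : R) : bdd X r x ->
  conv (trs y x true) (trs y x false) = tr y (conv (x true) (x false)).
Proof. by move=> hx; have [s1 _ _ _] := X_sums hx; rewrite tr_conv. Qed.

(* Galilean invariance: a moving frame removes the mean of the coefficient. *)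
Lemma galilei F1 F2 lo hi r (nu : R) (x : R -> seqs) : fsol F1 lo hi x ->
  (forall t, lo <= t <= hi -> bdd X r (x t)) ->
  (forall t b k, lo <= t <= hi -> F2 b (trs (nu * t) (x t)) k = tr (nu * t) (fun k => F1 b (x t) k + nu%:C * Dq (x t b) k) k) ->
  fsol F2 lo hi (fun t => trs (nu * t) (x t)).
Proof.
move=> [cx dx] bx hF; have dk k : cder lo hi (fun t => ek k (nu * t)) (fun t => (0 +i* k%:~R) * nu%:C * ek k (nu * t)).
  have := @cder_cis R (k%:~R * nu) lo hi; apply: cder_eq => t _; first by rewrite /ek mulrA.
  rewrite /ek mulrA; congr (_ * _); apply: complex_ext; rewrite ?cReM ?cImM /=; ring.
split=> [b|b k].
  apply: (phase_ccurve (w := wt s) (p := fun k t => ek k (nu * t)) (f := fun t => x t b)).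
  - by move=> i; exact: wt_ge0.
  - by move=> k t; exact: nC_ek.
  - by move=> k; exact: cder_ccont (dk k).
  - by move=> t tab; exists r; exact: bx.
  - exact: cx.
have := cderM (dk k) (dx b k); apply: cder_eq => // t tab.
rewrite (hF t b k tab) /trs /tr /Dq.
move: (0 +i* k%:~R) (ek k _) (nu%:C) (Lk b k) (x t b k) (F1 b _ k) => *; ring.
Qed.

Lemma to_frame lo hi r (m : R) (x : R -> seqs) : fsol Fu lo hi x -> (forall t, lo <= t <= hi -> bdd X r (x t)) ->
  (forall t, lo <= t <= hi -> conv (x t true) (x t false) 0 = m%:C) ->
  fsol Fr lo hi (fun t => trs (- m * t) (x t)).
Proof.
move=> hx bx hm; apply: (galilei hx bx) => t b k tab; have hb := bx t tab.
have [s1 s2 s3 s4] := X_sums hb; have := s1 true; have := s1 false => q1 q2; have q3 := s2 b.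
rewrite /Fr /rho (pair_trs _ hb) tr_md -(md_tr (- m * t)) /trs tr_Dq.
have -> : tr (- m * t) (conv (x t true) (x t false)) - tr (- m * t) (md (conv (x t true) (x t false))) = tr (- m * t) (rho (x t)).
  by apply/funext => j; rewrite /tr fctE -mulrBr.
rewrite tr_conv//; congr (ek _ _ * _).
rewrite /Fu /rho convBl//; [|summ_tac|summ_tac].
by rewrite conv_md fctE (hm t tab) rmorphN mulNr.
Qed.

Lemma from_frame lo hi r (m : R) (x : R -> seqs) : fsol Fr lo hi x -> (forall t, lo <= t <= hi -> bdd X r (x t)) ->
  (forall t, lo <= t <= hi -> conv (x t true) (x t false) 0 = m%:C) ->
  fsol Fu lo hi (fun t => trs (m * t) (x t)).
Proof.
move=> hx bx hm; apply: (galilei hx bx) => t b k tab; have hb := bx t tab.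
have [s1 s2 s3 s4] := X_sums hb; have := s1 true; have := s1 false => q1 q2; have q3 := s2 b.
rewrite /Fu (pair_trs _ hb) /trs tr_Dq tr_conv//; last by summ_tac.
congr (ek _ _ * _); rewrite /Fr /rho convBl//; [|summ_tac|summ_tac].
by rewrite conv_md fctE (hm t tab) subrK.
Qed.

End GaugeDynamics.

(** * Well-posedness on Fourier coefficients *)

Section WellposedU.
Context {R : realType}.
Notation seqs := (bool -> int -> R[i]).
Implicit Types (a c f g : int -> R[i]) (j k l : int) (b : bool).
Variables (s : R).
Hypothesis hs : 3 / 2 < s.
Notation X := (Hw (R := R) s).

Lemma nC_ek_lip k (u v : R) : nC (ek k u - ek k v) <= `|k%:~R| * `|u - v|.
Proof.
wlog vu : u v / v <= u => [H|].
  case: (leP v u) => [/H //|/ltW/H]; by rewrite distrC -opprB nCN.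
have := nC_mvt (M := `|k%:~R|) vu (@cder_ek R k v u); rewrite (ger0_norm (_ : 0 <= u - v)) ?subr_ge0//.
by apply => t _; rewrite nCM nC_ek mulr1 nC_ik.
Qed.

(** Translation is not Lipschitz in the velocity on H^s. At a fixed time the high frequencies form a
    small tail and the others move little; compactness of the time interval makes the choice
    uniform. *)
Lemma tr_unif lo hi (m e : R) (f : R -> int -> R[i]) : 0 < e -> ccurve X lo hi f -> (forall t, lo <= t <= hi -> exists A, nb X (f t) A) ->
  exists2 eta : R, 0 < eta & forall m' : R, `|m - m'| < eta -> forall t, lo <= t <= hi ->
    nb X (tr (m * t) (f t) - tr (m' * t) (f t)) e.
Proof.
(* Two sixths each for the increment of f and for the tail, where a difference of characters is only
   bounded by 2, and one for the low frequencies. *)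
move=> e0 cf bf; have e4 : 0 < e / 6 by rewrite divr_gt0.
have cK := @segment_compact R lo hi.
move/compact_near_coveringP : cK => /(_ R (nbhs m) (fun m' t => lo <= t <= hi -> nb X (tr (m * t) (f t) - tr (m' * t) (f t)) e)).
case.
  move=> x; rewrite /= in_itv /= => xab; have [A hA] := bf x xab; have A0 := nb_ge0 hA.
  have [d d0 Hd] := cf x xab _ e4.
  have [t ut ht] := tail_H (fun i => wt_ge0 s i) hA e4.
  pose K : R := \sum_(k <- t) `|k%:~R|; pose B : R := `|lo| + `|hi|.
  have K0 : 0 <= K by apply: sumr_ge0 => k _; exact: normr_ge0.
  have B0 : 0 <= B by rewrite addr_ge0.
  have [e1 e10 he1] := ler_eps_div e4 (mulr_ge0 (mulr_ge0 K0 B0) A0).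
  exists (ball x d, ball m e1); first by split; exact: nbhsx_ballx.
  move=> [u m'] /= [xu mm'] uab; have /(_ u uab) q1 := Hd.
  have {}q1 : nb X (f u - f x) (e / 6) by apply: q1; move: xu; rewrite /ball /= distrC.
  have p2 k : nC (ek k (m * u) - ek k (m' * u)) <= 2.
    by apply: le_trans (nCB _ _) _; rewrite !nC_ek.
  have g1 : nb X (fun k => (ek k (m * u) - ek k (m' * u)) * (f u - f x) k) (2 * (e / 6)).
    have := nbZ (2%:C : R[i]) q1; rewrite nC_real ger0_norm//; apply: nb_solid => // k.
    by rewrite !nCM nC_real ger0_norm// ler_wpM2r// nC_ge0.
  have g2 : nb X (fun k => (ek k (m * u) - ek k (m' * u)) * (if k \in t then 0 else f x k)) (2 * (e / 6)).
    have := nbZ (2%:C : R[i]) ht; rewrite nC_real ger0_norm//; apply: nb_solid => // k.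
    by rewrite !nCM nC_real ger0_norm// ler_wpM2r// nC_ge0.
  have g3 : nb X (fun k => (ek k (m * u) - ek k (m' * u)) * (if k \in t then f x k else 0)) (e / 6).
    have z0 : 0 <= K * B * e1 by rewrite !mulr_ge0// ltW.
    have := nbZ ((K * B * e1)%:C : R[i]) hA; rewrite nC_real ger0_norm// => q.
    apply: nb_mon (_ : K * B * e1 * A <= _) _; first by apply: le_trans he1; rewrite le_eqVlt; apply/orP; left; apply/eqP; ring.
    apply: nb_solid q => // k; rewrite !nCM nC_real ger0_norm//; case: ifP => kt; last first.
      by rewrite nC0 mulr0 mulr_ge0 ?nC_ge0.
    rewrite ler_wpM2r ?nC_ge0//; apply: le_trans (nC_ek_lip _ _ _) _.
    rewrite -mulrBl normrM -[leRHS]mulrA; apply: ler_pM => //.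
      rewrite /K (bigD1_seq k)//= lerDl; apply: sumr_ge0 => i _; exact: normr_ge0.
    rewrite mulrC; apply: ler_pM => //; last by apply: ltW; move: mm'; rewrite /ball.
    move: uab => /andP[u1 u2]; rewrite /B; have := ler_norm hi; have := ler_norm (- lo); rewrite normrN => z1 z2.
    by rewrite ler_norml; have := normr_ge0 lo; have := normr_ge0 hi; move=> z3 z4; apply/andP; split; lra.
  have := nbD (nbD g1 g2) g3; move/nb_mon => /(_ e) q; have {}q := q (_ : _ <= e).
  have : nb X ((fun k => (ek k (m * u) - ek k (m' * u)) * (f u - f x) k)
    + (fun k => (ek k (m * u) - ek k (m' * u)) * (if k \in t then 0 else f x k))
    + (fun k => (ek k (m * u) - ek k (m' * u)) * (if k \in t then f x k else 0))) e by apply: q; lra.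
  by apply: nb_eq => k; rewrite /tr !fctE; case: ifP => _; ring.
move=> eta eta0 H; exists eta => // m' mm' t tab; exact: (H m').
Qed.

Lemma lip2 (F : bool -> seqs -> int -> R[i]) r : (forall b, lipb X X (F b)) -> exists C, [/\ 0 <= C,
  forall x b, bdd X r x -> nb X (F b x) C &
  forall x y D b, bdd X r x -> bdd X r y -> (forall b, nb X (x b - y b) D) -> nb X (F b x - F b y) (C * D)].
Proof.
move=> hF; have [C1 [c1 p1 q1]] := hF true r; have [C2 [c2 p2 q2]] := hF false r.
exists (C1 + C2); split; first by rewrite addr_ge0.
  by move=> x [] /= hx; [apply: nb_mon (p1 x hx)|apply: nb_mon (p2 x hx)]; lra.
move=> x y D b hx hy hd; have D0 := nb_ge0 (hd b).
by case: b; [apply: nb_mon (q1 x y D hx hy hd)|apply: nb_mon (q2 x y D hx hy hd)]; rewrite ler_wpM2r//; lra.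
Qed.

Definition mean (x : seqs) : R := complex.Re (conv (x true) (x false) 0).
Definition zmean (x : seqs) := complex.Im (conv (x true) (x false) 0) = 0.

Lemma zmeanE x : zmean x -> conv (x true) (x false) 0 = (mean x)%:C.
Proof. by move=> h; apply: complex_ext. Qed.

Lemma gmq_bd (c : R[i]) r : exists C, [/\ 0 <= C, forall x, bdd X r x -> bdd X C (gmq c x) &
  forall x y D, bdd X r x -> bdd X r y -> (forall b, nb X (x b - y b) D) -> forall b, nb X (gmq c x b - gmq c y b) (C * D)].
Proof.
have [C [C0 h1 h2]] := @lip2 (fun b x => gmq c x b) r (fun b => lip_gmq hs c b).
by exists C; split=> // [x hx b|x y D hx hy hd b]; [exact: h1|exact: h2].
Qed.

Lemma to_w lo hi r (y : R -> seqs) : fsol s (@Fu R) lo hi y -> (forall t, lo <= t <= hi -> bdd X r (y t)) ->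
  lo <= hi -> zmean (y lo) -> [/\ fsol s (@Nn R) lo hi (fun t => gmq (-1) (trs (- mean (y lo) * t) (y t))),
   exists r', forall t, lo <= t <= hi -> bdd X r' (gmq (-1) (trs (- mean (y lo) * t) (y t))) &
   forall t, lo <= t <= hi -> y t = trs (mean (y lo) * t) (gmq 1 (gmq (-1) (trs (- mean (y lo) * t) (y t))))].
Proof.
move=> hy bd lh hz.
have hm t : lo <= t <= hi -> conv (y t true) (y t false) 0 = (mean (y lo))%:C.
  by move=> tab; rewrite (mean_const hs (lip_Fu hs) (@Fu_pair _ _ hs) hy bd tab) zmeanE.
have hU := to_frame hs hy bd hm.
have bU t : lo <= t <= hi -> bdd X r (trs (- mean (y lo) * t) (y t)) by move=> /bd; exact: trs_bdd.
have [C [_ hC _]] := gmq_bd (-1) r.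
split; first exact: (gauge_forward hs hU bU).
  by exists C => t tab; apply: hC; exact: bU.
move=> t tab; have := gmqK hs (bU t tab) (hC _ (bU t tab)); rewrite opprK => ->.
by apply/funext => b; rewrite /trs; have := trN (- mean (y lo) * t) (y t b); rewrite {1}mulNr opprK.
Qed.

(** Equal data have equal means, hence the same frame, and the gauged solutions coincide by
    [uniq_w]. *)
Lemma uniq_u lo hi r r' (y y' : R -> seqs) : fsol s (@Fu R) lo hi y -> fsol s (@Fu R) lo hi y' ->
  (forall t, lo <= t <= hi -> bdd X r (y t)) -> (forall t, lo <= t <= hi -> bdd X r' (y' t)) ->
  lo <= hi -> zmean (y lo) -> y lo = y' lo -> forall t, lo <= t <= hi -> y t = y' t.
Proof.
move=> hy hy' bd bd' lh hz e t tab; have hz' : zmean (y' lo) by rewrite -e.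
have [w1 [r1 b1] k1] := to_w hy bd lh hz; have [w2 [r2 b2] k2] := to_w hy' bd' lh hz'.
rewrite (k1 t tab) (k2 t tab) -e; congr (trs _ (gmq 1 _)).
have ll : lo <= lo <= hi by rewrite lexx.
have r10 : 0 <= r1 := nb_ge0 (b1 lo ll true); have r20 : 0 <= r2 := nb_ge0 (b2 lo ll true).
have r0 : 0 <= r1 + r2 by rewrite addr_ge0.
rewrite -e in w2 b2.
apply: (uniq_w hs r0 w1 w2) => //; last by rewrite e.
  by move=> u /b1 h b; apply: nb_mon (h b); rewrite lerDl.
by move=> u /b2 h b; apply: nb_mon (h b); rewrite lerDr.
Qed.

Lemma wellposed_u A : 0 <= A -> exists2 T : R, 0 < T &
  (forall y0, bdd X A y0 -> zmean y0 -> exists y r, [/\ fsol s (@Fu R) 0 T y, y 0 = y0 &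
     forall t, 0 <= t <= T -> bdd X r (y t)]) /\
  (forall y r, fsol s (@Fu R) 0 T y -> (forall t, 0 <= t <= T -> bdd X r (y t)) -> bdd X A (y 0) -> zmean (y 0) ->
   forall e : R, 0 < e -> exists2 d : R, 0 < d & forall y' r', fsol s (@Fu R) 0 T y' ->
     (forall t, 0 <= t <= T -> bdd X r' (y' t)) -> bdd X A (y' 0) -> zmean (y' 0) ->
     (forall b, nb X (y 0 b - y' 0 b) d) -> forall t b, 0 <= t <= T -> nb X (y t b - y' t b) e).
Proof.
move=> A0; have [C1 [C10 hC1 lC1]] := gmq_bd (-1) A.
have [T1 [r [T10 r0 hE]]] := exist_w hs C10; have [tau tau0 hL] := lip_w hs r0.
have [C2 [C20 hC2 lC2]] := gmq_bd 1 r.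
pose T := Num.min T1 tau; have T0 : 0 < T by rewrite lt_min T10.
have TT1 : T <= T1 by rewrite ge_min lexx.
have Ttau : T <= 0 + tau by rewrite add0r ge_min lexx orbT.
have zz : 0 <= (0 : R) <= T by rewrite lexx ltW.
(* A solution is constructed through the gauge for each datum; by uniqueness every solution has this
   form, so dependence on the datum need only be studied on these. *)
have build y0 : bdd X A y0 -> zmean y0 -> exists x, [/\ solw s 0 T x, x 0 = gmq (-1) y0,
    forall t, 0 <= t <= T -> bdd X r (x t) & fsol s (@Fu R) 0 T (fun t => trs (mean y0 * t) (gmq 1 (x t)))
      /\ trs (mean y0 * 0) (gmq 1 (x 0)) = y0].
  move=> hy0 hz; have [x [sx x0 bx]] := hE _ (hC1 _ hy0).
  have {}sx : solw s 0 T x := solw_sub (lexx 0) TT1 sx.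
  have {}bx t : 0 <= t <= T -> bdd X r (x t).
    by move=> /andP[t0 tT]; apply: bx; rewrite t0 (le_trans tT).
  have e0 : gmq 1 (x 0) = y0.
    rewrite x0; have := gmqK hs hy0 (hC1 _ hy0); by rewrite opprK.
  have hU := gauge_backward hs sx bx.
  have bU t : 0 <= t <= T -> bdd X C2 (gmq 1 (x t)) by move=> /bx; exact: hC2.
  have hm t : 0 <= t <= T -> conv (gmq 1 (x t) true) (gmq 1 (x t) false) 0 = (mean y0)%:C.
    move=> tab; have := mean_const hs (lip_Fr hs) (@Fr_pair _ _ hs) hU bU tab => /= ->.
    by rewrite e0 zmeanE.
  exists x; split=> //; split; first exact: (from_frame hs hU bU hm).
  by rewrite e0 mulr0; apply/funext => b; apply/funext => k; rewrite /trs /tr ek_x0 mul1r.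
exists T => //; split.
  move=> y0 hy0 hz; have [x [sx x0 bx [hy e0]]] := build _ hy0 hz.
  exists (fun t => trs (mean y0 * t) (gmq 1 (x t))), C2; split=> //.
  by move=> t /bx /hC2; exact: trs_bdd.
move=> y ry hy byy hA hz e e0; have [x [sx x0 bx [hyx ex]]] := build _ hA hz.
have bUx t : 0 <= t <= T -> bdd X C2 (trs (mean (y 0) * t) (gmq 1 (x t))) by move=> /bx /hC2; exact: trs_bdd.
have Ey := uniq_u hy hyx byy bUx (ltW T0) hz (esym ex).
have e2 : 0 < e / 2 by rewrite divr_gt0.
have cU b : ccurve X 0 T (fun t => gmq 1 (x t) b) by apply: lip_ccurve (lip_gmq hs 1 b) sx.1 bx.
have bU b t : 0 <= t <= T -> exists B, nb X (gmq 1 (x t) b) B by move=> /bx /hC2 h; exists C2.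
have [eta1 e10 H1] := tr_unif (mean (y 0)) e2 (cU true) (bU true).
have [eta2 e20 H2] := tr_unif (mean (y 0)) e2 (cU false) (bU false).
have [CA hCA] := algX hs; have CA1 := algn_ge0 hCA.
have lP : lipb X X (fun x => conv (x true) (x false)) by apply: (lip_conv hCA); exact: lip_proj.
have [CP [CP0 _ hP]] := lP A.
pose eta := Num.min eta1 eta2 / 2; have eta0 : 0 < eta by rewrite divr_gt0// lt_min e10.
have [d1 d10 Hd1] := ler_eps_div eta0 CP0.
have L0 : 0 <= C2 * (2 * C1) by rewrite !mulr_ge0.
have [d2 d20 Hd2] := ler_eps_div e2 L0.
exists (Num.min d1 d2); first by rewrite lt_min d10.
move=> y' ry' hy' byy' hA' hz' hd t b tab; have [x' [sx' x0' bx' [hyx' ex']]] := build _ hA' hz'.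
have bUx' t' : 0 <= t' <= T -> bdd X C2 (trs (mean (y' 0) * t') (gmq 1 (x' t'))) by move=> /bx' /hC2; exact: trs_bdd.
have Ey' := uniq_u hy' hyx' byy' bUx' (ltW T0) hz' (esym ex').
have m1 : Num.min d1 d2 <= d1 by rewrite ge_min lexx.
have m2 : Num.min d1 d2 <= d2 by rewrite ge_min lexx orbT.
have mm : `|mean (y 0) - mean (y' 0)| <= eta.
  have := nb_Hw_coef 0 (hP _ _ _ hA hA' hd); rewrite wt_00 mul1r => q.
  have q2 : nC (conv (y 0 true) (y 0 false) 0 - conv (y' 0 true) (y' 0 false) 0) <= eta.
    apply: le_trans q _; apply: le_trans Hd1; rewrite mulrC; exact: ler_wpM2r.
  by move: q2; rewrite !zmeanE// -rmorphB nC_real.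
have meta : eta < eta1 /\ eta < eta2.
  have a1 : Num.min eta1 eta2 <= eta1 by rewrite ge_min lexx.
  have a2 : Num.min eta1 eta2 <= eta2 by rewrite ge_min lexx orbT.
  clear -a1 a2 e10 e20 eta0; move: a1 a2 eta0; rewrite /eta; set q := Num.min _ _ => a1 a2 q0; split; lra.
rewrite (Ey t tab) (Ey' t tab) /trs.
have dx : forall b, nb X (x 0 b - x' 0 b) (C1 * Num.min d1 d2).
  by rewrite x0 x0' => b'; exact: lC1.
have dxt := hL _ _ _ _ _ (ltW T0) Ttau sx sx' bx bx' dx.
have dU := lC2 _ _ _ (bx t tab) (bx' t tab) (fun b => dxt t b tab) b.
(* The difference splits into a change of velocity on a fixed state and the translate of a
   difference of states. *)
have p1 : nb X (tr (mean (y 0) * t) (gmq 1 (x t) b) - tr (mean (y' 0) * t) (gmq 1 (x t) b)) (e / 2).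
  by case: b {dU}; [apply: H1|apply: H2] => //; apply: le_lt_trans mm _; case: meta.
have p2 : nb X (tr (mean (y' 0) * t) (gmq 1 (x t) b) - tr (mean (y' 0) * t) (gmq 1 (x' t) b)) (e / 2).
  apply: nb_mon (_ : C2 * (2 * (C1 * Num.min d1 d2)) <= e / 2) _.
    apply: le_trans Hd2; rewrite (_ : C2 * _ = Num.min d1 d2 * (C2 * (2 * C1))); last by ring.
    exact: ler_wpM2r.
  have := nb_tr (mean (y' 0) * t) dU; apply: nb_eq => k; by rewrite /tr !fctE mulrBr.
have := nbD p1 p2; rewrite -splitr; apply: nb_eq => k; rewrite !fctE; ring.
Qed.

End WellposedU.

(** * Fourier coefficients determine a function *)

Section AlmostEverywhere.
Context {R : realType}.
Notation mu := (@lebesgue_measure R).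
Implicit Types (c t x lo hi : R) (f g h : R -> R[i]) (k : int) (a b : int -> R[i]).

Definition aeT f g := {ae mu, forall x, - pi <= x <= pi -> f x = g x}.

Lemma ae_neq c : {ae mu, forall x, x != c}.
Proof.
exists [set c]; split=> //; first exact: lebesgue_measure_set1.
by move=> x /= /negP; rewrite negbK => /eqP.
Qed.

Lemma cmeas_ccont f : (forall lo hi, lo <= hi -> ccont lo hi f) -> cmeasurable f.
Proof.
move=> cf; have H (p : R[i] -> R) : (forall z w, `|p z - p w| <= nC (z - w)) -> measurable_fun setT (fun x => p (f x)).
  move=> hp; apply: continuous_measurable_fun => x; apply/cvgrPdist_le => /= e e0.
  have x1 : x - 1 <= x + 1 by lra.
  have [|d d0 Hd] := cf _ _ x1 x _ e e0; first by apply/andP; split; lra.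
  exists (Num.min d 1) => /=; first by rewrite lt_min d0 ltr01.
  move=> t; rewrite /ball /= lt_min distrC => /andP[t1 t2]; rewrite distrC; apply: le_trans (hp _ _) _.
  by apply: Hd => //; move: t2; rewrite ltr_norml => /andP[? ?]; apply/andP; split; lra.
split; apply: H => z w; first by have := Re_le (z - w); rewrite cReD cReN.
by have := Im_le (z - w); rewrite cImD cImN.
Qed.

Lemma cmeasD f g : cmeasurable f -> cmeasurable g -> cmeasurable (fun x => f x + g x).
Proof.
move=> [f1 f2] [g1 g2]; split.
  apply: (eq_measurable_fun (fun x => complex.Re (f x) + complex.Re (g x))); last exact: measurable_funD.
  by move=> x _; rewrite cReD.
apply: (eq_measurable_fun (fun x => complex.Im (f x) + complex.Im (g x))); last exact: measurable_funD.
by move=> x _; rewrite cImD.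
Qed.

Lemma cmeasM f g : cmeasurable f -> cmeasurable g -> cmeasurable (fun x => f x * g x).
Proof.
move=> [f1 f2] [g1 g2]; split.
  apply: (eq_measurable_fun (fun x => complex.Re (f x) * complex.Re (g x) - complex.Im (f x) * complex.Im (g x))).
    by move=> x _; rewrite cReM.
  by apply: measurable_funB; apply: measurable_funM.
apply: (eq_measurable_fun (fun x => complex.Re (f x) * complex.Im (g x) + complex.Im (f x) * complex.Re (g x))).
  by move=> x _; rewrite cImM.
by apply: measurable_funD; apply: measurable_funM.
Qed.

Lemma cmeas_cst (z : R[i]) : cmeasurable (fun=> z).
Proof. by split; exact: measurable_cst. Qed.

Lemma cmeasN f : cmeasurable f -> cmeasurable (fun x => - f x).
Proof.
move=> cf; have [h1 h2] := cmeasM (cmeas_cst (-1)) cf.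
split; [move: h1|move: h2]; apply: eq_measurable_fun => x _; by rewrite mulN1r.
Qed.

Lemma cmeasB f g : cmeasurable f -> cmeasurable g -> cmeasurable (fun x => f x - g x).
Proof. by move=> cf cg; apply: cmeasD => //; exact: cmeasN. Qed.

Lemma cmeas_Ss a : summ a -> cmeasurable (Ss a).
Proof. by move=> sa; apply: cmeas_ccont => lo hi lh; exact: Ss_ccont. Qed.

Lemma cint_ae f g : cmeasurable f -> cmeasurable g -> aeT f g ->
  cintegral (- pi) pi f = cintegral (- pi) pi g.
Proof.
move=> [f1 f2] [g1 g2] fg.
have mE (h : R -> R) : measurable_fun setT h -> measurable_fun `[- pi, pi] (EFin \o h).
  by move=> mh; apply/measurable_EFinP; exact: measurable_funS mh.
rewrite /cintegral /Rintegral; congr (fine _ +i* fine _); apply: ae_eq_integral => //; try exact: mE;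
  (apply: filterS fg; first exact: (ae_filter_ringOfSetsType mu)) => x H; by rewrite /= in_itv /= => /H ->.
Qed.

Lemma tint_ae f g : cmeasurable f -> cmeasurable g -> aeT f g -> tintegral f = tintegral g.
Proof. by move=> mf mg fg; rewrite /tintegral (cint_ae mf mg fg). Qed.

Lemma cable_dom (a b : R) f (h : R -> R) : cmeasurable f -> mu.-integrable `[a, b] (EFin \o h) ->
  (forall x, a <= x <= b -> nC (f x) <= h x) -> cable a b f.
Proof.
move=> [f1 f2] ih fh; have mE (u : R -> R) : measurable_fun setT u -> measurable_fun `[a, b] (EFin \o u).
  by move=> mh; apply/measurable_EFinP; exact: measurable_funS mh.
split; (apply: le_integrable ih => //; first exact: mE) => x; rewrite /= in_itv/= => /fh q;
  rewrite lee_fin; apply: le_trans (le_trans q (ler_norm _)); [exact: Re_le|exact: Im_le].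
Qed.

Lemma nC_measurable f : cmeasurable f -> measurable_fun setT (fun x => nC (f x)).
Proof.
move=> [f1 f2]; apply: (eq_measurable_fun (fun x => Num.sqrt (complex.Re (f x) ^+ 2 + complex.Im (f x) ^+ 2))).
  by move=> x _; case: (f x).
apply: measurableT_comp; first by apply: continuous_measurable_fun; exact: sqrt_continuous.
by apply: measurable_funD; apply: measurable_funX.
Qed.

Lemma cable_nC (a b : R) f : cmeasurable f -> cable a b f -> mu.-integrable `[a, b] (EFin \o (fun x => nC (f x))).
Proof.
move=> mf [i1 i2]; have h := integrableD _ (integrable_abse i1) (integrable_abse i2) => //.
have {}h := h (measurable_itv _); apply: le_integrable h => //.
  by apply/measurable_EFinP; exact: measurable_funS (nC_measurable mf).
move=> x _; rewrite -[leLHS]/((`|nC (f x)|)%:E) -[leRHS]/((`| `|complex.Re (f x)| + `|complex.Im (f x)| |)%:E).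
rewrite lee_fin ger0_norm ?nC_ge0// ger0_norm ?addr_ge0//.
exact: nC_le.
Qed.

Lemma cableM_bd (a b : R) f g (B : R) : cmeasurable f -> cable a b f -> cmeasurable g ->
  (forall x, a <= x <= b -> nC (g x) <= B) -> cable a b (fun x => f x * g x).
Proof.
move=> mf cf mg hB; apply: (cable_dom (h := fun x => B * nC (f x))); first exact: cmeasM.
  exact: RableZ (cable_nC mf cf).
by move=> x /hB q; rewrite nCM mulrC ler_wpM2r ?nC_ge0.
Qed.

Lemma cint_le_fun (a b : R) f (h : R -> R) : cable a b f -> mu.-integrable `[a, b] (EFin \o h) ->
  (forall x, a <= x <= b -> nC (f x) <= h x) -> nC (cintegral a b f) <= \int[mu]_(x in `[a, b]) h x.
Proof.
move=> cf ih fh; have [w w1 wE] := nC_unimod (cintegral a b f).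
have -> : nC (cintegral a b f) = complex.Re (w * cintegral a b f) by rewrite wE.
rewrite -cintZ//=; apply: le_Rintegral => //; first by have [] := cableZ w cf.
move=> x; rewrite /= in_itv/= => /fh; apply: le_trans.
by apply: le_trans (ler_norm _) _; apply: le_trans (Re_le _) _; rewrite nCM w1 mul1r.
Qed.

Lemma Ss_le a x (A : R) : sumle (fun k => nC (a k)) A -> nC (Ss a x) <= A.
Proof. by move=> h; apply: csum_le; apply: sumle_mon h => // k; rewrite nCM nC_ek mulr1. Qed.

Lemma Ss_orth f a : cmeasurable f -> table f -> (forall k, tintegral (fun x => f x * ek k x) = 0) ->
  summ a -> cintegral (- pi) pi (fun x => f x * Ss a x) = 0.
Proof.
move=> mf tf hf sa; have [A hA] := sa; have inf := cable_nC mf tf.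
set N := \int[mu]_(x in `[- pi, pi]) nC (f x).
have N0 : 0 <= N by apply: Rintegral_ge0 => x _; exact: nC_ge0.
have z k : cintegral (- pi) pi (fun x => f x * ek k x) = 0.
  have := hf k; rewrite /tintegral => /eqP; rewrite mulf_eq0 => /orP[/eqP q|/eqP //].
  have := congr1 (@Normc.normc R) q; rewrite nC_real nC0 => /eqP; rewrite normr_eq0 invr_eq0 => /eqP q0.
  by have := @pi2_gt0 R; rewrite q0 ltxx.
have mSs s : summ s -> cable (- pi) pi (fun x => f x * Ss s x).
  move=> ss; have [B hB] := ss; apply: (cableM_bd (B := B)) => //; first exact: cmeas_Ss.
  by move=> x _; exact: Ss_le.
apply/nC_eq0/eqP; rewrite eq_le nC_ge0 andbT; apply/ler_addgt0Pr => e e0; rewrite add0r.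
have [e1 e10 he] := ler_eps_div e0 N0; have [t ut ht] := csum_approx hA e10.
pose tl k := if k \in t then 0 else a k.
have htl : sumle (fun k => nC (tl k)) e1.
  by apply: sumle_mon ht => // k; rewrite /tl; case: ifP => _; rewrite ?nC0.
have E x : f x * Ss a x = \sum_(k <- t) a k * (f x * ek k x) + f x * Ss tl x.
  rewrite /Ss (csum_split ut (Ss_summ x sa)) mulrDr mulr_sumr; congr (_ + _ * _).
    by apply: eq_bigr => k _; rewrite mulrCA.
  by apply: eq_csum => k; rewrite /tl; case: ifP => _; rewrite ?mul0r.
have ck k : cable (- pi) pi (fun x => a k * (f x * ek k x)).
  apply: cableZ; apply: (cableM_bd (B := 1)) => //.
    by apply: cmeas_ccont => lo hi _; exact: ccont_ek.
  by move=> x _; rewrite nC_ek.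
have [s1 s2] := cable_sum t ck.
rewrite (cint_eq (fun x _ => E x)) cintD//; last by apply: mSs; exists e1.
rewrite s2 big1 ?add0r; last first.
  move=> k _; rewrite cintZ ?z ?mulr0//; apply: (cableM_bd (B := 1)) => //.
    by apply: cmeas_ccont => lo hi _; exact: ccont_ek.
  by move=> x _; rewrite nC_ek.
apply: le_trans he; rewrite -RintegralZl//; apply: cint_le_fun; first by apply: mSs; exists e1.
  exact: RableZ inf.
by move=> x _; rewrite nCM mulrC ler_wpM2r ?nC_ge0//; exact: Ss_le.
Qed.

(** Real functions with absolutely convergent Fourier series: an algebra that contains every cos(x -
    c), hence the functions [qn] below, which are polynomials in it. *)
Definition isS (q : R -> R) := exists2 a, summ a & forall x, Ss a x = (q x)%:C.

Lemma isS_cst c : isS (fun=> c).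
Proof.
exists (fun k => c%:C * dl k); first by apply: summZ; exact: summ_dl.
by move=> x; rewrite SsZ ?Ss_dl ?mulr1//; exact: summ_dl.
Qed.

Lemma isS_M p q : isS p -> isS q -> isS (fun x => p x * q x).
Proof.
move=> [a sa ha] [b sb hb]; exists (conv a b); first exact: summ_conv.
by move=> x; rewrite Ss_conv// ha hb -rmorphM.
Qed.

Lemma isS_B p q : isS p -> isS q -> isS (fun x => p x - q x).
Proof.
move=> [a sa ha] [b sb hb]; exists (a - b); first exact: summB'.
by move=> x; rewrite SsB// ha hb -rmorphB.
Qed.

Lemma isS_X p n : isS p -> isS (fun x => p x ^+ n).
Proof.
move=> hp; elim: n => [|n IH]; first by have := isS_cst 1; congr isS; apply/funext => x; rewrite expr0.
by have := isS_M hp IH; congr isS; apply/funext => x; rewrite exprS.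
Qed.

Lemma isS_cos c : isS (fun x => cos (x - c)).
Proof.
have sd k : summ (fun j => dl (j - k) : R[i]).
  exists 1; have [A hA] := @summ_dl R; have := @nb_dl_W R 0 => /nb_Ww0 h.
  by apply: (sumle_inj (h := fun j => j - k) _ h) => i j /addIr.
have Sd k x : Ss (fun j => dl (j - k) : R[i]) x = ek k x.
  rewrite /Ss (@csum_single _ _ _ k) /dl ?subrr ?eqxx ?mul1r// => j jk.
  by rewrite subr_eq0 (negbTE jk) mul0r.
exists ((fun j => (ek 1 (- c) / 2) * dl (j - 1)) + (fun j => (ek (-1) (- c) / 2) * dl (j + 1))).
  by apply: summD'; apply: summZ; [exact: sd|exact: (sd (-1))].
move=> x; rewrite SsD; [|by apply: summZ; exact: sd|by apply: summZ; exact: (sd (-1))].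
rewrite !SsZ; [|exact: (sd (-1))|exact: sd].
rewrite Sd (Sd (-1)) mulrAC -ek_addx [_ / 2 * ek (-1) x]mulrAC -ek_addx addrC -mulrDl.
rewrite [x - c]addrC; set y := - c + x.
have -> : ek (-1) y + ek 1 y = 2 * (cos y)%:C.
  apply: complex_ext; rewrite ?cReD ?cImD ?cReM ?cImM /ek /=.
    by rewrite mulN1r cosN mul1r !(addr0, mul0r, subr0, oppr0); ring.
  by rewrite mulN1r sinN mul1r !(addr0, mul0r, mulr0) addNr.
by rewrite mulrC mulKf// -[2]/(2%:R) pnatr_eq0.
Qed.

(* Stone-Weierstrass device: (1 - q^n)^(2^n) tends to 1 where q < 1/2 and to 0 where q > 1/2; here this
   selects the points at distance less than d of c. *)
Definition qX c d x : R := 1 / 2 - (1 / 4) * (cos (x - c) - cos d).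
Definition qn c d n x : R := (1 - qX c d x ^+ n) ^+ (2 ^ n).

Lemma isS_qn c d n : isS (qn c d n).
Proof.
apply: isS_X; apply: isS_B; first exact: isS_cst.
apply: isS_X; apply: isS_B; first exact: isS_cst.
apply: isS_M; first exact: isS_cst.
by apply: isS_B; [exact: isS_cos|exact: isS_cst].
Qed.

Lemma qX01 c d x : 0 <= qX c d x <= 1.
Proof.
have := cos_geN1 (x - c); have := cos_le1 (x - c); have := cos_geN1 d; have := cos_le1 d.
by rewrite /qX => *; apply/andP; split; lra.
Qed.

Lemma qn01 c d n x : 0 <= qn c d n x <= 1.
Proof.
have /andP[q0 q1] := qX01 c d x; have p0 := exprn_ge0 n q0; have p1 := exprn_ile1 n q0 q1.
by rewrite /qn exprn_ge0 ?subr_ge0// exprn_ile1 ?subr_ge0// gerBl.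
Qed.

Lemma bernoulli (y : R) m : 0 <= y <= 1 -> 1 - m%:R * y <= (1 - y) ^+ m.
Proof.
move=> /andP[y0 y1]; elim: m => [|m IH]; first by rewrite mul0r subr0 expr0.
rewrite exprS; have y1' : 0 <= 1 - y by rewrite subr_ge0.
apply: le_trans (ler_wpM2l y1' IH).
have : 0 <= m%:R * y * y by rewrite !mulr_ge0.
rewrite -natr1; lra.
Qed.

Lemma bernoulli_up (y : R) m : 0 <= y <= 1 -> (1 - y) ^+ m * (1 + m%:R * y) <= 1.
Proof.
move=> /andP[y0 y1]; elim: m => [|m IH]; first by rewrite mul0r addr0 expr0 mulr1.
apply: le_trans IH; rewrite exprSr -mulrA; apply: ler_wpM2l; first by rewrite exprn_ge0// subr_ge0.
have : 0 <= (m.+1)%:R * y * y by rewrite !mulr_ge0.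
rewrite -natr1; lra.
Qed.

Lemma geom_small (z e : R) : 0 <= z < 1 -> 0 < e -> exists N, forall n, (N <= n)%N -> z ^+ n <= e.
Proof.
move=> /andP[z0 z1] e0; have az : `|z| < 1 by rewrite ger0_norm.
have /cvgrPdist_le /(_ e e0) [N _ H] := cvg_expr az.
by exists N => n Nn; have := H n Nn; rewrite sub0r normrN ger0_norm// exprn_ge0.
Qed.

Lemma qn_one c d x : cos d < cos (x - c) -> qn c d n x @[n --> \oo] --> (1 : R).
Proof.
move=> h; have /andP[q0 q1] := qX01 c d x; have q2 : qX c d x < 1 / 2 by rewrite /qX; lra.
have z1 : 0 <= 2 * qX c d x < 1 by apply/andP; split; lra.
apply/cvgrPdist_le => e e0; have [N HN] := geom_small z1 e0.
exists N => // n /= Nn; have /andP[r0 r1] := qn01 c d n x.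
rewrite ger0_norm ?subr_ge0//; apply: le_trans (HN n Nn).
have p : 0 <= qX c d x ^+ n <= 1 by rewrite exprn_ge0//= exprn_ile1.
have := bernoulli (2 ^ n) p; rewrite -/(qn c d n x) natrX -exprMn; lra.
Qed.

Lemma qn_zero c d x : cos (x - c) < cos d -> qn c d n x @[n --> \oo] --> (0 : R).
Proof.
move=> h; have /andP[q0 q1] := qX01 c d x; have q2 : 1 / 2 < qX c d x by rewrite /qX; lra.
have q20 : 0 < 2 * qX c d x by lra.
have z1 : 0 <= (2 * qX c d x)^-1 < 1 by rewrite invr_ge0 ltW//= invf_lt1//; lra.
apply/cvgrPdist_le => e e0; have [N HN] := geom_small z1 e0.
exists N => // n /= Nn; have /andP[r0 r1] := qn01 c d n x.
rewrite sub0r normrN ger0_norm//; apply: le_trans (HN n Nn).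
have p : 0 <= qX c d x ^+ n <= 1 by rewrite exprn_ge0//= exprn_ile1.
have := bernoulli_up (2 ^ n) p; rewrite -/(qn c d n x) natrX -exprMn => hq.
rewrite exprVn -[leRHS]mul1r ler_pdivlMr ?exprn_gt0//; apply: le_trans hq.
by apply: ler_wpM2l => //; rewrite lerDr.
Qed.

Lemma cos_arc (d z : R) : 0 < d < pi -> (`|z| < d -> cos d < cos z) /\
  (d < `|z| -> `|z| < pi *+ 2 - d -> cos z < cos d).
Proof.
move=> /andP[d0 dpi]; have cN (y : R) : cos `|y| = cos y.
  by case: (ger0P y) => // _; rewrite cosN.
have lt (u v : R) : 0 <= u -> v <= pi -> u < v -> cos v < cos u.
  move=> u0 vp uv; rewrite ltr_cos// in_itv/=; first by rewrite u0 (le_trans (ltW uv)).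
  by rewrite vp (le_trans u0 (ltW uv)).
split=> [zd|dz z2]; rewrite -(cN z); first by apply: lt => //; exact: ltW.
case: (leP `|z| pi) => zp; first by apply: lt => //; exact: ltW.
have -> : cos `|z| = cos (pi *+ 2 - `|z|).
  by rewrite -[RHS]cosN opprB -[in RHS](cosD2pi (_ - _)) subrK.
by apply: lt; rewrite ?ltrBrDl; lra.
Qed.

(** The arc of centre (b - pi)/2 and half-length (b + pi)/2 runs from -pi to b, so the selected
    points of the period are those to the left of b. *)
Lemma qn_arc (b x : R) : - pi < b < pi -> - pi < x < pi -> x != b ->
  qn ((b - pi) / 2) ((b + pi) / 2) n x @[n --> \oo] --> (\1_(`]-oo, b[%classic) x : R).
Proof.
move=> /andP[b1 b2] /andP[x1 x2] xb.
have d0 : 0 < (b + pi) / 2 < pi by apply/andP; split; lra.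
have [h1 h2] := cos_arc (x - (b - pi) / 2) d0.
rewrite indicE; case: (ltgtP x b) xb => // xb _.
  rewrite mem_set//=; apply: qn_one; apply: h1; rewrite ltr_norml; apply/andP; split; lra.
rewrite memNset/=; last by rewrite in_itv/=; apply/negP; rewrite -leNgt ltW.
have p : 0 <= x - (b - pi) / 2 by lra.
apply: qn_zero; apply: h2; rewrite (ger0_norm p); first by lra.
by rewrite (mulr2n pi); lra.
Qed.

(** Dominated convergence: the functions [qn] take values in [0, 1] and converge to the indicator
    except at -pi, b and pi. *)
Lemma arc_zero (h : R -> R) (b : R) : measurable_fun setT h -> mu.-integrable `[- pi, pi] (EFin \o h) ->
  (forall c d n, \int[mu]_(x in `[- pi, pi]) (h x * qn c d n x) = 0) -> - pi < b < pi ->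
  \int[mu]_(x in `[- pi, b]) h x = 0.
Proof.
move=> mh ih hq bb; have /andP[b1 b2] := bb; pose A := `]-oo, b[%classic : set R.
pose c := (b - pi) / 2; pose d := (b + pi) / 2.
have mq n : measurable_fun setT (qn c d n).
  have [a sa ha] := isS_qn c d n; have [m _] := cmeas_Ss sa.
  by apply: eq_measurable_fun m => x _; rewrite ha.
have mA : measurable A by exact: measurable_itv.
have m1 n : measurable_fun `[- pi, pi] (EFin \o (fun x => h x * qn c d n x)).
  by apply/measurable_EFinP; apply: (@measurable_funS _ _ _ _ setT) => //; exact: measurable_funM.
have mI : measurable_fun setT (\1_A : R -> R) by exact: measurable_indic.
have m2 : measurable_fun `[- pi, pi] (EFin \o (fun x => h x * \1_A x)).
  apply/measurable_EFinP; apply: (@measurable_funS _ _ _ _ setT) => //; exact: measurable_funM.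
have dom n x : (`|(EFin \o (fun x => (h x * qn c d n x)%R)) x| <= `|(EFin \o h) x|)%E.
  rewrite -[leLHS]/((`|h x * qn c d n x|)%:E) -[leRHS]/((`|h x|)%:E) lee_fin normrM.
  have /andP[q0 q1] := qn01 c d n x; by rewrite ler_piMr// ger0_norm.
have lim : {ae mu, forall x, `[- pi, pi]%classic x -> (fun n => (EFin \o (fun x => h x * qn c d n x)) x) @ \oo --> (EFin \o (fun x => h x * \1_A x)) x}.
  have n1 := ae_neq b; have n2 := ae_neq (- pi); have n3 := ae_neq pi.
  have n12 := @filterI _ _ (ae_filter_ringOfSetsType mu) _ _ n1 n2.
  apply: (@filterS2 _ _ (ae_filter_ringOfSetsType mu) _ _ _ _ n12 n3) => x [x1 x2] x3.
  rewrite /= in_itv/= => /andP[x4 x5]; apply: cvg_EFin; first exact: nearW.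
  apply: cvgM; first exact: cvg_cst; apply: qn_arc => //.
  by rewrite !lt_neqAle x4 x5 x3 eq_sym x2.
have domae : {ae mu, forall x n, `[- pi, pi]%classic x ->
    (`|(EFin \o (fun x => (h x * qn c d n x)%R)) x| <= (abse \o (EFin \o h)) x)%E}.
  by apply: aeW => x n _; exact: dom.
have [_ _ D] := dominated_convergence (mu := mu) (measurable_itv _) m1 m2 lim (integrable_abse ih) domae.
have z n : (\int[mu]_(x in `[(- pi)%R, pi]) (EFin \o (fun x => (h x * qn c d n x)%R)) x = 0)%E.
  have i1 : mu.-integrable `[- pi, pi] (EFin \o (fun x => h x * qn c d n x)).
    by apply: le_integrable ih => //; exact: m1.
  by rewrite -[LHS]fineK ?integrable_fin_num//; congr EFin; exact: hq.
have E : (\int[mu]_(x in `[(- pi)%R, pi]) (EFin \o (fun x => (h x * \1_A x)%R)) x = 0)%E.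
  apply: (cvg_unique _ D) => //; rewrite (_ : (fun n => _) = fun=> 0%E); first exact: cvg_cst.
  by apply/funext => n; exact: z.
have ib : mu.-integrable `[- pi, b[ (EFin \o h).
  by apply: integrableS ih => //; apply: subset_itvl; rewrite bnd_simp ltW.
rewrite -Rintegral_itv_bndo_bndc//.
have -> : `[- pi, b[%classic = `[- pi, pi]%classic `&` A.
  apply/seteqP; split=> x /=; rewrite !in_itv/=.
    by move=> /andP[x1 x2]; rewrite /A /= in_itv/= x1 x2 (le_trans (ltW x2) (ltW b2)).
  by rewrite /A /= in_itv/= => -[/andP[-> _] ->].
rewrite Rintegral_mkcondr /Rintegral -[RHS]/(fine 0%E) -E; congr fine; apply: eq_integral => x _ /=.
by congr EFin; rewrite patchE indicE; case: ifP => _; rewrite ?mulr1 ?mulr0.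
Qed.

(** The primitive of h from -pi vanishes by [arc_zero], so Lebesgue's differentiation theorem gives
    h = 0 almost everywhere. *)
Lemma real_inj (h : R -> R) : measurable_fun setT h -> mu.-integrable `[- pi, pi] (EFin \o h) ->
  (forall c d n, \int[mu]_(x in `[- pi, pi]) (h x * qn c d n x) = 0) ->
  {ae mu, forall x, - pi <= x <= pi -> h x = 0}.
Proof.
move=> mh ih hq; pose D := `[- pi, pi]%classic : set R; pose k := h \_ D.
have mD : measurable D by exact: measurable_itv.
have ik : mu.-integrable setT (EFin \o k).
  by have /integrable_mkcond := ih => /(_ mD); rewrite restrict_EFin.
have H := @FTC1 R k (BLeft (- pi)) _ (integrable_locally mD ih).
have iky y : mu.-integrable `[- pi, y] (EFin \o k) by apply: integrableS ik.
have {}H := H iky.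
have n2 := ae_neq (- pi); have n3 := ae_neq pi.
have n23 := @filterI _ _ (ae_filter_ringOfSetsType mu) _ _ n2 n3.
apply: (@filterS2 _ _ (ae_filter_ringOfSetsType mu) _ _ _ _ n23 H) => x [x2 x3] Hx xx.
have /andP[x4 x5] := xx.
have y4 : - pi < x by rewrite lt_neqAle eq_sym x2.
have y5 : x < pi by rewrite lt_neqAle x3.
have [|_ e] := Hx; first by rewrite /= lte_fin.
have kx : k x = h x by rewrite /k patchE mem_set//= in_itv.
rewrite -kx -e derive1E.
set F := (fun y => _) in e *.
have F0 : \forall y \near x, F y = (fun=> 0) y.
  near=> y; rewrite /F.
  have y1 : - pi < y by near: y; exact: lt_nbhsr.
  have y2 : y < pi by near: y; exact: lt_nbhsl.
  rewrite -[RHS](@arc_zero h y mh ih hq); last by rewrite y1.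
  apply: eq_Rintegral => z; rewrite inE/= in_itv/= => /andP[z1 z2].
  by rewrite /k patchE mem_set//= /D /= in_itv/= z1 (le_trans z2 (ltW y2)).
by rewrite (near_eq_derive _ F0) ?derive_cst// oner_neq0.
Unshelve. all: by end_near.
Qed.

Lemma fourier_ek f k : fourier f k = tintegral (fun x => f x * ek (- k) x).
Proof. by apply: tint_eq => x _; rewrite ekNc. Qed.

Lemma fourier_inj0 f : cmeasurable f -> table f -> (forall k, fourier f k = 0) -> aeT f (fun=> 0).
Proof.
move=> mf tf hf.
have z k : tintegral (fun x => f x * ek k x) = 0 by rewrite -[k]opprK -fourier_ek hf.
have H c d n : cintegral (- pi) pi (fun x => f x * (qn c d n x)%:C) = 0.
  have [a sa ha] := isS_qn c d n; rewrite -[RHS](Ss_orth mf tf z sa).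
  by apply: cint_eq => x _; rewrite ha.
have [m1 m2] := mf; have [i1 i2] := tf.
have H1 := @real_inj _ m1 i1; have H2 := @real_inj _ m2 i2.
apply: (@filterS2 _ _ (ae_filter_ringOfSetsType mu) _ _ _ _ (H1 _) (H2 _)).
- by move=> x e1 e2 xx; apply: complex_ext; rewrite ?e1 ?e2.
- move=> c d n; have := congr1 (@complex.Re R) (H c d n) => /= <-.
  by apply: eq_Rintegral => x _; rewrite cReM /= mulr0 subr0.
- move=> c d n; have := congr1 (@complex.Im R) (H c d n) => /= <-.
  by apply: eq_Rintegral => x _; rewrite cImM /= mulr0 add0r.
Qed.

Lemma lebesgue_shift (c : R) (A : set R) : measurable A -> mu ((fun x => x + c) @^-1` A) = mu A.
Proof.
move=> mA; suff : pushforward mu ((fun x => x + c) : _ -> measurableTypeR R) A = mu A by [].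
have mf : measurable_fun setT ((fun x => x + c) : _ -> measurableTypeR R).
  by apply: measurable_funD => //; exact: measurable_cst.
apply/esym/lebesgue_measure_unique => //= _ [[a b]] _ <-.
rewrite /pushforward (_ : _ @^-1` _ = `]a - c, b - c]%classic).
  by rewrite !lebesgue_measure_itv/= !lte_fin ltrD2r; case: ifP => // _; rewrite -!EFinB; congr EFin; ring.
by apply/seteqP; split=> x /=; rewrite !in_itv/= ltrBlDr lerBrDr.
Qed.

(** The exceptional set is covered by the translates of one null set by the countably many multiples
    of the period. *)
Lemma ae_periodic f g : periodic f (pi *+ 2) -> periodic g (pi *+ 2) -> aeT f g ->
  {ae mu, forall x, f x = g x}.
Proof.
move=> pf pg [N [mN N0 subN]].
have pn (u : R -> R[i]) n x : periodic u (pi *+ 2) -> u (x + (pi *+ 2) *+ n) = u x.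
  by move=> pu; elim: n => [|n IH]; [rewrite mulr0n addr0|rewrite mulrS addrCA addrC pu].
have sh (m : R) : mu.-negligible ((fun x => x + m) @^-1` N).
  exists ((fun x => x + m) @^-1` N); split=> //; last by rewrite lebesgue_shift.
  rewrite -[X in measurable X]setTI; apply: (_ : measurable_fun setT _) => //.
  by apply: measurable_funD => //; exact: measurable_cst.
have ng : mu.-negligible ((\bigcup_n ((fun x => x + (pi *+ 2) *+ n) @^-1` N)) `|`
    (\bigcup_n ((fun x => x - (pi *+ 2) *+ n) @^-1` N))).
  by apply: negligibleU; apply: negligible_bigcup => n; exact: sh.
apply: negligibleS ng => x /= fg.
have p0 : 0 < pi *+ 2 :> R := @pi2_gt0 R.
pose n := Num.floor ((x + pi) / (pi *+ 2)).
have [n1 n2] : n%:~R * (pi *+ 2) <= x + pi /\ x + pi < (n + 1)%:~R * (pi *+ 2).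
  by rewrite -ler_pdivlMr// -ltr_pdivrMr// floor_le_tmp floorD1_gt.
pose y := x - n%:~R * (pi *+ 2).
have yy : - pi <= y <= pi.
  rewrite intrD mulrDl mul1r in n2; rewrite /y; apply/andP; split; first by lra.
  rewrite mulr2n in n1 n2 *; lra.
have Ny : (f y <> g y) -> N y.
  by move=> fgy; apply: subN => /= H; apply: fgy; exact: H.
case nE : n => [m|m].
  right; exists m => //=; have e : x - pi *+ 2 *+ m = y.
    by rewrite /y nE -mulr_natl.
  rewrite e; apply: Ny => q; apply: fg.
  by rewrite -(subrK (pi *+ 2 *+ m) x) !pn// e.
left; exists m.+1 => //=; have e : x + pi *+ 2 *+ m.+1 = y.
  by rewrite /y nE NegzE -mulr_natl rmorphN mulNr opprK.
rewrite e; apply: Ny => q; apply: fg.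
by rewrite -(pn f m.+1)// -(pn g m.+1)// e.
Qed.

End AlmostEverywhere.

(** * Convergence to 0 in the extended reals *)

Section ErealConvergence.
Context {R : realType}.

Lemma cvg0_ereal (T : Type) (F : set_system T) (FF : Filter F) (f : T -> \bar R) : (forall x, 0 <= f x)%E ->
  (forall e : R, 0 < e -> \forall x \near F, (f x <= e%:E)%E) -> f @ F --> 0%E.
Proof.
move=> f0 H; apply/fine_cvgP; split.
  by apply: filterS (H 1 ltr01) => x h; rewrite ge0_fin_numE// (le_lt_trans h) ?ltry.
apply/cvgrPdist_le => e e0; apply: filterS (H e e0) => x h /=.
have hx : f x \is a fin_num by rewrite ge0_fin_numE// (le_lt_trans h) ?ltry.
by rewrite sub0r normrN ger0_norm ?fine_ge0// -lee_fin fineK.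
Qed.

Lemma ereal_cvg0 (T : Type) (F : set_system T) (f : T -> \bar R) : f @ F --> 0%E ->
  forall e : R, 0 < e -> F [set x | (f x < e%:E)%E].
Proof. by move=> H e e0; apply: (H [set y | (y < e%:E)%E]); exact: (@nbhs_open_ereal_lt R 0 (fun=> e)). Qed.

End ErealConvergence.

(** * Sobolev functions and their coefficients *)

Section SobolevBridge.
Context {R : realType}.
Notation mu := (@lebesgue_measure R).
Implicit Types (s c e t x lo hi : R) (f g : R -> R[i]) (k : int) (a : int -> R[i]) (p : nat).

Lemma Lp1_table f : Lp_torus 1 f -> cmeasurable f /\ table f.
Proof.
move=> [_ mf i1]; split=> //; apply: (cable_dom (h := fun x => nC (f x) ^+ 1)) => //.
Qed.

Lemma Lp2_table f : Lp_torus 2 f -> cmeasurable f /\ table f.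
Proof.
move=> [_ mf i2]; split=> //; apply: (cable_dom (h := fun x => 1 + nC (f x) ^+ 2)) => //.
  have [i1 _] := @cable_cst R (- pi) pi 1.
  by have := integrableD _ i1 i2 => /(_ (measurable_itv _)); apply: eq_integrable.
move=> x _; have : 0 <= (nC (f x) - 1) ^+ 2 := sqr_ge0 _.
have := nC_ge0 (f x); have : 0 <= nC (f x) ^+ 2 := sqr_ge0 _; rewrite sqrrB; lra.
Qed.

Lemma periodic_Ss a : periodic (Ss a) (pi *+ 2 : R).
Proof. by move=> x; apply: eq_csum => k; rewrite ek_periodic. Qed.

Lemma Lp_Ss p a : summ a -> Lp_torus p (Ss a).
Proof.
move=> sa; have [A hA] := sa; have A0 := sumle_ge0 hA; have m := cmeas_Ss sa; split=> //; first exact: periodic_Ss.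
have [i1 _] := @cable_cst R (- pi) pi (A ^+ p)%:C; apply: le_integrable i1 => //.
  apply/measurable_EFinP; apply: measurable_funX; exact: measurable_funS (nC_measurable m).
move=> x _; rewrite -[leLHS]/((`|nC (Ss a x) ^+ p|)%:E) -[leRHS]/((`|A ^+ p|)%:E) lee_fin !ger0_norm ?exprn_ge0 ?nC_ge0//.
by apply: lerXn2r; rewrite ?nnegrE ?nC_ge0//; exact: Ss_le.
Qed.

Lemma table_ek f k : cmeasurable f -> table f -> table (fun x => f x * ek k x).
Proof.
move=> mf tf; apply: (cableM_bd (B := 1)) => //; first by apply: cmeas_ccont => lo hi _; exact: ccont_ek.
by move=> x _; rewrite nC_ek.
Qed.

Lemma fourierB f g : cmeasurable f -> table f -> cmeasurable g -> table g -> fourier (f - g) = fourier f - fourier g.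
Proof.
move=> mf tf mg tg; apply/funext => k; rewrite -[RHS]/(fourier f k - fourier g k) !fourier_ek -tintB; try exact: table_ek.
by apply: tint_eq => x _; rewrite fctE mulrBl.
Qed.

Lemma fourier_Ss' a : summ a -> fourier (Ss a) = a.
Proof. by move=> sa; apply/funext => k; exact: fourier_Ss. Qed.

Lemma fourier_inj f g : cmeasurable f -> table f -> cmeasurable g -> table g -> fourier f = fourier g -> aeT f g.
Proof.
move=> mf tf mg tg e; have := @fourier_inj0 R (f - g) (cmeasB mf mg) (cableB tf tg).
rewrite fourierB// e => H; apply: filterS (H _); first exact: (ae_filter_ringOfSetsType mu).
  by move=> x h /h /eqP; rewrite fctE subr_eq0 => /eqP.
by move=> k; rewrite subrr.
Qed.

(** The link between the extended-real Sobolev norm and the calculus of [nb]; an infinite sum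
    satisfies neither side. *)
Lemma Hs_norm_le s f c : 0 <= c -> (Hs_norm s f <= c%:E)%E <-> nb (Hw s) (fourier f) c.
Proof.
move=> c0; pose F k := (wt s k * nC (fourier f k)) ^+ 2.
have F0 k : 0 <= F k by exact: sqr_ge0.
have -> : Hs_norm s f = ((\esum_(k in [set: int]) (F k)%:E) `^ 2^-1)%E.
  by rewrite /Hs_norm; congr (_ `^ _)%E; apply: eq_esum => k _; rewrite /F exprMn wt_sqr.
have K : nb (Hw s) (fourier f) c <-> (\esum_(k in [set: int]) (F k)%:E <= (c ^+ 2)%:E)%E.
  by split=> [/(nb_Hw _ _ c0)/(sumle_esum _ F0)|/(sumle_esum _ F0)/(nb_Hw _ _ c0)].
apply: (iff_trans _ (iff_sym K)); have : (0 <= \esum_(k in [set: int]) (F k)%:E)%E.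
  by apply: esum_ge0 => k _; rewrite lee_fin.
case: (\esum_(k in [set: int]) (F k)%:E)%E => [r r0||//]; last first.
  by rewrite poweRyr ?invr_eq0// => _; rewrite !leye_eq.
rewrite poweR_EFin !lee_fin in r0 *; rewrite powR12_sqrt//; split=> h.
  by rewrite -(sqr_sqrtr r0); apply: lerXn2r; rewrite ?nnegrE ?sqrtr_ge0.
by rewrite -(ger0_norm c0) -sqrtr_sqr; exact: ler_wsqrtr.
Qed.

Lemma Hs_norm_ge0 s f : (0 <= Hs_norm s f)%E. Proof. exact: poweR_ge0. Qed.

Lemma Hs2_norm_ge0 s f g : (0 <= Hs2_norm s f g)%E.
Proof. by rewrite adde_ge0// Hs_norm_ge0. Qed.

Lemma Hs2_norm_lt s f g e : 0 <= e -> (Hs2_norm s f g < e%:E)%E ->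
  nb (Hw s) (fourier f) e /\ nb (Hw s) (fourier g) e.
Proof.
move=> e0 h; split; apply/(Hs_norm_le _ _ e0); apply: le_trans (ltW h).
  by rewrite /Hs2_norm leeDl// Hs_norm_ge0.
by rewrite /Hs2_norm leeDr// Hs_norm_ge0.
Qed.

Lemma Hs2_norm_nb s f g e : 0 <= e -> nb (Hw s) (fourier f) (e / 2) -> nb (Hw s) (fourier g) (e / 2) ->
  (Hs2_norm s f g <= e%:E)%E.
Proof.
move=> e0 h1 h2; have e2 : 0 <= e / 2 by rewrite divr_ge0.
by rewrite (splitr e) EFinD; apply: leeD; apply/(Hs_norm_le _ _ e2).
Qed.

Lemma Hs_nb s f : Hs s f -> exists2 c, 0 <= c & nb (Hw s) (fourier f) c.
Proof.
move=> [_ /= h]; have n0 := Hs_norm_ge0 s f.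
have fn : Hs_norm s f \is a fin_num by rewrite ge0_fin_numE.
exists (fine (Hs_norm s f)); first exact: fine_ge0.
by apply/(Hs_norm_le _ _ (fine_ge0 n0)); rewrite fineK.
Qed.

Lemma Hs_table s f : Hs s f -> cmeasurable f /\ table f.
Proof. by move=> [/Lp2_table]. Qed.

Lemma Hs_Ss s a c : summ a -> nb (Hw s) a c -> Hs s (Ss a).
Proof.
move=> sa h; split; first exact: Lp_Ss.
rewrite /=; have c0 := nb_ge0 h; rewrite -(fourier_Ss' sa) in h.
by apply: le_lt_trans (ltry c); apply/(Hs_norm_le _ _ c0).
Qed.

Section Regular.
Variable (s : R).
Hypothesis hs : 3 / 2 < s.
Notation X := (Hw (R := R) s).

Lemma Hs_summ f : Hs s f -> summ (fourier f) /\ summ (Dq (fourier f)).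
Proof. by move=> /Hs_nb[c _ h]; have [] := X_facts hs h. Qed.

Lemma Hs_ae f : Hs s f -> aeT f (Ss (fourier f)).
Proof.
move=> hf; have [mf tf] := Hs_table hf; have [sa _] := Hs_summ hf.
have [m t] := Lp1_table (Lp_Ss 1 sa); apply: fourier_inj => //.
by rewrite fourier_Ss'.
Qed.

(** Membership in a class stable under differentiation replaces explicit formulas for the
    derivatives of all orders. *)
Lemma smooth_class (C : (R -> R) -> Prop) :
  (forall f : R -> R, C f -> (forall x, derivable f x 1) /\ C (derive1 f)) -> forall f : R -> R, C f -> smooth1 f.
Proof.
move=> H f Cf n x; have : C (derive1n n f) by elim: n => [//|n IH]; rewrite derive1nS; exact: (H _ IH).2.
by move=> /H[].
Qed.

Lemma trig_smooth (A B m : R) : smooth1 (fun x => A * cos (m * x) + B * sin (m * x)).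
Proof.
apply: (@smooth_class (fun f : R -> R => exists A B, f = fun x => A * cos (m * x) + B * sin (m * x))); last by exists A, B.
move=> _ [{}A [{}B ->]].
have d x : is_derive x (1 : R) (fun x => A * cos (m * x) + B * sin (m * x)) ((B * m) * cos (m * x) + (- A * m) * sin (m * x)).
  have d1 : is_derive x (1 : R) (fun x => m * x) m.
    by have := @is_deriveZ _ _ _ (id : R -> R) m x 1 1 (is_derive_id _ _); rewrite /GRing.scale /= mulr1.
  have d2 := @is_derive1_comp R (@cos R) (fun x => m * x) x _ _ (is_derive_cos (m * x)) d1.
  have d3 := @is_derive1_comp R (@sin R) (fun x => m * x) x _ _ (is_derive_sin (m * x)) d1.
  have h := is_deriveD (is_deriveZ A d2) (is_deriveZ B d3); apply: (is_derive_eq h).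
  by rewrite /GRing.scale /=; ring.
split=> [x|]; first by have [] := d x.
by exists (B * m), (- A * m); apply/funext => x; rewrite derive1E (@derive_val _ _ _ _ _ _ _ (d x)).
Qed.

Lemma csmooth_ek k : csmooth1 (ek k : R -> R[i]).
Proof.
split; first by have := @trig_smooth 1 0 k%:~R; congr smooth1; apply/funext => x; rewrite mul1r mul0r addr0.
by have := @trig_smooth 0 1 k%:~R; congr smooth1; apply/funext => x; rewrite mul1r mul0r add0r.
Qed.

Lemma csmooth_cder (phi : R -> R[i]) lo hi : csmooth1 phi -> cder lo hi phi (cderive phi).
Proof.
move=> [s1 s2]; apply: rder_cder => x _; apply: is_derive_rderat; rewrite /cderive /= derive1E; apply: DeriveDef => //.
  exact: (s1 0%N).
exact: (s2 0%N).
Qed.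

Lemma csmooth_cderive (phi : R -> R[i]) : csmooth1 phi -> csmooth1 (cderive phi).
Proof. by move=> [s1 s2]; split=> n x; rewrite /cderive /= -derive1Sn; [exact: (s1 n.+1)|exact: (s2 n.+1)]. Qed.

Lemma csmooth_ccont (phi : R -> R[i]) lo hi : csmooth1 phi -> ccont lo hi phi.
Proof. by move=> h; exact: cder_ccont (@csmooth_cder phi lo hi h). Qed.

Lemma cderive_ek k x : cderive (ek k) x = (0 +i* k%:~R) * ek k x.
Proof.
have h : rderat (x - 1) (x + 1) (fun t => complex.Re (ek k t)) x (complex.Re ((0 +i* k%:~R) * ek k x))
  /\ rderat (x - 1) (x + 1) (fun t => complex.Im (ek k t)) x (complex.Im ((0 +i* k%:~R) * ek k x)).
  have xx : x - 1 <= x <= x + 1 by apply/andP; split; lra.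
  by split; [exact: cder_Re xx (@cder_ek R k _ _)|exact: cder_Im xx (@cder_ek R k _ _)].
have xx : x - 1 < x < x + 1 by apply/andP; split; lra.
have [h1 h2] := h; apply: complex_ext; rewrite /cderive /= derive1E.
  exact: (@derive_val _ _ _ _ _ _ _ (rderat_is_derive xx h1)).
exact: (@derive_val _ _ _ _ _ _ _ (rderat_is_derive xx h2)).
Qed.

Lemma tint_by_parts k (phi : R -> R[i]) : periodic phi (pi *+ 2) -> csmooth1 phi ->
  tintegral (fun x => ek k x * cderive phi x) = - (0 +i* k%:~R) * tintegral (fun x => ek k x * phi x).
Proof.
move=> pp cp; have d := cderM (@cder_ek R k (- pi) pi) (@csmooth_cder phi (- pi) pi cp).
have c1 : ccont (- pi) pi (fun x => (0 +i* k%:~R) * ek k x * phi x).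
  by apply: ccontM; [apply: ccontM; [exact: ccont_cst|exact: ccont_ek]|exact: csmooth_ccont].
have c2 : ccont (- pi) pi (fun x => ek k x * cderive phi x).
  by apply: ccontM; [exact: ccont_ek|apply: csmooth_ccont; exact: csmooth_cderive].
have := cint_FTC (@Npi_le_pi R) d (ccontD c1 c2).
have -> : phi pi = phi (- pi) by rewrite -(pp (- pi)); congr phi; rewrite mulr2n addKr.
rewrite ek_pi subrr cintD; try exact: ccont_cable.
move/eqP; rewrite addrC addr_eq0 => /eqP h; rewrite /tintegral h mulrN mulNr mulrCA; congr (- (_ * _)).
rewrite -cintZ; last by apply: ccont_cable; apply: ccontM; [exact: ccont_ek|exact: csmooth_ccont].
by apply: cint_eq => x _; rewrite mulrA.
Qed.

Lemma weak_der_exists f : Hs s f -> is_weak_derivative f (Ss (Dq (fourier f))).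
Proof.
move=> hf; have [sa sD] := Hs_summ hf; split; first exact: Lp_Ss.
move=> phi pp cp; have [mf _] := Hs_table hf.
have cphi := @csmooth_ccont phi (- pi) pi cp; have cphi' := @csmooth_ccont _ (- pi) pi (csmooth_cderive cp).
have mphi' : cmeasurable (cderive phi).
  by apply: cmeas_ccont => lo hi _; apply: csmooth_ccont; exact: csmooth_cderive.
have -> : tintegral (fun x => f x * cderive phi x) = tintegral (fun x => Ss (fourier f) x * cderive phi x).
  apply: tint_ae; [exact: cmeasM|by apply: cmeasM => //; exact: cmeas_Ss|].
  by apply: filterS (Hs_ae hf); [exact: (ae_filter_ringOfSetsType mu)|move=> x H /H ->].
have [-> _] := Ss_tint_mul sD cphi; have [-> s2] := Ss_tint_mul sa cphi'.
rewrite -csumN//; apply: eq_csum => k; rewrite tint_by_parts// /Dq; ring.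
Qed.

Lemma weak_der_fourier f g : Hs s f -> is_weak_derivative f g -> fourier g = Dq (fourier f).
Proof.
move=> hf [_ h]; have [mf tf] := Hs_table hf; apply/funext => k.
rewrite fourier_ek h; [|exact: ek_periodic|exact: csmooth_ek].
rewrite (tint_eq (fun x _ => congr1 (fun z => f x * z) (cderive_ek (- k) x))).
rewrite (tint_eq (g := fun x => (0 +i* (- k)%:~R) * (f x * ek (- k) x))); last by move=> x _; rewrite mulrCA.
rewrite tintZ; last exact: table_ek.
rewrite -fourier_ek /Dq -mulNr; congr (_ * _); rewrite rmorphN; apply: complex_ext; by rewrite ?cReN ?cImN /= ?oppr0 ?opprK.
Qed.

(** A weak derivative exists, and testing against characters forces the coefficients of the chosen
    one, so the choice is immaterial up to a null set. *)
Lemma weak_derivativeP f : Hs s f -> cmeasurable (weak_derivative f) /\ aeT (weak_derivative f) (Ss (Dq (fourier f))).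
Proof.
move=> hf; have [_ sD] := Hs_summ hf; have h : is_weak_derivative f (weak_derivative f).
  by apply: (@xgetPex _ (fun=> 0) [set g | is_weak_derivative f g]); exists (Ss (Dq (fourier f))); exact: weak_der_exists.
have [m t] := Lp1_table h.1; split=> //; have [m' t'] := Lp1_table (Lp_Ss 1 sD).
by apply: fourier_inj => //; rewrite (weak_der_fourier hf h) fourier_Ss'.
Qed.

Definition cf (u v : R -> R -> R[i]) t b : int -> R[i] := fourier (if b then u t else v t).

Lemma nonlinearity_ae (u v w : R -> R -> R[i]) t : Hs s (u t) -> Hs s (v t) -> Hs s (w t) ->
  cmeasurable (nonlinearity u v w t) /\
  aeT (nonlinearity u v w t) (Ss (conv (conv (fourier (u t)) (fourier (v t))) (Dq (fourier (w t))))).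
Proof.
move=> hu hv hw; have [mu' _] := Hs_table hu; have [mv _] := Hs_table hv; have [mw aw] := weak_derivativeP hw.
have [su _] := Hs_summ hu; have [sv _] := Hs_summ hv; have [_ sw] := Hs_summ hw.
split; first by apply: cmeasM => //; exact: cmeasM.
have h12 := @filterI _ _ (ae_filter_ringOfSetsType mu) _ _ (Hs_ae hu) (Hs_ae hv).
apply: (@filterS2 _ _ (ae_filter_ringOfSetsType mu) _ _ _ _ h12 aw) => x [h1 h2] h3 xx.
by rewrite /nonlinearity (h1 xx) (h2 xx) (h3 xx) Ss_conv ?Ss_conv//; exact: summ_conv.
Qed.

Lemma Hs2_0_zmean f g : Hs2_0 s f g <-> [/\ Hs s f, Hs s g & complex.Im (conv (fourier f) (fourier g) 0) = 0].
Proof.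
suff H : Hs s f -> Hs s g -> tintegral (fun x => f x * g x) = conv (fourier f) (fourier g) 0.
  by split=> -[h1 h2 h3]; split=> //; [rewrite -H|rewrite H].
move=> hf hg; have [mf _] := Hs_table hf; have [mg _] := Hs_table hg.
have [sf _] := Hs_summ hf; have [sg _] := Hs_summ hg.
rewrite -(fourier_Ss 0 (summ_conv sf sg)) fourier_ek oppr0.
apply: tint_ae; [exact: cmeasM|by apply: cmeasM; [apply: cmeas_Ss; exact: summ_conv|apply: cmeas_ccont => lo hi _; exact: ccont_ek]|].
apply: (@filterS2 _ _ (ae_filter_ringOfSetsType mu) _ _ _ _ (Hs_ae hf) (Hs_ae hg)) => x h1 h2 xx.
by rewrite (h1 xx) (h2 xx) ek0 mulr1 Ss_conv.
Qed.

Lemma C_Hs2_ccurve lo hi u v : C_Hs2 s lo hi u v ->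
  (forall b, ccurve X lo hi (fun t => cf u v t b)) /\
  (forall t b, lo <= t <= hi -> exists A, nb X (cf u v t b) A).
Proof.
move=> [H1 H2]; have hH t : lo <= t <= hi -> Hs s (u t) /\ Hs s (v t) by move=> tt; apply: H1; rewrite in_itv.
split=> [b x xx e e0|t b /hH[h1 h2]]; last by case: b; [have [c _ h] := Hs_nb h1|have [c _ h] := Hs_nb h2]; exists c.
have xi : x \in `[lo, hi] by rewrite in_itv.
have := ereal_cvg0 (H2 x xi) e0; rewrite /within /= => -[d d0 Hd]; exists d => // t tt tx.
have q : (Hs2_norm s (u t - u x)%R (v t - v x)%R < e%:E)%E by apply: Hd; [rewrite /ball /= distrC|rewrite /= in_itv].
have [n1 n2] := Hs2_norm_lt (ltW e0) q.
have [[m1 t1] [m2 t2]] := (Hs_table (hH t tt).1, Hs_table (hH t tt).2).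
have [[m3 t3] [m4 t4]] := (Hs_table (hH x xx).1, Hs_table (hH x xx).2).
by rewrite fourierB// in n1; rewrite fourierB// in n2; case: b.
Qed.

Lemma ccurve_C_Hs2 lo hi (y : R -> bool -> int -> R[i]) :
  (forall b, ccurve X lo hi (fun t => y t b)) -> (forall t b, lo <= t <= hi -> exists A, nb X (y t b) A) ->
  C_Hs2 s lo hi (fun t => Ss (y t true)) (fun t => Ss (y t false)).
Proof.
move=> cy by'; have hH t b : lo <= t <= hi -> Hs s (Ss (y t b)).
  by move=> /(by' _ b)[A h]; apply: (Hs_Ss _ h); have [] := X_facts hs h.
split=> [t|x]; rewrite in_itv/= => xx; first by split; exact: hH.
apply: cvg0_ereal => [t|e e0]; first exact: Hs2_norm_ge0.
have e2 : 0 < e / 2 by rewrite divr_gt0.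
have [d1 d10 H1] := cy true x xx _ e2; have [d2 d20 H2] := cy false x xx _ e2.
exists (Num.min d1 d2) => /=; first by rewrite lt_min d10.
move=> t; rewrite /ball /= lt_min distrC => /andP[t1 t2]; rewrite in_itv/= => tt.
have sm t' b : lo <= t' <= hi -> summ (y t' b) by move=> /(by' _ b)[A h]; have [] := X_facts hs h.
have fB b : fourier (Ss (y t b) - Ss (y x b)) = y t b - y x b.
  have [[m1 t1'] [m2 t2']] := (Hs_table (hH t b tt), Hs_table (hH x b xx)).
  by rewrite fourierB// !fourier_Ss'//; exact: sm.
by apply: Hs2_norm_nb; rewrite ?(ltW e0)// fB; [exact: H1|exact: H2].
Qed.

End Regular.
End SobolevBridge.

(** * Test functions *)

Section FlatFunction.
Context {R : realType}.
Implicit Types (x y t e a b : R) (p : {poly R}).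

Lemma rderat_eq a b (f g : R -> R) x d : (forall t, a <= t <= b -> f t = g t) -> a <= x <= b ->
  rderat a b f x d -> rderat a b g x d.
Proof.
move=> fg xab H e e0; have [del d0 Hd] := H e e0; exists del => // t tab tx.
by rewrite -!fg//; exact: Hd.
Qed.

Lemma pow_exp_bounded n : exists M : R, forall y, 0 <= y -> y ^+ n * expR (- y) <= M.
Proof.
exists (n`!%:R + 1) => y y0; rewrite expRN ler_pdivrMr ?expR_gt0//.
have e1 : 1 <= expR y by rewrite -expR0 ler_expR.
have e0 : 0 <= n`!%:R * expR y by rewrite mulr_ge0// expR_ge0.
rewrite mulrDl mul1r; case: n e0 => [|n] e0; first by rewrite expr0; lra.
have := expR_ge1Dxn n y0; have f0 : 0 < n.+1`!%:R :> R by rewrite ltr0n fact_gt0.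
move=> h; have : y ^+ n.+1 / n.+1`!%:R <= expR y by lra.
by rewrite ler_pdivrMr// mulrC => h'; rewrite (le_trans h')// lerDl expR_ge0.
Qed.

Lemma poly_exp_bounded p : exists2 M : R, 0 <= M & forall y, 0 <= y -> `|p.[y] * expR (- y)| <= M.
Proof.
have /choice[M hM] n : exists M : R, forall y, 0 <= y -> y ^+ n * expR (- y) <= M := pow_exp_bounded n.
exists (\sum_(i < size p) `|p`_i| * M i).
  apply: sumr_ge0 => i _; rewrite mulr_ge0//; apply: le_trans (hM i 1 ler01).
  by rewrite mulr_ge0 ?expR_ge0// expr1n.
move=> y y0; rewrite horner_coef mulr_suml; apply: le_trans (ler_norm_sum _ _ _) _.
apply: ler_sum => i _; rewrite -mulrA normrM ler_wpM2l// ger0_norm ?hM//.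
by rewrite mulr_ge0 ?expR_ge0 ?exprn_ge0.
Qed.

(* A class stable under differentiation that contains the flat function exp(-1/x). *)
Definition flatp p x : R := if 0 < x then p.[x^-1] * expR (- x^-1) else 0.

(** With y = 1/x, d/dx is - y^2 d/dy, which sends p(y) exp(- y) to y^2 (p - p')(y) exp(- y). At 0
    the function is t^2 times a bounded quantity, because a polynomial times exp(- y) is bounded for
    y >= 0. *)
Lemma flatp_der p x : is_derive x (1 : R) (flatp p) (flatp ('X ^+ 2 * (p - p^`())) x).
Proof.
case: (ltgtP x 0) => [x0|x0|->].
- have xx : x - 1 < x < x / 2 by apply/andP; split; lra.
  apply: (rderat_is_derive xx); have xx' : x - 1 <= x <= x / 2 by apply/andP; split; lra.
  rewrite {2}/flatp ltNge (ltW x0) /=.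
  apply: (rderat_eq (f := fun=> 0) _ xx').
    by move=> t /andP[_ t2]; rewrite /flatp ltNge (_ : t <= 0)//; lra.
  by apply: is_derive_rderat; exact: is_derive_cst.
- have xx : x / 2 < x < x + 1 by apply/andP; split; lra.
  apply: (rderat_is_derive xx); have xx' : x / 2 <= x <= x + 1 by apply/andP; split; lra.
  rewrite {2}/flatp x0.
  apply: (rderat_eq (f := fun x => p.[x^-1] * expR (- x^-1)) _ xx').
    by move=> t /andP[t1 _]; rewrite /flatp (_ : 0 < t)//; lra.
  have xn : x != 0 by rewrite gt_eqF.
  have d0 := @is_deriveV R id x 1 1 xn (is_derive_id _ _).
  have d1 := @is_derive1_comp R (horner p) _ x _ _ (is_derive_poly p x^-1) d0.
  have d2 := @is_derive1_comp R expR _ x _ _ (is_derive_expR (- x^-1)) (is_deriveN d0).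
  apply: is_derive_rderat; have h := is_deriveM d1 d2; apply: (is_derive_eq h).
  rewrite -[LHS]/(p.[x^-1] * (expR (- x^-1) * - (- x ^- 2 * 1)) + expR (- x^-1) * (p^`().[x^-1] * (- x ^- 2 * 1))).
  rewrite hornerM hornerXn hornerD hornerN.
  by move: p.[_] p^`().[_] (expR _) => u v w; field.
have xx : (- 1 < 0 :> R) && (0 < 1 :> R) by rewrite ltrN10 ltr01.
apply: (rderat_is_derive xx) => e e0; rewrite {3}/flatp ltxx.
have [M M0 hM] := poly_exp_bounded ('X ^+ 2 * p); have [d d0 hd] := ler_eps_div e0 M0.
exists d => // t _; rewrite !subr0 mulr0 subr0 {2}/flatp ltxx subr0 => td; rewrite /flatp; case: ifP => t0; last first.
  by rewrite normr0 mulr_ge0// ltW.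
have tn : t != 0 by rewrite gt_eqF.
have ti : 0 <= t^-1 by rewrite invr_ge0 ltW.
have := hM _ ti; rewrite !hornerE => h.
rewrite (_ : _ * expR _ = t ^+ 2 * (t^-1 ^+ 2 * p.[t^-1] * expR (- t^-1))); last by field.
rewrite normrM normrX; move: h; set P := `|_ * expR _| => h.
rewrite (_ : `|t| ^+ 2 * P = `|t| * P * `|t|); last by ring.
apply: ler_wpM2r => //; apply: le_trans hd; apply: ler_pM => //; [exact: normr_ge0|exact: ltW].
Qed.

Definition flat x : R := flatp 1 x.
Definition flat' x : R := flatp ('X ^+ 2) x.

Lemma flat_der x : is_derive x (1 : R) flat (flat' x).
Proof. by have := flatp_der 1 x; rewrite derivC subr0 mulr1. Qed.

Lemma flat_le0 x : x <= 0 -> flat x = 0. Proof. by rewrite /flat /flatp ltNge => ->. Qed.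
Lemma flat'_le0 x : x <= 0 -> flat' x = 0. Proof. by rewrite /flat' /flatp ltNge => ->. Qed.

Lemma flat'_ge0 x : 0 <= flat' x.
Proof. by rewrite /flat' /flatp; case: ifP => // x0; rewrite hornerXn mulr_ge0 ?expR_ge0// sqr_ge0. Qed.

Lemma flat_le1 x : flat x <= 1.
Proof. by rewrite /flat /flatp; case: ifP => // x0; rewrite hornerC mul1r -expR0 ler_expR oppr_le0 invr_ge0 ltW. Qed.

Lemma flat_ge x : 0 < x -> 1 - x^-1 <= flat x.
Proof. by move=> x0; rewrite /flat /flatp x0 hornerC mul1r; exact: expR_ge1Dx. Qed.

(** A smooth cut-off that is 0 for t >= c and tends to 1 for t < c as lam grows. For c > 0 it does
    not vanish at t = 0, so the weak formulation sees the initial datum. *)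
Definition flatc (lam c t : R) : R := flat (lam * (c - t)).

Lemma flatc_der (lam c t : R) : is_derive t (1 : R) (flatc lam c) (- lam * flat' (lam * (c - t))).
Proof.
have d1 : is_derive t (1 : R) (fun t => lam * (c - t)) (- lam).
  have := @is_deriveZ R R _ (fun t => c - t) lam t 1 (-1) _; rewrite /GRing.scale /= mulrN1; apply.
  have h := @is_deriveB _ _ _ (fun=> c) id t 1 0 1 (is_derive_cst _ _ _) (is_derive_id _ _).
  by apply: (is_derive_eq h); rewrite sub0r.
have h := @is_derive1_comp R flat (fun t => lam * (c - t)) t _ _ (flat_der _) d1.
by apply: (is_derive_eq h); rewrite mulrC.
Qed.

Lemma smooth_flatc (lam c : R) : smooth1 (flatc lam c).
Proof.
apply: (@smooth_class _ (fun f : R -> R => exists p, f = fun t => flatp p (lam * (c - t)))); last by exists 1.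
move=> _ [p ->]; have d t : is_derive t (1 : R) (fun t => flatp p (lam * (c - t))) (flatp ((- lam)%:P * ('X ^+ 2 * (p - p^`()))) (lam * (c - t))).
  have d1 : is_derive t (1 : R) (fun t => lam * (c - t)) (- lam).
    have := @is_deriveZ R R _ (fun t => c - t) lam t 1 (-1) _; rewrite /GRing.scale /= mulrN1; apply.
    have h := @is_deriveB _ _ _ (fun=> c) id t 1 0 1 (is_derive_cst _ _ _) (is_derive_id _ _).
    by apply: (is_derive_eq h); rewrite sub0r.
  have h := @is_derive1_comp R (flatp p) (fun t => lam * (c - t)) t _ _ (flatp_der p _) d1.
  apply: (is_derive_eq h); rewrite mulrC /flatp; case: ifP => _; last by rewrite mulr0.
  by rewrite mulrA; congr (_ * _); rewrite !hornerE.
split=> [t|]; first by have [] := d t.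
by eexists; apply/funext => t; rewrite derive1E (@derive_val _ _ _ _ _ _ _ (d t)).
Qed.

Lemma smooth_der (f : R -> R) : smooth1 f -> smooth1 (derive1 f).
Proof. by move=> sf n x; rewrite -derive1Sn; exact: (sf n.+1). Qed.

Lemma smooth_cont (f : R -> R) : smooth1 f -> continuous f.
Proof. by move=> sf x; apply: differentiable_continuous; apply/derivable1_diffP; exact: (sf 0%N). Qed.

Lemma Cn2_mul (f g : R -> R) n : smooth1 f -> smooth1 g -> Cn2 n (fun t x => f t * g x).
Proof.
elim: n f g => [|n IH] f g sf sg; have cfg : continuous (fun p : R * R => f p.1 * g p.2).
- move=> p; apply: (@continuousM _ _ (fun p : R * R => f p.1) (fun p : R * R => g p.2)).
    by apply: continuous_comp; [exact: cvg_fst|exact: smooth_cont].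
  by apply: continuous_comp; [exact: cvg_snd|exact: smooth_cont].
- by [].
- move=> p; apply: (@continuousM _ _ (fun p : R * R => f p.1) (fun p : R * R => g p.2)).
    by apply: continuous_comp; [exact: cvg_fst|exact: smooth_cont].
  by apply: continuous_comp; [exact: cvg_snd|exact: smooth_cont].
have df t : derivable f t 1 by exact: (sf 0%N).
have dg t : derivable g t 1 by exact: (sg 0%N).
have D1 x t : is_derive t (1 : R) (fun t => f t * g x) (derive1 f t * g x).
  have h := is_deriveM (DeriveDef (df t) (esym (derive1E f t))) (is_derive_cst (g x) t (1 : R)).
  by apply: (is_derive_eq h); rewrite /GRing.scale /= mulr0 add0r mulrC.
have D2 x t : is_derive x (1 : R) (fun x => f t * g x) (f t * derive1 g x).
  have := @is_deriveZ R R _ g (f t) x 1 (derive1 g x); rewrite /GRing.scale /=; apply.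
  exact: (DeriveDef (dg x) (esym (derive1E g x))).
split; [exact: cfg|split].
- by move=> t x; have [] := D1 x t.
- by move=> t x; have [] := D2 x t.
- have -> : (fun t x : R => derive1 (fun t => f t * g x) t) = fun t x => derive1 f t * g x; last exact: (IH _ _ (smooth_der sf) sg).
  by apply/funext => t; apply/funext => x; rewrite derive1E (@derive_val _ _ _ _ _ _ _ (D1 x t)).
have -> : (fun t x : R => derive1 (fun x => f t * g x) x) = fun t x => f t * derive1 g x; last exact: (IH _ _ sf (smooth_der sg)).
by apply/funext => t; apply/funext => x; rewrite derive1E (@derive_val _ _ _ _ _ _ _ (D2 x t)).
Qed.

End FlatFunction.

(** * The lemma of du Bois-Reymond and weak solutions of scalar equations *)

Section DuBoisReymond.
Context {R : realType}.
Notation mu := (@lebesgue_measure R).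
Implicit Types (c t lam e : R) (h g G : R -> R[i]).

Lemma flatc_cder lam c lo hi : cder lo hi (fun t => (flatc lam c t)%:C) (fun t => (- lam * flat' (lam * (c - t)))%:C).
Proof.
apply: rder_cder => x _; first by apply: is_derive_rderat; exact: flatc_der.
by apply: is_derive_rderat; exact: is_derive_cst.
Qed.

Lemma flat'_ccont lam c lo hi : ccont lo hi (fun t => (- lam * flat' (lam * (c - t)))%:C).
Proof.
have h := smooth_der (@smooth_flatc R lam c).
have : cder lo hi (fun t => (derive1 (flatc lam c) t)%:C) (fun t => (derive1 (derive1 (flatc lam c)) t)%:C).
  apply: rder_cder => x _; apply: is_derive_rderat; last exact: is_derive_cst.
  by rewrite [X in is_derive _ _ _ X]derive1E; apply: DeriveDef => //; exact: (h 0%N).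
move/cder_ccont; apply: ccont_eq => t _.
by rewrite derive1E (@derive_val _ _ _ _ _ _ _ (flatc_der lam c t)).
Qed.

Lemma cint_bd_re a b f (h : R -> R) : ccont a b f -> ccont a b (fun t => (h t)%:C) ->
  (forall x, a <= x <= b -> nC (f x) <= h x) -> nC (cintegral a b f) <= complex.Re (cintegral a b (fun t => (h t)%:C)).
Proof.
move=> cf ch H; have [i1 _] := ccont_cable ch.
by apply: le_trans (cint_le_fun (ccont_cable cf) i1 H) _.
Qed.

(* The derivative of [- flatc lam c] is an approximate identity at c from the left as lam grows. *)
Lemma dubois (T : R) h : 0 < T -> ccont 0 T h ->
  (forall lam c, 0 < lam -> 0 < c < T -> cintegral 0 T (fun t => h t * (- lam * flat' (lam * (c - t)))%:C) = 0) ->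
  forall t, 0 <= t <= T -> h t = 0.
Proof.
move=> T0 ch H.
have [M M0 hM] := ccont_bounded (ltW T0) ch.
have key c : 0 < c < T -> h c = 0.
  move=> /andP[c0 cT]; apply: nC_eq0; apply/eqP; rewrite eq_le nC_ge0 andbT.
  apply/ler_addgt0Pr => e e0; rewrite add0r; have e3 : 0 < e / 3 by rewrite divr_gt0.
  have cc : 0 <= c <= T by rewrite !ltW.
  have [d1 d10 Hd1] := ch c cc _ e3.
  pose d := Num.min (d1 / 2) (c / 2).
  have d0 : 0 < d by rewrite lt_min !divr_gt0.
  have dd1 : d <= d1 / 2 by rewrite ge_min lexx.
  have dc : d <= c / 2 by rewrite ge_min lexx orbT.
  have m0 : 0 <= 2 * M * d^-1 + M * c^-1 by rewrite addr_ge0// mulr_ge0// ?mulr_ge0// invr_ge0 ltW.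
  have [e1 e10 he1] := ler_eps_div e3 m0.
  (* The kernel has mass at most 1/(lam d) before c - d, and its total mass on [0, T] falls short of
     1 by at most 1/(lam c); [e1] makes both contributions small. *)
  pose lam := e1^-1; have l0 : 0 < lam by rewrite invr_gt0.
  pose k t := lam * flat' (lam * (c - t)); have k0 t : 0 <= k t by rewrite mulr_ge0 ?(ltW l0)// flat'_ge0.
  have kE t : - (- lam * flat' (lam * (c - t))) = k t by rewrite mulNr opprK.
  have ck lo hi : ccont lo hi (fun t => (k t)%:C).
    have := ccontM (@ccont_cst R lo hi (-1)) (@flat'_ccont lam c lo hi); apply: ccont_eq => t _.
    by rewrite mulN1r -rmorphN kE.
  have ik lo hi : lo <= hi -> cintegral lo hi (fun t => (k t)%:C) = (flatc lam c lo - flatc lam c hi)%:C.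
    move=> lh; have := cint_FTC lh (cderN (@flatc_cder lam c lo hi)).
    rewrite (_ : (fun t => - _) = fun t => (k t)%:C); last by apply/funext => t; rewrite -rmorphN kE.
    by move=> ->//; rewrite !rmorphB; ring.
  have le1 : c - d <= T by lra.
  have le0 : 0 <= c - d by lra.
  have z1 : cintegral 0 T (fun t => (k t)%:C * h t) = 0.
    transitivity (cintegral 0 T (fun t => - (h t * (- lam * flat' (lam * (c - t)))%:C))).
      by apply: cint_eq => t _; rewrite -mulrN -rmorphN kE mulrC.
    rewrite cintN ?H ?oppr0// ?c0//; apply: ccont_cable; apply: ccontM => //; exact: flat'_ccont.
  have chB lo hi : 0 <= lo -> hi <= T -> ccont lo hi (fun t => (k t)%:C * (h c - h t)).
    move=> l0' hT; apply: ccontM => //; apply: (@ccont_eq R lo hi (fun t => h c + (-1) * h t)); first by move=> t _; rewrite mulN1r.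
    apply: ccontD; first exact: ccont_cst.
    apply: ccontM; first exact: ccont_cst.
    move=> x /andP[x1 x2] e' e'0; have xx : 0 <= x <= T by rewrite (le_trans l0')//= (le_trans x2).
    have [dd dd0 Hdd] := ch x xx e' e'0; exists dd => // t /andP[t1 t2]; apply: Hdd.
    by rewrite (le_trans l0')//= (le_trans t2).
  have z2 : (flatc lam c 0)%:C * h c = cintegral 0 T (fun t => (k t)%:C * (h c - h t)).
    have -> : cintegral 0 T (fun t => (k t)%:C * (h c - h t)) = cintegral 0 T (fun t => h c * (k t)%:C - (k t)%:C * h t).
      by apply: cint_eq => t _; ring.
    rewrite cintB; [|by apply: cableZ; exact: ccont_cable|by apply: ccont_cable; exact: ccontM].
    rewrite cintZ; last exact: ccont_cable.
    rewrite z1 subr0 ik ?ltW// [flatc _ _ T]flat_le0 ?subr0 1?mulrC//.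
    by rewrite mulr_le0_ge0 ?(ltW l0)// subr_le0 ltW.
  have b1 : nC (cintegral 0 (c - d) (fun t => (k t)%:C * (h c - h t))) <= 2 * M * (lam * d)^-1.
    have : nC (cintegral 0 (c - d) (fun t => (k t)%:C * (h c - h t))) <=
       complex.Re (cintegral 0 (c - d) (fun t => (2 * M * k t)%:C)).
      apply: cint_bd_re; first exact: chB.
        by have := ccontM (@ccont_cst R 0 (c - d) (2 * M)%:C) (ck 0 (c - d)); apply: ccont_eq => t _; rewrite -rmorphM.
      move=> t /andP[t1 t2]; rewrite nCM nC_real ger0_norm// mulrC ler_wpM2r//.
      have tt : 0 <= t <= T by rewrite t1 (le_trans t2).
      by apply: le_trans (nCB _ _) _; have := hM t tt; have := hM c cc; lra.
    move/le_trans; apply; have -> : (fun t => (2 * M * k t)%:C) = fun t => (2 * M)%:C * (k t)%:C :> R[i].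
      by apply/funext => t; rewrite rmorphM.
    rewrite cintZ ?ik//; last exact: ccont_cable.
    rewrite -rmorphM /= ler_wpM2l ?mulr_ge0//.
    have q : c - (c - d) = d by lra.
    have := @flat_ge R (lam * d); rewrite mulr_gt0// => /(_ isT); have := @flat_le1 R (lam * (c - 0)).
    rewrite /flatc q; lra.
  have b2 : nC (cintegral (c - d) T (fun t => (k t)%:C * (h c - h t))) <= e / 3.
    have : nC (cintegral (c - d) T (fun t => (k t)%:C * (h c - h t))) <=
       complex.Re (cintegral (c - d) T (fun t => (e / 3 * k t)%:C)).
      apply: cint_bd_re; first exact: chB.
        by have := ccontM (@ccont_cst R (c - d) T (e / 3)%:C) (ck (c - d) T); apply: ccont_eq => t _; rewrite -rmorphM.
      move=> t /andP[t1 t2]; rewrite nCM nC_real ger0_norm// mulrC.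
      have [ct|tc] := leP c t.
        have -> : k t = 0 by rewrite /k flat'_le0 ?mulr0// mulr_ge0_le0 ?(ltW l0)// subr_le0.
        by rewrite !mulr0.
      have tt : 0 <= t <= T by rewrite (le_trans le0).
      rewrite ler_wpM2r// nCC; apply: Hd1 => //.
      by rewrite ltr0_norm ?subr_lt0//; lra.
    move/le_trans; apply; have -> : (fun t => (e / 3 * k t)%:C) = fun t => (e / 3)%:C * (k t)%:C :> R[i].
      by apply/funext => t; rewrite rmorphM.
    rewrite cintZ ?ik//; last exact: ccont_cable.
    rewrite -rmorphM /= -[leRHS]mulr1 ler_wpM2l ?(ltW e3)//.
    have q : flatc lam c T = 0 by rewrite /flatc flat_le0// mulr_ge0_le0 ?ltW// subr_lt0.
    by rewrite q subr0 flat_le1.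
  have b3 : flatc lam c 0 * nC (h c) <= 2 * M * (lam * d)^-1 + e / 3.
    apply: le_trans (_ : nC ((flatc lam c 0)%:C * h c) <= _).
      by rewrite nCM nC_real ler_wpM2r ?nC_ge0// ler_norm.
    have le00 : 0 <= c - d <= T by rewrite le0.
    rewrite z2 (cint_split le00 (ccont_cable (chB 0 T (lexx 0) (lexx T)))).
    by apply: le_trans (nCD _ _) _; exact: lerD.
  have b4 : nC (h c) <= flatc lam c 0 * nC (h c) + (lam * c)^-1 * M.
    have q : 1 - (lam * c)^-1 <= flatc lam c 0 by rewrite /flatc subr0 flat_ge// mulr_gt0.
    have lc : 0 <= (lam * c)^-1 by rewrite invr_ge0 mulr_ge0 ?ltW.
    have := ler_wpM2r (nC_ge0 (h c)) q; rewrite mulrBl mul1r.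
    have := ler_wpM2l lc (hM c cc); lra.
  have b5 : 2 * M * (lam * d)^-1 + (lam * c)^-1 * M <= e / 3.
    apply: le_trans he1; rewrite /lam !invfM !invrK le_eqVlt; apply/orP; left; apply/eqP; ring.
  lra.
(* The end points are reached by continuity. *)
have ext t : 0 <= t <= T -> (forall d, 0 < d -> exists2 u, 0 < u < T & `|u - t| < d) -> h t = 0.
  move=> tt Hu; apply: nC_eq0; apply/eqP; rewrite eq_le nC_ge0 andbT.
  apply/ler_addgt0Pr => e e0; rewrite add0r; have [d d0 Hd] := ch t tt e e0.
  have [u /andP[u0 uT] ut] := Hu d d0; have uu : 0 <= u <= T by rewrite !ltW.
  have := Hd u uu ut.
  by rewrite key ?u0// sub0r nCN.
move=> t /andP[t0 tT]; case: (ltgtP t 0) t0 => // [t0 _|t0 _].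
  case: (ltgtP t T) tT => // [tT _|tT _]; first by apply: key; rewrite t0.
  apply: ext; first by rewrite tT lexx ltW.
  move=> d d0; exists (Num.max (T / 2) (T - d / 2)); first by rewrite lt_max gt_max; apply/andP; split; [apply/orP; left; lra|apply/andP; split; lra].
  rewrite tT ltr_norml; apply/andP; split.
    by rewrite ltrBrDr lt_max; apply/orP; right; lra.
  by rewrite ltrBlDr gt_max; apply/andP; split; lra.
apply: ext; first by rewrite t0 lexx ltW.
move=> d d0; exists (Num.min (T / 2) (d / 2)); first by rewrite lt_min gt_min; apply/andP; split; [apply/andP; split; lra|apply/orP; left; lra].
rewrite t0 subr0 gtr0_norm; last by rewrite lt_min; apply/andP; split; lra.
by rewrite gt_min; apply/orP; right; lra.
Qed.

(** With P the primitive of G, an integration by parts turns the hypothesis into orthogonality of g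
    - g0 - P to the derivative of every cut-off, so this function vanishes by [dubois]; at t = 0
    this is the initial condition. *)
Lemma weak_ode (T : R) g G (g0 : R[i]) : 0 < T -> ccont 0 T g -> ccont 0 T G ->
  (forall lam c, 0 < lam -> 0 < c < T ->
    cintegral 0 T (fun t => g t * (- lam * flat' (lam * (c - t)))%:C) + g0 * (flatc lam c 0)%:C
    + cintegral 0 T (fun t => G t * (flatc lam c t)%:C) = 0) ->
  g 0 = g0 /\ cder 0 T g G.
Proof.
move=> T0 cg cG H; have le0T := ltW T0; have z0 : 0 <= (0 : R) <= T by rewrite lexx.
pose P t := cintegral 0 t G.
have dP : cder 0 T P G := cint_primitive cG.
have P0 : P 0 = 0.
  have : nC (cintegral 0 0 G) <= nC (G 0) * (0 - 0).
    apply: cint_le => //; first by apply: cable_sub (ccont_cable cG).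
    by move=> x /le_anti <-.
  by rewrite subrr mulr0 => q; apply: nC_eq0; apply/eqP; rewrite eq_le q nC_ge0.
have cP := cder_ccont dP.
have ccB f f' : ccont 0 T f -> ccont 0 T f' -> ccont 0 T (fun t => f t - f' t).
  move=> c1 c2; have := ccontD c1 (ccontM (@ccont_cst R 0 T (-1)) c2); apply: ccont_eq => t _; by rewrite mulN1r.
have hz := dubois T0 (ccB _ _ (ccB _ _ cg (@ccont_cst R 0 T g0)) cP).
have {}hz t : 0 <= t <= T -> g t - g0 - P t = 0.
  apply: hz => lam c l0 c0T; have [c0 cT] := andP c0T.
  pose eta' t := (- lam * flat' (lam * (c - t)))%:C : R[i].
  have ce : ccont 0 T eta' by exact: flat'_ccont.
  have de := @flatc_cder lam c 0 T; have cet := cder_ccont de.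
  have eT : flatc lam c T = 0 by rewrite /flatc flat_le0// mulr_ge0_le0 ?ltW// subr_lt0.
  have i1 : cintegral 0 T (fun t => g0 * eta' t) = - (g0 * (flatc lam c 0)%:C).
    by rewrite cintZ ?(cint_FTC le0T de ce) ?eT ?sub0r ?mulrN//; exact: ccont_cable.
  have i2 : cintegral 0 T (fun t => P t * eta' t) = - cintegral 0 T (fun t => G t * (flatc lam c t)%:C).
    have := cint_FTC le0T (cderM dP de) (ccontD (ccontM cG cet) (ccontM cP ce)).
    rewrite cintD; [|by apply: ccont_cable; exact: ccontM|by apply: ccont_cable; exact: ccontM].
    rewrite eT P0 mulr0 mul0r subrr => /eqP; rewrite addrC addr_eq0 => /eqP //.
  transitivity (cintegral 0 T (fun t => g t * eta' t - g0 * eta' t - P t * eta' t)).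
    by apply: cint_eq => t' _; rewrite -/(eta' t'); ring.
  rewrite cintB ?cintB ?i1 ?i2 ?opprK; try by [apply: ccont_cable; exact: ccontM|apply: ccont_cable; apply: ccontM => //; exact: ccont_cst].
    exact: H.
  by apply: ccont_cable; apply: ccB; apply: ccontM => //; exact: ccont_cst.
have gE t : 0 <= t <= T -> g0 + P t = g t.
  by move=> /hz /eqP; rewrite subr_eq0 subr_eq => /eqP ->; rewrite addrC.
split; first by rewrite -(gE 0 z0) P0 addr0.
apply: cder_eq (cderD (@cder_cst R 0 T g0) dP) => t tt; first exact: gE.
by rewrite add0r.
Qed.

End DuBoisReymond.

(** * Smooth test functions and their Fourier coefficients *)

Section TestFunctions.
Context {R : realType}.
Notation mu := (@lebesgue_measure R).
Implicit Types (t x lo hi e : R) (k : int) (chi : R -> R -> R[i]).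

(* The supremum norm over a period: each test family is a single point. *)
Definition Sn : gnorm (R := R) R.
refine (@Gnorm R R (fun s th => (s = [::] /\ th = fun=> 0) \/ exists2 x, - pi <= x <= pi & s = [:: x] /\ th = fun=> 1) _ _).
- by move=> s th [[_ ->]|[x _ [_ ->]]].
- by exists (fun=> 0); left.
Defined.

Lemma nb_Sn (g : R -> R[i]) c : 0 <= c -> nb Sn g c <-> (forall x, - pi <= x <= pi -> nC (g x) <= c).
Proof.
move=> c0; split=> [h x xx|h s th [[-> ->]|[x xx [-> ->]]]].
- by have := h [:: x] (fun=> 1) (or_intror (ex_intro2 _ _ x xx (conj erefl erefl))); rewrite big_seq1 mul1r.
- by rewrite big_nil.
by rewrite big_seq1 mul1r; exact: h.
Qed.

Definition ccont2 (f : R -> R -> R[i]) :=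
  continuous (fun p : R * R => complex.Re (f p.1 p.2)) /\ continuous (fun p : R * R => complex.Im (f p.1 p.2)).

Lemma ccont2_near (f : R -> R -> R[i]) t x e : ccont2 f -> 0 < e ->
  \forall p \near (t, x), nC (f p.1 p.2 - f t x) <= e.
Proof.
move=> [c1 c2] e0; have e2 : 0 < e / 2 by rewrite divr_gt0.
have /cvgrPdist_le /(_ _ e2) h1 := c1 (t, x); have /cvgrPdist_le /(_ _ e2) h2 := c2 (t, x).
apply: filterS2 h1 h2 => p /= h1 h2; apply: le_trans (nC_le _) _.
rewrite cReD cImD cReN cImN distrC [X in _ + X]distrC; lra.
Qed.

(** Compactness of the period makes continuity in t uniform in x. *)
Lemma ccont2_curve (f : R -> R -> R[i]) lo hi : ccont2 f -> ccurve Sn lo hi f.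
Proof.
move=> cf t tt e e0; have e2 : 0 < e / 2 by rewrite divr_gt0.
have cK := @segment_compact R (- pi) pi.
move/compact_near_coveringP : cK => /(_ R (nbhs t) (fun u x => nC (f u x - f t x) <= e)).
case.
  move=> x _; have [[A B] /= [hA hB] h] := ccont2_near t x cf e2.
  exists (B, A); first by split.
  move=> [z u] /= [zB uA]; have h1 := h (u, z) (conj uA zB).
  have h2 := h (t, z) (conj (nbhs_singleton hA) zB).
  rewrite (_ : f u z - f t z = (f u z - f t x) - (f t z - f t x)); last by ring.
  by apply: le_trans (nCB _ _) _; move: h1 h2 => /=; lra.
move=> d d0 Hd; exists d => // u _ ut; apply/nb_Sn; first exact: ltW.
move=> x xx; apply: (Hd u); first by rewrite /ball_ /= distrC.
by rewrite /= in_itv.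
Qed.

Lemma ccont2_x (f : R -> R -> R[i]) t lo hi : ccont2 f -> ccont lo hi (f t).
Proof.
move=> cf x _ e e0; have [[A B] /= [hA hB] h] := ccont2_near t x cf e0.
have [d d0 Hd] := hB; exists d => // z _ zx; apply: (h (t, z)); split; first exact: nbhs_singleton.
by apply: Hd; rewrite /ball_ /= distrC.
Qed.

Lemma csmooth2_cont chi : csmooth2 chi -> ccont2 chi.
Proof. by move=> h; have [[c1 _] [c2 _]] := h 0%N. Qed.

Lemma csmooth2_dt chi : csmooth2 chi -> csmooth2 (dt chi).
Proof. by move=> h n; have [[_ [_ _ h1 _]] [_ [_ _ h2 _]]] := h n.+1. Qed.

Lemma csmooth2_dx chi : csmooth2 chi -> csmooth2 (dx chi).
Proof. by move=> h n; have [[_ [_ _ _ h1]] [_ [_ _ _ h2]]] := h n.+1. Qed.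

Lemma csmooth2_x chi t : csmooth2 chi -> csmooth1 (chi t).
Proof.
move=> h; split.
  apply: (@smooth_class _ (fun g => exists f : R -> R -> R, (forall n, Cn2 n f) /\ g = f t)).
    move=> _ [f [hf ->]]; split=> [x|]; first by have [_ [_ h2 _ _]] := hf 1%N.
    by exists (fun t x => derive1 (f t) x); split=> // n; have [_ [_ _ _]] := hf n.+1.
  by exists (fun t x => complex.Re (chi t x)); split=> // n; have [] := h n.
apply: (@smooth_class _ (fun g => exists f : R -> R -> R, (forall n, Cn2 n f) /\ g = f t)).
  move=> _ [f [hf ->]]; split=> [x|]; first by have [_ [_ h2 _ _]] := hf 1%N.
  by exists (fun t x => derive1 (f t) x); split=> // n; have [_ [_ _ _]] := hf n.+1.
by exists (fun t x => complex.Im (chi t x)); split=> // n; have [] := h n.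
Qed.

Lemma csmooth2_der chi lo hi x : csmooth2 chi -> cder lo hi (chi ^~ x) (dt chi ^~ x).
Proof.
move=> h; have [[_ [h1 _ _ _]] [_ [h2 _ _ _]]] := h 1%N.
by apply: rder_cder => t _; apply: is_derive_rderat; rewrite /dt /cderive /= derive1E; apply: DeriveDef.
Qed.

Lemma periodic_cderive (phi : R -> R[i]) : periodic phi (pi *+ 2) -> periodic (cderive phi) (pi *+ 2).
Proof.
have H (g : R -> R) : periodic g (pi *+ 2) -> periodic (derive1 g) (pi *+ 2).
  move=> pg x; rewrite /derive1 (_ : (fun z => z^-1 *: (g (z + (x + pi *+ 2)) - g (x + pi *+ 2))) = fun z => z^-1 *: (g (z + x) - g x))//.
  by apply/funext => z; rewrite addrA !pg.
by move=> pp x; rewrite /cderive !H// => y; rewrite pp.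
Qed.

(** The coefficient of chi at frequency -k, dual to frequency k in the bilinear pairing of a
    function with chi. *)
Definition tk k chi t : R[i] := tintegral (fun x => ek k x * chi t x).

Lemma table_ekM k (g : R -> R[i]) : ccont (- pi) pi g -> table (fun x => ek k x * g x).
Proof. by move=> cg; apply: ccont_cable; apply: ccontM => //; exact: ccont_ek. Qed.

Lemma tk_le k (g : R -> R[i]) c : ccont (- pi) pi g -> nb Sn g c -> nC (tintegral (fun x => ek k x * g x)) <= c.
Proof.
move=> cg hg; have c0 := nb_ge0 hg; move/nb_Sn : hg => /(_ c0) hg.
by apply: tint_le => [|x /hg]; [exact: table_ekM|rewrite nCM nC_ek mul1r].
Qed.

Lemma tk_bounded chi lo hi : csmooth2 chi -> exists2 B, 0 <= B & forall t k, lo <= t <= hi -> nC (tk k chi t) <= B.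
Proof.
move=> h; have c2 := csmooth2_cont h.
have [|r hr] := @ccurve_bounded _ _ Sn lo hi chi (ccont2_curve c2).
  move=> t _; have [B B0 hB] := ccont_bounded (@Npi_le_pi R) (@ccont2_x _ t (- pi) pi c2).
  by exists B; apply/nb_Sn.
exists (Num.max r 0); first by rewrite le_max lexx orbT.
by move=> t k /hr q; rewrite le_max; apply/orP; left; apply: tk_le q; exact: ccont2_x.
Qed.

Lemma tk_ccont chi k lo hi : csmooth2 chi -> ccont lo hi (tk k chi).
Proof.
move=> h; have c2 := csmooth2_cont h; move=> t tt e e0; have [d d0 Hd] := ccont2_curve c2 tt e0.
exists d => // u uu ut; rewrite /tk -tintB; [|by apply: table_ekM; exact: ccont2_x|by apply: table_ekM; exact: ccont2_x].
rewrite (tint_eq (g := fun x => ek k x * (chi u x - chi t x))); last by move=> x _; rewrite mulrBr.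
apply: tk_le; last exact: (Hd u uu ut).
have := ccontD (@ccont2_x _ u (- pi) pi c2) (ccontM (@ccont_cst R (- pi) pi (-1)) (@ccont2_x _ t (- pi) pi c2)).
by apply: ccont_eq => x _; rewrite mulN1r.
Qed.

Lemma tk_der chi k lo hi : csmooth2 chi -> cder lo hi (tk k chi) (tk k (dt chi)).
Proof.
move=> h; have c2 := csmooth2_cont h; have c3 := csmooth2_cont (csmooth2_dt h); move=> t tt e e0.
have [d d0 Hd] := nb_der (fun x => @csmooth2_der chi lo hi x h) (ccont2_curve c3) tt e0.
exists d => // u uu ut; have := Hd u uu ut => q.
have t1 := @table_ekM k _ (@ccont2_x _ u (- pi) pi c2); have t2 := @table_ekM k _ (@ccont2_x _ t (- pi) pi c2).
have t3 := @table_ekM k _ (@ccont2_x _ t (- pi) pi c3).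
rewrite /tk -tintB// -tintZ// -tintB; [|exact: cableB|exact: cableZ].
rewrite (tint_eq (g := fun x => ek k x * (chi u x - chi t x - (u - t)%:C * dt chi t x))); last by move=> x _; ring.
apply: tk_le q.
have := ccontD (ccontD (@ccont2_x _ u (- pi) pi c2) (ccontM (@ccont_cst R (- pi) pi (-1)) (@ccont2_x _ t (- pi) pi c2)))
  (ccontM (@ccont_cst R (- pi) pi (- (u - t)%:C)) (@ccont2_x _ t (- pi) pi c3)).
by apply: ccont_eq => x _; rewrite mulN1r mulNr.
Qed.

Lemma tk_dxx chi k t : csmooth2 chi -> periodic (chi t) (pi *+ 2) -> tk k (dx (dx chi)) t = - kc k ^+ 2 * tk k chi t.
Proof.
move=> h p; have s1 := csmooth2_x t h; have s2 := csmooth_cderive s1.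
rewrite /tk /dx tint_by_parts//; last exact: periodic_cderive.
rewrite tint_by_parts// ikE /kc mulrA mulrNN; congr (_ * _).
by rewrite -expr2 exprMn sqr_i mulN1r.
Qed.

(** Up to sign, k^2 times the coefficient is that of the second x-derivative. This decay makes the
    pairing with a nonlinearity in H^(s-1) absolutely convergent. *)
Lemma tk_decay chi lo hi : csmooth2 chi -> (forall t, periodic (chi t) (pi *+ 2)) ->
  exists2 B, 0 <= B & forall t k, lo <= t <= hi -> nC (tk k chi t) <= B * wt (- 2) k.
Proof.
move=> h p; have [B1 B10 h1] := tk_bounded lo hi h.
have [B2 B20 h2] := tk_bounded lo hi (csmooth2_dx (csmooth2_dx h)).
exists (B1 + B2); first by rewrite addr_ge0.
move=> t k tt; rewrite wtN ler_pdivlMr ?wt_gt0//.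
have -> : wt 2 k = 1 + k%:~R ^+ 2 :> R by rewrite /wt divff// powRr1// addr_ge0// sqr_ge0.
have := h2 t k tt; rewrite tk_dxx// nCM nCN.
have -> : nC (kc k ^+ 2 : R[i]) = k%:~R ^+ 2 :> R.
  have -> : kc k = (k%:~R : R)%:C :> R[i] by rewrite /kc rmorph_int.
  by rewrite -rmorphXn nC_real ger0_norm// sqr_ge0.
have := h1 t k tt; move=> q1 q2; rewrite mulrDr mulr1 mulrC [X in _ + X <= _]mulrC; lra.
Qed.

End TestFunctions.

(** * The weak formulation on Fourier coefficients *)

Section WeakFormulation.
Context {R : realType}.
Notation mu := (@lebesgue_measure R).
Notation seqs := (bool -> int -> R[i]).
Implicit Types (t x lo hi e : R) (k : int) (chi : R -> R -> R[i]) (b : bool).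
Variables (s : R).
Hypothesis hs : 3 / 2 < s.
Notation X := (Hw (R := R) s).

Definition sg b : R[i] := if b then -1 else 1.

Lemma ep_sg b : ep b = - 'i * sg b :> R[i].
Proof. by case: b; rewrite /ep /sg ?mulr1 ?mulrN1 ?opprK. Qed.

Lemma Fu_ccurve lo hi r (y : R -> seqs) b : (forall b, ccurve X lo hi (y ^~ b)) ->
  (forall t, lo <= t <= hi -> bdd X r (y t)) -> ccurve (Hw (s - 1)) lo hi (fun t => Fu b (y t)).
Proof. by move=> cy by'; exact: lip_ccurve (lip_Fu hs b) cy by'. Qed.

Lemma pairing_bounds lo hi (z : R -> int -> R[i]) p r : ccurve (Hw p) lo hi z ->
  (forall t, lo <= t <= hi -> nb (Hw p) (z t) r) ->
  (forall k, ccont lo hi (z ^~ k)) /\ (forall k t, lo <= t <= hi -> nC (z t k) <= r * wt (- p) k).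
Proof.
move=> cz bz; split=> [k|k t tt]; first exact: ccurve_coef cz.
by rewrite wtN ler_pdivlMr ?wt_gt0// mulrC; exact: nb_Hw_coef (bz t tt).
Qed.

Lemma cint_pairing lo hi (z : R -> int -> R[i]) (g : int -> R -> R[i]) C1 C2 p q : lo <= hi -> 1 < p + q -> 0 <= C1 -> 0 <= C2 ->
  (forall k, ccont lo hi (z ^~ k)) -> (forall k t, lo <= t <= hi -> nC (z t k) <= C1 * wt (- p) k) ->
  (forall k, ccont lo hi (g k)) -> (forall k t, lo <= t <= hi -> nC (g k t) <= C2 * wt (- q) k) ->
  [/\ cintegral lo hi (fun t => csum (fun k => z t k * g k t)) = csum (fun k => cintegral lo hi (fun t => z t k * g k t)) &
    summ (fun k => cintegral lo hi (fun t => z t k * g k t))].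
Proof.
move=> lh pq C10 C20 cz bz cg bg; have [C hC] := sumle_wt pq.
have := @cint_csum R int lo hi (fun k t => z t k * g k t) (fun k => C1 * C2 * wt (- (p + q)) k) _ lh
  (fun k => ccontM (cz k) (cg k)) _ (sumleZ (mulr_ge0 C10 C20) hC).
case=> [k t tt|-> h]; last by split.
rewrite opprD wtD nCM (_ : C1 * C2 * _ = (C1 * wt (- p) k) * (C2 * wt (- q) k)); last by ring.
by apply: ler_pM; rewrite ?nC_ge0//; [exact: bz|exact: bg].
Qed.

(** Frequency by frequency, the left-hand side is - i times the integral of the derivative of y_k
    g_k, because [sg b] times - k^2 equals - i [Lk b k]. *)
Lemma pairing_identity lo hi (y f : R -> int -> R[i]) (g g1 g2 : int -> R -> R[i]) b C1 C2 B1 B2 B3 : lo <= hi ->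
  0 <= C1 -> 0 <= C2 -> 0 <= B1 -> 0 <= B2 -> 0 <= B3 ->
  (forall k, cder lo hi (y ^~ k) (fun t => Lk b k * y t k + f t k)) ->
  (forall k, cder lo hi (g k) (g1 k)) -> (forall k t, g2 k t = - kc k ^+ 2 * g k t) ->
  (forall k, ccont lo hi (y ^~ k)) -> (forall k t, lo <= t <= hi -> nC (y t k) <= C1 * wt (- s) k) ->
  (forall k, ccont lo hi (f ^~ k)) -> (forall k t, lo <= t <= hi -> nC (f t k) <= C2 * wt (- (s - 1)) k) ->
  (forall k, ccont lo hi (g1 k)) -> (forall k t, lo <= t <= hi -> nC (g1 k t) <= B1) ->
  (forall k, ccont lo hi (g2 k)) -> (forall k t, lo <= t <= hi -> nC (g2 k t) <= B2) ->
  (forall k, ccont lo hi (g k)) -> (forall k t, lo <= t <= hi -> nC (g k t) <= B3 * wt (- 2) k) ->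
  - 'i * cintegral lo hi (fun t => csum (fun k => y t k * g1 k t))
  + sg b * cintegral lo hi (fun t => csum (fun k => y t k * g2 k t))
  - 'i * cintegral lo hi (fun t => csum (fun k => f t k * g k t)) =
  - 'i * (csum (fun k => y hi k * g k hi) - csum (fun k => y lo k * g k lo)).
Proof.
move=> lh C10 C20 B10 B20 B30 dy dg eg c1 b1 c2 b2 k1 hB1 k2 hB2 k3 hB3.
have ll : lo <= lo <= hi by rewrite lexx.
have hh : lo <= hi <= hi by rewrite lexx andbT.
have w0 (B : R) k : B <= B * wt (- 0) k by rewrite oppr0 wt0 mulr1.
have hs0 := hs; have p1 : 1 < s + 0 by lra.
have p2 : 1 < s - 1 + 2 by lra.
have [e1 s1] := cint_pairing lh p1 C10 B10 c1 b1 k1 (fun k t tt => le_trans (hB1 k t tt) (w0 B1 k)).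
have [e2 s2] := cint_pairing lh p1 C10 B20 c1 b1 k2 (fun k t tt => le_trans (hB2 k t tt) (w0 B2 k)).
have [e3 s3] := cint_pairing lh p2 C20 B30 c2 b2 k3 hB3.
rewrite e1 e2 e3.
have sb t : lo <= t <= hi -> summ (fun k => y t k * g k t).
  move=> tt; have [C hC] := sumle_wt p1; exists (C1 * B3 * C).
  apply: sumle_mon (sumleZ (mulr_ge0 C10 B30) hC) => // k.
  rewrite addr0 nCM (_ : C1 * B3 * _ = C1 * wt (- s) k * B3); last by ring.
  apply: ler_pM; rewrite ?nC_ge0//; first exact: b1.
  have w2 : wt (- 2) k <= wt 0 k :> R by apply: wt_mono; lra.
  by apply: le_trans (hB3 k t tt) _; rewrite wt0 in w2; rewrite -[leRHS]mulr1 ler_wpM2l.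
have S1 := summZ (- 'i) s1; have S2 := summZ (sg b) s2; have S3 := summZ 'i s3.
rewrite -(csumB (sb hi hh) (sb lo ll)) -(csumZ _ s1) -(csumZ _ s2) -(csumZ _ s3) -(csumZ _ (summB (sb hi hh) (sb lo ll))).
rewrite -(csumD S1 S2) -(csumB (summD S1 S2) S3).
apply: eq_csum => k.
have cyk := c1 k; have cFk := c2 k; have {}k1 := k1 k; have {}k2 := k2 k; have {}k3 := k3 k.
have m1 : ccont lo hi (fun t => y t k * g1 k t) by exact: ccontM.
have m2 : ccont lo hi (fun t => y t k * g2 k t) by exact: ccontM.
have m3 : ccont lo hi (fun t => f t k * g k t) by exact: ccontM.
have m4 : ccont lo hi (fun t => (Lk b k * y t k + f t k) * g k t).
  by apply: ccontM => //; apply: ccontD => //; apply: ccontM => //; exact: ccont_cst.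
rewrite -(cint_FTC lh (cderM (dy k) (dg k)) (ccontD m4 m1)).
rewrite -!cintZ; try exact: ccont_cable; last exact: ccont_cable (ccontD m4 m1).
have cz (z : R[i]) h : ccont lo hi h -> cable lo hi (fun t => z * h t) by move=> ch; apply: cableZ; exact: ccont_cable.
rewrite -(cintD (cz _ _ m1) (cz _ _ m2)) -(cintB (cableD (cz _ _ m1) (cz _ _ m2)) (cz _ _ m3)).
apply: cint_eq => t tt; rewrite eg /Lk ep_sg.
move: (y t k) (f t k) (g k t) (g1 k t) (kc k ^+ 2) (sg b) => Y F G G1 K S; have i2 := ii (R := R).
apply/eqP; rewrite -subr_eq0; apply/eqP; transitivity ((1 + 'i * 'i) * (- S * K * Y * G)); first by ring.
by rewrite i2 subrr mul0r.
Qed.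

Lemma fsol_pairing lo hi r (y : R -> seqs) chi b : lo <= hi -> fsol s (@Fu R) lo hi y ->
  (forall t, lo <= t <= hi -> bdd X r (y t)) -> csmooth2 chi -> (forall t, periodic (chi t) (pi *+ 2)) ->
  - 'i * cintegral lo hi (fun t => csum (fun k => y t b k * tk k (dt chi) t))
  + sg b * cintegral lo hi (fun t => csum (fun k => y t b k * tk k (dx (dx chi)) t))
  - 'i * cintegral lo hi (fun t => csum (fun k => Fu b (y t) k * tk k chi t)) =
  - 'i * (csum (fun k => y hi b k * tk k chi hi) - csum (fun k => y lo b k * tk k chi lo)).
Proof.
move=> lh [cy dy] by' hc pc; have ll : lo <= lo <= hi by rewrite lexx.
have r0 : 0 <= r := nb_ge0 (by' lo ll b).
have [c1 b1] := pairing_bounds (cy b) (fun t tt => by' t tt b).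
have cF := Fu_ccurve b cy by'.
have [rF hF] : exists rF, forall t, lo <= t <= hi -> nb (Hw (s - 1)) (Fu b (y t)) rF.
  have [C [_ hC _]] := lip_Fu hs b r; by exists C => t /by'; exact: hC.
have rF0 : 0 <= rF := nb_ge0 (hF lo ll).
have [c2 b2] := pairing_bounds cF hF.
have [B1 B10 hB1] := tk_bounded lo hi (csmooth2_dt hc).
have [B2 B20 hB2] := tk_bounded lo hi (csmooth2_dx (csmooth2_dx hc)).
have [B3 B30 hB3] := tk_decay lo hi hc pc.
exact: (@pairing_identity lo hi (fun t => y t b) (fun t => Fu b (y t)) (fun k => tk k chi) (fun k => tk k (dt chi))
  (fun k => tk k (dx (dx chi))) b r rF B1 B2 B3 lh r0 rF0 B10 B20 B30 (dy b) (fun k => @tk_der R chi k lo hi hc)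
  (fun k t => tk_dxx k hc (pc t)) c1 b1 c2 b2 (fun k => @tk_ccont R _ k lo hi (csmooth2_dt hc)) (fun k t => hB1 t k)
  (fun k => @tk_ccont R _ k lo hi (csmooth2_dx (csmooth2_dx hc))) (fun k t => hB2 t k)
  (fun k => @tk_ccont R _ k lo hi hc) (fun k t => hB3 t k)).
Qed.

Lemma tint_pair (f g : R -> R[i]) : Hs s f -> (forall lo hi, ccont lo hi g) ->
  tintegral (fun x => f x * g x) = csum (fun k => fourier f k * tintegral (fun x => ek k x * g x)).
Proof.
move=> hf cg; have [mf _] := Hs_table hf; have [sf _] := Hs_summ hs hf.
have mg : cmeasurable g by apply: cmeas_ccont => lo hi _.
have [<- _] := Ss_tint_mul sf (cg (- pi) pi).
apply: tint_ae; [exact: cmeasM|by apply: cmeasM => //; exact: cmeas_Ss|].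
by apply: filterS (Hs_ae hs hf); [exact: (ae_filter_ringOfSetsType mu)|move=> x H /H ->].
Qed.

Lemma tint_pair_F (u v w : R -> R -> R[i]) t (g : R -> R[i]) : Hs s (u t) -> Hs s (v t) -> Hs s (w t) ->
  (forall lo hi, ccont lo hi g) ->
  tintegral (fun x => nonlinearity u v w t x * g x) =
  csum (fun k => conv (conv (fourier (u t)) (fourier (v t))) (Dq (fourier (w t))) k * tintegral (fun x => ek k x * g x)).
Proof.
move=> hu hv hw cg; have [mn an] := nonlinearity_ae hs hu hv hw.
have [su _] := Hs_summ hs hu; have [sv _] := Hs_summ hs hv; have [_ sw] := Hs_summ hs hw.
have sc := summ_conv (summ_conv su sv) sw.
have mg : cmeasurable g by apply: cmeas_ccont => lo hi _.
have [<- _] := Ss_tint_mul sc (cg (- pi) pi).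
apply: tint_ae; [exact: cmeasM|by apply: cmeasM => //; exact: cmeas_Ss|].
by apply: filterS an; [exact: (ae_filter_ringOfSetsType mu)|move=> x H /H ->].
Qed.

Definition sel b (u v : R -> R -> R[i]) := if b then u else v.

Lemma cf_sel (u v : R -> R -> R[i]) t b : cf u v t b = fourier (sel b u v t).
Proof. by case: b. Qed.

Lemma C_Hs2_sel lo hi u v b t : C_Hs2 s lo hi u v -> lo <= t <= hi -> Hs s (sel b u v t).
Proof. by move=> [H _] tt; have [|h1 h2] := H t; first (by rewrite in_itv); rewrite /sel; case: b. Qed.

Lemma C_Hs2_bounded lo hi u v : C_Hs2 s lo hi u v -> lo <= hi -> exists r, forall t, lo <= t <= hi -> bdd X r (cf u v t).
Proof.
move=> h lh; have [cy by'] := C_Hs2_ccurve h.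
have [r1 h1] := ccurve_bounded (cy true) (fun t => by' t true).
have [r2 h2] := ccurve_bounded (cy false) (fun t => by' t false).
exists (Num.max r1 r2) => t tt []; [apply: nb_mon (h1 t tt)|apply: nb_mon (h2 t tt)]; by rewrite le_max lexx ?orbT.
Qed.

Lemma fsol_weak lo hi u v chi b : lo <= hi -> C_Hs2 s lo hi u v -> fsol s (@Fu R) lo hi (cf u v) ->
  csmooth2 chi -> (forall t, periodic (chi t) (pi *+ 2)) ->
  - 'i * cintegral lo hi (fun t => tintegral (fun x => sel b u v t x * dt chi t x))
  + sg b * cintegral lo hi (fun t => tintegral (fun x => sel b u v t x * dx (dx chi) t x))
  - 'i * cintegral lo hi (fun t => tintegral (fun x => nonlinearity u v (sel b u v) t x * chi t x)) =
  - 'i * (tintegral (fun x => sel b u v hi x * chi hi x) - tintegral (fun x => sel b u v lo x * chi lo x)).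
Proof.
move=> lh hC hf hc pc; have [r hr] := C_Hs2_bounded hC lh.
have hsel c t : lo <= t <= hi -> Hs s (sel c u v t) := C_Hs2_sel c hC.
have cc (f : R -> R -> R[i]) t : csmooth2 f -> forall lo hi, ccont lo hi (f t).
  by move=> /csmooth2_cont h *; exact: ccont2_x.
have := fsol_pairing b lh hf hr hc pc.
have ll : lo <= lo <= hi by rewrite lexx.
have hh : lo <= hi <= hi by rewrite lexx andbT.
have E f t : csmooth2 f -> lo <= t <= hi -> tintegral (fun x => sel b u v t x * f t x) = csum (fun k => cf u v t b k * tk k f t).
  by move=> sf tt; rewrite tint_pair ?cf_sel//; [exact: hsel|exact: cc].
rewrite (E _ _ hc ll) (E _ _ hc hh) => <-.
congr (_ * _ + _ * _ - _ * _); apply: cint_eq => t tt; [exact: E (csmooth2_dt hc) tt|exact: E (csmooth2_dx (csmooth2_dx hc)) tt|].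
have h1 := hsel true t tt; have h2 := hsel false t tt.
transitivity (csum (fun k => conv (conv (fourier (u t)) (fourier (v t))) (Dq (fourier (sel b u v t))) k * tk k chi t)).
  exact: (tint_pair_F h1 h2 (hsel b t tt) (cc chi t hc)).
by rewrite -[fourier (sel b u v t)](cf_sel u v t b).
Qed.

Lemma csmooth2_mul (eta : R -> R) m : smooth1 eta -> csmooth2 (fun t x => (eta t)%:C * ek m x).
Proof.
move=> se n; split.
  have := Cn2_mul n se (csmooth_ek (R := R) m).1; congr Cn2; apply/funext => t; apply/funext => x.
  by rewrite cReM /= mul0r subr0.
have := Cn2_mul n se (csmooth_ek (R := R) m).2; congr Cn2; apply/funext => t; apply/funext => x.
by rewrite cImM /= mul0r addr0.
Qed.

Lemma cder_cderive (f f' : R -> R[i]) x : (forall lo hi, cder lo hi f f') -> cderive f x = f' x.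
Proof.
move=> h; have xx : x - 1 <= x <= x + 1 by apply/andP; split; lra.
have xx' : x - 1 < x < x + 1 by apply/andP; split; lra.
apply: complex_ext; rewrite /cderive /= derive1E.
  exact: (@derive_val _ _ _ _ _ _ _ (rderat_is_derive xx' (cder_Re xx (h _ _)))).
exact: (@derive_val _ _ _ _ _ _ _ (rderat_is_derive xx' (cder_Im xx (h _ _)))).
Qed.

Lemma dt_mul (eta eta' : R -> R) m t x : (forall t, is_derive t (1 : R) eta (eta' t)) ->
  dt (fun t x => (eta t)%:C * ek m x) t x = (eta' t)%:C * ek m x.
Proof.
move=> d; rewrite /dt; apply: (cder_cderive (f' := fun t => (eta' t)%:C * ek m x)) => lo hi.
have d1 : cder lo hi (fun t => (eta t)%:C) (fun t => (eta' t)%:C).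
  by apply: rder_cder => z _; [exact: is_derive_rderat (d z)|apply: is_derive_rderat; exact: is_derive_cst].
have := cderM d1 (@cder_cst R lo hi (ek m x)); apply: cder_eq => z _ //.
by rewrite mulr0 addr0.
Qed.

Lemma dx_mul (c : R[i]) (f : R -> R -> R[i]) m t x : f t = (fun x => c * ek m x) ->
  dx f t x = c * (0 +i* m%:~R) * ek m x.
Proof.
move=> e; rewrite /dx e; apply: (cder_cderive (f' := fun x => c * (0 +i* m%:~R) * ek m x)) => lo hi.
by have := cderZ c (@cder_ek R m lo hi); apply: cder_eq => z _ //; rewrite mulrA.
Qed.

(** The character of frequency -m extracts the coefficient m, and the chosen weak derivative is
    replaced almost everywhere by its Fourier series. *)
Lemma weak_coefficient (u v w : R -> R -> R[i]) (w0 : R -> R[i]) lo hi (eta eta' : R -> R) kappa sigma m :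
  (forall t, lo <= t <= hi -> Hs s (u t) /\ Hs s (v t)) -> (forall t, lo <= t <= hi -> Hs s (w t)) -> Hs s w0 ->
  (forall t, is_derive t (1 : R) eta (eta' t)) ->
  weak_identity lo hi kappa sigma w0 w (nonlinearity u v w) (fun t x => (eta t)%:C * ek (- m) x) ->
  - 'i * cintegral lo hi (fun t => fourier (w t) m * (eta' t)%:C) + kappa * 'i * (fourier w0 m * (eta 0)%:C)
  + sigma * cintegral lo hi (fun t => - (kc m ^+ 2) * (fourier (w t) m * (eta t)%:C))
  = 'i * cintegral lo hi (fun t => conv (conv (fourier (u t)) (fourier (v t))) (Dq (fourier (w t))) m * (eta t)%:C).
Proof.
move=> huv hw hw0 de; rewrite /weak_identity.
have E f (z : R[i]) : cmeasurable f -> table f -> tintegral (fun x => f x * (z * ek (- m) x)) = fourier f m * z.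
  move=> mf tf; rewrite fourier_ek [RHS]mulrC -tintZ; last exact: table_ek.
  by apply: tint_eq => x _; rewrite mulrCA.
have ccE (z : R[i]) : forall lo hi, ccont lo hi (fun x => z * ek (- m) x).
  by move=> *; apply: ccontM; [exact: ccont_cst|exact: ccont_ek].
have alg (a b c I1 I1' W W' I2 I2' J J' : R[i]) : I1 = I1' -> W = W' -> I2 = I2' -> J = J' ->
  a * I1 + b * W + c * I2 = 'i * J -> a * I1' + b * W' + c * I2' = 'i * J' by move=> -> -> -> ->.
apply: alg.
- apply: cint_eq => t tt; have [mw tw] := Hs_table (hw t tt); rewrite -E//.
  by apply: tint_eq => x _; rewrite (dt_mul _ _ _ de).
- by have [mw tw] := Hs_table hw0; rewrite E.
- apply: cint_eq => t tt; have [mw tw] := Hs_table (hw t tt).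
  transitivity (fourier (w t) m * ((eta t)%:C * (0 +i* (- m)%:~R) * (0 +i* (- m)%:~R))).
    rewrite -E//; apply: tint_eq => x _; congr (_ * _).
    apply: (dx_mul (c := (eta t)%:C * (0 +i* (- m)%:~R))); apply/funext => y.
    exact: dx_mul.
  have kN : kc (- m) = - kc m :> R[i] by rewrite /kc rmorphN.
  rewrite ikE kN; have i2 := ii (R := R); move: (fourier _ _) (eta t)%:C (kc m : R[i]) => a b c.
  transitivity (('i * 'i) * (a * b * c ^+ 2)); first by ring.
  by rewrite i2; ring.
apply: cint_eq => t tt; have [hu hv] := huv t tt; have hwt := hw t tt.
have [mn an] := nonlinearity_ae hs hu hv hwt.
have [su _] := Hs_summ hs hu; have [sv _] := Hs_summ hs hv; have [_ sw] := Hs_summ hs hwt.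
have sc := summ_conv (summ_conv su sv) sw; have [ms ts] := Lp1_table (Lp_Ss 1 sc).
have mE : cmeasurable (fun x => (eta t)%:C * ek (- m) x) by apply: cmeas_ccont => *; exact: ccE.
transitivity (tintegral (fun x => Ss (conv (conv (fourier (u t)) (fourier (v t))) (Dq (fourier (w t)))) x * ((eta t)%:C * ek (- m) x))).
  apply: tint_ae; [exact: cmeasM|exact: cmeasM|].
  by apply: filterS an; [exact: (ae_filter_ringOfSetsType mu)|move=> x H /H ->].
by rewrite E// fourier_Ss.
Qed.

Lemma cder_flip lo hi (f f' : R -> R[i]) : cder lo hi f f' -> cder (- hi) (- lo) (fun t => f (- t)) (fun t => - f' (- t)).
Proof.
move=> H t tt e e0; have tt' : lo <= - t <= hi by rewrite lerNr lerNl andbC.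
have [d d0 Hd] := H (- t) tt' e e0; exists d => // u uu ut.
have uu' : lo <= - u <= hi by rewrite lerNr lerNl andbC.
have q : - u - - t = - (u - t) by ring.
by have := Hd (- u) uu'; rewrite q normrN => /(_ ut); rewrite rmorphN mulNr mulrN.
Qed.

Lemma ccont_flip lo hi (f : R -> R[i]) : ccont lo hi f -> ccont (- hi) (- lo) (fun t => f (- t)).
Proof.
move=> H t tt e e0; have tt' : lo <= - t <= hi by rewrite lerNr lerNl andbC.
have [d d0 Hd] := H (- t) tt' e e0; exists d => // u uu ut.
have uu' : lo <= - u <= hi by rewrite lerNr lerNl andbC.
by apply: Hd => //; rewrite (_ : - u - - t = - (u - t)) ?normrN//; ring.
Qed.

Lemma cint_flip lo hi (f : R -> R[i]) : lo <= hi -> ccont lo hi f ->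
  cintegral (- hi) (- lo) (fun t => f (- t)) = cintegral lo hi f.
Proof.
move=> lh cf; have d := cder_flip (cint_primitive cf).
have c := ccont_flip cf; have ab : - hi <= - lo by rewrite lerN2.
have cN : ccont (- hi) (- lo) (fun t => - f (- t)).
  by have := ccontM (@ccont_cst R (- hi) (- lo) (-1)) c; apply: ccont_eq => t _; rewrite mulN1r.
have := cint_FTC ab d cN; rewrite !opprK cintN; last exact: ccont_cable.
have -> : cintegral lo lo f = 0.
  have : nC (cintegral lo lo f) <= nC (f lo) * (lo - lo).
    apply: cint_le => //; first by apply: cable_sub (ccont_cable cf).
    by move=> x /le_anti <-.
  by rewrite subrr mulr0 => q; apply: nC_eq0; apply/eqP; rewrite eq_le q nC_ge0.
by rewrite sub0r => /oppr_inj.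
Qed.

(** Multiplication by i brings the weak identity to the shape that [weak_ode] expects. *)
Lemma weak_form (I1 W I2 J : R[i]) (K sigma kappa : R[i]) :
  - 'i * I1 + kappa * 'i * W + sigma * (- K * I2) = 'i * J ->
  I1 - kappa * W + (- 'i * sigma * K * I2 + J) = 0.
Proof.
move=> h; have i2 := ii (R := R); have : 'i * (- 'i * I1 + kappa * 'i * W + sigma * (- K * I2)) = 'i * ('i * J) by rewrite h.
move=> h2; apply/eqP; rewrite -(subrr ('i * ('i * J))) -{1}h2; apply/eqP.
transitivity ((- ('i * 'i)) * I1 + ('i * 'i) * (kappa * W) - 'i * sigma * K * I2 - ('i * 'i) * J); last by ring.
by rewrite i2; ring.
Qed.

Lemma forward_fsol T u0 v0 u v : 0 < T -> Hs s u0 -> Hs s v0 -> solution_forward s T u0 v0 u v ->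
  fsol s (@Fu R) 0 T (cf u v) /\ cf u v 0 = fun b => fourier (if b then u0 else v0).
Proof.
move=> T0 hu0 hv0 [hC H]; have [r hr] := C_Hs2_bounded hC (ltW T0); have [cy _] := C_Hs2_ccurve hC.
have K b k : cf u v 0 b k = fourier (if b then u0 else v0) k /\
    cder 0 T (fun t => cf u v t b k) (fun t => Lk b k * cf u v t b k + Fu b (cf u v t) k).
  have cg : ccont 0 T (fun t => cf u v t b k) := ccurve_coef k (cy b).
  have cF : ccont 0 T (fun t => Fu b (cf u v t) k) := ccurve_coef k (Fu_ccurve b cy hr).
  have cG : ccont 0 T (fun t => Lk b k * cf u v t b k + Fu b (cf u v t) k).
    by apply: ccontD => //; apply: ccontM => //; exact: ccont_cst.
  apply: (weak_ode T0 cg cG) => lam c l0 /andP[c0 cT].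
  have hchi : test_forward T (fun t x => (flatc lam c t)%:C * ek (- k) x).
    split; first by apply: csmooth2_mul; exact: smooth_flatc.
      by move=> t x; rewrite ek_periodic.
    exists c => // t x ct; rewrite /flatc flat_le0 ?mul0r// mulr_ge0_le0 ?(ltW l0)// subr_le0//.
  have [h1 h2] := H _ hchi.
  have hh b' t : 0 <= t <= T -> Hs s (sel b' u v t) := C_Hs2_sel b' hC.
  have q : - 'i * cintegral 0 T (fun t => cf u v t b k * (- lam * flat' (lam * (c - t)))%:C)
    + (-1) * 'i * (fourier (if b then u0 else v0) k * (flatc lam c 0)%:C)
    + sg b * cintegral 0 T (fun t => - (kc k ^+ 2) * (cf u v t b k * (flatc lam c t)%:C))
    = 'i * cintegral 0 T (fun t => Fu b (cf u v t) k * (flatc lam c t)%:C).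
    case: b {cg cF cG} => /=.
      exact: (weak_coefficient (fun t tt => conj (hh true t tt) (hh false t tt)) (hh true) hu0 (flatc_der lam c) h1).
    exact: (weak_coefficient (fun t tt => conj (hh true t tt) (hh false t tt)) (hh false) hv0 (flatc_der lam c) h2).
  have ce : ccont 0 T (fun t => (flatc lam c t)%:C) := cder_ccont (@flatc_cder R lam c 0 T).
  have i1 := ccont_cable (ccontM cg ce); have i2 := ccont_cable (ccontM cF ce).
  rewrite cintZ// in q; have := weak_form q; rewrite mulN1r opprK => <-; congr (_ + _).
  rewrite -(cintZ _ i1) -(cintD (cableZ _ i1) i2).
  by apply: cint_eq => t _; rewrite /Lk ep_sg; ring.
split; last by apply/funext => b; apply/funext => k; exact: (K b k).1.
by split=> // b k; exact: (K b k).2.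
Qed.

Lemma backward_fsol T u0 v0 u v : 0 < T -> Hs s u0 -> Hs s v0 -> solution_backward s T u0 v0 u v ->
  fsol s (@Fu R) (- T) 0 (cf u v) /\ cf u v 0 = fun b => fourier (if b then u0 else v0).
Proof.
move=> T0 hu0 hv0 [hC H]; have NT : - T <= 0 by rewrite oppr_le0 ltW.
have [r hr] := C_Hs2_bounded hC NT; have [cy _] := C_Hs2_ccurve hC.
have K b k : cf u v 0 b k = fourier (if b then u0 else v0) k /\
    cder (- T) 0 (fun t => cf u v t b k) (fun t => Lk b k * cf u v t b k + Fu b (cf u v t) k).
  have cg : ccont (- T) 0 (fun t => cf u v t b k) := ccurve_coef k (cy b).
  have cF : ccont (- T) 0 (fun t => Fu b (cf u v t) k) := ccurve_coef k (Fu_ccurve b cy hr).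
  have cG : ccont (- T) 0 (fun t => Lk b k * cf u v t b k + Fu b (cf u v t) k).
    by apply: ccontD => //; apply: ccontM => //; exact: ccont_cst.
  have fg := ccont_flip cg; have fG := ccont_flip cG; rewrite oppr0 opprK in fg fG.
  have fGN : ccont 0 T (fun t => - (Lk b k * cf u v (- t) b k + Fu b (cf u v (- t)) k)).
    by have := ccontM (@ccont_cst R 0 T (-1)) fG; apply: ccont_eq => t _; rewrite mulN1r.
  suff [w1 w2] : cf u v (- 0) b k = fourier (if b then u0 else v0) k /\
      cder 0 T (fun t => cf u v (- t) b k) (fun t => - (Lk b k * cf u v (- t) b k + Fu b (cf u v (- t)) k)).
    rewrite oppr0 in w1; split=> //; have := cder_flip w2; rewrite oppr0.
    by apply: cder_eq => t _; rewrite ?opprK.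
  apply: (weak_ode T0 fg fGN) => lam c l0 /andP[c0 cT].
  (* [weak_ode] runs forward in time, so it is applied after t -> - t; the reflected cut-off
     vanishes for t <= - c, as a backward test function must. *)
  pose eta t := flatc lam c (- t).
  have de t : is_derive t (1 : R) eta (lam * flat' (lam * (c + t))).
    have h := @is_derive1_comp R (flatc lam c) -%R t _ _ (flatc_der lam c (- t)) (is_deriveN (is_derive_id t (1 : R))).
    by apply: (is_derive_eq h); rewrite opprK mulrN1 mulNr opprK.
  have se : smooth1 eta.
    apply: (@smooth_class _ (fun f : R -> R => exists g : R -> R, smooth1 g /\ f = fun t => g (- t))); last first.
      by exists (flatc lam c); split=> //; exact: smooth_flatc.
    move=> _ [g [sg' ->]]; have dg t : is_derive t (1 : R) (fun t => g (- t)) (- derive1 g (- t)).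
      have d1 : is_derive (- t) (1 : R) g (derive1 g (- t)) by rewrite derive1E; apply: DeriveDef => //; exact: (sg' 0%N).
      have h := @is_derive1_comp R g -%R t _ _ d1 (is_deriveN (is_derive_id t (1 : R))).
      by apply: (is_derive_eq h); rewrite mulrN1.
    split=> [t|]; first by have [] := dg t.
    exists (fun t => - derive1 g t); split.
      have sm := smooth_der sg'.
      apply: (@smooth_class _ (fun f : R -> R => exists g : R -> R, smooth1 g /\ f = fun t => - g t)); last by exists (derive1 g).
      move=> _ [h [sh ->]]; have dh t : is_derive t (1 : R) (fun t => - h t) (- derive1 h t).
        by apply: is_deriveN; rewrite derive1E; apply: DeriveDef => //; exact: (sh 0%N).
      split=> [t|]; first by have [] := dh t.
      exists (derive1 h); split; first exact: smooth_der.
      by apply/funext => t; rewrite derive1E (@derive_val _ _ _ _ _ _ _ (dh t)).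
    by apply/funext => t; rewrite derive1E (@derive_val _ _ _ _ _ _ _ (dg t)).
  have hchi : test_backward T (fun t x => (eta t)%:C * ek (- k) x).
    split; first exact: csmooth2_mul.
      by move=> t x; rewrite ek_periodic.
    exists (- c); first by rewrite ltrN2.
    by move=> t x tc; rewrite /eta /flatc flat_le0 ?mul0r// mulr_ge0_le0 ?(ltW l0)// subr_le0 lerNr.
  have [h1 h2] := H _ hchi.
  have hh b' t : - T <= t <= 0 -> Hs s (sel b' u v t) := C_Hs2_sel b' hC.
  have q : - 'i * cintegral (- T) 0 (fun t => cf u v t b k * (lam * flat' (lam * (c + t)))%:C)
    + 1 * 'i * (fourier (if b then u0 else v0) k * (eta 0)%:C)
    + sg b * cintegral (- T) 0 (fun t => - (kc k ^+ 2) * (cf u v t b k * (eta t)%:C))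
    = 'i * cintegral (- T) 0 (fun t => Fu b (cf u v t) k * (eta t)%:C).
    case: b {cg cF cG fg fG fGN} => /=.
      exact: (weak_coefficient (fun t tt => conj (hh true t tt) (hh false t tt)) (hh true) hu0 de h1).
    exact: (weak_coefficient (fun t tt => conj (hh true t tt) (hh false t tt)) (hh false) hv0 de h2).
  have ce : ccont (- T) 0 (fun t => (eta t)%:C).
    by have := ccont_flip (cder_ccont (@flatc_cder R lam c 0 T)); rewrite oppr0.
  have ce' : ccont (- T) 0 (fun t => (lam * flat' (lam * (c + t)))%:C).
    have := ccontM (@ccont_cst R (- T) (- 0) (-1)) (ccont_flip (@flat'_ccont R lam c 0 T)); rewrite oppr0.
    by apply: ccont_eq => t _; rewrite opprK mulN1r -rmorphN mulNr opprK.
  have i1 := ccont_cable (ccontM cg ce); have i2 := ccont_cable (ccontM cF ce).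
  rewrite cintZ// in q; have := weak_form q; rewrite mul1r => q2.
  have f1 := cint_flip NT (ccontM cg ce'); have f2 := cint_flip NT (ccontM cG ce); rewrite oppr0 opprK in f1 f2.
  have e1 : cintegral 0 T (fun t => cf u v (- t) b k * (- lam * flat' (lam * (c - t)))%:C)
     = - cintegral (- T) 0 (fun t => cf u v t b k * (lam * flat' (lam * (c + t)))%:C).
    rewrite -f1 -cintN; last by apply: ccont_cable; have := ccont_flip (ccontM cg ce'); rewrite oppr0 opprK.
    by apply: cint_eq => t _; rewrite mulNr rmorphN mulrN.
  have e2 : cintegral 0 T (fun t => - (Lk b k * cf u v (- t) b k + Fu b (cf u v (- t)) k) * (flatc lam c t)%:C)
     = - cintegral (- T) 0 (fun t => (Lk b k * cf u v t b k + Fu b (cf u v t) k) * (eta t)%:C).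
    rewrite -f2 -cintN; last by apply: ccont_cable; have := ccont_flip (ccontM cG ce); rewrite oppr0 opprK.
    by apply: cint_eq => t _; rewrite /eta opprK mulNr.
  have e3 : cintegral (- T) 0 (fun t => (Lk b k * cf u v t b k + Fu b (cf u v t) k) * (eta t)%:C) =
     - 'i * sg b * kc k ^+ 2 * cintegral (- T) 0 (fun t => cf u v t b k * (eta t)%:C)
     + cintegral (- T) 0 (fun t => Fu b (cf u v t) k * (eta t)%:C).
    rewrite -(cintZ _ i1) -(cintD (cableZ _ i1) i2).
    by apply: cint_eq => t _; rewrite /Lk ep_sg; ring.
  rewrite e1 e2 e3 -[RHS](oppr0) -q2 /eta oppr0; ring.
split; last by apply/funext => b; apply/funext => k; exact: (K b k).1.
by split=> // b k; exact: (K b k).2.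
Qed.

End WeakFormulation.

(** * Both time directions *)

Section TimeReversal.
Context {R : realType}.
Notation seqs := (bool -> int -> R[i]).
Implicit Types (a c : int -> R[i]) (k : int) (b : bool) (x : seqs).
Variables (s : R).
Hypothesis hs : 3 / 2 < s.
Notation X := (Hw (R := R) s).

Definition rv a : int -> R[i] := fun k => a (- k).
(* The symmetry (u, v)(t, x) -> (v, u)(-t, -x) of the system, on Fourier coefficients. *)
Definition refl x : seqs := fun b => rv (x (~~ b)).

Lemma reflK x : refl (refl x) = x.
Proof. by apply/funext => b; apply/funext => k; rewrite /refl /rv negbK opprK. Qed.

Lemma nb_rv a A : nb X a A -> nb X (rv a) A.
Proof.
move=> h; have A0 := nb_ge0 h; apply/nb_Hw => //; have /(nb_Hw _ _ A0) := h.
move/(@sumle_inj R _ _ (fun k : int => - k) _ _ oppr_inj); apply: sumle_mon => // k.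
by rewrite /= /rv wt_opp.
Qed.

Lemma bdd_refl x (r : R) : bdd X r x -> bdd X r (refl x).
Proof. by move=> h b; apply: nb_rv; exact: h. Qed.

Lemma conv_rv a c : conv (rv a) (rv c) = rv (conv a c).
Proof.
apply/funext => k; rewrite /rv /conv -(csum_reindex (h := fun j : int => - j)); last by exists (fun j => - j) => j; rewrite opprK.
by apply: eq_csum => j; rewrite /= !opprK opprD.
Qed.

Lemma Dq_rv a : Dq (rv a) = - rv (Dq a).
Proof.
apply/funext => k; rewrite -[RHS]/(- (Dq a (- k))) !Dq_at /rv.
have -> : kc (- k) = - kc k :> R[i] by rewrite /kc rmorphN.
by rewrite mulrN mulNr opprK.
Qed.

Lemma conv_refl x : conv (refl x true) (refl x false) = rv (conv (x true) (x false)).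
Proof. by rewrite /refl conv_rv convC. Qed.

Lemma zmean_refl x : zmean x -> zmean (refl x).
Proof. by rewrite /zmean conv_refl /rv oppr0. Qed.

Lemma convNr a c : summ a -> summ c -> conv a (- c) = - conv a c.
Proof.
move=> sa sc; apply/funext => k; rewrite -[RHS]/(- csum _) -csumN; last exact: conv_summ.
by apply: eq_csum => j; rewrite -mulrN.
Qed.

(** Reversing time changes the sign of both terms. Exchanging the components changes that of [ep b],
    and reflecting x that of the single derivative in the nonlinearity. *)
Lemma fsol_refl lo hi (y : R -> seqs) (r : R) : fsol s (@Fu R) lo hi y -> (forall t, lo <= t <= hi -> bdd X r (y t)) ->
  fsol s (@Fu R) (- hi) (- lo) (fun t => refl (y (- t))).
Proof.
move=> [cy dy] by'; split=> [b t tt e e0|b k].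
  have tt' : lo <= - t <= hi by rewrite lerNr lerNl andbC.
  have [d d0 Hd] := cy (~~ b) (- t) tt' e e0; exists d => // u uu ut.
  have uu' : lo <= - u <= hi by rewrite lerNr lerNl andbC.
  have q : `|- u - - t| < d by rewrite (_ : - u - - t = - (u - t)) ?normrN//; ring.
  exact: (nb_rv (Hd (- u) uu' q)).
have := cder_flip (dy (~~ b) (- k)).
suff e t : lo <= - t <= hi -> - (Lk (~~ b) (- k) * y (- t) (~~ b) (- k) + Fu (~~ b) (y (- t)) (- k)) =
    Lk b k * refl (y (- t)) b k + Fu b (refl (y (- t))) k.
  by apply: cder_eq => t tt //; apply: e; rewrite lerNr lerNl andbC.
move=> tt; rewrite opprD -mulNr; congr (_ * _ + _).
  by rewrite /Lk /kc rmorphN sqrrN; case: b; rewrite /ep ?mulNr ?opprK.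
have hx := by' _ tt; have [s1 s2 _ _] := X_sums hs hx.
have rvs a : summ a -> summ (rv a) by move=> [C hC]; exists C; exact: (sumle_inj (h := fun k : int => - k) oppr_inj hC).
rewrite /Fu conv_refl -[refl (y (- t)) b]/(rv (y (- t) (~~ b))) Dq_rv convNr; [|by apply: rvs; exact: summ_conv|exact: rvs].
by rewrite conv_rv.
Qed.

End TimeReversal.

(** * Existence and continuous dependence on [-T, T] *)

Section TwoSided.
Context {R : realType}.
Notation mu := (@lebesgue_measure R).
Notation seqs := (bool -> int -> R[i]).
Implicit Types (t e A T : R) (b : bool) (f g : R -> R[i]) (u v : R -> R -> R[i]).
Variables (s : R).
Hypothesis hs : 3 / 2 < s.
Notation X := (Hw (R := R) s).

Definition dat f g : seqs := fun b => fourier (if b then f else g).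

Lemma C_Hs2_sub lo hi lo' hi' u v : lo <= lo' -> hi' <= hi -> C_Hs2 s lo hi u v -> C_Hs2 s lo' hi' u v.
Proof.
move=> l h [H1 H2]; have S t : t \in `[lo', hi'] -> t \in `[lo, hi].
  by rewrite !in_itv/= => /andP[t1 t2]; rewrite (le_trans l)//= (le_trans t2).
split=> t tt; first exact: H1 (S t tt).
by apply: cvg_trans (H2 t (S t tt)); apply: cvg_app; apply: within_subset => z; exact: S.
Qed.

Lemma Hs2_0_dat f g : Hs2_0 s f g -> [/\ Hs s f, Hs s g & zmean (dat f g)].
Proof. by move=> /(Hs2_0_zmean hs). Qed.

Lemma fsol_eq lo hi (y z : R -> seqs) : (forall t, lo <= t <= hi -> y t = z t) -> fsol s (@Fu R) lo hi y -> fsol s (@Fu R) lo hi z.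
Proof.
move=> yz [cy dy]; split=> [b|b k].
  by apply: ccurve_eq (cy b) => t tt; rewrite yz.
by apply: cder_eq (dy b k) => t tt; rewrite yz.
Qed.

Lemma tint_fourier_eq f g (h : R -> R[i]) : Hs s f -> Hs s g -> fourier f = fourier g -> (forall lo hi, ccont lo hi h) ->
  tintegral (fun x => f x * h x) = tintegral (fun x => g x * h x).
Proof. by move=> hf hg e ch; rewrite (tint_pair hs hf ch) (tint_pair hs hg ch) e. Qed.

Lemma tint_zero (h g : R -> R[i]) : (forall x, g x = 0) -> tintegral (fun x => h x * g x) = 0.
Proof. by move=> g0; rewrite (tint_eq (g := fun=> 0)) ?tint_cst// => x _; rewrite g0 mulr0. Qed.

Lemma weak_balance (a x z w : R[i]) : a + x - z = - w -> a + w + x = z.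
Proof.
move=> h; apply/eqP; rewrite -subr_eq0; apply/eqP; transitivity ((a + x - z) + w); first by ring.
by rewrite h addNr.
Qed.

Lemma fsol_forward T f g u v : 0 < T -> Hs s f -> Hs s g -> C_Hs2 s 0 T u v -> fsol s (@Fu R) 0 T (cf u v) -> cf u v 0 = dat f g ->
  solution_forward s T f g u v.
Proof.
move=> T0 hf hg hC hy e0; split=> // chi [sc pc [T' T'T hz]].
have zz : 0 <= (0 : R) <= T by rewrite lexx ltW.
have cc lo hi : ccont lo hi (chi 0) by apply: ccont2_x; exact: csmooth2_cont.
have W b := fsol_weak hs b (ltW T0) hC hy sc pc.
have E b : tintegral (fun x => sel b u v 0 x * chi 0 x) = tintegral (fun x => (if b then f else g) x * chi 0 x).
  apply: (tint_fourier_eq (C_Hs2_sel b hC zz) _ _ cc); first by case: b.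
  by rewrite -cf_sel e0.
have Z b : tintegral (fun x => sel b u v T x * chi T x) = 0 by apply: tint_zero => x; apply: hz; exact: ltW.
by split; apply: weak_balance; [apply: etrans (W true) _|apply: etrans (W false) _]; rewrite Z E sub0r mulrN mulN1r !mulNr opprK.
Qed.

Lemma fsol_backward T f g u v : 0 < T -> Hs s f -> Hs s g -> C_Hs2 s (- T) 0 u v -> fsol s (@Fu R) (- T) 0 (cf u v) -> cf u v 0 = dat f g ->
  solution_backward s T f g u v.
Proof.
move=> T0 hf hg hC hy e0; split=> // chi [sc pc [T' T'T hz]].
have NT : - T <= 0 by rewrite oppr_le0 ltW.
have zz : - T <= (0 : R) <= 0 by rewrite lexx NT.
have cc lo hi : ccont lo hi (chi 0) by apply: ccont2_x; exact: csmooth2_cont.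
have W b := fsol_weak hs b NT hC hy sc pc.
have E b : tintegral (fun x => sel b u v 0 x * chi 0 x) = tintegral (fun x => (if b then f else g) x * chi 0 x).
  apply: (tint_fourier_eq (C_Hs2_sel b hC zz) _ _ cc); first by case: b.
  by rewrite -cf_sel e0.
have Z b : tintegral (fun x => sel b u v (- T) x * chi (- T) x) = 0 by apply: tint_zero => x; apply: hz; exact: ltW.
by split; apply: weak_balance; [apply: etrans (W true) _|apply: etrans (W false) _]; rewrite Z E subr0 mul1r mulNr.
Qed.

Lemma ccurve_glue (N : gnorm (R := R) int) (T : R) (z : R -> int -> R[i]) : 0 < T -> ccurve N (- T) 0 z -> ccurve N 0 T z -> ccurve N (- T) T z.
Proof.
move=> T0 h1 h2 t /andP[t1 t2] e e0; case: (ltgtP t 0) => t0.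
- have tt : - T <= t <= 0 by rewrite t1 ltW.
  have [d d0 Hd] := h1 t tt e e0; exists (Num.min d (- t)); first by rewrite lt_min d0 oppr_gt0.
  move=> x /andP[x1 x2]; rewrite lt_min => /andP[q1 q2]; apply: Hd => //; rewrite x1 /=.
  by move: q2; rewrite ltr_norml => /andP[_]; lra.
- have tt : 0 <= t <= T by rewrite t2 ltW.
  have [d d0 Hd] := h2 t tt e e0; exists (Num.min d t); first by rewrite lt_min d0.
  move=> x /andP[x1 x2]; rewrite lt_min => /andP[q1 q2]; apply: Hd => //; rewrite x2 andbT.
  by move: q2; rewrite ltr_norml => /andP[]; lra.
have z1 : - T <= t <= 0 by rewrite t0 lexx oppr_le0 ltW.
have z2 : 0 <= t <= T by rewrite t0 lexx ltW.
have [d d0 Hd] := h1 t z1 e e0; have [d' d'0 Hd'] := h2 t z2 e e0.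
exists (Num.min d d'); first by rewrite lt_min d0.
move=> x /andP[x1 x2]; rewrite lt_min => /andP[q1 q2].
by case: (leP x 0) => x0; [apply: Hd; rewrite ?x1|apply: Hd'; rewrite ?x2 ?ltW].
Qed.

Lemma solution_coefficients T f g u v : 0 < T -> Hs s f -> Hs s g -> solution_0 s T f g u v ->
  [/\ fsol s (@Fu R) 0 T (cf u v), fsol s (@Fu R) 0 T (fun t => refl (cf u v (- t))),
   cf u v 0 = dat f g & exists r, forall t, 0 <= t <= T -> bdd X r (cf u v t) /\ bdd X r (refl (cf u v (- t)))].
Proof.
move=> T0 hf hg [[hC _] [sF sB]].
have [yF y0] := forward_fsol hs T0 hf hg sF; have [yB _] := backward_fsol hs T0 hf hg sB.
have NT : - T <= T by lra.
have [r hr] := C_Hs2_bounded hC NT; split; [exact: yF| |exact: y0|]; last first.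
  by exists r => t /andP[t1 t2]; split; [|apply: bdd_refl]; apply: hr; apply/andP; split; lra.
have rB t : - T <= t <= 0 -> bdd X r (cf u v t) by move=> /andP[t1 t2]; apply: hr; apply/andP; split; lra.
by have := fsol_refl hs yB rB; rewrite oppr0 opprK.
Qed.

(** T depends on the data only through the radius A, so that one interval serves a whole ball of
    data. *)
Lemma two_sided A : 0 <= A -> exists2 T : R, 0 < T &
  (forall f g, Hs2_0 s f g -> bdd X A (dat f g) -> exists u v, solution_0 s T f g u v) /\
  (forall f g u v, Hs2_0 s f g -> bdd X A (dat f g) -> solution_0 s T f g u v -> forall e, 0 < e -> exists2 d : R, 0 < d &
    forall f' g' u' v', Hs2_0 s f' g' -> bdd X A (dat f' g') -> solution_0 s T f' g' u' v' ->
    (forall b, nb X (dat f g b - dat f' g' b) d) -> forall t b, - T <= t <= T -> nb X (cf u v t b - cf u' v' t b) e).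
Proof.
move=> A0; have [T T0 [hE hL]] := wellposed_u hs A0; exists T => //.
have NT : - T <= 0 by rewrite oppr_le0 ltW.
split=> [f g hfg hA|f g u v hfg hA hu e e0]; have [hf hg hz] := Hs2_0_dat hfg.
  have [y [r [hy y0 by']]] := hE _ hA hz.
  have [z [r' [hz' z0 bz]]] := hE _ (bdd_refl hA) (zmean_refl hz).
  (* The negative half is the reflection of the solution with reflected data; the halves agree at t
     = 0. *)
  pose x t := if 0 <= t then y t else refl (z (- t)).
  have xz t : - T <= t <= 0 -> refl (z (- t)) = x t.
    rewrite /x => /andP[_ t0]; case: ifP => // t1.
    by have -> : t = 0; [apply/eqP; rewrite eq_le t0 t1|rewrite oppr0 z0 reflK y0].
  have xy t : 0 <= t <= T -> y t = x t by rewrite /x => /andP[-> _].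
  have x0 : x 0 = dat f g by rewrite /x lexx.
  have hxF := fsol_eq xy hy.
  have hxB : fsol s (@Fu R) (- T) 0 x.
    by apply: (fsol_eq xz); have := fsol_refl hs hz' bz; rewrite oppr0.
  have bxF t : 0 <= t <= T -> bdd X r (x t) by move=> tt; rewrite -xy//; exact: by'.
  have bxB t : - T <= t <= 0 -> bdd X r' (x t).
    by move=> tt; rewrite -xz//; apply: bdd_refl; apply: bz; rewrite lerNr oppr0 lerNl andbC.
  have bx t : - T <= t <= T -> bdd X (Num.max r r') (x t).
    move=> /andP[t1 t2] b; case: (leP 0 t) => t0.
      have tt : 0 <= t <= T by rewrite t0.
      by apply: nb_mon (bxF t tt b); rewrite le_max lexx.
    have tt : - T <= t <= 0 by rewrite t1 ltW.
    by apply: nb_mon (bxB t tt b); rewrite le_max lexx orbT.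
  have cx b : ccurve X (- T) T (x ^~ b) := ccurve_glue T0 (hxB.1 b) (hxF.1 b).
  have sx t b : - T <= t <= T -> summ (x t b) by move=> /bx /(_ b) h; have [] := X_facts hs h.
  have hC : C_Hs2 s (- T) T (fun t => Ss (x t true)) (fun t => Ss (x t false)).
    by apply: (ccurve_C_Hs2 hs cx) => t b /bx h; exists (Num.max r r'); exact: h.
  have cfx t : - T <= t <= T -> x t = cf (fun t => Ss (x t true)) (fun t => Ss (x t false)) t.
    by move=> tt; apply/funext => -[]; rewrite /cf fourier_Ss'//; exact: sx.
  have zx t : - T <= t <= T -> zmean (x t).
    (* The mean is conserved on each half; on the negative one, both t and 0 are compared with -
       T. *)
    have key lo hi r0 t' : fsol s (@Fu R) lo hi x -> (forall t, lo <= t <= hi -> bdd X r0 (x t)) -> lo <= t' <= hi ->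
        conv (x t' true) (x t' false) 0 = conv (x lo true) (x lo false) 0.
      by move=> h1 h2; exact: (mean_const hs (lip_Fu hs) (@Fu_pair _ _ hs) h1 h2).
    move=> /andP[t1 t2]; rewrite /zmean; case: (leP 0 t) => t0.
      by rewrite (key _ _ _ _ hxF bxF) ?t0// x0.
    rewrite (key _ _ _ _ hxB bxB) ?t1 ?ltW// -(key _ _ _ 0 hxB bxB) ?NT ?lexx// x0//.
  exists (fun t => Ss (x t true)), (fun t => Ss (x t false)).
  split; [split; [exact: hC|]|split].
  - move=> t; rewrite in_itv /= => tt; apply/(Hs2_0_zmean hs); have [|h1 h2] := hC.1 t; first by rewrite in_itv.
    by split; [exact: h1|exact: h2|rewrite (fourier_Ss' (sx t true tt)) (fourier_Ss' (sx t false tt)); exact: (zx t tt)].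
  - apply: (fsol_forward T0 hf hg).
    + exact: (C_Hs2_sub NT (lexx T) hC).
    + by apply: fsol_eq hxF => t /andP[t1 t2]; apply: cfx; rewrite t2 (le_trans NT).
    + by rewrite -cfx ?NT ?ltW.
  apply: (fsol_backward T0 hf hg).
  + exact: (C_Hs2_sub (lexx _) (ltW T0) hC).
  + by apply: fsol_eq hxB => t /andP[t1 t2]; apply: cfx; rewrite t1 (le_trans t2)// ltW.
  by rewrite -cfx ?NT ?ltW.
have [yF yB y0 [r hr]] := solution_coefficients T0 hf hg hu.
have hrF t : 0 <= t <= T -> bdd X r (cf u v t) by move=> /hr[].
have hrB t : 0 <= t <= T -> bdd X r (refl (cf u v (- t))) by move=> /hr[].
have hA' := hA; rewrite -y0 in hA'; have hz' := hz; rewrite -y0 in hz'.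
have b0 : bdd X A (refl (cf u v (- 0))) by rewrite oppr0; exact: bdd_refl.
have z0 : zmean (refl (cf u v (- 0))) by rewrite oppr0; exact: zmean_refl.
have [d1 d10 H1] := hL _ _ yF hrF hA' hz' e e0.
have [d2 d20 H2] := hL _ _ yB hrB b0 z0 e e0.
exists (Num.min d1 d2); first by rewrite lt_min d10.
move=> f' g' u' v' hfg' hbA' hu' hd t b /andP[t1 t2]; have [hf' hg' hzz] := Hs2_0_dat hfg'.
have [yF' yB' y0' [r' hr']] := solution_coefficients T0 hf' hg' hu'.
have m1 : Num.min d1 d2 <= d1 by rewrite ge_min lexx.
have m2 : Num.min d1 d2 <= d2 by rewrite ge_min lexx orbT.
case: (leP 0 t) => t0.
  have tt : 0 <= t <= T by rewrite t0.
  have q1 : bdd X A (cf u' v' 0) by rewrite y0'.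
  have q2 : zmean (cf u' v' 0) by rewrite y0'.
  have q3 b' : nb X (cf u v 0 b' - cf u' v' 0 b') d1 by rewrite y0 y0'; apply: nb_mon m1 (hd b').
  exact: (H1 _ r' yF' (fun t h => (hr' t h).1) q1 q2 q3 t b tt).
have tt : 0 <= - t <= T by rewrite oppr_ge0 ltW// lerNl.
have q1 : bdd X A (refl (cf u' v' (- 0))) by rewrite oppr0 y0'; exact: bdd_refl.
have q2 : zmean (refl (cf u' v' (- 0))) by rewrite oppr0 y0'; exact: zmean_refl.
have q3 b' : nb X (refl (cf u v (- 0)) b' - refl (cf u' v' (- 0)) b') d2.
  by rewrite oppr0 y0 y0'; apply: nb_mon m2 _; exact: (nb_rv (hd (~~ b'))).
have := nb_rv (H2 _ r' yB' (fun t h => (hr' t h).2) q1 q2 q3 (- t) (~~ b) tt).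
rewrite opprK /refl negbK; apply: nb_eq => k.
by rewrite /rv !fctE !opprK.
Qed.

End TwoSided.

Theorem theorem1p3 (R : realType) (s : R) (hs : 3 / 2 < s)
    (u0 v0 : R -> R[i]) (h0 : Hs2_0 s u0 v0) :
  exists T : R, 0 < T /\
  exists u v : R -> R -> R[i],
    (solution_0 s T u0 v0 u v /\
     forall u' v' : R -> R -> R[i], solution_0 s T u0 v0 u' v' ->
       forall t, t \in `[- T, T] ->
         {ae lebesgue_measure, forall x, u' t x = u t x} /\
         {ae lebesgue_measure, forall x, v' t x = v t x}) /\
    (forall u0n v0n : nat -> R -> R[i],
       (forall n, Hs2_0 s (u0n n) (v0n n)) ->
       Hs2_norm s (u0n n - u0) (v0n n - v0) @[n --> \oo] --> 0%E ->
       (\forall n \near \oo, exists un vn : R -> R -> R[i],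
          solution_0 s T (u0n n) (v0n n) un vn) /\
       (forall un vn : nat -> R -> R -> R[i],
          (\forall n \near \oo, solution_0 s T (u0n n) (v0n n) (un n) (vn n)) ->
          C_Hs2_dist s (- T) T (un n) (vn n) u v @[n --> \oo] --> 0%E)).
Proof.
have [hu0 hv0 hz0] := Hs2_0_dat hs h0.
have [c1 c10 hc1] := Hs_nb hu0; have [c2 c20 hc2] := Hs_nb hv0.
(* One unit of room, so that data within distance 1 of the given one lie in the ball for which T is
   chosen. *)
pose A := Num.max c1 c2 + 1.
have mA : c1 <= A - 1 /\ c2 <= A - 1 by rewrite /A addrK !le_max !lexx orbT.
have [m1 m2] := mA; have A0 : 0 <= A by lra.
have hA1 : bdd (Hw s) (A - 1) (dat u0 v0) by case; [exact: nb_mon hc1|exact: nb_mon hc2].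
have hA : bdd (Hw s) A (dat u0 v0) by move=> b; apply: nb_mon (hA1 b); lra.
have [T T0 [hE hL]] := two_sided hs A0.
have [u [v huv]] := hE _ _ h0 hA.
exists T; split=> //; exists u, v.
have hsT u' v' f g t b : solution_0 s T f g u' v' -> - T <= t <= T -> Hs s (sel b u' v' t).
  by move=> [[hC _] _] tt; exact: (C_Hs2_sel b hC tt).
split.
  split=> // u' v' huv' t; rewrite in_itv /= => tt.
  (* Uniqueness is continuous dependence for equal data, with an arbitrary tolerance. *)
  have E b : cf u' v' t b = cf u v t b.
    apply/funext => k; apply/eqP; rewrite eq_sym -subr_eq0; apply/eqP/nC_eq0/eqP; rewrite eq_le nC_ge0 andbT.
    have [K hK] := @Hw_coefC R s k; apply/ler_addgt0Pr => e e0; rewrite add0r.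
    have [e1 e10 he] := ler_eps_div e0 (normr_ge0 K).
    have [d d0 Hd] := hL _ _ _ _ h0 hA huv _ e10.
    have z b' : nb (Hw s) (dat u0 v0 b' - dat u0 v0 b') d by rewrite subrr; apply: nb_mon (@nb0 R _ _); exact: ltW.
    have := hK _ _ (Hd _ _ _ _ h0 hA huv' z t b tt); move/le_trans; apply; apply: le_trans he.
    by rewrite mulrC ler_wpM2l ?(ltW e10)// ler_norm.
  have P b : {ae lebesgue_measure, forall x, sel b u' v' t x = sel b u v t x}.
    have h1 := hsT _ _ _ _ t b huv' tt; have h2 := hsT _ _ _ _ t b huv tt.
    have [[[p1 _ _] _] [[p2 _ _] _]] := (h1, h2); have [[q1 r1] [q2 r2]] := (Hs_table h1, Hs_table h2).
    by apply: ae_periodic => //; apply: fourier_inj => //; rewrite -!cf_sel.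
  by split; [exact: (P true)|exact: (P false)].
move=> u0n v0n hn hcv.
have ev (d : R) : 0 < d -> \forall n \near \oo, forall b, nb (Hw s) (dat u0 v0 b - dat (u0n n) (v0n n) b) d.
  move=> d0; apply: filterS (ereal_cvg0 hcv d0) => n /= q; have [n1 n2] := Hs2_norm_lt (ltW d0) q.
  have [hun hvn _] := Hs2_0_dat hs (hn n).
  have [[a1 a2] [a3 a4]] := (Hs_table hu0, Hs_table hv0); have [[b1 b2] [b3 b4]] := (Hs_table hun, Hs_table hvn).
  rewrite fourierB// in n1; rewrite fourierB// in n2.
  by case; apply: nbBC.
have evA : \forall n \near \oo, bdd (Hw s) A (dat (u0n n) (v0n n)).
  apply: filterS (ev 1 ltr01) => n q b; have := nbB (hA1 b) (q b); rewrite subrK.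
  by apply: nb_eq => k; rewrite !fctE; ring.
split; first by apply: filterS evA => n; exact: hE.
move=> un vn hsol; apply: cvg0_ereal => [n|e e0].
  (* The distance is a supremum over a non-empty set of times, hence non-negative. *)
  have TT : - T <= 0 <= T by rewrite oppr_le0 !ltW.
  apply: le_trans (Hs2_norm_ge0 s (un n 0 - u 0) (vn n 0 - v 0)) _; apply: ereal_sup_ubound.
  by exists 0 => //; rewrite /= in_itv.
have e2 : 0 < e / 2 by rewrite divr_gt0.
have [d d0 Hd] := hL _ _ _ _ h0 hA huv _ e2.
apply: filterS3 (ev d d0) evA hsol => n q1 q2 q3; apply: ge_ereal_sup => _ [t /= tt <-].
have {}tt : - T <= t <= T by move: tt; rewrite in_itv.
have key b : nb (Hw s) (fourier (sel b (un n) (vn n) t - sel b u v t)) (e / 2).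
  have [a1 a2] := Hs_table (hsT _ _ _ _ t b q3 tt); have [b1 b2] := Hs_table (hsT _ _ _ _ t b huv tt).
  by rewrite fourierB// -!cf_sel; apply: nbBC; exact: (Hd _ _ _ _ (hn n) q2 q3 q1).
by apply: Hs2_norm_nb; [exact: ltW|exact: (key true)|exact: (key false)].
Qed.
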